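(* Let $n\ge 2$, $p\geq 2$, and let $f$ satisfy condition (F) of the context. For each $\ell>0$ let $u_\ell$ be a weak solution of $\Delta_p u_\ell=f(u_\ell)$ in $S_\ell$ with $u_\ell(x)\to\infty$ as $x\to\partial S_\ell$. For $x\in S$ define $$u(x)=\inf_{\ell\ge \ell(x)}u_\ell(x),$$ where $\ell(x)>0$ is such that $x\in S_{\ell(x)}$. Then $u$ solves $$\Delta_p u=f(u)\ \text{ in } S,\qquad u(x)\to\infty\ \text{ as } x\to\zeta\in\partial S,$$ in the weak sense.
   Context: Here $S=B^{n-1}_1(0)\times\mathbb{R}\subset\mathbb{R}^n$, where $B^{n-1}_1(0)$ is the open unit ball of $\mathbb{R}^{n-1}$, and for $\ell>0$ $$S_\ell=\Big\{x\in\mathbb{R}^n:\ \sum_{i=1}^{n-1}x_i^2<1,\ -\ell<x_n<\ell\Big\}\cup\Big\{x\in\mathbb{R}^n:\ \Big(\sum_{i=1}^{n-1}x_i^2\Big)^2+(x_n\pm\ell)^4<1\Big\}$$ (the second set denotes the union of the two sets obtained from the two signs). $S_\ell$ is a bounded domain with $C^2$ boundary, and $S_\ell\to S$ as $\ell\to\infty$. $\Delta_p u=\operatorname{div}(|\nabla u|^{p-2}\nabla u)$. Condition (F): $f:[0,\infty)\to[0,\infty)$ is continuous, increasing, positive on $(0,\infty)$, $f(0)=0$, and satisfies the Keller–Osserman condition: for every $r>0$, $\Psi_p(r):=\left(1-\frac1p\right)^{1/p}\int_r^\infty \frac{ds}{F(s)^{1/p}}<\infty$, where $F(x)=\int_0^x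 f(s)\,ds$. Weak solution: for a domain $\Omega\subset\mathbb{R}^n$, $u\in W^{1,p}_{loc}(\Omega)$ is a weak solution of $\Delta_p u=f(u)$ in $\Omega$ if for every $\Omega'\subset\subset\Omega$, $-\int_{\Omega'}|\nabla u|^{p-2}\nabla u\cdot\nabla\phi\,dx=\int_{\Omega'}f(u)\phi\,dx$ for all $\phi\in W^{1,p}_0(\Omega')$. *)

(* Defs.v *)
From HB Require Import structures.
From mathcomp Require Import all_boot all_order all_algebra.
From mathcomp Require Import all_classical all_reals all_analysis.

Set Implicit Arguments.
Unset Strict Implicit.
Unset Printing Implicit Defensive.
Import Order.TTheory GRing.Theory Num.Theory.
Import numFieldNormedType.Exports.

Local Open Scope classical_set_scope.
Local Open Scope ring_scope.

(* Only the Lebesgue measure on the line is available.  We equip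
   R^n = 'rV[R]_n with its product (= Borel) sigma-algebra and build the
   n-dimensional Lebesgue measure by induction on n.  Working with Borel instead
   of Lebesgue measurable functions only selects representatives in L^p. *)
Section measurable_rV.
Context {R : realType} (n : nat).

Let coord_rV (i : 'I_n) (x : 'rV[R]_n) : measurableTypeR R := x ord0 i.

Let rV_set0 : g_sigma_preimage coord_rV set0.
Proof. exact: sigma_algebra0. Qed.

Let rV_setC A : g_sigma_preimage coord_rV A -> g_sigma_preimage coord_rV (~` A).
Proof. exact: sigma_algebraC. Qed.

Let rV_bigcup (F : _^nat) : (forall i, g_sigma_preimage coord_rV (F i)) ->
  g_sigma_preimage coord_rV (\bigcup_i (F i)).
Proof. exact: sigma_algebra_bigcup. Qed.

HB.instance Definition _ :=
  @isMeasurable.Build (measure_tuple_display default_measure_display)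
  'rV[R]_n (g_sigma_preimage coord_rV) rV_set0 rV_setC rV_bigcup.

Lemma measurable_coord_rV (i : 'I_n) :
  measurable_fun [set: 'rV[R]_n] (fun x => x ord0 i : measurableTypeR R).
Proof.
move=> _ Y mY; rewrite setTI; apply: sub_sigma_algebra => /=.
rewrite -bigcup_seq/=; exists i => /=; first by rewrite mem_index_enum.
by exists Y => //; rewrite setTI.
Qed.

Lemma measurable_fun_rV d (T : measurableType d) (f : T -> 'rV[R]_n) :
  (forall i, measurable_fun [set: T]
    (fun t => f t ord0 i : measurableTypeR R)) ->
  measurable_fun [set: T] f.
Proof.
move=> mf _ A mA; move: A mA.
pose G := [set A : set 'rV[R]_n | measurable ([set: T] `&` f @^-1` A)].
suff : measurable `<=` G by [].
apply: smallest_sub.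
  split; rewrite /G /=.
  - by rewrite preimage_set0 setI0.
  - move=> A mA; rewrite setTD !setTI in mA *; rewrite preimage_setC.
    exact: measurableC.
  - move=> F mF; rewrite setTI preimage_bigcup.
    by apply: bigcup_measurable => k _; have := mF k; rewrite setTI.
move=> A; rewrite -bigcup_seq => -[i _] [B mB <-].
by rewrite /G /= setTI; exact: (mf i measurableT B mB).
Qed.

End measurable_rV.

Definition snoc_rV (R : realType) (n : nat) (z : 'rV[R]_n * measurableTypeR R)
  : 'rV[R]_n.+1 := \row_i oapp (z.1 ord0) z.2 (unlift ord_max i).

Lemma measurable_snoc_rV (R : realType) (n : nat) :
  measurable_fun setT (@snoc_rV R n).
Proof.
apply: measurable_fun_rV => i; rewrite /snoc_rV.
under eq_fun do rewrite mxE.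
case: (unlift ord_max i) => [j|] /=; last exact: measurable_snd.
exact: (measurableT_comp (measurable_coord_rV j) measurable_fst).
Qed.

(* The pushforward of mu \x lebesgue_measure, as a bundled measure. *)
Definition snoc_measure (R : realType) (n : nat)
    (mu : {measure set 'rV[R]_n -> \bar R}) :
    {measure set 'rV[R]_n.+1 -> \bar R} :=
  measure_function_pushforward__canonical__measure_function_Measure
    (mu \x @lebesgue_measure R)%E (@measurable_snoc_rV R n).

Fixpoint lebesgue_rV (R : realType) (n : nat) :
    {measure set 'rV[R]_n -> \bar R} :=
  match n with
  | 0 => dirac (0 : 'rV[R]_0)
  | m.+1 => snoc_measure (lebesgue_rV R m)
  end.

Lemma lebesgue_rV_box (R : realType) (n : nat) (a b : 'I_n -> R) :
  (forall i, a i <= b i) ->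
  lebesgue_rV R n [set x | forall i, x ord0 i \in `]a i, b i]] =
  (\prod_i (b i - a i))%:E.
Proof.
elim: n a b => [|n IHn] a b ab /=.
  rewrite big_ord0 diracE mem_set//= => -[] //.
pose w := widen_ord (leqnSn n).
have wE i : w i = lift ord_max i.
  by apply/val_inj; rewrite /= /bump leqNgt ltn_ord.
rewrite /pushforward (_ : _ @^-1` _ =
    [set x : 'rV[R]_n | forall i, x ord0 i \in `]a (w i), b (w i)]]
    `*` [set` `]a ord_max, b ord_max]]); last first.
  apply/seteqP; split => -[x t] /=; rewrite /snoc_rV.
    move=> H; split; last by have := H ord_max; rewrite mxE unlift_none.
    by move=> i; have := H (w i); rewrite mxE wE liftK.
  move=> [Hx Ht] i; rewrite mxE; case: unliftP => [j ->|->] //=.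
  by rewrite -wE; exact: Hx.
have mbox : measurable
    [set x : 'rV[R]_n | forall i, x ord0 i \in `]a (w i), b (w i)]].
  rewrite (_ : [set x | _] = \bigcap_(i in [set: 'I_n])
      [set x : 'rV[R]_n | x ord0 i \in `]a (w i), b (w i)]]); last first.
    by apply/seteqP; split => x /= H i; [move=> _; exact: H|exact: H].
  apply: fin_bigcap_measurable => // i _; rewrite -[X in measurable X]setTI.
  exact: (@measurable_coord_rV R n i measurableT
    [set` `]a (w i), b (w i)]] (measurable_itv _)).
rewrite product_measure1E//.
rewrite IHn//= big_ord_recr/= EFinM lebesgue_measure_itv/= lte_fin.
congr (_ * _)%E; case: ltgtP (ab ord_max) => // -> _; by rewrite subrr.
Qed.

Section pde.
Context {R : realType} {n : nat}.
Implicit Types (p M : R) (O D : set 'rV[R]_n) (u v phi : 'rV[R]_n -> R)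
  (g psi : 'rV[R]_n -> 'rV[R]_n) (x y : 'rV[R]_n).
Local Notation mu := (lebesgue_rV R n).

(* The norm `|x| of the library is the sup norm on 'rV[R]_n. *)
Definition dotv x y : R := \sum_i x ord0 i * y ord0 i.
Definition enorm x : R := Num.sqrt (dotv x x).

Definition boundary O : set 'rV[R]_n := closure O `\` interior O.

Definition compactly_inside D O :=
  [/\ open D, compact (closure D) & closure D `<=` O].

Definition partial (i : 'I_n) phi : 'rV[R]_n -> R :=
  fun x => 'D_(delta_mx ord0 i) phi x.

Definition iter_partial (s : seq 'I_n) phi := foldr partial phi s.

Definition smooth phi := forall s : seq 'I_n,
  continuous (iter_partial s phi) /\
  forall i x, derivable (iter_partial s phi) x (delta_mx ord0 i).

Definition test_function O phi :=
  let supp := closure [set x | phi x != 0] in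
  [/\ smooth phi, compact supp & supp `<=` O].

Definition in_Lp p D v :=
  measurable_fun D v /\ (\int[mu]_(x in D) (`|v x| `^ p)%:E < +oo)%E.

Definition coord g (i : 'I_n) : 'rV[R]_n -> R := fun x => g x ord0 i.

(* g is a representative of the weak gradient of v, which is in W^{1,p}_loc(O) *)
Definition W1p_loc p O v g :=
  [/\ forall D, compactly_inside D O -> in_Lp p D v,
      forall D, compactly_inside D O -> forall i, in_Lp p D (coord g i) &
      forall phi, test_function O phi -> forall i,
        \int[mu]_(x in O) (v x * partial i phi x) =
        - (\int[mu]_(x in O) (g x ord0 i * phi x))].

Definition Lp_cvg p D (vk : nat -> 'rV[R]_n -> R) v :=
  (fun k => \int[mu]_(x in D) (`|vk k x - v x| `^ p)%:E)%E @ \oo --> 0%E.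

(* v is in W^{1,p}_0(D), the closure of the test functions in W^{1,p}(D), and
   psi represents its weak gradient *)
Definition W1p_0 p D v psi :=
  [/\ in_Lp p D v, forall i, in_Lp p D (coord psi i) &
      exists2 vk : nat -> 'rV[R]_n -> R, forall k, test_function D (vk k) &
        Lp_cvg p D vk v /\
        forall i, Lp_cvg p D (fun k => partial i (vk k)) (coord psi i)].

(* The nonlinearity is only meaningful on [0, +oo[, hence the sign condition;
   integrability of f(u) phi is what gives a meaning to the right-hand side
   (Rintegral is a total function), the left-hand side being integrable by
   Hoelder's inequality.  Apart from the sign, this only constrains u up to null
   sets: statements about the pointwise values of a solution have to fix a
   representative (the continuous one, which exists by regularity theory). *)
Definition weak_solution p (f : R -> R) O u :=
  (forall x, O x -> 0 <= u x) /\
  exists2 g, W1p_loc p O u g &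
    forall D, compactly_inside D O ->
    forall phi psi, W1p_0 p D phi psi ->
      mu.-integrable D (EFin \o (fun x => f (u x) * phi x)) /\
      - (\int[mu]_(x in D) (enorm (g x) `^ (p - 2) * dotv (g x) (psi x))) =
        \int[mu]_(x in D) (f (u x) * phi x).

(* u(x) -> +oo as the distance from x \in O to the boundary of O tends to 0 *)
Definition blowup_near_boundary O u :=
  forall M, exists2 delta : R, 0 < delta &
    forall x, O x -> (exists2 z, boundary O z & enorm (x - z) < delta) ->
      M < u x.

Definition blowup_at_boundary_points O u :=
  forall z, boundary O z -> u x @[x --> within O (nbhs z)] --> +oo.

End pde.

Section condition_F.
Context {R : realType}.
Implicit Types (p r x : R) (f : R -> R).
Local Notation leb := (@lebesgue_measure R).

Definition primitive f x : R := \int[leb]_(s in `[0, x]) f s.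

Definition Psi p f r : \bar R :=
  (((1 - p^-1) `^ p^-1)%:E *
   \int[leb]_(s in `]r, +oo[) ((primitive f s `^ p^-1)^-1)%:E)%E.

(* f : R -> R stands for its restriction to [0, +oo[ *)
Definition condition_F p f :=
  [/\ {within `[0, +oo[, continuous f},
      {in `[0, +oo[ &, {homo f : x y / x <= y}},
      (forall x, 0 < x -> 0 < f x), f 0 = 0 &
      forall r, 0 < r -> (Psi p f r < +oo)%E].

End condition_F.

Section cylinders.
Context {R : realType} {m : nat}.
Implicit Types (x : 'rV[R]_m.+1) (l : R).

(* In R^(m + 1) the last coordinate is the one of index ord_max. *)
Definition horiz2 x : R := \sum_(i | i != ord_max) x ord0 i ^+ 2.
Definition lastc x : R := x ord0 ord_max.

Definition cylinder : set 'rV[R]_m.+1 := [set x | horiz2 x < 1].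

Definition capped_cylinder l : set 'rV[R]_m.+1 :=
  [set x | horiz2 x < 1 /\ - l < lastc x < l] `|`
  ([set x | horiz2 x ^+ 2 + (lastc x + l) ^+ 4 < 1] `|`
   [set x | horiz2 x ^+ 2 + (lastc x - l) ^+ 4 < 1]).

End cylinders.

Arguments cylinder : clear implicits.
Arguments capped_cylinder : clear implicits.

(* Main.v *)
(* Let [U] be the minimal large solution of the radial equation in the cross-section, that is the increasing
   limit of solutions [G_k] of a perturbed equation with [G_k 1] close to [k].  A weak comparison principle,
   obtained by testing with a truncation of the difference, gives [G_k <= u_l], hence [U <= u_l], without any
   regularity theory.  Conversely the Keller-Osserman condition bounds the [u_l] locally, hence
   [u_l <= U + k] for some [k] away from the caps.  A radial strict supersolution plus a small multiple of
   [(x_n - t0)^2] is still a supersolution and exceeds that bound at two heights: thus radial barriers can be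
   used as if there were no dependence on [x_n].  Barriers built from [U] lower the constant [k], whose
   infimum is therefore 0.  Consequently [u] is the explicit [C^1] function [U(|x'|)], for which the equation
   follows from integration by parts. *)

From HB Require Import structures.
Require Import Defs.
From mathcomp Require Import all_boot all_order all_algebra.
From mathcomp Require Import all_classical all_reals all_analysis.
From mathcomp Require Import measurable_realfun lebesgue_integral_under ring lra.
Import Order.TTheory GRing.Theory Num.Theory.
Import numFieldNormedType.Exports.
Local Open Scope classical_set_scope.
Local Open Scope ring_scope.
Set Implicit Arguments.
Unset Strict Implicit.
Unset Printing Implicit Defensive.

(** * Lebesgue measure on R^n *)

(** Without compactness or gradient estimates for weak solutions, the equation cannot be passed to
    the limit along the [u_l]; it has to come from identifying [u] with a function whose derivatives
    are explicit. The difficulty is then the uniqueness of large solutions, for an [f] that is only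
    nondecreasing and may be constant on intervals. Comparison therefore always works with strict
    inequalities between right-hand sides: the lower approximations carry an extra [1 / (k + 1)],
    the supersolutions a gap [e]. The shift [U + k] need not be a strict supersolution, and the
    lowering of [k] rests on the one strictness available: by superlinear growth [f] cannot be
    constant along all steps of length [k]. Radial equations are written for the flux
    [|G'|^(p-2) G'], which is differentiable even where the gradient vanishes. The quadratic term in
    [x_n] destroys the radial form of the flux; this forces the regularised slope
    [sroot (Y r) - delta], chosen so that the total gradient, with vertical part at most [delta],
    never exceeds [sroot (Y r)]. *)

Section integrable_real.
Context d {T : measurableType d} {R : realType} {mu : {measure set T -> \bar R}} {D : set T}.
Implicit Types f g : T -> R.
Hypothesis mD : measurable D.

Lemma integrable_addr f g : mu.-integrable D (EFin \o f) -> mu.-integrable D (EFin \o g) ->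
  mu.-integrable D (EFin \o (fun x => f x + g x)).
Proof. by move=> h1 h2; apply: eq_integrable (integrableD mD h1 h2). Qed.

Lemma integrable_subr f g : mu.-integrable D (EFin \o f) -> mu.-integrable D (EFin \o g) ->
  mu.-integrable D (EFin \o (fun x => f x - g x)).
Proof. by move=> h1 h2; apply: eq_integrable (integrableB mD h1 h2). Qed.

Lemma integrable_scaler f k : mu.-integrable D (EFin \o f) ->
  mu.-integrable D (EFin \o (fun x => k * f x)).
Proof. by move=> h1; apply: eq_integrable (integrableZl mD k h1). Qed.

Lemma integrable_dominated f g : measurable_fun D f -> (forall x, D x -> `|f x| <= g x) ->
  mu.-integrable D (EFin \o g) -> mu.-integrable D (EFin \o f).
Proof.
move=> mf fg; apply: le_integrable => //; first exact/measurable_EFinP.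
by move=> x Dx; rewrite /= lee_fin (le_trans (fg x Dx))// ler_norm.
Qed.

End integrable_real.

Section measure_rV.
Context {R : realType} {n : nat}.
Implicit Types (x y z : 'rV[R]_n) (A D : set 'rV[R]_n).
Local Notation mu := (lebesgue_rV R n).

Definition box (a b : 'I_n -> R) : set 'rV[R]_n :=
  [set x | forall i, x ord0 i \in `]a i, b i]].

Lemma measurable_coord (i : 'I_n) (B : set R) : measurable B ->
  measurable [set x : 'rV[R]_n | B (x ord0 i)].
Proof.
by move=> mB; have := @measurable_coord_rV R n i measurableT B mB; rewrite setTI.
Qed.

Lemma measurable_all (P : 'I_n -> set 'rV[R]_n) : (forall i, measurable (P i)) ->
  measurable [set x | forall i, P i x].
Proof.
move=> mP; rewrite (_ : [set x | _] = \bigcap_(i in [set: 'I_n]) P i).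
  by apply: fin_bigcap_measurable.
by apply/seteqP; split => x /= H i; [move=> _; exact: H|exact: H].
Qed.

Lemma measurable_box a b : measurable (box a b).
Proof.
by apply: measurable_all => i; apply: (@measurable_coord i [set` `]a i, b i]]).
Qed.

Lemma ball_rVP x y (e : R) : 0 < e ->
  ball x e y <-> forall i, `|x ord0 i - y ord0 i| < e.
Proof.
move=> e0; split.
  by move=> [_ H] i; exact: (H ord0 i).
by move=> H; split => // i j; rewrite ord1; exact: H.
Qed.

Lemma coord_le_norm x i : `|x ord0 i| <= `|x|.
Proof.
rewrite [leRHS]mx_normrE.
exact: (le_bigmax_cond _ (fun ij : 'I_1 * 'I_n => `|x ij.1 ij.2|) (j := (ord0, i))).
Qed.

(** The sigma-algebra is generated by the coordinates and not by the open sets. An open set is the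
    union of the sup-norm cubes with rational centre and radius [1 / (k + 1)] that it contains, and
    there are countably many of these. *)
Lemma open_measurable_rV A : open A -> measurable A.
Proof.
move=> oA.
pose B (q : 'rV[rat]_n * nat) : set 'rV[R]_n :=
  [set x | forall i, `|ratr (q.1 ord0 i) - x ord0 i| < q.2.+1%:R^-1].
pose F q := [set x | B q x /\ B q `<=` A].
have -> : A = \bigcup_q F q.
  apply/seteqP; split => [x Ax|x [q _ [Bx]]]; last exact.
  have /nbhs_ballP[e /= e0 eA] : nbhs x A by exact: open_nbhs_nbhs.
  have [k ke] : exists k : nat, k.+1%:R^-1 < e / 2.
    have := near_infty_natSinv_lt (PosNum (divr_gt0 e0 (ltr0n R 2))).
    by case=> k _ H; exists k; apply: H => /=.
  have k0 : (0 : R) < k.+1%:R^-1 by rewrite invr_gt0 ltr0n.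
  have H i : {q : rat | `|ratr q - x ord0 i| < k.+1%:R^-1}.
    apply: cid.
    have [] := @rat_in_itvoo R (x ord0 i) (x ord0 i + k.+1%:R^-1).
      by rewrite ltrDl.
    move=> q; rewrite in_itv/= => /andP[q1 q2]; exists q.
    by rewrite gtr0_norm ?subr_gt0// ltrBlDr addrC.
  exists (\row_i sval (H i), k) => //; split.
    by move=> i /=; rewrite mxE; exact: svalP (H i).
  move=> y By; apply: eA; apply/ball_rVP => // i.
  have := By i; have := svalP (H i); rewrite /= mxE; set q := ratr _ => h1 h2.
  have -> : x ord0 i - y ord0 i = (q - y ord0 i) - (q - x ord0 i) by ring.
  apply: (le_lt_trans (ler_normB _ _)); rewrite (splitr e).
  by apply: ltrD; exact: (lt_trans _ ke).
apply: countable_bigcupT_measurable => [|q]; first exact: countableP.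
have [sub|nsub] := pselect (B q `<=` A); last first.
  rewrite (_ : F q = set0); first exact: measurable0.
  by apply/seteqP; split => // x [].
rewrite (_ : F q = B q); last by apply/seteqP; split => x //= [].
apply: measurable_all => i; apply: (@measurable_coord i
  [set t | `|ratr (q.1 ord0 i) - t| < q.2.+1%:R^-1]).
apply: open_measurable.
rewrite (_ : [set t | _] = ball (ratr (q.1 ord0 i) : R) q.2.+1%:R^-1) //.
by apply: ball_open; rewrite invr_gt0 ltr0n.
Qed.

Lemma closed_measurable_rV A : closed A -> measurable A.
Proof.
by move=> cA; rewrite -(setCK A); apply: measurableC; apply: open_measurable_rV;
  rewrite openC.
Qed.

Lemma measurable_cont A (f : 'rV[R]_n -> R) : open A ->
  (forall x, A x -> {for x, continuous f}) -> measurable_fun A f.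
Proof.
move=> oA cf; apply: (measurability _ (RGenOInfty.measurableE R)).
move=> /= _ [_ [a ->]] <-; apply: open_measurable_rV.
rewrite openE => x [Ax fx].
apply: filterI; first exact: open_nbhs_nbhs.
apply: (cf x Ax); apply: open_nbhs_nbhs; split => //; exact: interval_open.
Qed.

Definition measurable_contT (f : 'rV[R]_n -> R) (cf : continuous f) :
  measurable_fun setT f := measurable_cont openT (fun x _ => cf x).

(** Half-open boxes are stable under intersection, which makes this generating family the input of
    the uniqueness theorem for measures and of the approximation of indicators. *)
Lemma measurable_rV_genE :
  @measurable _ 'rV[R]_n = <<s range (fun ab => box ab.1 ab.2) >>.
Proof.
apply/seteqP; split; last first.
  apply: smallest_sub; first exact: sigma_algebra_measurable.
  by move=> _ [[a b] _ <-]; exact: measurable_box.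
apply: smallest_sub; first exact: smallest_sigma_algebra.
move=> A; rewrite -bigcup_seq => -[i _] [B mB <-]; rewrite setTI.
pose G := range (fun ab : ('I_n -> R) * ('I_n -> R) => box ab.1 ab.2).
pose M := [set B : set R | <<s G >> [set x : 'rV[R]_n | B (x ord0 i)]].
suff : @measurable _ (measurableTypeR R) `<=` M by apply.
apply: smallest_sub.
  split; rewrite /M/=.
  - rewrite (_ : [set x | _] = set0); first exact: sigma_algebra0.
    by apply/seteqP; split.
  - by move=> C /sigma_algebraC; congr (<<s _ >> _); apply/seteqP; split=> x //= [].
  - move=> C mC.
    rewrite (_ : [set x | _] = \bigcup_k [set x : 'rV[R]_n | C k (x ord0 i)]).
      exact: sigma_algebra_bigcup.
    by apply/seteqP; split.
move=> _ [[a b] _ <-]; rewrite /M/=.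
rewrite (_ : [set x | _] = \bigcup_k box (fun j => if j == i then a else - k%:R)
   (fun j => if j == i then b else k%:R)).
  apply: sigma_algebra_bigcup => k; apply: sub_sigma_algebra.
  by exists (fun j => if j == i then a else - k%:R, fun j => if j == i then b else k%:R).
apply/seteqP; split => [x /= xab|x [k _ /(_ i)]]; last by rewrite eqxx.
exists (Num.trunc (`|x|%R) ).+1 => // j; case: eqP => [->//|_].
have : `|x ord0 j| < (Num.trunc `|x|).+1%:R.
  apply: (@le_lt_trans _ _ `|x|); last by rewrite truncnS_gt.
  exact: coord_le_norm.
rewrite in_itv/= ltr_norml => /andP[-> /ltW ->//].
Qed.


Lemma box_empty a b i : b i < a i -> box a b = set0.
Proof.
move=> ba; apply/seteqP; split => // x /(_ i); rewrite in_itv/= => /andP[h1 h2].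
by have := lt_trans (lt_le_trans h1 h2) ba; rewrite ltxx.
Qed.

Lemma lebesgue_box_fin a b : (mu (box a b) < +oo)%E.
Proof.
have [ab|] := pselect (forall i, a i <= b i).
  by rewrite /box lebesgue_rV_box// ltry.
by move=> /existsNP[i /negP]; rewrite -ltNge => /box_empty ->; rewrite measure0.
Qed.

Lemma setT_bigcup_box :
  \bigcup_k box (fun=> - k%:R) (fun=> k%:R : R) = [set: 'rV[R]_n].
Proof.
apply/seteqP; split => // x _; exists (Num.trunc `|x|).+1 => // j.
have : `|x ord0 j| < (Num.trunc `|x|).+1%:R.
  exact: le_lt_trans (coord_le_norm x j) (truncnS_gt _).
by rewrite in_itv/= ltr_norml => /andP[-> /ltW ->].
Qed.

Lemma measurable_shift a : measurable_fun setT (fun x : 'rV[R]_n => x + a).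
Proof.
apply: measurable_fun_rV => i; under eq_fun do rewrite mxE.
by apply: measurable_funD => //; exact: measurable_coord_rV.
Qed.

Lemma preimage_shift_box c a b : (fun x => x + c) @^-1` box a b =
  box (fun i => a i - c ord0 i) (fun i => b i - c ord0 i).
Proof.
apply/seteqP; split => x /= H i; have := H i; rewrite !in_itv/= mxE.
  by rewrite ltrBlDr lerBrDr.
by rewrite ltrBlDr lerBrDr.
Qed.

(** [lebesgue_rV] is an iterated product, so translation invariance is recovered from uniqueness:
    the measure and its translate agree on the pi-system of boxes, where both give the product of
    the side lengths. *)
Lemma lebesgue_shift c A : measurable A -> mu ((fun x => x + c) @^-1` A) = mu A.
Proof.
move=> mA; apply/esym.
apply: (measure_unique (range (fun ab : ('I_n -> R) * ('I_n -> R) => box ab.1 ab.2))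
  (fun k => box (fun=> - k%:R) (fun=> k%:R)) _ _ _ _ mu
  (measure_function_pushforward__canonical__measure_function_Measure mu
     (measurable_shift c))) => //.
- exact: measurable_rV_genE.
- move=> _ _ [[a b] _ <-] [[a' b'] _ <-] /=.
  exists (fun i => Num.max (a i) (a' i), fun i => Num.min (b i) (b' i)) => //=.
  apply/seteqP; split => [x H|x [H1 H2] i].
    split => i; have := H i; rewrite !in_itv/= gt_max le_min.
      by move=> /andP[/andP[-> _] /andP[-> _]].
    by move=> /andP[/andP[_ ->] /andP[_ ->]].
  have := H1 i; have := H2 i; rewrite !in_itv/= gt_max le_min.
  by move=> /andP[-> ->] /andP[-> ->].
- by move=> k; exists (fun=> - k%:R, fun=> k%:R).
- exact: setT_bigcup_box.
- move=> _ [[a b] _ <-] /=; rewrite /pushforward preimage_shift_box.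
  have [ab|] := pselect (forall i, a i <= b i).
    rewrite /box !lebesgue_rV_box//; last by move=> i; rewrite lerD2r.
    by congr (_%:E); apply: eq_bigr => i _; ring.
  move=> /existsNP[i /negP]; rewrite -ltNge => ba.
  by rewrite (box_empty ba) (@box_empty _ _ i) ?measure0// ltrD2r.
- by move=> k; exact: lebesgue_box_fin.
Qed.

Lemma lebesgue_sigma_finite : sigma_finite setT mu.
Proof.
exists (fun k => box (fun=> - k%:R) (fun=> k%:R)); first by rewrite setT_bigcup_box.
by move=> k; split; [exact: measurable_box|exact: lebesgue_box_fin].
Qed.

(** The recursion in [lebesgue_rV] only yields a bundled measure; this alias carries the
    sigma-finite structure under which Tonelli's theorem applies. *)
Definition lebesgue_sf : set 'rV[R]_n -> \bar R := mu.
HB.instance Definition _ := Measure.copy lebesgue_sf mu.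
HB.instance Definition _ := Measure_isSigmaFinite.Build _ _ _ lebesgue_sf lebesgue_sigma_finite.

Lemma bounded_sub_box A (M : R) : (forall x, A x -> `|x| <= M) ->
  exists k : nat, A `<=` box (fun=> - k%:R) (fun=> k%:R).
Proof.
move=> AM; exists (Num.trunc M).+1 => x Ax i.
have : `|x ord0 i| < (Num.trunc M).+1%:R.
  apply: le_lt_trans (truncnS_gt _); exact: (le_trans (coord_le_norm x i) (AM _ Ax)).
by rewrite in_itv/= ltr_norml => /andP[-> /ltW ->].
Qed.

Lemma compact_fin A : compact A -> measurable A /\ (mu A < +oo)%E.
Proof.
move=> cA; have mA : measurable A.
  by apply: closed_measurable_rV; apply: compact_closed => //; exact: norm_hausdorff.
split => //; have [M [_ /(_ (M + 1)) HM]] := compact_bounded cA.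
have [k kA] := @bounded_sub_box A (M + 1) (HM (ltr_pwDr ltr01 (lexx _))).
apply: le_lt_trans (lebesgue_box_fin (fun=> - k%:R) (fun=> k%:R)).
by apply: le_measure; rewrite ?inE//; exact: measurable_box.
Qed.

Lemma open_pos A x : open A -> A x -> (0 < mu A)%E.
Proof.
move=> oA Ax; have /nbhs_ballP[e /= e0 eA] : nbhs x A by exact: open_nbhs_nbhs.
pose b := box (fun i => x ord0 i - e / 2) (fun i => x ord0 i + e / 2).
apply: (@lt_le_trans _ _ (mu b)).
  rewrite /b /box lebesgue_rV_box; last by move=> i; lra.
  by rewrite lte_fin prodr_gt0// => i _; lra.
apply: le_measure; rewrite ?inE; [exact: measurable_box|exact: open_measurable_rV|].
move=> y yb; apply: eA; apply/ball_rVP => // i; have := yb i.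
by rewrite in_itv/= ltr_norml => /andP[? ?]; apply/andP; split; lra.
Qed.

Lemma ge0_integral_shift c (f : 'rV[R]_n -> \bar R) : measurable_fun setT f ->
  (forall x, 0 <= f x)%E ->
  (\int[mu]_x f (x + c)%R = \int[mu]_x f x)%E.
Proof.
move=> mf f0.
have := @ge0_integral_pushforward _ _ _ _ R _ (measurable_shift c) mu setT f measurableT mf (fun x _ => f0 x).
rewrite preimage_setT => <-.
apply: (@eq_measure_integral _ _ _ setT mu
  (measure_function_pushforward__canonical__measure_function_Measure mu (measurable_shift c)) f) => A mA _.
exact: (lebesgue_shift c mA).
Qed.

Lemma integral_shift c (f : 'rV[R]_n -> \bar R) : measurable_fun setT f ->
  (\int[mu]_x f (x + c)%R = \int[mu]_x f x)%E.
Proof.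
move=> mf; rewrite integralE [RHS]integralE.
congr (_ - _)%E.
  have mp : measurable_fun setT (f^\+)%E by exact: measurable_funepos.
  rewrite -[RHS](ge0_integral_shift c mp (fun x => funepos_ge0 f x)).
  by apply: eq_integral => x _; exact: (congr1 (@^~ x) (funepos_comp f (+%R^~ c))).
have mp : measurable_fun setT (f^\-)%E by exact: measurable_funeneg.
rewrite -[RHS](ge0_integral_shift c mp (fun x => funeneg_ge0 f x)).
by apply: eq_integral => x _; exact: (congr1 (@^~ x) (funeneg_comp f (+%R^~ c))).
Qed.


Lemma integrable_supp A (f : 'rV[R]_n -> R) (M : R) : measurable A -> (mu A < +oo)%E ->
  measurable_fun setT f -> (forall x, `|f x| <= M) -> (forall x, ~ A x -> f x = 0) ->
  mu.-integrable setT (EFin \o f).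
Proof.
move=> mA fA mf fM f0.
have -> : EFin \o f = (EFin \o f) \_ A.
  apply/funext => x; rewrite patchE; case: ifPn => //; rewrite notin_setE => nA.
  by rewrite /= f0.
apply/(integrable_mkcond _ mA).1; apply: measurable_bounded_integrable => //.
  exact: measurable_funTS.
by exists M; split; [rewrite num_real|move=> t Mt x _; exact: le_trans (fM x) (ltW Mt)].
Qed.

End measure_rV.

(** * Directional derivatives and integration by parts *)

Section line_derivative.
Context {R : realType} {V : normedModType R}.
Implicit Types (f : V -> R) (x v : V).

Lemma is_derive_line f x v (s df : R) :
  is_derive s 1 (fun h : R => f (h *: v + x)) df <-> is_derive (s *: v + x) v f df.
Proof.
have E : (fun h : R => h^-1 *: (((fun h : R => f (h *: v + x)) \o shift s) (h *: 1) -
    f (s *: v + x))) = (fun h : R => h^-1 *: ((f \o shift (s *: v + x)) (h *: v) -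
    f (s *: v + x))).
  by apply/funext => h /=; rewrite [h *: 1]mulr1 scalerDl addrA.
by split => -[h1 h2]; split; move: h1 h2; rewrite /derivable /derive E.
Qed.

Lemma is_derive_line0 f x v (df : R) :
  is_derive (0 : R) 1 (fun h : R => f (h *: v + x)) df <-> is_derive x v f df.
Proof. by rewrite is_derive_line scale0r add0r. Qed.

Lemma is_derive1_lip (f : R -> R) (df : R -> R) (C a b : R) :
  (forall t : R, is_derive t (1 : R) f (df t)) -> (forall t : R, `|df t| <= C) ->
  `|f b - f a| <= C * `|b - a|.
Proof.
move=> fd dC; wlog ab : a b / a <= b.
  by move=> H; case: (leP a b) => [/H //|/ltW /H]; rewrite distrC [`|a - b|]distrC.
have [|c _ ->] := @MVT_segment R f df a b ab (fun t _ => fd t).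
  apply: derivable_within_continuous => t _; by have [] := fd t.
by rewrite normrM ler_wpM2r.
Qed.

Lemma derive_lip f x v (C s : R) : (forall x, derivable f x v) ->
  (forall x, `|'D_v f x| <= C) -> `|f (s *: v + x) - f x| <= C * `|s|.
Proof.
move=> fd fC.
have := @is_derive1_lip (fun h : R => f (h *: v + x)) (fun h => 'D_v f (h *: v + x)) C 0 s.
rewrite scale0r add0r subr0; apply => // h; apply/is_derive_line.
exact: derivableP.
Qed.

(** Difference quotients along [1 / (k + 1)] present a partial derivative as the limit of a
    sequence, the form in which it enters measurability and dominated convergence. *)
Lemma derive_quotient f x v df : is_derive x v f df ->
  (fun k : nat => k.+1%:R * (f (x + k.+1%:R^-1 *: v) - f x)) @ \oo --> df.
Proof.
move=> [fd <-].
have : (fun k : nat => (k.+1%:R^-1 : R)) @ \oo --> (0 : R)^'.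
  move=> A [e /= e0 eA].
  have := near_infty_natSinv_lt (PosNum e0); apply: filterS => k /= ke.
  apply: eA => /=; last by rewrite invr_eq0 pnatr_eq0.
  by rewrite sub0r normrN gtr0_norm// invr_gt0.
move=> /cvg_comp H; have := H _ _ _ fd; apply: cvg_trans.
apply: near_eq_cvg; near=> k => /=.
by rewrite invrK [X in f X]addrC.
Unshelve. all: by end_near. Qed.

End line_derivative.

Section ibp.
Context {R : realType} {n : nat}.
Implicit Types (x y z : 'rV[R]_n) (A D : set 'rV[R]_n).
Local Notation mu := (lebesgue_rV R n).
Local Notation "''e_' i" := (delta_mx ord0 i : 'rV[R]_n) (at level 8, i at level 2, format "''e_' i").

(** A partial derivative that may be discontinuous is measurable as a pointwise limit of difference
    quotients; [F] is extended by zero off [A] so that the quotients are defined everywhere. *)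
Lemma measurable_partial A i (F : 'rV[R]_n -> R) : open A ->
  (forall x, A x -> {for x, continuous F}) ->
  (forall x, A x -> derivable F x 'e_i) -> measurable_fun A (partial i F).
Proof.
move=> oA cF dF; have mA := open_measurable_rV oA.
pose G := F \_ A.
have mG : measurable_fun setT G by apply: (measurable_restrictT _ mA).1; exact: measurable_cont.
apply: (@measurable_fun_cvg _ _ _ _ (fun k : nat => fun x => k.+1%:R * (G (x + k.+1%:R^-1 *: 'e_i) - G x))).
- move=> k; apply: measurable_funTS; apply: measurable_funM => //.
  apply: measurable_funB => //; apply: (measurableT_comp mG); exact: measurable_shift.
move=> x Ax.
apply: cvg_trans (derive_quotient (derivableP (dF x Ax))).
apply: near_eq_cvg.
have /nbhs_ballP[e /= e0 eA] : nbhs x A by exact: open_nbhs_nbhs.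
have := near_infty_natSinv_lt (PosNum e0); apply: filterS => k /= ke.
rewrite /G !patchE !mem_set//; apply: eA; apply/ball_rVP => // j.
rewrite !mxE opprD addrA subrr add0r normrN normrM gtr0_norm ?invr_gt0//.
apply: le_lt_trans ke; rewrite ler_piMr ?invr_ge0//.
by case: (_ && _); rewrite /= ?normr1 ?normr0.
Qed.

(** By translation invariance every difference quotient of [F] has integral zero. The bound on the
    derivative and the compact support give a dominating function, so the limit has integral zero as
    well. This covers derivatives that are merely bounded. *)
Lemma integral_partial0 (F : 'rV[R]_n -> R) i (C : R) K :
  continuous F -> compact K -> (forall x, ~ K x -> F x = 0) ->
  (forall x, derivable F x 'e_i) -> (forall x, `|partial i F x| <= C) ->
  mu.-integrable setT (EFin \o partial i F) /\ \int[mu]_x partial i F x = 0.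
Proof.
move=> cF cK F0 dF FC.
have mF := measurable_contT cF.
have [mK fK] := compact_fin cK.
have [M1 [_ HM1]] := compact_bounded cK.
pose M := M1 + 1.
have KM x : K x -> `|x| <= M by apply: HM1; rewrite ltr_pwDr.
(* One unit beyond the radius of [K], because the steps [1 / (k + 1)] are at most 1: a single box
   contains the supports of all the quotients. *)
have [k0 Qk] := @bounded_sub_box _ _ [set x | `|x| <= M + 1] (M + 1) (fun x h => h).
set Q := box _ _ in Qk; have mQ : measurable Q by exact: measurable_box.
have fQ : (mu Q < +oo)%E by exact: lebesgue_box_fin.
have FQ x : ~ Q x -> F x = 0.
  by move=> nQ; apply: F0 => Kx; apply: nQ; apply: Qk => /=; rewrite (le_trans (KM x Kx))// lerDl.
have [MF HMF] : exists MF, forall x, `|F x| <= MF.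
  have : compact (F @` K) by apply: continuous_compact => //; exact: continuous_subspaceT.
  move=> /compact_bounded[MF [_ HMF]]; exists (`|MF| + 1) => x.
  have [Kx|nK] := pselect (K x); last by rewrite F0// normr0 addr_ge0.
  by apply: (HMF (`|MF| + 1)); [rewrite (le_lt_trans (ler_norm MF))// ltrDl|exists x].
have C0 : 0 <= C by exact: le_trans (normr_ge0 _) (FC 0).
pose Fk (k : nat) x := k.+1%:R * (F (x + k.+1%:R^-1 *: 'e_i) - F x).
have mFk k : measurable_fun setT (Fk k).
  apply: measurable_funM => //; apply: measurable_funB => //.
  by apply: (measurableT_comp mF); exact: measurable_shift.
have intF : mu.-integrable setT (EFin \o F) by exact: (integrable_supp mQ fQ mF HMF FQ).
have FkC k x : `|Fk k x| <= C.
  rewrite normrM gtr0_norm// addrC mulrC -ler_pdivlMr//.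
  have := derive_lip x (k.+1%:R^-1) dF FC.
  by rewrite [X in C * X]gtr0_norm ?invr_gt0// [_ + x]addrC [- _ + _]addrC.
have FkQ k x : ~ Q x -> Fk k x = 0.
  move=> nQ; rewrite /Fk (FQ x nQ) subr0 F0 ?mulr0// => /KM h; apply: nQ; apply: Qk => /=.
  rewrite -[x](addrK (k.+1%:R^-1 *: 'e_i)); apply: (le_trans (ler_normB _ _)).
  apply: lerD => //; rewrite normrZ gtr0_norm ?invr_gt0//.
  rewrite mulr_ile1 ?invr_ge0 ?invf_le1// ?ler1n//.
  rewrite [leLHS]mx_normrE; apply: bigmax_le => // j _; rewrite mxE.
  by case: (_ && _); rewrite /= ?normr1 ?normr0.
have intFk k : \int[mu]_x Fk k x = 0.
  have intFs : mu.-integrable setT (EFin \o (fun x => F (x + k.+1%:R^-1 *: 'e_i))).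
    apply: (integrable_supp mQ fQ) => //.
      by apply: (measurableT_comp mF); exact: measurable_shift.
    move=> x nQ; have := FkQ k x nQ; rewrite /Fk (FQ x nQ) subr0 => /eqP.
    by rewrite mulf_eq0 pnatr_eq0 /= => /eqP.
  rewrite /Fk RintegralZl//; last exact: integrable_subr.
  rewrite RintegralB// /Rintegral.
  have mFe : measurable_fun setT (EFin \o F) by apply/measurable_EFinP.
  have /= -> := integral_shift (k.+1%:R^-1 *: 'e_i) mFe.
  by rewrite subrr mulr0.
pose g := EFin \o (fun x => C * \1_Q x).
have intg : mu.-integrable setT g.
  apply: (integrable_supp (A := Q) (M := C)) => //.
  - by apply: measurable_funM => //; exact: measurable_indic.
  - by move=> x; rewrite indicE; case: (_ \in _); rewrite ?mulr1 ?mulr0 ?normr0// ger0_norm.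
  - by move=> x nQ; rewrite indicE memNset// mulr0.
have mP : measurable_fun setT (partial i F).
  by apply: measurable_partial => //; [exact: openT|move=> x _; exact: cF].
have [] := @dominated_convergence _ _ R mu setT measurableT (fun k => EFin \o Fk k) (EFin \o partial i F) g.
- by move=> k; apply/measurable_EFinP; exact: mFk.
- by apply/measurable_EFinP.
- apply: aeW => x _; apply: cvg_EFin; first by near=> k.
  exact: (derive_quotient (derivableP (dF x))).
- exact: intg.
- apply: aeW => x k _; rewrite /= lee_fin indicE.
  have [Qx|nQ] := pselect (Q x); first by rewrite mem_set// mulr1.
  by rewrite FkQ// normr0 memNset// mulr0.
move=> intP _ cvgP; split => //; rewrite /Rintegral.
have -> : (\int[mu]_x (partial i F x)%:E = 0)%E; last by [].
apply: (cvg_unique _ cvgP); first exact: ereal_hausdorff.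
apply: cvg_near_cst; near=> k.
have fin : (\int[mu]_x (Fk k x)%:E)%E \is a fin_num.
  by apply: integrable_fin_num => //; exact: (integrable_supp mQ fQ (mFk k) (FkC k) (FkQ k)).
by have := congr1 (@EFin R) (intFk k); rewrite /Rintegral fineK.
Unshelve. all: by end_near. Qed.

End ibp.

(** * Smooth functions *)

Section continuity_rules.
Context {T : topologicalType} {R : realType}.
Implicit Types (f g : T -> R) (x : T).

Lemma contD f g x : {for x, continuous f} -> {for x, continuous g} ->
  {for x, continuous (fun y => f y + g y)}.
Proof. by move=> cf cg; apply: cvgD. Qed.

Lemma contB f g x : {for x, continuous f} -> {for x, continuous g} ->
  {for x, continuous (fun y => f y - g y)}.
Proof. by move=> cf cg; apply: cvgB. Qed.

Lemma contM f g x : {for x, continuous f} -> {for x, continuous g} ->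
  {for x, continuous (fun y => f y * g y)}.
Proof. by move=> cf cg; apply: cvgM. Qed.

Lemma cont_cst (c : R) x : {for x, continuous (fun=> c : R)}.
Proof. exact: cvg_cst. Qed.

Lemma contV f x : f x != 0 -> {for x, continuous f} -> {for x, continuous (fun y => (f y)^-1)}.
Proof. by move=> f0 cf; apply: cvgV. Qed.

Lemma cont_comp (h : R -> R) f x : {for f x, continuous h} -> {for x, continuous f} ->
  {for x, continuous (fun y => h (f y))}.
Proof. by move=> ch cf; exact: (@continuous_comp _ _ _ f h x cf ch). Qed.

Lemma cont_sum (I : Type) (r : seq I) (P : pred I) (F : I -> T -> R) x :
  (forall i, {for x, continuous (F i)}) ->
  {for x, continuous (fun y => \sum_(i <- r | P i) F i y)}.
Proof.
move=> cF; rewrite /prop_for/=; elim: r => [|i r IH].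
  rewrite (_ : (fun y => _) = fun=> 0); first exact: cont_cst.
  by apply/funext => y; rewrite big_nil.
rewrite (_ : (fun y => _) = fun y => if P i then F i y + \sum_(j <- r | P j) F j y
    else \sum_(j <- r | P j) F j y); last by apply/funext => y; rewrite big_cons.
by case: (P i) => //; apply: contD => //; exact: cF.
Qed.

End continuity_rules.

Section derivative_rules.
Context {R : realType} {V : normedModType R}.
Implicit Types (f g : V -> R) (x v : V).

Lemma isdD f g x v df dg : is_derive x v f df -> is_derive x v g dg ->
  is_derive x v (fun y => f y + g y) (df + dg).
Proof. exact: is_deriveD. Qed.

Lemma isdB f g x v df dg : is_derive x v f df -> is_derive x v g dg ->
  is_derive x v (fun y => f y - g y) (df - dg).
Proof. exact: is_deriveB. Qed.

Lemma isdN f x v df : is_derive x v f df -> is_derive x v (fun y => - f y) (- df).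
Proof. exact: is_deriveN. Qed.

Lemma isdM f g x v df dg : is_derive x v f df -> is_derive x v g dg ->
  is_derive x v (fun y => f y * g y) (df * g x + f x * dg).
Proof.
by move=> hf hg; apply: (is_derive_eq (is_deriveM hf hg)); rewrite /GRing.scale/=; ring.
Qed.

Lemma isd_cst c x v : is_derive x v (fun=> c : R) 0.
Proof. exact: is_derive_cst. Qed.

Lemma isdZ k f x v df : is_derive x v f df -> is_derive x v (fun y => k * f y) (k * df).
Proof. by move=> hf; apply: (is_derive_eq (isdM (isd_cst k x v) hf)); rewrite mul0r add0r. Qed.

Lemma isd_id (x v : R) : is_derive x v (fun y : R => y) v.
Proof. exact: is_derive_id. Qed.

Lemma isd_comp (h : R -> R) f x v dh df :
  is_derive (f x) 1 h dh -> is_derive x v f df -> is_derive x v (fun y => h (f y)) (dh * df).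
Proof.
move=> hh /is_derive_line0 Hf; apply/is_derive_line0.
apply: (@is_derive1_comp _ h (fun s : R => f (s *: v + x))) Hf.
by rewrite scale0r add0r.
Qed.

Lemma isdV f x v df : f x != 0 -> is_derive x v f df ->
  is_derive x v (fun y => (f y)^-1) (- df / f x ^+ 2).
Proof.
move=> f0 hf.
have H : is_derive (f x) (1 : R) (fun s : R => s^-1) (- (f x) ^- 2).
  by apply: (@is_derive_eq _ _ _ _ _ _ _ _ (@is_deriveV R id (f x) 1 1 f0 _)); rewrite [_ *: _]mulr1.
by apply: (is_derive_eq (isd_comp H hf)); rewrite !mulNr mulrC.
Qed.

Lemma isd_cont (h : R -> R) (x dh : R) : is_derive x 1 h dh -> {for x, continuous h}.
Proof. by move=> [H _]; apply/differentiable_continuous/derivable1_diffP. Qed.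

End derivative_rules.

Section flat.
Context {R : realType}.
Implicit Types (q : {poly R}) (s t : R).

(** The polynomial factor in [1 / t] makes the family stable under differentiation; [flat 1] is the
    classical smooth function [exp (-1/t)], used as the cutoff throughout. *)
Definition flat q t : R := if 0 < t then q.[t^-1] * expR (- t^-1) else 0.

Lemma horner_bound q : exists C k, 0 <= C /\ forall s, 1 <= s -> `|q.[s]| <= C * s ^+ k.
Proof.
elim/poly_ind: q => [|q c [C [k [C0 H]]]].
  by exists 0, 0%N; split => // s _; rewrite horner0 normr0 mul0r.
exists (C + `|c|), k.+1; split => [|s s1]; first exact: addr_ge0.
rewrite hornerMXaddC (le_trans (ler_normD _ _))// mulrDl lerD//.
  rewrite normrM (ger0_norm (le_trans ler01 s1)) exprSr mulrA.
  by rewrite ler_wpM2r ?H// (le_trans ler01).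
by rewrite ler_peMr// exprn_ege1.
Qed.

(** From [exp s >= s^(k+1) / (k+1)!] with [s = 1 / t]: every polynomial in [1 / t] is beaten with
    one factor [t] to spare. *)
Lemma flat_bound q : exists2 C, 0 <= C & forall t, `|t| <= 1 -> `|flat q t| <= C * `|t|.
Proof.
have [C [k [C0 H]]] := horner_bound q.
exists (C * (k.+1)`!%:R) => [|t t1]; first by rewrite mulr_ge0.
rewrite /flat; case: ltP => t0; last by rewrite normr0 !mulr_ge0.
have tv : 1 <= t^-1 by rewrite invf_ge1// -(gtr0_norm t0).
have tv0 : 0 < t^-1 by rewrite invr_gt0.
rewrite (gtr0_norm t0) normrM (ger0_norm (expR_ge0 _)) expRN.
have E : t^-1 ^+ k.+1 / (k.+1)`!%:R <= expR t^-1.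
  by apply: le_trans (expR_ge1Dxn k (ltW tv0)); rewrite lerDr.
have F0 : (0 : R) < (k.+1)`!%:R by rewrite ltr0n fact_gt0.
rewrite ler_pdivrMr ?expR_gt0// (le_trans (H _ tv))//.
apply: (@le_trans _ _ (C * (k.+1)`!%:R * t * (t^-1 ^+ k.+1 / (k.+1)`!%:R))).
  rewrite le_eqVlt; apply/orP; left; apply/eqP; rewrite exprS; field.
  by rewrite ?gt_eqF.
by rewrite ler_wpM2l// !mulr_ge0// ltW.
Qed.

Lemma flatX q t : flat (q * 'X) t = flat q t / t.
Proof.
by rewrite /flat; case: ifP; rewrite ?mul0r// hornerMX => _; rewrite mulrAC.
Qed.

Lemma is_derive_horner q t : is_derive t 1 (horner q) q^`().[t].
Proof. by split; [exact: derivable_horner|rewrite -derive1E -derivE]. Qed.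

Lemma is_derive_flat q t : is_derive t 1 (flat q) (flat ((q - q^`()) * 'X^2) t).
Proof.
have [t0|t0|->] := ltgtP t 0.
- have E : \forall s \near t, 0 = flat q s.
    by near=> s; rewrite /flat ltNge ltW//; near: s; exact: lt_nbhsl.
  rewrite {2}/flat ltNge (ltW t0)/=.
  exact: (near_eq_is_derive E).
- have E : \forall s \near t, q.[s^-1] * expR (- s^-1) = flat q s.
    by near=> s; rewrite /flat ifT//; near: s; exact: lt_nbhsr.
  apply: (near_eq_is_derive E).
  have dV : is_derive t (1 : R) (fun s : R => s^-1) (- t ^- 2).
    by apply: (@is_derive_eq _ _ _ _ _ _ _ _ (@is_deriveV R id t 1 1 _ _)); rewrite ?gt_eqF// [_ *: _]mulr1.
  have dq : is_derive t (1:R) (fun s : R => q.[s^-1]) (q^`().[t^-1] * - t ^- 2).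
    exact: (isd_comp (is_derive_horner q t^-1) dV).
  have de : is_derive t (1:R) (fun s : R => expR (- s^-1)) (expR (- t^-1) * t ^- 2).
    apply: (@isd_comp _ _ expR (fun s : R => - s^-1) _ _ _ _ (is_derive_expR (- t^-1))).
    by apply: (is_derive_eq (isdN dV)); rewrite opprK.
  apply: (is_derive_eq (is_deriveM dq de)).
  rewrite /flat t0 !scalerAl /= hornerM hornerXn hornerD hornerN.
  by rewrite /GRing.scale/= exprVn; ring.
(* The difference quotient of [flat q] at 0 is [flat (q * 'X)], which is [O(|h|)]. *)
have [C C0 HC] := flat_bound (q * 'X).
rewrite {2}/flat ltxx.
suff H : (fun h : R => h^-1 *: ((flat q \o shift (0 : R)) (h *: (1 : R)) - flat q 0)) @ 0^' --> (0 : R).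
  by split; [apply/cvg_ex; exists 0|exact: cvg_lim H].
apply/cvgrPdist_lt => e e0; near=> h.
rewrite sub0r normrN /= addr0 [h *: 1]mulr1 {2}/flat ltxx subr0 /GRing.scale/= mulrC -flatX.
have h1 : `|h| < Num.min 1 (e / (C + 1)).
  near: h; apply: dnbhs0_lt; rewrite lt_min ltr01 divr_gt0//.
  by rewrite ltr_wpDl.
move: h1; rewrite lt_min => /andP[h1 h2].
apply: (le_lt_trans (HC _ (ltW h1))).
apply: (@le_lt_trans _ _ ((C + 1) * `|h|)); first by rewrite ler_wpM2r// lerDl.
by rewrite mulrC -ltr_pdivlMr// ltr_wpDl.
Unshelve. all: by end_near. Qed.

Lemma flat1_ge0 t : 0 <= flat 1 t.
Proof. by rewrite /flat; case: ifP; rewrite // hornerC mul1r expR_ge0. Qed.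

Lemma flat1_gt0 t : 0 < t -> 0 < flat 1 t.
Proof. by move=> t0; rewrite /flat t0 hornerC mul1r expR_gt0. Qed.

Lemma flat_le0 q t : t <= 0 -> flat q t = 0.
Proof. by move=> t0; rewrite /flat ltNge t0. Qed.

Lemma continuous_flat q : continuous (flat q).
Proof.
move=> t; apply/differentiable_continuous/derivable1_diffP.
by have [] := is_derive_flat q t.
Qed.

Lemma flat1_le1 t : flat 1 t <= 1.
Proof.
rewrite /flat; case: ifP => // t0; rewrite hornerC mul1r expR_le1 oppr_le0 invr_ge0 ltW//.
Qed.

Definition dflat1 := flat 'X^2 : R -> R.

Lemma is_derive_flat1 t : is_derive t 1 (flat 1) (dflat1 t).
Proof. by apply: (is_derive_eq (is_derive_flat 1 t)); rewrite derivC subr0 mul1r. Qed.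

Lemma dflat1_ge0 t : 0 <= dflat1 t.
Proof.
by rewrite /dflat1 /flat; case: ifP => // t0; rewrite hornerXn mulr_ge0 ?expR_ge0// exprn_ge0// invr_ge0 ltW.
Qed.

End flat.

Section smooth_algebra.
Context {R : realType} {n : nat}.
Local Notation "''e_' i" := (delta_mx ord0 i : 'rV[R]_n) (at level 8, i at level 2, format "''e_' i").
Implicit Types (F G : 'rV[R]_n -> R) (B : ('rV[R]_n -> R) -> Prop).

(** Smoothness asks for all iterated partial derivatives; a class of functions stable under partial
    derivatives provides them by induction on the list of indices. *)
Lemma smooth_closed B :
  (forall F, B F -> continuous F /\
     forall i, (forall x, derivable F x 'e_i) /\ B (partial i F)) ->
  forall F, B F -> smooth F.
Proof.
move=> H F BF s.
have : B (iter_partial s F) by elim: s => //= i s IH; have [_ /(_ i)[]] := H _ IH.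
by move=> /H[cF dF]; split => // i x; have [/(_ x)] := dF i.
Qed.

(** The function algebra over [B]. In [smooth_generated] the partial derivatives of members of [B]
    have to lie in this algebra only, so that chain-rule expressions are covered as products. *)
Inductive generated B : ('rV[R]_n -> R) -> Prop :=
| gen_base F of B F : generated B F
| gen_cst c : generated B (fun=> c)
| gen_add F G of generated B F & generated B G : generated B (fun x => F x + G x)
| gen_mul F G of generated B F & generated B G : generated B (fun x => F x * G x).

Lemma smooth_generated B :
  (forall F, B F -> continuous F /\
     forall i, (forall x, derivable F x 'e_i) /\ generated B (partial i F)) ->
  forall F, generated B F -> smooth F.
Proof.
move=> H; apply: smooth_closed => F.
elim=> {F} [F /H//|c|F G _ [cF dF] _ [cG dG]|F G gF [cF dF] gG [cG dG]].
- split; first exact: cst_continuous.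
  move=> i; split => [x|]; first exact: derivable_cst.
  rewrite (_ : partial i _ = fun=> 0); first exact: gen_cst.
  by apply/funext => x; rewrite /partial derive_cst.
- split; first by move=> x; apply: contD; [exact: cF|exact: cG].
  move=> i; have [dFi gFi] := dF i; have [dGi gGi] := dG i.
  split => [x|]; first exact: derivableD.
  rewrite (_ : partial i _ = fun x => partial i F x + partial i G x); first exact: gen_add.
  by apply/funext => x; rewrite /partial deriveD.
split; first by move=> x; apply: contM; [exact: cF|exact: cG].
move=> i; have [dFi gFi] := dF i; have [dGi gGi] := dG i.
split => [x|]; first exact: derivableM.
rewrite (_ : partial i _ = fun x => F x * partial i G x + G x * partial i F x).
  by apply: gen_add; apply: gen_mul.
by apply/funext => x; rewrite /partial deriveM.
Qed.

Lemma partialE i F x df : is_derive x 'e_i F df -> partial i F x = df.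
Proof. by move=> [_]. Qed.

Lemma is_derive_coord i x v : is_derive x v (fun x : 'rV[R]_n => x ord0 i) (v ord0 i).
Proof.
apply/is_derive_line0.
rewrite (_ : (fun _ => _) = fun h : R => h * v ord0 i + x ord0 i); last first.
  by apply/funext => h; rewrite !mxE.
apply: (is_derive_eq (isdD (isdM (isd_id _ _) (isd_cst _ _ _)) (isd_cst _ _ _))).
by rewrite mul1r mulr0 !addr0.
Qed.

Definition bump (e : R) (x : 'rV[R]_n) : R := flat 1 (e ^+ 2 - dotv x x).

Lemma is_derive_dotv i x : is_derive x 'e_i (fun x : 'rV[R]_n => dotv x x) (2 * x ord0 i).
Proof.
rewrite /dotv.
have H j : is_derive x 'e_i (fun x : 'rV[R]_n => x ord0 j * x ord0 j) (2 * x ord0 j * (i == j)%:R).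
  apply: (is_derive_eq (is_deriveM (is_derive_coord j x 'e_i) (is_derive_coord j x 'e_i))).
  by rewrite mxE eqxx eq_sym /GRing.scale/=; ring.
have := is_derive_sum (fun j => H j).
rewrite (_ : \sum_(j < n) _ = (fun x : 'rV[R]_n => \sum_j x ord0 j * x ord0 j)); last first.
  by apply/funext => y; rewrite fct_sumE.
move=> /is_derive_eq; apply.
rewrite (bigD1 i)//= eqxx mulr1 big1 ?addr0// => j ji.
by rewrite eq_sym (negPf ji) mulr0.
Qed.

Lemma continuous_dotv : continuous (fun x : 'rV[R]_n => dotv x x).
Proof.
move=> x; rewrite /dotv; apply: cont_sum => i.
by apply: contM; exact: coord_continuous.
Qed.

Lemma smooth_bump e : smooth (bump e).
Proof.
pose B F := (exists q, F = fun x => flat q (e ^+ 2 - dotv x x)) \/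
            (exists i, F = fun x : 'rV[R]_n => x ord0 i).
apply: (@smooth_generated B); last by apply: gen_base; left; exists 1.
move=> _ [[q ->]|[j ->]]; split.
- move=> x; apply: (@cont_comp _ _ (flat q) (fun x => e ^+ 2 - dotv x x)); first exact: continuous_flat.
  by apply: contB; [exact: cont_cst|exact: continuous_dotv].
- move=> i; have H x : is_derive x 'e_i (fun x => flat q (e ^+ 2 - dotv x x))
     (flat ((q - q^`()) * 'X^2) (e ^+ 2 - dotv x x) * (-2 * x ord0 i)).
    apply: (isd_comp (is_derive_flat q _)).
    have := is_deriveB (is_derive_cst (e ^+ 2) x 'e_i) (is_derive_dotv i x).
    by move=> /is_derive_eq; apply; rewrite sub0r mulNr.
  split => [x|]; first by have [] := H x.
  rewrite (_ : partial i _ = fun x => flat ((q - q^`()) * 'X^2) (e ^+ 2 - dotv x x) * (-2 * x ord0 i)); last first.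
    by apply/funext => x; exact: partialE.
  apply: gen_mul; first by apply: gen_base; left; exists ((q - q^`()) * 'X^2).
  by apply: gen_mul; [exact: gen_cst|apply: gen_base; right; exists i].
- exact: coord_continuous.
move=> i; split => [x|]; first by have [] := is_derive_coord j x 'e_i.
rewrite (_ : partial i _ = fun=> ('e_i ord0 j)); first exact: gen_cst.
by apply/funext => x; apply: partialE; exact: is_derive_coord.
Qed.

End smooth_algebra.

(** * Mollification *)

Section compactness.
Context {R : realType} {V : normedModType R}.
Implicit Types (F : V -> R) (K : set V).

Lemma compact_unif K F : compact K -> (forall x, K x -> {for x, continuous F}) ->
  forall eta, 0 < eta -> exists2 d, 0 < d &
    forall x y, K x -> `|x - y| < d -> `|F x - F y| < eta.
Proof.
move=> cK cF eta eta0.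
pose P (d : R) (x : V) := forall y, `|x - y| < d -> `|F x - F y| < eta.
have [r /= r0 Hr] : \forall d \near (0 : R)^'+, K `<=` P d.
  move/compact_near_coveringP : cK; apply => x Kx.
  have /cvgrPdist_lt/(_ _ (divr_gt0 eta0 (ltr0n R 2))) := cF x Kx.
  move=> /nbhs_ballP[r /= r0 rF].
  exists (ball x (r / 2), [set d | d < r / 2]); first split => /=.
  - by apply: nbhsx_ballx; exact: divr_gt0.
  - by apply: nbhs_right_lt; exact: divr_gt0.
  move=> [x' d] [/= xx' dr] y x'y.
  have h1 : `|F x - F x'| < eta / 2.
    by apply: rF; apply: le_ball xx'; lra.
  have h2 : `|F x - F y| < eta / 2.
    apply: rF; apply: (@ball_split _ _ x') => //.
    by rewrite -ball_normE /ball_/=; apply: (lt_trans x'y).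
  rewrite (splitr eta) (_ : F x' - F y = (F x - F y) - (F x - F x')); last by ring.
  exact: (le_lt_trans (ler_normB _ _) (ltrD h2 h1)).
exists (r / 2); first exact: divr_gt0.
move=> x y Kx; apply: (Hr (r / 2)) => //=.
  by rewrite sub0r normrN gtr0_norm ?divr_gt0// ltr_pdivrMr// ltr_pMr// ltr1n.
exact: divr_gt0.
Qed.

Lemma compact_bound K F : compact K -> (forall x, K x -> {for x, continuous F}) ->
  exists2 M, 0 <= M & forall x, K x -> `|F x| <= M.
Proof.
move=> cK cF.
have : compact (F @` K).
  by apply: continuous_compact => //; apply: continuous_in_subspaceT => x /set_mem; exact: cF.
move=> /compact_bounded[M [_ HM]]; exists (`|M| + 1); first exact: addr_ge0.
move=> x Kx; apply: (HM (`|M| + 1)); last by exists x.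
by rewrite (le_lt_trans (ler_norm M))// ltrDl.
Qed.

Lemma supp_unif K F : compact K -> continuous F -> (forall x, ~ K x -> F x = 0) ->
  forall eta, 0 < eta -> exists2 d, 0 < d & forall x y, `|x - y| < d -> `|F x - F y| < eta.
Proof.
move=> cK cF F0 eta eta0.
have [d d0 H] := compact_unif cK (fun x _ => cF x) eta0.
exists d => // x y xy.
have [Kx|nKx] := pselect (K x); first exact: H.
have [Ky|nKy] := pselect (K y); first by rewrite distrC; apply: H; rewrite // distrC.
by rewrite !F0// subrr normr0.
Qed.

End compactness.

Lemma cont_dist {R : realType} {T : topologicalType} (f : T -> R) (x : T) :
  (forall e, 0 < e -> \forall y \near x, `|f x - f y| < e) -> {for x, continuous f}.
Proof. by move=> H; apply/cvgrPdist_lt. Qed.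

Section convolution.
Context {R : realType} {n : nat}.
Implicit Types (x y z : 'rV[R]_n) (Q D : set 'rV[R]_n) (K v : 'rV[R]_n -> R).
Local Notation mu := (lebesgue_rV R n).
Local Notation "''e_' i" := (delta_mx ord0 i : 'rV[R]_n) (at level 8, i at level 2, format "''e_' i").

Lemma compact_norm_le (M : R) : compact [set x : 'rV[R]_n | `|x| <= M].
Proof.
apply: bounded_closed_compact.
  exists M; split; first exact: num_real.
  by move=> t Mt x /= xM; exact: le_trans xM (ltW Mt).
by apply: (@closed_comp _ _ (fun x => `|x|) [set t | t <= M]); [move=> x _; exact: norm_continuous|exact: closed_le].
Qed.

Definition csmooth K := smooth K /\ exists2 C, compact C & forall x, ~ C x -> K x = 0.

Lemma csmooth_cont K : csmooth K -> continuous K.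
Proof. by move=> [sK _]; have [] := sK [::]. Qed.

Lemma csmooth_derivable K i x : csmooth K -> derivable K x 'e_i.
Proof. by move=> [sK _]; have [_] := sK [::]; exact. Qed.

Lemma partial_off_supp K C : closed C -> (forall x, ~ C x -> K x = 0) ->
  forall i x, ~ C x -> is_derive x 'e_i K 0.
Proof.
move=> cC K0 i x nC.
have E : \forall y \near x, 0 = K y.
  have : nbhs x (~` C) by apply: open_nbhs_nbhs; split => //; rewrite openC.
  by apply: filterS => y nCy; rewrite K0.
exact: (near_eq_is_derive E).
Qed.

Lemma csmooth_partial K i : csmooth K -> csmooth (partial i K).
Proof.
move=> [sK [C cC K0]]; split.
  by move=> s; have := sK (rcons s i); rewrite /iter_partial foldr_rcons.
exists C => // x nC; apply: partialE; apply: (partial_off_supp _ K0) => //.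
by apply: compact_closed => //; exact: norm_hausdorff.
Qed.

Lemma csmooth_bound K : csmooth K -> exists2 M, 0 <= M & forall x, `|K x| <= M.
Proof.
move=> cK; have [sK [C cC K0]] := cK.
have cF : continuous K by exact: csmooth_cont.
have [M M0 HM] := compact_bound cC (fun x _ => cF x).
by exists M => // x; have [/HM//|/K0 ->] := pselect (C x); rewrite normr0.
Qed.

Lemma csmooth_unif K : csmooth K -> forall eta, 0 < eta ->
  exists2 d, 0 < d & forall x y, `|x - y| < d -> `|K x - K y| < eta.
Proof. by move=> cK; have [sK [C cC K0]] := cK; apply: (supp_unif cC) => //; exact: csmooth_cont. Qed.

Lemma integral_pos D (U : set 'rV[R]_n) (h : 'rV[R]_n -> R) c x :
  measurable D -> measurable_fun D h -> (forall x, D x -> 0 <= h x) ->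
  open U -> U `<=` D -> U x -> 0 < c -> (forall x, U x -> c <= h x) ->
  (0 < \int[mu]_(x in D) (h x)%:E)%E.
Proof.
move=> mD mh h0 oU UD Ux c0 hc; have mU := open_measurable_rV oU.
apply: (@lt_le_trans _ _ (\int[mu]_(x in U) (cst c%:E) x)%E).
  rewrite integral_cst// mule_gt0 ?lte_fin//; exact: open_pos Ux.
apply: (@le_trans _ _ (\int[mu]_(x in U) (h x)%:E)%E).
  apply: ge0_le_integral => //.
  - by move=> y _ /=; rewrite lee_fin ltW.
  - by apply/measurable_EFinP; exact: (measurable_funS mD UD mh).
by apply: ge0_subset_integral => //; exact/measurable_EFinP.
Qed.

Section kernel.
Variables (Q : set 'rV[R]_n) (v : 'rV[R]_n -> R).
Hypotheses (mQ : measurable Q) (iv : mu.-integrable Q (EFin \o v)).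

Definition conv K x := \int[mu]_(z in Q) (K (x - z) * v z).

Lemma mv : measurable_fun Q v.
Proof. by apply/measurable_EFinP; exact: measurable_int iv. Qed.

Lemma conv_norm_int : mu.-integrable Q (EFin \o (fun z => `|v z|)).
Proof. by apply: eq_integrable (integrable_abse iv). Qed.

Lemma cont_subl K x : continuous K -> continuous (fun z => K (x - z)).
Proof.
move=> cK z; apply: (@continuous_comp _ _ _ (fun z => x - z) K); last exact: cK.
by apply: continuousB; [exact: cst_continuous|exact: (fun=> id)].
Qed.

Lemma conv_int K x : csmooth K -> mu.-integrable Q (EFin \o (fun z => K (x - z) * v z)).
Proof.
move=> cK; have [M M0 HM] := csmooth_bound cK.
apply: (@integrable_dominated _ _ _ _ _ mQ _ (fun z => M * `|v z|)).
- apply: measurable_funM mv; apply: measurable_funTS; apply: measurable_contT.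
  exact: cont_subl (csmooth_cont cK).
- by move=> z _; rewrite normrM ler_wpM2r.
- exact: integrable_scaler conv_norm_int.
Qed.

Lemma conv_cont K : csmooth K -> continuous (conv K).
Proof.
move=> cK x; apply: cont_dist => e e0.
pose I := \int[mu]_(z in Q) `|v z|.
have I0 : 0 <= I by apply: Rintegral_ge0.
have I1 : 0 < I + 1 by rewrite ltr_wpDl.
have [d d0 H] := csmooth_unif cK (divr_gt0 e0 I1).
near=> y; rewrite /conv -RintegralB//; try exact: conv_int.
apply: (le_lt_trans (le_normr_Rintegral _ _)) => //.
  by apply: integrable_subr => //; exact: conv_int.
apply: (@le_lt_trans _ _ (\int[mu]_(z in Q) (e / (I + 1) * `|v z|))).
  apply: le_Rintegral => //.
  - by apply: (@eq_integrable _ _ _ _ _ mQ _ _ _ (integrable_abse (integrable_subr mQ (conv_int x cK) (conv_int y cK)))).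
  - exact: integrable_scaler conv_norm_int.
  move=> z _; rewrite -mulrBl normrM ler_wpM2r// ltW// H//.
  rewrite (_ : x - z - (y - z) = x - y); last by rewrite opprB addrA subrK.
  by near: y; apply: (@cvgr_dist_lt _ _ _ (nbhs x) _ id x).
rewrite RintegralZl//; last exact: conv_norm_int.
by rewrite mulrAC ltr_pdivrMr// ltr_pM2l// ltrDl.
Unshelve. all: by end_near. Qed.

Lemma conv_derive K i x : csmooth K -> is_derive x 'e_i (conv K) (conv (partial i K) x).
Proof.
move=> cK; have [M M0 HM] := csmooth_bound (csmooth_partial i cK).
apply/is_derive_line0.
pose f (h : R) z := K (h *: 'e_i + x - z) * v z.
have df h z : is_derive h (1 : R) (f ^~ z) (partial i K (h *: 'e_i + x - z) * v z).
  have := @is_derive_line _ _ K (x - z) 'e_i h (partial i K (h *: 'e_i + (x - z))).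
  move=> [_ /(_ (derivableP (@csmooth_derivable K i _ cK)))] H.
  have := isdM H (isd_cst (v z) h (1 : R)); rewrite mulr0 addr0 addrA.
  by apply: near_eq_is_derive; near=> s; rewrite /f addrA.
have I0 : `](-1), 1[%classic (0 : R) by rewrite /= in_itv/= ltrN10 ltr01.
have If h : `](-1), 1[%classic h -> mu.-integrable Q (EFin \o f h) by move=> _; exact: conv_int.
have Df h z : `](-1), 1[%classic h -> Q z -> derivable (f ^~ z) h 1 by move=> _ _; have [] := df h z.
have G0 z : 0 <= M * `|v z| by rewrite mulr_ge0.
have IG : mu.-integrable Q (EFin \o (fun z => M * `|v z|)) by exact: integrable_scaler conv_norm_int.
have dE h z : partial1of2 f h z = partial i K (h *: 'e_i + x - z) * v z.
  by rewrite /partial1of2 derive1E; have [] := df h z.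
have UG h z : `](-1), 1[%classic h -> Q z -> `|partial1of2 f h z| <= M * `|v z|.
  by move=> _ _; rewrite dE normrM ler_wpM2r.
have E : (fun h : R => conv K (h *: 'e_i + x)) = (fun h => \int[mu]_(z in Q) f h z) by [].
split; first by rewrite E; exact: (derivable_under_integral mQ I0 If Df G0 IG UG).
rewrite E -derive1E (differentiation_under_integral mQ I0 If Df G0 IG UG).
by apply: eq_Rintegral => z _; rewrite dE scale0r add0r.
Unshelve. all: by end_near. Qed.

Lemma smooth_conv K : csmooth K -> smooth (conv K).
Proof.
move=> cK.
apply: (@smooth_closed _ _ (fun F => exists2 K, csmooth K & F = conv K)); last by exists K.
move=> _ [{cK} {}K cK ->]; split; first exact: conv_cont.
move=> i; split => [x|]; first by have [] := conv_derive i x cK.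
by exists (partial i K); [exact: csmooth_partial|apply/funext => x; exact: partialE (conv_derive i x cK)].
Qed.

End kernel.

Lemma dotv_ge_coord x i : x ord0 i ^+ 2 <= dotv x x.
Proof.
rewrite /dotv (bigD1 i)//= expr2 lerDl sumr_ge0// => j _; exact: sqr_ge0.
Qed.

Lemma bump_off e x : 0 < e -> e < `|x| -> bump e x = 0.
Proof.
move=> e0; rewrite [X in _ < X -> _]mx_normrE => ex.
have [i ix] : exists i, e < `|x ord0 i|.
  apply: contrapT => /forallNP H; move: ex; rewrite ltNge => /negP; apply.
  apply: bigmax_le => [|[i j] _] /=; first exact: ltW.
  by rewrite ord1 leNgt; apply/negP/H.
apply: flat_le0; rewrite subr_le0; apply: le_trans (dotv_ge_coord x i).
by have := ltW ix; rewrite -ler_sqr ?nnegrE ?(ltW e0)// real_normK ?num_real.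
Qed.

Lemma csmooth_bump e : 0 < e -> csmooth (bump e : 'rV[R]_n -> R).
Proof.
move=> e0; split; first exact: smooth_bump.
exists [set x | `|x| <= e]; first exact: compact_norm_le.
by move=> x /negP; rewrite -ltNge => /(bump_off e0).
Qed.

Lemma csmooth_integrable K : csmooth K -> mu.-integrable setT (EFin \o K).
Proof.
move=> cK; have [M M0 HM] := csmooth_bound cK; have [sK [C cC K0]] := cK.
have [mC fC] := compact_fin cC.
apply: (integrable_supp mC fC _ HM K0); apply: measurable_contT; exact: csmooth_cont.
Qed.

Definition mass (e : R) : R := \int[mu]_x bump e x.

Lemma mass_gt0 e : 0 < e -> 0 < mass e.
Proof.
move=> e0; have cb := csmooth_bump e0.
have b0 : 0 < bump e (0 : 'rV[R]_n).
  apply: flat1_gt0; rewrite /dotv big1 ?subr0 ?exprn_gt0// => i _.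
  by rewrite mxE mulr0.
have cB : continuous (bump e : 'rV[R]_n -> R) by exact: csmooth_cont.
pose c := bump e (0 : 'rV[R]_n) / 2.
have oU : open [set x : 'rV[R]_n | c < bump e x].
  apply: (@open_comp _ _ (bump e) [set t | c < t]); last exact: open_gt.
  by move=> x _; exact: cB.
rewrite /mass -lte_fin /Rintegral fineK; last first.
  by apply: integrable_fin_num => //; exact: csmooth_integrable.
apply: (@integral_pos setT _ _ c 0 _ _ _ oU) => //=.
- exact: measurable_contT.
- by move=> x _; exact: flat1_ge0.
- by rewrite /c ltr_pdivrMr// ltr_pMr// ltr1n.
- by rewrite divr_gt0.
- by move=> x /ltW.
Qed.

Definition mollifier (e : R) x : R := (mass e)^-1 * bump e x.

Section mollifier.
Variable e : R.
Hypothesis e0 : 0 < e.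

Lemma mollifier_ge0 x : 0 <= mollifier e x.
Proof. by rewrite mulr_ge0 ?flat1_ge0// invr_ge0 ltW// mass_gt0. Qed.

Lemma mollifier_off x : e < `|x| -> mollifier e x = 0.
Proof. by move=> /(bump_off e0); rewrite /mollifier => ->; rewrite mulr0. Qed.

Lemma csmoothZ k K : csmooth K -> csmooth (fun x => k * K x).
Proof.
move=> cK; split; last first.
  by have [_ [C cC K0]] := cK; exists C => // x /K0 ->; rewrite mulr0.
apply: (@smooth_closed _ _ (fun F => exists2 K, csmooth K & F = fun x => k * K x)); last by exists K.
move=> _ [{cK} {}K cK ->]; split.
  have cF : continuous K by exact: csmooth_cont.
  by move=> x; apply: contM; [exact: cont_cst|exact: cF].
have H i x := isdZ k (derivableP (@csmooth_derivable K i x cK)).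
move=> i; split => [x|]; first by have [] := H i x.
by exists (partial i K); [exact: csmooth_partial|apply/funext => x; exact: partialE (H i x)].
Qed.

Lemma csmooth_mollifier : csmooth (mollifier e).
Proof. by apply: csmoothZ; exact: csmooth_bump. Qed.

Lemma mollifier_sym x y : mollifier e (x - y) = mollifier e (y - x).
Proof.
rewrite /mollifier /bump /dotv; congr (_ * flat 1 (_ - _)).
by apply: eq_bigr => i _; rewrite !mxE; ring.
Qed.

Lemma integral_mollifier y : (\int[mu]_x (mollifier e (x - y))%:E = 1)%E.
Proof.
have im := csmooth_integrable csmooth_mollifier.
have mm : measurable_fun setT (EFin \o mollifier e) by exact: measurable_int im.
have /= -> := integral_shift (- y) mm.
have H : \int[mu]_x mollifier e x = 1.
  rewrite RintegralZl//; last by exact: csmooth_integrable (csmooth_bump e0).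
  by rewrite mulVf// gt_eqF// mass_gt0.
by rewrite -[LHS]fineK ?[fine _]H//; exact: integrable_fin_num.
Qed.

End mollifier.

End convolution.

(** * Approximation in L^p *)

Lemma cvg_shrink {R : realType} (u : nat -> R) (l : R) :
  (forall e, 0 < e -> \forall k \near \oo, `|u k - l| < e) -> u @ \oo --> l.
Proof. by move=> H; apply/cvgrPdist_lt => e /H; apply: filterS => k; rewrite distrC. Qed.

Lemma cvge0_lt {R : realType} (u : nat -> \bar R) : u @ \oo --> 0%E ->
  forall eta, (0 < eta)%R -> \forall k \near \oo, (u k < eta%:E)%E.
Proof.
move=> H eta eta0; apply: (H [set y | (y < eta%:E)%E]).
by apply: open_nbhs_nbhs; split; [exact: open_ereal_lt_ereal|rewrite /= lte_fin].
Qed.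

Lemma cvge0P {R : realType} (u : nat -> \bar R) : (forall k, 0 <= u k)%E ->
  (forall eta, (0 < eta)%R -> \forall k \near \oo, (u k < eta%:E)%E) -> u @ \oo --> 0%E.
Proof.
move=> u0 H; apply/fine_cvgP; split.
  have := H 1 ltr01; apply: filterS => k uk.
  by rewrite ge0_fin_numE// (lt_le_trans uk)// leey.
apply: cvg_shrink => e e0; have := H e e0; apply: filterS => k uk /=.
rewrite subr0 ger0_norm ?fine_ge0// -lte_fin fineK//.
by rewrite ge0_fin_numE// (lt_le_trans uk)// leey.
Qed.

Section density.
Context {R : realType} {n : nat}.
Implicit Types (x y z : 'rV[R]_n) (h c : 'rV[R]_n -> R) (A : set 'rV[R]_n).
Local Notation mu := (lebesgue_rV R n).
Variables (Q : set 'rV[R]_n).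
Hypotheses (mQ : measurable Q) (fQ : (mu Q < +oo)%E).

Definition unit_valued h := forall x, 0 <= h x <= 1.

(** Approximation by continuous functions in [L^1(Q)], among functions with values in [[0, 1]]: the
    range bound gives dominated convergence with a constant, and turns [L^1] closeness into [L^p]
    closeness because [t^p <= t] there. *)
Definition approximable h := measurable_fun setT h /\ unit_valued h /\
  forall eta, 0 < eta -> exists c, [/\ continuous c, unit_valued c &
    (\int[mu]_(x in Q) (`|h x - c x|)%:E < eta%:E)%E].

Lemma integrable_cstQ (k : R) : mu.-integrable Q (cst k%:E).
Proof.
apply: (@measurable_bounded_integrable _ _ _ mu (cst k)) => //.
by exists `|k|; split; [rewrite num_real|move=> t kt x _; exact: ltW].
Qed.

Lemma measurable_normB h c : measurable_fun setT h -> measurable_fun setT c ->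
  measurable_fun Q (fun x => (`|h x - c x|)%:E).
Proof.
move=> mh mc; apply: measurable_funTS; apply/measurable_EFinP.
by apply: measurableT_comp => //; exact: measurable_funB.
Qed.

Lemma int_dist_le h h1 h2 : measurable_fun setT h1 -> measurable_fun setT h2 ->
  measurable_fun setT h -> (forall x, Q x -> `|h x| <= `|h1 x| + `|h2 x|) ->
  (\int[mu]_(x in Q) (`|h x|)%:E <=
   \int[mu]_(x in Q) (`|h1 x|)%:E + \int[mu]_(x in Q) (`|h2 x|)%:E)%E.
Proof.
move=> m1 m2 m H.
have M (g : 'rV[R]_n -> R) : measurable_fun setT g -> measurable_fun Q (fun x => (`|g x|)%:E).
  by move=> mg; apply: measurable_funTS; apply/measurable_EFinP; apply: measurableT_comp.
rewrite -ge0_integralD//; [|exact: M|exact: M].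
apply: ge0_le_integral => //; [exact: M|by apply: emeasurable_funD; exact: M].
Qed.

Lemma approximable_trans h : measurable_fun setT h -> unit_valued h ->
  (forall eta, 0 < eta -> exists2 h', approximable h' &
    (\int[mu]_(x in Q) (`|h x - h' x|)%:E < eta%:E)%E) -> approximable h.
Proof.
move=> mh uh H; split => //; split => // eta eta0.
have e2 : 0 < eta / 2 by exact: divr_gt0.
have [h' [mh' [uh' /(_ _ e2)[c [cc uc hc]]]] hh'] := H _ e2.
have mc := measurable_contT cc.
exists c; split => //; rewrite (splitr eta) EFinD.
apply: le_lt_trans (lteD hh' hc).
apply: (@int_dist_le (fun x => h x - c x) (fun x => h x - h' x) (fun x => h' x - c x)); try exact: measurable_funB.
move=> x _; rewrite (_ : h x - c x = (h x - h' x) + (h' x - c x)); last by ring.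
exact: ler_normD.
Qed.

Lemma approximable_lim (hk : nat -> 'rV[R]_n -> R) h : (forall k, approximable (hk k)) ->
  measurable_fun setT h -> unit_valued h ->
  (forall x, (fun k => hk k x) @ \oo --> h x) -> approximable h.
Proof.
move=> ak mh uh hcvg; apply: approximable_trans => // eta eta0.
have mk k : measurable_fun setT (hk k) by have [] := ak k.
have uk k : unit_valued (hk k) by have [_ []] := ak k.
have [] := @dominated_convergence _ _ R mu Q mQ (fun k => EFin \o hk k) (EFin \o h) (cst 1%E).
- by move=> k; apply: measurable_funTS; exact/measurable_EFinP.
- by apply: measurable_funTS; exact/measurable_EFinP.
- by apply: aeW => x _; apply: cvg_EFin; [near=> k|exact: hcvg].
- exact: integrable_cstQ.
- apply: aeW => x k _; rewrite /= lee_fin; have /andP[h0 h1] := uk k x.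
  by rewrite ger0_norm.
move=> _ H _.
have [k _ /(_ k (leqnn k)) Hk] : \forall k \near \oo,
    (\int[mu]_(x in Q) `|(EFin \o hk k) x - (EFin \o h) x| < eta%:E)%E.
  exact: (cvge0_lt H).
exists (hk k) => //; apply: le_lt_trans Hk; rewrite le_eqVlt; apply/orP; left; apply/eqP.
by apply: eq_integral => x _ /=; rewrite distrC.
Unshelve. all: by end_near. Qed.

Lemma approximable_cont c : continuous c -> unit_valued c -> approximable c.
Proof.
move=> cc uc; split; first exact: measurable_contT.
split => // eta eta0; exists c; split => //.
under eq_integral do rewrite subrr normr0.
by rewrite integral0 lte_fin.
Qed.

Lemma approximable_compl h : approximable h -> approximable (fun x => 1 - h x).
Proof.
move=> [mh [uh H]]; split; first exact: measurable_funB.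
split; first by move=> x; have := uh x; lra.
move=> eta /H[c [cc uc hc]]; exists (fun x => 1 - c x); split.
- by move=> x; apply: contB; [exact: cont_cst|exact: cc].
- by move=> x; have := uc x; lra.
apply: le_lt_trans hc; rewrite le_eqVlt; apply/orP; left; apply/eqP.
by apply: eq_integral => x _ /=; rewrite distrC; congr (`| _ |%:E); ring.
Qed.

Lemma approximable_op (op : R -> R -> R) h1 h2 :
  (forall c1 c2, continuous c1 -> continuous c2 -> continuous (fun x => op (c1 x) (c2 x))) ->
  (forall a b, 0 <= a <= 1 -> 0 <= b <= 1 -> 0 <= op a b <= 1) ->
  (forall a b a' b', 0 <= a <= 1 -> 0 <= b <= 1 -> 0 <= a' <= 1 -> 0 <= b' <= 1 ->
     `|op a b - op a' b'| <= `|a - a'| + `|b - b'|) ->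
  measurable_fun setT (fun x => op (h1 x) (h2 x)) ->
  approximable h1 -> approximable h2 -> approximable (fun x => op (h1 x) (h2 x)).
Proof.
move=> cop uop lop m [m1 [u1 H1]] [m2 [u2 H2]]; split => //; split.
  by move=> x; apply: uop.
move=> eta eta0; have e2 : 0 < eta / 2 by exact: divr_gt0.
have [c1 [cc1 uc1 hc1]] := H1 _ e2; have [c2 [cc2 uc2 hc2]] := H2 _ e2.
have cc := cop _ _ cc1 cc2.
exists (fun x => op (c1 x) (c2 x)); split => //; first by move=> x; exact: uop.
rewrite (splitr eta) EFinD; apply: le_lt_trans (lteD hc1 hc2).
have mc1 := measurable_contT cc1; have mc2 := measurable_contT cc2; have mc := measurable_contT cc.
apply: (@int_dist_le (fun x => op (h1 x) (h2 x) - op (c1 x) (c2 x)) (fun x => h1 x - c1 x) (fun x => h2 x - c2 x)); try exact: measurable_funB.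
by move=> x _; exact: lop.
Qed.

Lemma indic_unit A : unit_valued (\1_A : 'rV[R]_n -> R).
Proof. by move=> x; rewrite indicE; case: (_ \in _); rewrite ?ler01 lexx. Qed.

Lemma approximable_mul h1 h2 : approximable h1 -> approximable h2 ->
  approximable (fun x => h1 x * h2 x).
Proof.
move=> a1 a2; have [m1 _] := a1; have [m2 _] := a2.
apply: (@approximable_op *%R) => //; last exact: measurable_funM.
- by move=> c1 c2 cc1 cc2 x; apply: contM; [exact: cc1|exact: cc2].
- by move=> a b /andP[a0 a1'] /andP[b0 b1]; rewrite mulr_ge0// mulr_ile1.
- move=> a b a' b' /andP[a0 a1'] /andP[b0 b1] /andP[a0' a1''] /andP[b0' b1'].
  rewrite (_ : a * b - a' * b' = (a - a') * b + a' * (b - b')); last by ring.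
  rewrite (le_trans (ler_normD _ _))// !normrM (ger0_norm b0) (ger0_norm a0').
  by rewrite lerD// ?ler_piMr// ler_piMl.
Qed.

Lemma approximable_indicI A B : approximable \1_A -> approximable \1_B -> approximable (\1_(A `&` B)).
Proof.
move=> a1 a2; have := approximable_mul a1 a2; congr approximable.
by apply/funext => x; rewrite indicI.
Qed.

Lemma approximable_indicC A : approximable \1_A -> approximable (\1_(~` A)).
Proof.
move=> /approximable_compl; congr approximable.
by apply/funext => x; rewrite indicC indicE; case: (x \in A); rewrite /= ?subrr ?subr0.
Qed.

Lemma approximable_halfspace i (a : R) : approximable (\1_[set x | a < x ord0 i]).
Proof.
pose g (k : nat) x := Num.min 1 (Num.max 0 (k%:R * (x ord0 i - a))).
have gu k : unit_valued (g k).
  by move=> x; rewrite /g le_min ler01 le_max lexx /= ge_min lexx.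
have gc k : continuous (g k).
  move=> x; apply: (@continuous_min R _ (fun=> 1) (fun x => Num.max 0 (k%:R * (x ord0 i - a)))).
    exact: cont_cst.
  apply: (@continuous_max R _ (fun=> 0) (fun x => k%:R * (x ord0 i - a))); first exact: cont_cst.
  apply: contM; first exact: cont_cst.
  by apply: contB; [exact: coord_continuous|exact: cont_cst].
apply: (@approximable_lim g).
- by move=> k; exact: approximable_cont.
- apply: measurable_indic.
  have := @measurable_coord R n i [set` `]a, +oo[] (measurable_itv _); congr (measurable _).
  by apply/seteqP; split => x /=; rewrite in_itv/= andbT.
- exact: indic_unit.
move=> x; rewrite indicE; have [xa|xa] := ltP a (x ord0 i); last first.
  rewrite memNset /=; last by rewrite ltNge xa.
  apply: cvg_near_cst; near=> k; rewrite /g max_l ?min_r//.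
  by rewrite mulr_ge0_le0// subr_le0.
rewrite mem_set//=; apply: cvg_near_cst.
have xa0 : 0 < x ord0 i - a by rewrite subr_gt0.
exists (Num.trunc (x ord0 i - a)^-1).+1 => // k /= hk.
have : 1 <= k%:R * (x ord0 i - a).
  rewrite -ler_pdivrMr// div1r; apply: (le_trans (ltW (truncnS_gt _))).
  by rewrite ler_nat.
by move=> k1; rewrite /g max_r ?min_l// (le_trans ler01).
Unshelve. all: by end_near. Qed.

Lemma approximable_bigcap (I : finType) (A : I -> set 'rV[R]_n) :
  (forall i, approximable \1_(A i)) -> approximable (\1_[set x | forall i, A i x]).
Proof.
move=> aA.
suff H (s : seq I) : approximable (\1_[set x | forall i, i \in s -> A i x]).
  have := H (enum I); congr (approximable \1_ _).
  by apply/seteqP; split => x /= h i; [apply: h; rewrite mem_enum|move=> _; exact: h].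
elim: s => [|i s IH].
  rewrite (_ : \1_ _ = fun=> 1).
    apply: approximable_cont; first exact: cst_continuous.
    by move=> x; rewrite ler01 lexx.
  by apply/funext => x; rewrite indicE mem_set.
have := approximable_indicI (aA i) IH; congr (approximable \1_ _).
apply/seteqP; split => x /=.
  by move=> [h1 h2] j; rewrite inE => /predU1P[->//|/h2].
by move=> h; split => [|j js]; apply: h; rewrite inE ?eqxx ?js ?orbT.
Qed.

(** The sets with approximable indicator form a sigma-algebra that contains the half-spaces, hence
    the boxes. This takes the place of inner and outer regularity of the measure. *)
Lemma approximable_indic A : measurable A -> approximable \1_A.
Proof.
rewrite measurable_rV_genE; move: A.
suff : <<s range (fun ab : ('I_n -> R) * ('I_n -> R) => box ab.1 ab.2) >> `<=`
   [set A | approximable \1_A] by [].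
apply: smallest_sub.
  split => /=.
  - rewrite indic0; apply: approximable_cont; first exact: cst_continuous.
    by move=> x; rewrite ler01 lexx.
  - by move=> A; rewrite setTD; exact: approximable_indicC.
  move=> F aF.
  have aU N : approximable (\1_[set x | forall k : 'I_N, (~` F k) x]).
    by apply: approximable_bigcap => i; apply: approximable_indicC.
  have mF k : measurable (F k).
    have [m _] := aF k.
    rewrite (_ : F k = [set: 'rV[R]_n] `&` \1_(F k) @^-1` [set (1 : R)]).
      by apply: m.
    rewrite setTI; apply/seteqP; split => x /=; rewrite indicE.
      by move=> Fx; rewrite mem_set.
    by case: (boolP (x \in F k)) => [/set_mem//|_ /eqP]; rewrite eq_sym oner_eq0.
  apply: (@approximable_lim (fun N => \1_(~` [set x | forall k : 'I_N, (~` F k) x]))).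
  - by move=> N; apply: approximable_indicC.
  - by apply: measurable_indic; exact: bigcup_measurable.
  - exact: indic_unit.
  move=> x; rewrite !indicE; apply: cvg_near_cst.
  have [[k _ Fk]|nF] := pselect ((\bigcup_k F k) x).
    have -> : x \in \bigcup_k F k by apply/mem_set; exists k.
    by exists k.+1 => // N /= kN; rewrite indicE mem_set// => /(_ (Ordinal kN)); exact.
  near=> N; rewrite indicE !memNset//= => h; apply: h => k Fk; apply: nF.
  by exists k.
move=> _ [[a b] _ <-] /=.
rewrite (_ : box a b = [set x | forall i, ([set x | a i < x ord0 i] `&`
   ~` [set x | b i < x ord0 i]) x]).
  apply: approximable_bigcap => i; apply: approximable_indicI.
    exact: approximable_halfspace.
  apply: approximable_indicC; exact: approximable_halfspace.
apply/seteqP; split => x h i; have := h i; rewrite in_itv/=.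
  by move=> /andP[-> xb]; split => //; apply/negP; rewrite -leNgt.
by move=> [-> /negP]; rewrite -leNgt.
Unshelve. all: by end_near. Qed.

Lemma approximable_avg (h : nat -> 'rV[R]_n -> R) N : (forall k, approximable (h k)) ->
  approximable (fun x => (\sum_(k < N) h k x) / N%:R).
Proof.
move=> ah; elim: N => [|N IH].
  rewrite (_ : (fun x => _) = fun=> 0); last by apply/funext => x; rewrite big_ord0 mul0r.
  apply: approximable_cont; first exact: cst_continuous.
  by move=> x; rewrite ler01 lexx.
pose t : R := N.+1%:R^-1.
have t01 : 0 <= t <= 1 by rewrite /t invr_ge0 ler0n/= invf_le1// ler1n.
have [t0 t1] := andP t01.
rewrite (_ : (fun x => _) = fun x => (1 - t) * ((\sum_(k < N) h k x) / N%:R) + t * h N x); last first.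
  apply/funext => x; rewrite big_ord_recr/= /t.
  case: N {IH t t01 t0 t1} => [|N]; first by rewrite big_ord0 invr1; ring.
  have n1 : (N.+1%:R : R) != 0 by rewrite pnatr_eq0.
  have n2 : (N.+1%:R + 1 : R) != 0 by rewrite natr1 pnatr_eq0.
  by rewrite -(natr1 N.+1); field; apply/andP.
apply: (@approximable_op (fun a b => (1 - t) * a + t * b)) => //.
- move=> c1 c2 cc1 cc2 x.
  apply: (@contD _ _ (fun y => (1 - t) * c1 y) (fun y => t * c2 y)).
    by apply: contM; [exact: cont_cst|exact: cc1].
  by apply: contM; [exact: cont_cst|exact: cc2].
- by move=> a b /andP[a0 a1] /andP[b0 b1]; apply/andP; split; nra.
- move=> a b a' b' _ _ _ _.
  rewrite (_ : _ - _ = (1 - t) * (a - a') + t * (b - b')); last by ring.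
  rewrite (le_trans (ler_normD _ _))// !normrM (ger0_norm t0) ger0_norm ?subr_ge0//.
  by rewrite lerD// ler_piMl// lerBlDr lerDl.
have [mI _] := IH; have [mh _] := ah N.
by apply: measurable_funD; apply: measurable_funM.
Qed.

Lemma approximable_unit (w : 'rV[R]_n -> R) : measurable_fun setT w -> unit_valued w ->
  approximable w.
Proof.
move=> mw uw.
(* Layer-cake sum: the average over [k] of the indicators of [(k + 1) / (N + 1) <= w] is
   [floor((N + 1) w) / (N + 1)], within [1 / (N + 1)] of [w]. *)
pose h N k := \1_[set x | k.+1%:R / N.+1%:R <= w x] : 'rV[R]_n -> R.
apply: (@approximable_lim (fun N x => (\sum_(k < N.+1) h N k x) / N.+1%:R)) => //.
  move=> N; apply: approximable_avg => k; apply: approximable_indic.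
  rewrite (_ : [set x | _] = [set: 'rV[R]_n] `&` w @^-1` `[k.+1%:R / N.+1%:R, +oo[).
    by apply: mw.
  by rewrite setTI; apply/seteqP; split => x /=; rewrite in_itv/= andbT.
move=> x; have /andP[w0 w1] := uw x.
have E N : `|(\sum_(k < N.+1) h N k x) / N.+1%:R - w x| <= N.+1%:R^-1.
  have N0 : (0 : R) < N.+1%:R by [].
  pose j := Num.trunc (w x * N.+1%:R).
  have /andP[j1 j2] : j%:R <= w x * N.+1%:R < j.+1%:R by apply: truncn_itv; rewrite mulr_ge0.
  have jN : (j <= N.+1)%N.
    by rewrite -(@ler_nat R) (le_trans j1)// ler_piMl.
  have -> : \sum_(k < N.+1) h N k x = j%:R.
    rewrite (eq_bigr (fun k : 'I_N.+1 => (k < j)%N%:R)); last first.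
      move=> k _; rewrite /h indicE; congr (_%:R).
      have [kj|kj] := ltnP k j.
        by rewrite mem_set//= ler_pdivrMr// (le_trans _ j1)// ler_nat.
      rewrite memNset//= ler_pdivrMr//; apply/negP; rewrite -ltNge (lt_le_trans j2)//.
      by rewrite ler_nat.
    rewrite -natr_sum; congr (_%:R).
    rewrite -(big_mkord xpredT (fun k => (k < j)%N : nat)) (big_cat_nat _ jN)//=.
    rewrite (eq_big_nat _ _ (F2 := fun=> 1%N)); last by move=> k /andP[_ ->].
    rewrite sum_nat_const_nat subn0 muln1 big_nat_cond big1 ?addn0//.
    by move=> k /andP[/andP[jk _] _]; rewrite ltnNge jk.
  have -> : j%:R / N.+1%:R - w x = (j%:R - w x * N.+1%:R) / N.+1%:R by field.
  rewrite normrM [X in _ * X]gtr0_norm ?invr_gt0// ler_piMl ?invr_ge0//.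
  rewrite distrC ger0_norm ?subr_ge0// lerBlDr (le_trans (ltW j2))//.
  by rewrite -natr1 addrC.
apply: cvg_shrink => // e e0.
have := near_infty_natSinv_lt (PosNum e0); apply: filterS => k /= ke.
exact: le_lt_trans (E k) ke.
Qed.

End density.

Section powR_inequalities.
Context {R : realType}.
Implicit Types a b s p : R.

Lemma powR_add_le a b p : 0 <= a -> 0 <= b -> 0 <= p ->
  (a + b) `^ p <= 2 `^ p * (a `^ p + b `^ p).
Proof.
move=> a0 b0 p0; rewrite mulrDr -!powRM//.
have [ab|/ltW ab] := leP a b.
  apply: (@le_trans _ _ ((2 * b) `^ p)); last by rewrite lerDr powR_ge0.
  by apply: ge0_ler_powR => //; rewrite ?nnegrE ?addr_ge0 ?mulr_ge0//; lra.
apply: (@le_trans _ _ ((2 * a) `^ p)); last by rewrite lerDl powR_ge0.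
by apply: ge0_ler_powR => //; rewrite ?nnegrE ?addr_ge0 ?mulr_ge0//; lra.
Qed.

(** Young's inequality for the product [s * a^(p-1)]; it supplies the tangent line from which
    Jensen's inequality is derived. *)
Lemma powR_tangent s a p : 0 <= s -> 0 <= a -> 1 < p ->
  a `^ p + p * a `^ (p - 1) * (s - a) <= s `^ p.
Proof.
move=> s0 a0 p1; have p0 : 0 < p by lra.
have q0 : 0 < p - 1 by lra.
have := @conjugate_powR R s (a `^ (p - 1)) p (p / (p - 1)) s0 (powR_ge0 _ _) p0.
rewrite divr_gt0// => /(_ isT); rewrite invf_div.
have -> : p^-1 + (p - 1) / p = 1 by field; rewrite gt_eqF.
move=> /(_ erefl); rewrite -powRrM (_ : (p - 1) * (p / (p - 1)) = p); last by field; rewrite gt_eqF.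
have E : a * a `^ (p - 1) = a `^ p by apply: mulr_powRB1.
move=> H.
have : p * (s * a `^ (p - 1)) <= p * (s `^ p / p + a `^ p * ((p - 1) / p)).
  by rewrite ler_pM2l.
rewrite (_ : p * (_ + _) = s `^ p + (p - 1) * a `^ p); last by field; rewrite gt_eqF.
rewrite mulrBr (_ : p * _ * a = p * (a * a `^ (p - 1))); last by ring.
rewrite E; nra.
Qed.

Lemma le1_powR a p : 0 <= a <= 1 -> 1 <= p -> a `^ p <= a.
Proof.
move=> /andP[a0 a1] p1; case: (ltgtP 0 a) a0 => // [a0 _|<- _]; last by rewrite powR0 ?gt_eqF//; lra.
by apply: ge1r_powR => //; rewrite a0.
Qed.

Lemma le_1_add_powR a p : 0 <= a -> 1 <= p -> a <= 1 + a `^ p.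
Proof.
move=> a0 p1; have [a1|/ltW a1] := leP a 1; first by rewrite (le_trans a1)// lerDl powR_ge0.
by rewrite (le_trans (le1r_powR a1 p1))// lerDr.
Qed.

End powR_inequalities.

(** * Density of continuous functions in L^p and convergence of mollifications *)

Section mollification.
Context {R : realType} {n : nat}.
Implicit Types (x y z : 'rV[R]_n) (h c w v f g : 'rV[R]_n -> R) (A : set 'rV[R]_n).
Local Notation mu := (lebesgue_rV R n).
Variables (Q : set 'rV[R]_n) (p : R).
Hypotheses (mQ : measurable Q) (fQ : (mu Q < +oo)%E) (p1 : 1 < p).

Let p0 : 0 <= p. Proof. exact: ltW (lt_trans ltr01 p1). Qed.

Let pgt0 : 0 < p. Proof. exact: lt_trans ltr01 p1. Qed.

Definition NLp A w := (\int[mu]_(x in A) (`|w x| `^ p)%:E)%E.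

Lemma measurable_powabs A w : measurable_fun A w -> measurable_fun A (fun x => `|w x| `^ p).
Proof.
by move=> mw; apply: (measurableT_comp (measurable_powR p)); apply: measurableT_comp.
Qed.

Lemma NLp_ge0 A w : (0 <= NLp A w)%E.
Proof. by apply: integral_ge0 => x _; rewrite lee_fin powR_ge0. Qed.

Lemma NLp_le A w v : measurable A -> measurable_fun A w -> measurable_fun A v ->
  (forall x, A x -> `|w x| <= `|v x|) -> (NLp A w <= NLp A v)%E.
Proof.
move=> mA mw mv wv; apply: ge0_le_integral => //.
- by apply/measurable_EFinP; exact: measurable_powabs.
- by apply/measurable_EFinP; exact: measurable_powabs.
- by move=> x Ax; rewrite lee_fin; apply: ge0_ler_powR => //; rewrite ?nnegrE//; exact: wv.
Qed.

Lemma NLp_add A f g : measurable A -> measurable_fun A f -> measurable_fun A g ->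
  (NLp A (fun x => f x + g x)%R <= (2 `^ p)%:E * (NLp A f + NLp A g))%E.
Proof.
move=> mA mf mg.
have m w : measurable_fun A w -> measurable_fun A (fun x => (`|w x| `^ p)%:E).
  by move=> mw; apply/measurable_EFinP; exact: measurable_powabs.
pose F x : \bar R := ((`|f x| `^ p)%:E + (`|g x| `^ p)%:E)%E.
have mF : measurable_fun A F by apply: emeasurable_funD; exact: m.
have F0 x : A x -> (0 <= F x)%E by move=> _; rewrite adde_ge0// lee_fin powR_ge0.
have -> : (NLp A f + NLp A g = \int[mu]_(x in A) F x)%E.
  by rewrite /F ge0_integralD//; [exact: m|exact: m].
rewrite -ge0_integralZl//.
apply: ge0_le_integral => //.
- by apply: m; exact: measurable_funD.
- by apply: emeasurable_funM.
move=> x _; rewrite /F -EFinD -EFinM lee_fin; apply: le_trans (powR_add_le _ _ _) => //.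
by apply: ge0_ler_powR => //; rewrite ?nnegrE ?addr_ge0// ler_normD.
Qed.

(** After the affine change [w' = (w + M) / (2 M)] all values lie in [[0, 1]], where [t^p <= t]
    upgrades the [L^1] approximation. *)
Lemma Lp_dense_bounded w (M : R) : 0 < M -> measurable_fun setT w -> (forall x, `|w x| <= M) ->
  forall eta, 0 < eta -> exists c, [/\ continuous c, (forall x, `|c x| <= M) &
    (NLp Q (fun x => w x - c x)%R < eta%:E)%E].
Proof.
move=> M0 mw wM eta eta0.
have M20 : 0 < 2 * M by lra.
pose w' x := (w x + M) / (2 * M).
have mw' : measurable_fun setT w' by apply: measurable_funM => //; exact: measurable_funD.
have uw' : unit_valued w'.
  move=> x; have := wM x; rewrite ler_norml => /andP[h1 h2].
  by rewrite /w' divr_ge0 ?ler_pdivrMr; lra.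
have [_ [_ H]] := approximable_unit mQ fQ mw' uw'.
have C0 : 0 < (2 * M) `^ p by exact: powR_gt0.
have [c' [cc' uc' hc']] := H _ (divr_gt0 eta0 C0).
have cc : continuous (fun x => 2 * M * c' x - M).
  move=> x; apply: (@contB _ _ (fun x => 2 * M * c' x) (fun=> M)); last exact: cont_cst.
  by apply: contM; [exact: cont_cst|exact: cc'].
exists (fun x => 2 * M * c' x - M); split => //.
  by move=> x; have := uc' x => /andP[h1 h2]; rewrite ler_norml; apply/andP; split; nra.
have mc' := measurable_contT cc'; have mc := measurable_contT cc.
apply: (@le_lt_trans _ _ (((2 * M) `^ p)%:E * \int[mu]_(x in Q) (`|w' x - c' x|)%:E)%E); last first.
  by rewrite muleC -lte_pdivlMr//.
rewrite -ge0_integralZl//; last 2 first.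
- exact: measurable_normB.
- by rewrite lee_fin ltW.
apply: ge0_le_integral => //.
- apply/measurable_EFinP; apply: measurable_powabs; apply: measurable_funTS.
  exact: measurable_funB.
- apply: emeasurable_funM; first exact: measurable_cst.
  exact: measurable_normB.
move=> x _; rewrite -EFinM lee_fin.
have -> : w x - (2 * M * c' x - M) = 2 * M * (w' x - c' x).
  by rewrite /w'; field; rewrite gt_eqF.
have -> : `|2 * M * (w' x - c' x)| = 2 * M * `|w' x - c' x| by rewrite normrM gtr0_norm.
rewrite powRM; [|exact: ltW|exact: normr_ge0].
rewrite (ler_pM2l C0).
apply: le1_powR; last exact: ltW.
have /andP[a0 a1] := uw' x; have /andP[b0 b1] := uc' x.
by rewrite normr_ge0 ler_norml; apply/andP; split; lra.
Qed.

Lemma Lp_dense w : measurable_fun setT w -> (NLp Q w < +oo)%E ->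
  forall eta, 0 < eta -> exists c, [/\ continuous c, (exists M, forall x, `|c x| <= M) &
    (NLp Q (fun x => w x - c x)%R < eta%:E)%E].
Proof.
move=> mw fw eta eta0.
pose wk (k : nat) x := Num.max (- k%:R) (Num.min k%:R (w x)).
have mwk k : measurable_fun setT (wk k).
  by apply: measurable_maxr => //; apply: measurable_minr.
have bwk k x : `|wk k x| <= k%:R.
  rewrite ler_norml /wk; have k0 : (0 : R) <= k%:R by [].
  by rewrite le_max lexx /= ge_max ge_min lexx !andbT; lra.
have dwk k x : `|w x - wk k x| <= `|w x|.
  have k0 : (0 : R) <= k%:R by [].
  rewrite /wk; have [h1|h1] := leP k%:R (w x).
    rewrite max_r; last by lra.
    by rewrite !ger0_norm; lra.
  have [h2|h2] := leP (- k%:R) (w x); first by rewrite subrr normr0.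
  by rewrite [leRHS]ler0_norm ?ler0_norm; lra.
(* [NLp_add] costs a factor [2^p], and the error is shared equally between truncation and
   approximation. *)
have [k Hk] : exists k, (NLp Q (fun x => w x - wk k x)%R < (eta / (2 `^ p * 2))%:E)%E.
  have [] := @dominated_convergence _ _ R mu Q mQ (fun k x => (`|w x - wk k x| `^ p)%:E) (cst 0%E)
     (fun x => (`|w x| `^ p)%:E).
  - move=> k; apply/measurable_EFinP; apply: measurable_powabs; apply: measurable_funTS.
    exact: measurable_funB.
  - exact: measurable_cst.
  - apply: aeW => x _; apply: cvg_near_cst.
    exists (Num.trunc `|w x|).+1 => // k /= hk.
    have : `|w x| < k%:R by rewrite (lt_le_trans (truncnS_gt _))// ler_nat.
    rewrite ltr_norml => /andP[h1 h2].
    by rewrite /wk min_r ?max_r ?subrr ?normr0 ?powR0 ?gt_eqF//; lra.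
  - apply/integrableP; split.
      by apply/measurable_EFinP; apply: measurable_powabs; exact: measurable_funTS.
    apply: le_lt_trans fw; rewrite le_eqVlt; apply/orP; left; apply/eqP.
    by apply: eq_integral => x _; rewrite gee0_abs// lee_fin powR_ge0.
  - apply: aeW => x k _; rewrite gee0_abs ?lee_fin ?powR_ge0//.
    by apply: ge0_ler_powR => //; rewrite ?nnegrE//.
  move=> _ _; rewrite integral0 => /cvge0_lt H.
  have e1 : 0 < eta / (2 `^ p * 2) by rewrite divr_gt0// mulr_gt0// powR_gt0.
  by have [k _ /(_ k (leqnn k))] := H _ e1; exists k.
have P0 : 0 < 2 `^ p :> R by exact: powR_gt0.
have e1 : 0 < eta / (2 `^ p * 2) by rewrite divr_gt0// mulr_gt0.
have k1 : (0 : R) < k%:R + 1 by rewrite ltr_wpDl.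
have bk x : `|wk k x| <= k%:R + 1 by rewrite (le_trans (bwk k x))// lerDl.
have [c [cc bc hc]] := Lp_dense_bounded k1 (mwk k) bk e1.
exists c; split => //; first by exists (k%:R + 1).
have mc := measurable_contT cc.
have -> : (fun x => w x - c x) = (fun x => (w x - wk k x) + (wk k x - c x)).
  by apply/funext => x; ring.
apply: le_lt_trans (NLp_add mQ _ _) _; try by apply: measurable_funTS; exact: measurable_funB.
have -> : (eta%:E = (2 `^ p)%:E * ((eta / (2 `^ p * 2))%:E + (eta / (2 `^ p * 2))%:E))%E.
  by rewrite -EFinD -EFinM; congr (_%:E); field; rewrite gt_eqF.
have P0e : (0 < (2 `^ p)%:E)%E by rewrite lte_fin.
rewrite (lte_pmul2l _ P0e); [exact: (lteD Hk hc)|by []].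
Qed.

Lemma NLp_cst_le A w (C : R) : measurable A -> (mu A < +oo)%E -> measurable_fun A w ->
  0 <= C -> (forall x, A x -> `|w x| <= C) -> (NLp A w <= (C `^ p)%:E * mu A)%E.
Proof.
move=> mA fA mw C0 wC; rewrite -integral_cst//; apply: ge0_le_integral => //.
- by apply/measurable_EFinP; exact: measurable_powabs.
- by move=> x Ax; rewrite lee_fin; apply: ge0_ler_powR => //; rewrite ?nnegrE//; exact: wC.
Qed.

Lemma Lp_integrable A w : measurable A -> (mu A < +oo)%E -> measurable_fun A w ->
  (NLp A w < +oo)%E -> mu.-integrable A (EFin \o w) /\
  mu.-integrable A (EFin \o (fun x => `|w x| `^ p)).
Proof.
move=> mA fA mw fw.
have ip : mu.-integrable A (EFin \o (fun x => `|w x| `^ p)).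
  apply/integrableP; split.
    by apply/measurable_EFinP; exact: measurable_powabs.
  apply: le_lt_trans fw; rewrite le_eqVlt; apply/orP; left; apply/eqP.
  by apply: eq_integral => x _; rewrite gee0_abs// lee_fin powR_ge0.
split => //; apply: (@integrable_dominated _ _ _ mu _ mA _ (fun x => 1 + `|w x| `^ p)) => //.
  by move=> x _; apply: le_1_add_powR => //; exact: ltW.
apply: integrable_addr => //.
by apply: (integrable_cstQ mA fA 1).
Qed.

Section contraction.
Variables (D K : set 'rV[R]_n) (delta : R).
Hypotheses (mD : measurable D) (cK : compact K) (DK : D `<=` K).
Hypothesis KQ : forall x z, K x -> `|x - z| <= delta -> Q z.

Let DQ : D `<=` Q -> (mu D < +oo)%E.
Proof. by move=> h; apply: le_lt_trans fQ; apply: le_measure; rewrite ?inE. Qed.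

(** [Q] contains the [delta]-neighbourhood of [K], so for [x] in [K] the kernel centred at [x] lives
    inside [Q] and loses no mass. *)
Lemma moll_mass e x : 0 < e -> e <= delta -> K x ->
  mu.-integrable Q (EFin \o (fun z => mollifier e (x - z))) /\
  \int[mu]_(z in Q) mollifier e (x - z) = 1.
Proof.
move=> e0 ed Kx; have cm := csmooth_mollifier e0 : csmooth (mollifier e : 'rV[R]_n -> R).
have iz : mu.-integrable setT (EFin \o (fun z => mollifier e (x - z))).
  rewrite (_ : (fun z => _) = (fun z => mollifier e (z - x))); last first.
    by apply/funext => z; exact: mollifier_sym.
  have [M M0 HM] := csmooth_bound cm.
  have [mB fB] := compact_fin (@compact_norm_le R n (`|x| + e)).
  apply: (integrable_supp mB fB (M := M)) => //.
    apply: (measurableT_comp (f := mollifier e)); last exact: measurable_shift.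
    by apply: measurable_contT; exact: csmooth_cont.
  move=> z /= /negP; rewrite -ltNge => h; apply: mollifier_off => //.
  have := ler_normD (z - x) x; rewrite subrK; lra.
split; first exact: (integrableS measurableT mQ _ iz).
rewrite Rintegral_mkcond /Rintegral.
rewrite (eq_integral (fun z => (mollifier e (z - x))%:E)); first by rewrite integral_mollifier.
move=> z _; rewrite patchE; case: ifPn => [_|nQ]; first by rewrite mollifier_sym.
rewrite mollifier_off// ltNge; apply/negP => h; move/negP: nQ; apply; apply/mem_set.
by apply: KQ Kx _; rewrite distrC (le_trans h).
Qed.

(** Jensen's inequality for the probability density [mollifier e (x - z)]: integrate the tangent
    inequality of [t^p] at the point [a], the mean of [|w|]. *)
Lemma conv_jensen e w x : 0 < e -> e <= delta -> measurable_fun Q w -> (NLp Q w < +oo)%E -> K x ->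
  ((`|conv Q w (mollifier e) x| `^ p)%:E <=
   \int[mu]_(z in Q) (mollifier e (x - z) * `|w z| `^ p)%:E)%E.
Proof.
move=> e0 ed mw fw Kx; have cm := csmooth_mollifier e0 : csmooth (mollifier e : 'rV[R]_n -> R).
have [iw ip] := Lp_integrable mQ fQ mw fw.
have [im m1] := moll_mass e0 ed Kx.
have ia := conv_int mQ (conv_norm_int mQ iw) x cm.
have ipp := conv_int mQ ip x cm.
set a := \int[mu]_(z in Q) (mollifier e (x - z) * `|w z|).
have a0 : 0 <= a by apply: Rintegral_ge0 => z _; rewrite mulr_ge0// mollifier_ge0.
have ca : `|conv Q w (mollifier e) x| <= a.
  apply: le_trans (le_normr_Rintegral _ _) _ => //; first exact: conv_int.
  rewrite le_eqVlt; apply/orP; left; apply/eqP; apply: eq_Rintegral => z _.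
  by rewrite normrM ger0_norm// mollifier_ge0.
have E : (\int[mu]_(z in Q) (mollifier e (x - z) * `|w z| `^ p)%:E)%E =
    (\int[mu]_(z in Q) (mollifier e (x - z) * `|w z| `^ p))%:E.
  by rewrite /Rintegral fineK//; exact: integrable_fin_num.
rewrite E lee_fin; apply: (@le_trans _ _ (a `^ p)).
  by apply: ge0_ler_powR => //; rewrite nnegrE.
pose b := p * a `^ (p - 1).
have i2 : mu.-integrable Q (EFin \o (fun z => (a `^ p - b * a) * mollifier e (x - z) + b * (mollifier e (x - z) * `|w z|))).
  by apply: integrable_addr => //; exact: integrable_scaler.
have : \int[mu]_(z in Q) ((a `^ p - b * a) * mollifier e (x - z) + b * (mollifier e (x - z) * `|w z|)) <=
   \int[mu]_(z in Q) (mollifier e (x - z) * `|w z| `^ p).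
  apply: le_Rintegral => // z _.
  have := powR_tangent (normr_ge0 (w z)) a0 p1; rewrite -/b => h.
  have := ler_wpM2l (mollifier_ge0 e0 (x - z)) h; apply: le_trans.
  by rewrite le_eqVlt; apply/orP; left; apply/eqP; ring.
apply: le_trans; rewrite RintegralD//; [|exact: integrable_scaler|exact: integrable_scaler].
rewrite RintegralZl// RintegralZl// m1 -/a.
by rewrite le_eqVlt; apply/orP; left; apply/eqP; ring.
Qed.

(** Jensen at each point of [D], then Tonelli: for each [z] the kernel has integral one in [x]. *)
Lemma conv_contract e w : 0 < e -> e <= delta -> measurable_fun Q w -> (NLp Q w < +oo)%E ->
  (NLp D (conv Q w (mollifier e)) <= NLp Q w)%E.
Proof.
move=> e0 ed mw fw; have cm := csmooth_mollifier e0 : csmooth (mollifier e : 'rV[R]_n -> R).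
have [iw ip] := Lp_integrable mQ fQ mw fw.
pose W := (fun z => `|w z| `^ p) \_ Q.
have W0 z : 0 <= W z by rewrite /W patchE; case: ifP => //; rewrite powR_ge0.
have mW : measurable_fun setT W.
  by apply: (measurable_restrictT _ mQ).1; exact: measurable_powabs.
pose F (xz : 'rV[R]_n * 'rV[R]_n) := (mollifier e (xz.1 - xz.2) * W xz.2)%:E.
have mF : measurable_fun setT F.
  apply/measurable_EFinP; apply: measurable_funM; last first.
    exact: (measurableT_comp mW).
  apply: (measurableT_comp (f := mollifier e)).
    by apply: measurable_contT; exact: csmooth_cont.
  apply: measurable_fun_rV => i; under eq_fun do rewrite !mxE.
  apply: measurable_funB.
    exact: (measurableT_comp (measurable_coord_rV i) measurable_fst).
  exact: (measurableT_comp (measurable_coord_rV i) measurable_snd).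
have F0 xz : (0 <= F xz)%E by rewrite lee_fin mulr_ge0// mollifier_ge0.
apply: (@le_trans _ _ (\int[mu]_x \int[mu]_z F (x, z))%E).
  rewrite /NLp integral_mkcond.
  apply: ge0_le_integral => //.
  - by move=> x _; rewrite patchE; case: ifP => //; rewrite lee_fin powR_ge0.
  - have cc : continuous (conv Q w (mollifier e)) by exact: conv_cont.
    apply: (measurable_restrictT _ mD).1; apply/measurable_EFinP; apply: measurable_powabs.
    apply: measurable_funTS; exact: (measurable_contT cc).
  - exact: (@measurable_fun_fubini_tonelli_F _ _ _ _ _ (@lebesgue_sf R n) F mF F0).
  move=> x _; rewrite patchE; case: ifPn => [/set_mem /DK Kx|_]; last exact: integral_ge0.
  apply: (le_trans (conv_jensen e0 ed mw fw Kx)).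
  rewrite integral_mkcond; apply: ge0_le_integral => //.
  - by move=> z _; rewrite patchE; case: ifP => //; rewrite lee_fin mulr_ge0// ?mollifier_ge0// powR_ge0.
  - apply: (measurable_restrictT _ mQ).1.
    exact: measurable_int (conv_int mQ ip x cm).
  - exact: (measurableT_comp mF (measurable_pair1 x)).
  by move=> z _; rewrite /F /W !patchE; case: ifP => //= _; rewrite mulr0.
rewrite (fubini_tonelli (m1 := @lebesgue_sf R n) (m2 := @lebesgue_sf R n) F mF F0).
rewrite le_eqVlt; apply/orP; left; apply/eqP.
rewrite /NLp [RHS]integral_mkcond; apply: eq_integral => z _.
under eq_integral do rewrite /F/= EFinM.
rewrite ge0_integralZr//; last 3 first.
- by apply/measurable_EFinP; apply: (measurableT_comp (f := mollifier e)); [apply: measurable_contT; exact: csmooth_cont|exact: measurable_shift].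
- by move=> x _; rewrite lee_fin mollifier_ge0.
- by rewrite lee_fin.
rewrite (integral_mollifier e0 z) mul1e /W !patchE; by case: ifP.
Qed.

Lemma conv_cont_close c (M : R) : continuous c -> (forall x, `|c x| <= M) -> 0 < delta ->
  forall eta, 0 < eta -> exists2 e0, 0 < e0 & forall e, 0 < e -> e < e0 ->
  forall x, K x -> `|conv Q c (mollifier e) x - c x| <= eta.
Proof.
move=> cc cM d0 eta eta0.
have [d dd0 Hd] := compact_unif cK (fun x _ => cc x) eta0.
have ic : mu.-integrable Q (EFin \o c).
  apply: measurable_bounded_integrable => //; first exact: measurable_funTS (measurable_contT cc).
  by exists M; split; [rewrite num_real|move=> t Mt x _; exact: le_trans (cM x) (ltW Mt)].
exists (Num.min d delta); first by rewrite lt_min dd0.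
move=> e e0; rewrite lt_min => /andP[ed /ltW edl] x Kx.
have cm := csmooth_mollifier e0 : csmooth (mollifier e : 'rV[R]_n -> R).
have [im m1] := moll_mass e0 edl Kx.
have -> : conv Q c (mollifier e) x - c x = \int[mu]_(z in Q) (mollifier e (x - z) * c z - c x * mollifier e (x - z)).
  rewrite RintegralB//; [|exact: conv_int|exact: integrable_scaler].
  by rewrite RintegralZl// m1 mulr1.
have id := integrable_subr mQ (conv_int mQ ic x cm) (integrable_scaler mQ (c x) im).
apply: (le_trans (le_normr_Rintegral _ _)) => //.
rewrite -[leRHS]mulr1 -m1 -RintegralZl//.
apply: le_Rintegral => //.
- by apply: eq_integrable (integrable_abse id).
- exact: integrable_scaler.
move=> z _; have -> : mollifier e (x - z) * c z - c x * mollifier e (x - z) = mollifier e (x - z) * (c z - c x) by ring.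
rewrite normrM ger0_norm ?mollifier_ge0// mulrC.
have [h|h] := ltP `|x - z| d; last by rewrite mollifier_off// ?mulr0// (lt_le_trans ed).
by rewrite ler_wpM2r ?mollifier_ge0// distrC ltW// Hd.
Qed.

(** Split [w] into a bounded continuous part, approximated uniformly on [K], and a remainder small
    in [L^p(Q)], whose mollification stays small by contraction. *)
Lemma mollifier_cvg w : measurable_fun setT w -> (NLp Q w < +oo)%E -> 0 < delta ->
  forall eta, 0 < eta -> exists2 e0, 0 < e0 & forall e, 0 < e -> e < e0 ->
  (NLp D (fun x => conv Q w (mollifier e) x - w x)%R < eta%:E)%E.
Proof.
move=> mw fw d0 eta eta0.
have KQ' : K `<=` Q by move=> x Kx; apply: (KQ Kx); rewrite subrr normr0 ltW.
have DsQ : D `<=` Q by move=> x /DK /KQ'.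
have fD := DQ DsQ.
pose P : R := 2 `^ p.
have P1 : 1 <= P.
  have : 1 `^ p <= P by apply: ge0_ler_powR => //; rewrite ?nnegrE ?ler1n.
  by rewrite powR1.
have P0 : 0 < P by exact: lt_le_trans P1.
(* With [P = 2^p], two uses of [NLp_add] give at most [P (e1 + P (2 e1))], which is at most
   [3 eta / 4] since [P >= 1]. *)
pose e1 := eta / (4 * P * P).
have e10 : 0 < e1 by rewrite divr_gt0// !mulr_gt0.
have [c [cc [M cM] hc]] := Lp_dense mw fw e10.
have mc := measurable_contT cc.
pose q := fine (mu Q).
have q0 : 0 <= q by rewrite fine_ge0.
pose e2 := Num.min 1 (e1 / (1 + q)).
have q1 : 0 < 1 + q by rewrite ltr_wpDr.
have e20 : 0 < e2 by rewrite lt_min ltr01 divr_gt0.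
have [r r0 Hr] := conv_cont_close cc cM d0 e20.
exists (Num.min r delta); first by rewrite lt_min r0.
move=> e e0; rewrite lt_min => /andP[er /ltW edl].
have cm := csmooth_mollifier e0 : csmooth (mollifier e : 'rV[R]_n -> R).
pose v x := w x - c x.
have mv : measurable_fun setT v by exact: measurable_funB.
have mvQ : measurable_fun Q v by exact: measurable_funTS.
have fv : (NLp Q v < +oo)%E by rewrite (lt_trans hc)// ltry.
have [iv _] := Lp_integrable mQ fQ mvQ fv.
have ic : mu.-integrable Q (EFin \o c).
  apply: measurable_bounded_integrable => //; first exact: measurable_funTS.
  by exists M; split; [rewrite num_real|move=> t Mt x _; exact: le_trans (cM x) (ltW Mt)].
have mcv g : mu.-integrable Q (EFin \o g) -> measurable_fun D (conv Q g (mollifier e)).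
  move=> ig; have cg : continuous (conv Q g (mollifier e)) by exact: conv_cont.
  exact: measurable_funTS (measurable_contT cg).
have mvv := mcv _ iv; have mcc := mcv _ ic.
have mcD : measurable_fun D c by exact: measurable_funTS.
have mvD : measurable_fun D v by exact: measurable_funTS.
have -> : (fun x => conv Q w (mollifier e) x - w x) =
    (fun x => conv Q v (mollifier e) x + ((conv Q c (mollifier e) x - c x) + (- v x))).
  apply/funext => x; have -> : conv Q w (mollifier e) x = conv Q v (mollifier e) x + conv Q c (mollifier e) x.
    rewrite /conv -RintegralD//; [|exact: (conv_int mQ iv)|exact: (conv_int mQ ic)].
    by apply: eq_Rintegral => z _; rewrite /v; ring.
  by rewrite /v; ring.
have mB : measurable_fun D (fun x => conv Q c (mollifier e) x - c x) by exact: measurable_funB.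
have mN : measurable_fun D (fun x => - v x) by exact: measurableT_comp.
apply: le_lt_trans (NLp_add mD mvv _) _; first exact: measurable_funD.
have H1 : (NLp D (conv Q v (mollifier e)) < e1%:E)%E.
  by apply: le_lt_trans hc; exact: conv_contract.
have H3 : (NLp D (fun x => - v x)%R < e1%:E)%E.
  apply: le_lt_trans hc; rewrite /NLp; under eq_integral do rewrite normrN.
  apply: ge0_subset_integral => //.
  by apply/measurable_EFinP; exact: measurable_powabs.
have H2 : (NLp D (fun x => conv Q c (mollifier e) x - c x)%R <= e1%:E)%E.
  apply: le_trans (NLp_cst_le mD fD mB (ltW e20) _) _.
    by move=> x Dx; apply: Hr => //; exact: DK.
  have : (mu D <= q%:E)%E.
    rewrite /q fineK ?ge0_fin_numE//; apply: le_measure; rewrite ?inE//.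
  move=> /(@lee_wpmul2l _ (e2 `^ p)%:E); rewrite lee_fin powR_ge0 => /(_ isT) /le_trans; apply.
  rewrite -EFinM lee_fin (@le_trans _ _ (e2 * (1 + q)))//.
    apply: ler_pM => //; rewrite ?powR_ge0 ?lerDr//.
    by apply: le1_powR; [rewrite ltW//= ge_min lexx|exact: ltW].
  by rewrite -ler_pdivlMr// ge_min lexx orbT.
have H23 : (NLp D (fun x => (conv Q c (mollifier e) x - c x) + (- v x))%R <= (P * (2 * e1))%:E)%E.
  apply: le_trans (NLp_add mD mB mN) _; rewrite EFinM.
  have -> : (2 * e1)%:E = (e1%:E + e1%:E)%E by rewrite -EFinD; congr (_%:E); ring.
  by apply: lee_wpmul2l; [rewrite lee_fin ltW|exact: (leeD H2 (ltW H3))].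
apply: (@le_lt_trans _ _ (P%:E * (e1%:E + (P * (2 * e1))%:E))%E).
  by apply: lee_wpmul2l; [rewrite lee_fin ltW|exact: (leeD (ltW H1) H23)].
rewrite -EFinD -EFinM lte_fin /e1.
have -> : P * (eta / (4 * P * P) + P * (2 * (eta / (4 * P * P)))) = eta * (P^-1 / 4 + 1 / 2).
  by field; rewrite gt_eqF.
have : P^-1 <= 1 by rewrite invf_le1.
nra.
Qed.

End contraction.

End mollification.

(** * Truncations in W^{1,p}_0 *)

Lemma filter_ord_forall {T : Type} {F : set_system T} {FF : Filter F} n (P : 'I_n -> T -> Prop) :
  (forall i, \forall x \near F, P i x) -> \forall x \near F, forall i, P i x.
Proof.
elim: n P => [|n IH] P H; first by apply: nearW => x [].
apply: filterS (@filterI T F FF _ _ (H ord0) (IH (fun i => P (lift ord0 i)) (fun i => H _))).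
move=> x [h0 h1] i; case: (unliftP ord0 i) => [j ->|->]//; exact: h1.
Qed.

Section flat_lipschitz.
Context {R : realType}.

Lemma pow_expN_le (s : R) k : 0 <= s -> s ^+ k.+1 * expR (- s) <= (k.+1)`!%:R.
Proof.
move=> s0; rewrite expRN ler_pdivrMr ?expR_gt0// mulrC -ler_pdivrMr ?ltr0n ?fact_gt0//.
by apply: le_trans (expR_ge1Dxn k s0); rewrite lerDr.
Qed.

Lemma dflat1_le2 (t : R) : `|dflat1 t| <= 2.
Proof.
rewrite /dflat1 /flat; case: ltP => t0; last by rewrite normr0.
have s0 : 0 <= t^-1 by rewrite invr_ge0 ltW.
rewrite hornerXn ger0_norm ?mulr_ge0 ?exprn_ge0 ?expR_ge0//.
exact: (pow_expN_le 1 s0).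
Qed.

Lemma flat1_lip (a b : R) : `|flat 1 b - flat 1 a| <= 2 * `|b - a|.
Proof. exact: is_derive1_lip is_derive_flat1 dflat1_le2. Qed.

(** The second derivative of [flat 1] is [(s^4 - 2 s^3) exp(-s)] with [s = 1 / t], and
    [36 = 4! + 2 * 3!]. *)
Lemma dflat1_lip (a b : R) : `|dflat1 b - dflat1 a| <= 36 * `|b - a|.
Proof.
apply: is_derive1_lip (is_derive_flat 'X^2) _ => t.
rewrite /flat; case: ltP => t0; last by rewrite normr0.
have s0 : 0 <= t^-1 by rewrite invr_ge0 ltW.
have h4 := pow_expN_le 3 s0; have h3 := pow_expN_le 2 s0.
rewrite derivXn /= hornerM hornerD hornerN hornerMn expr1 hornerX !hornerXn.
set s := t^-1 in s0 h4 h3 *; have e0 := expR_ge0 (- s).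
have -> : (s ^+ 2 - s *+ 2) * s ^+ 2 * expR (- s) = s ^+ 4 * expR (- s) - 2 * (s ^+ 3 * expR (- s)) by ring.
have p4 : 0 <= s ^+ 4 * expR (- s) by rewrite mulr_ge0// exprn_ge0.
have p3 : 0 <= s ^+ 3 * expR (- s) by rewrite mulr_ge0// exprn_ge0.
move: h4 h3; rewrite (_ : 4`! = 24)%N// (_ : 3`! = 6)%N// => h4 h3.
by rewrite ler_norml; apply/andP; split; lra.
Qed.

End flat_lipschitz.

Lemma Rintegral_supp_eq d {T : measurableType d} {R : realType} (mu : {measure set T -> \bar R})
  (A1 A2 : set T) (f : T -> R) : (forall x, f x != 0 -> A1 x /\ A2 x) ->
  \int[mu]_(x in A1) f x = \int[mu]_(x in A2) f x.
Proof.
move=> H; rewrite Rintegral_mkcond [RHS]Rintegral_mkcond; apply: eq_Rintegral => x _.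
have [f0|/H[h1 h2]] := eqVneq (f x) 0; last by rewrite !patchE !mem_set.
by rewrite !patchE f0; case: ifP; case: ifP.
Qed.

Lemma cont_near_eq {R : realType} {T : topologicalType} (f g : T -> R) (x : T) :
  (\forall y \near x, f y = g y) -> {for x, continuous f} -> {for x, continuous g}.
Proof.
move=> E cf; have E0 : f x = g x by exact: (nbhs_singleton E).
have H : f @ x --> g x by rewrite -E0; exact: cf.
by apply: cvg_trans H; exact: near_eq_cvg E.
Qed.

Lemma dist_close {R : realType} (a b c : R) : `|a - b| <= c -> b - c <= a <= b + c.
Proof. by rewrite ler_norml => /andP[h1 h2]; apply/andP; split; lra. Qed.

Lemma smooth_shift {R : realType} {n : nat} (K : 'rV[R]_n -> R) (x : 'rV[R]_n) : smooth K ->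
  smooth (fun z => K (z - x)).
Proof.
move=> sK; apply: (@smooth_closed _ _ (fun F => exists2 K, smooth K & F = fun z => K (z - x))); last by exists K.
move=> _ [{sK} {}K sK ->].
have [cK dK] := sK [::].
have H i z : is_derive z (delta_mx ord0 i) (fun z => K (z - x)) (partial i K (z - x)).
  apply/is_derive_line0.
  have /is_derive_line0 := derivableP (dK i (z - x)).
  by apply: near_eq_is_derive; near=> h; rewrite addrA.
split.
  move=> z; apply: (@continuous_comp 'rV[R]_n 'rV[R]_n R (fun z => z - x) K); last exact: cK.
  by apply: continuousB; [exact: (fun=> id)|exact: cst_continuous].
move=> i; split => [z|]; first by have [] := H i z.
exists (partial i K); last by apply/funext => z; exact: partialE (H i z).
by move=> s; have := sK (rcons s i); rewrite /iter_partial foldr_rcons.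
Unshelve. all: by end_near. Qed.

Section truncation.
Context {R : realType} {n : nat}.
Implicit Types (x y z : 'rV[R]_n).
Local Notation mu := (lebesgue_rV R n).
Local Notation "''e_' i" := (delta_mx ord0 i : 'rV[R]_n) (at level 8, i at level 2, format "''e_' i").
Variables (p : R) (O : set 'rV[R]_n) (v : 'rV[R]_n -> R) (w : 'rV[R]_n -> 'rV[R]_n) (c : R).
Hypotheses (p1 : 1 < p) (oO : open O) (cv : forall x, O x -> {for x, continuous v}).
Hypothesis c0 : 0 < c.
Let C := [set x | O x /\ c <= v x].
Hypothesis cC : compact C.
Variable D : set 'rV[R]_n.
Hypotheses (DO : compactly_inside D O) (CD : C `<=` D).
Hypothesis wg : forall phi, test_function D phi -> forall i,
  \int[mu]_(x in O) (v x * partial i phi x) = - (\int[mu]_(x in O) (w x ord0 i * phi x)).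
Hypothesis wD : forall i, in_Lp p D (Defs.coord w i).

Definition trunc x : R := if x \in O then Num.max (v x - c) 0 else 0.

Lemma trunc_off x : ~ C x -> trunc x = 0.
Proof.
rewrite /trunc => nC; case: ifPn => // /set_mem Ox.
by rewrite max_r// subr_le0 leNgt; apply/negP => /ltW cx; apply: nC.
Qed.

Lemma trunc_in x : C x -> trunc x = v x - c.
Proof. by move=> [Ox cx]; rewrite /trunc mem_set// max_l// subr_ge0. Qed.

Lemma trunc_pos x : 0 < trunc x -> C x.
Proof. by move=> h; apply: contrapT => /trunc_off e; rewrite e ltxx in h. Qed.

Let clC : closed C. Proof. by apply: compact_closed => //; exact: norm_hausdorff. Qed.

Lemma trunc_cont : continuous trunc.
Proof.
move=> x; have [Ox|nO] := pselect (O x).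
  apply: (@cont_near_eq _ _ (fun y => Num.max (v y - c) 0)).
    have : nbhs x O by exact: open_nbhs_nbhs.
    by apply: filterS => y Oy; rewrite /trunc mem_set.
  apply: (@continuous_max R _ (fun y => v y - c) (fun=> 0)); last exact: cont_cst.
  by apply: contB; [exact: cv|exact: cont_cst].
apply: (@cont_near_eq _ _ (fun=> 0)); last exact: cont_cst.
have : nbhs x (~` C) by apply: open_nbhs_nbhs; split; [rewrite openC|move=> [/nO]].
by apply: filterS => y nCy; rewrite trunc_off.
Qed.

(** On [C] this is [flat 1 (v - 2 c)]. The second subtraction of [c] leaves a collar: where a fine
    mollification of [trunc] exceeds [c], all nearby points are still in [C], so there [trunc] is
    [v] up to a constant and has weak gradient [w]. The chain rule for a nonsmooth truncation is
    thus replaced by one for smooth functions. *)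
Definition cutval x : R := flat 1 (trunc x - c).
Definition cutgrad x : 'rV[R]_n := dflat1 (trunc x - c) *: w x.

Let mD : measurable D. Proof. by apply: open_measurable_rV; have [] := DO. Qed.
Let cDb : compact (closure D). Proof. by have [] := DO. Qed.
Let fD : (mu D < +oo)%E.
Proof.
have [mc fc] := compact_fin cDb; apply: le_lt_trans fc.
by apply: le_measure; rewrite ?inE//; exact: subset_closure.
Qed.
Let mC : measurable C. Proof. exact: closed_measurable_rV. Qed.
Let CsO : C `<=` O. Proof. by move=> x []. Qed.
Let wt i : 'rV[R]_n -> R := (Defs.coord w i) \_ C.
Let p0 : 0 < p. Proof. exact: lt_trans ltr01 p1. Qed.

Let mwt i : measurable_fun setT (wt i).
Proof.
by apply: (measurable_restrictT _ mC).1; have [m _] := wD i; exact: measurable_funS m.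
Qed.

Let fwt i Q : measurable Q -> (NLp p Q (wt i) < +oo)%E.
Proof.
move=> mQ; have [m h] := wD i; apply: le_lt_trans h.
have mp : measurable_fun setT (fun x => (`|wt i x| `^ p)%:E).
  by apply/measurable_EFinP; exact: measurable_powabs.
apply: (@le_trans _ _ (NLp p setT (wt i))).
  by apply: ge0_subset_integral => //; exact: mp.
rewrite [X in (_ <= X)%E]integral_mkcond; apply: ge0_le_integral => //.
- by apply: (measurable_restrictT _ mD).1; apply/measurable_EFinP; exact: measurable_powabs.
move=> x _; rewrite /wt !patchE; case: ifPn => [/set_mem/CD Dx|_].
  by rewrite mem_set.
by rewrite normr0 powR0 ?gt_eqF//; case: ifP => //; rewrite lee_fin powR_ge0.
Qed.

Let V (Q : set 'rV[R]_n) e := conv Q trunc (mollifier e).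

(** The mollification is within [eta < c / 2] of [trunc], and [trunc] oscillates by less than
    [c / 2] on balls of radius [e]; hence where the mollification exceeds [c] the kernel is
    supported in [C]. There the reflected kernel is a test function and the weak gradient of [v]
    gives the derivative; elsewhere [dflat1] vanishes. *)
Lemma trunc_conv_near : exists Q : set 'rV[R]_n, [/\ measurable Q, (mu Q < +oo)%E,
  (forall x z, closure D x -> `|x - z| <= 1 -> Q z),
  mu.-integrable Q (EFin \o trunc) & forall eta, 0 < eta -> exists2 e0, 0 < e0 &
   forall e, 0 < e -> e < e0 -> e <= 1 /\ (forall x, `|V Q e x - trunc x| <= eta) /\
     (eta < c / 2 -> forall x, (flat 1 (V Q e x - c) != 0 -> C x) /\ forall i,
     is_derive x 'e_i (fun x => flat 1 (V Q e x - c)) (dflat1 (V Q e x - c) * conv Q (wt i) (mollifier e) x))].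
Proof.
have [M M0 HM] : exists2 M, 0 <= M & forall x, closure D x -> `|x| <= M.
  have [M [_ h]] := compact_bounded cDb; exists (`|M| + 1); first exact: addr_ge0.
  by apply: h; rewrite (le_lt_trans (ler_norm M))// ltrDl.
pose Q := [set x : 'rV[R]_n | `|x| <= M + 2].
have [mQ fQ] : measurable Q /\ (mu Q < +oo)%E by apply: compact_fin; exact: compact_norm_le.
pose K' := [set x : 'rV[R]_n | `|x| <= M + 1].
have cK' : compact K' by exact: compact_norm_le.
have K'Q x z : K' x -> `|x - z| <= 1 -> Q z.
  rewrite /K' /Q /= => xK' xz.
  by have := ler_normB x (x - z); rewrite subKr; lra.
have DK' x : closure D x -> K' x by move=> /HM xM; rewrite /K'/=; lra.
have CK x : C x -> `|x| <= M by move=> /CD /(@subset_closure _ D) /HM.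
have tc : continuous trunc by exact: trunc_cont.
have [Mt Mt0 HMt] := compact_bound cC (fun x _ => tc x).
have tM x : `|trunc x| <= Mt.
  by have [/HMt//|/trunc_off ->] := pselect (C x); rewrite normr0.
have mt := measurable_contT tc.
have it : mu.-integrable Q (EFin \o trunc).
  apply: measurable_bounded_integrable => //; first exact: measurable_funTS.
  by exists Mt; split; [rewrite num_real|move=> t Mtt x _; exact: le_trans (tM x) (ltW Mtt)].
exists Q; split => // [x z /DK'|]; first exact: K'Q.
move=> eta eta0.
have [r r0 Hr] := conv_cont_close mQ fQ cK' K'Q tc tM ltr01 eta0.
have c20 : 0 < c / 2 by rewrite divr_gt0.
have [d d0 Hd] := supp_unif cC tc trunc_off c20.
exists (Num.min r (Num.min d 1)); first by rewrite !lt_min r0 d0 ltr01.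
move=> e e0; rewrite !lt_min => /and3P[er ed e1].
have cm := csmooth_mollifier e0 : csmooth (mollifier e : 'rV[R]_n -> R).
have close x : `|V Q e x - trunc x| <= eta.
  (* Outside [K'] the point is farther than [e] from [C], so both terms vanish. *)
  have [Kx|nK] := pselect (K' x); first exact: (Hr e e0 er).
  rewrite trunc_off; last by move=> /CK h; apply: nK; rewrite /K'/=; lra.
  rewrite subr0 /V /conv (_ : \int[mu]_(z in Q) _ = 0) ?normr0 ?ltW//.
  rewrite (@eq_Rintegral _ _ _ mu _ (fun=> 0)) ?Rintegral_cst ?mul0r// => z _.
  have [Cz|nC] := pselect (C z); last by rewrite trunc_off// mulr0.
  rewrite mollifier_off ?mul0r// ltNge; apply/negP => xz; apply: nK; rewrite /K'/=.
  by have := CK z Cz; have := ler_normD (x - z) z; rewrite subrK; lra.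
split; [exact: ltW|split => //].
move=> ec x.
have nearC : c < V Q e x -> forall z, `|x - z| <= e -> C z.
  move=> cV z xz; apply: trunc_pos.
  have /andP[h1 h2] := dist_close (close x).
  have := Hd x z (le_lt_trans xz ed); rewrite ltr_norml => /andP[h3 h4].
  lra.
split.
  move=> f0; apply: nearC; last by rewrite subrr normr0 ltW.
  by rewrite ltNge; apply/negP => h; move/eqP: f0; apply; apply: flat_le0; rewrite subr_le0.
move=> i.
have Vc : is_derive x 'e_i (V Q e) (conv Q trunc (partial i (mollifier e)) x) by exact: conv_derive.
have [cV|cV] := ltP c (V Q e x); last first.
  apply: (is_derive_eq (isd_comp (is_derive_flat1 _) (isdB Vc (isd_cst c x 'e_i)))).
  by rewrite /dflat1 flat_le0 ?mul0r// subr_le0.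
apply: (is_derive_eq (isd_comp (is_derive_flat1 _) (isdB Vc (isd_cst c x 'e_i)))).
rewrite subr0; congr (_ * _).
have nC := nearC cV.
pose phi z := mollifier e (x - z).
have phi_off z : ~ (`|x - z| <= e) -> phi z = 0.
  by move=> /negP; rewrite -ltNge; exact: mollifier_off.
have dphi j z : is_derive z 'e_j phi (- partial j (mollifier e) (x - z)).
  apply/is_derive_line0.
  have H : is_derive (x - z) 'e_j (mollifier e) (partial j (mollifier e) (x - z)).
    exact: derivableP (@csmooth_derivable _ _ (mollifier e) j (x - z) cm).
  move/is_derive_line0 : H => H.
  have H1 : is_derive (- (0 : R)) (1 : R) (fun h : R => mollifier e (h *: 'e_j + (x - z))) (partial j (mollifier e) (x - z)).
    by rewrite oppr0.
  have := isd_comp H1 (isdN (isd_id (0 : R) (1 : R))); rewrite mulrN1.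
  apply: near_eq_is_derive; near=> h; rewrite /phi; congr mollifier.
  by rewrite scaleNr opprD addrCA.
pose B := [set z | `|x - z| <= e].
have BC z : B z -> C z by exact: nC.
have cB : closed B.
  apply: (@closed_comp _ _ (fun z : 'rV[R]_n => `|x - z|) [set t | t <= e]); last exact: closed_le.
  move=> z _; apply: (@continuous_comp 'rV[R]_n 'rV[R]_n R (fun z => x - z) (fun z => `|z|)); last exact: norm_continuous.
  by apply: continuousB; [exact: cst_continuous|exact: (fun=> id)].
have phi_B z : ~ B z -> phi z = 0 by exact: phi_off.
have csphi : csmooth phi.
  split; last by exists B => //; apply: (subclosed_compact cB cC).
  rewrite (_ : phi = fun z => mollifier e (z - x)); last first.
    by apply/funext => z; exact: mollifier_sym.
  exact: smooth_shift (csmooth_mollifier e0).1.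
have tphi : test_function D phi.
  have sub : closure [set z | phi z != 0] `<=` B.
    rewrite [X in _ `<=` X]((closure_id B).1 cB); apply: closure_subset => z /= /eqP phi0.
    by apply: contrapT => /phi_B.
  split; [exact: csphi.1| |by move=> z /sub /BC /CD].
  by apply: subclosed_compact cC (subset_trans sub BC); exact: closed_closure.
have pphi z : partial i phi z = - partial i (mollifier e) (x - z) by exact: partialE (dphi i z).
have pB z : ~ B z -> partial i phi z = 0 by move=> nB; exact: partialE (partial_off_supp cB phi_B i nB).
have cp := csmooth_partial i csphi.
have ip := csmooth_integrable cp.
have CQ z : C z -> Q z by move=> Cz; apply: (K'Q z); rewrite /K'/= ?subrr ?normr0//; have := CK z Cz; lra.
have cpc : continuous (partial i phi) by exact: csmooth_cont.
have [Mp Mp0 HMp] := csmooth_bound cp.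
have itp : mu.-integrable setT (EFin \o (fun z => trunc z * partial i phi z)).
  have [_ fC] := compact_fin cC.
  apply: (integrable_supp (A := C) (M := Mt * Mp)) => //.
  - by apply: measurable_funM => //; exact: measurable_contT.
  - by move=> z; rewrite normrM ler_pM.
  - by move=> z /trunc_off ->; rewrite mul0r.
have I0 : \int[mu]_z partial i phi z = 0.
  have cphi : continuous phi by exact: csmooth_cont.
  have [_] := @integral_partial0 R n phi i Mp C cphi cC (fun z nCz => phi_B z (fun Bz => nCz (BC z Bz)))
    (fun z => @csmooth_derivable _ _ phi i z csphi) HMp.
  exact.
(* On the support of [phi] one has [v = trunc + c], and the constant contributes nothing because
   [partial i phi] has integral zero. *)
have E1 : \int[mu]_(z in O) (v z * partial i phi z) = \int[mu]_z (trunc z * partial i phi z).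
  rewrite (@Rintegral_supp_eq _ _ _ mu O setT); last first.
    move=> z; have [/BC[Oz _]//|nB] := pselect (B z); by rewrite pB// mulr0 eqxx.
  rewrite (@eq_Rintegral _ _ _ mu _ (fun z => trunc z * partial i phi z + c * partial i phi z)); last first.
    move=> z _; have [/BC Cz|nB] := pselect (B z); last by rewrite pB// !mulr0 addr0.
    by rewrite trunc_in//; ring.
  rewrite RintegralD//; last exact: integrable_scaler.
  by rewrite RintegralZl// I0 mulr0 addr0.
have E2 : conv Q trunc (partial i (mollifier e)) x = - \int[mu]_z (trunc z * partial i phi z).
  rewrite /conv (@Rintegral_supp_eq _ _ _ mu Q setT); last first.
    move=> z; have [Cz|/trunc_off ->] := pselect (C z); last by rewrite mulr0 eqxx.
    by split => //; exact: CQ.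
  rewrite -mulN1r -RintegralZl//; apply: eq_Rintegral => z _; rewrite pphi; ring.
rewrite E2 -E1 wg// opprK /conv (@Rintegral_supp_eq _ _ _ mu O Q); last first.
  move=> z; have [Bz _|nB] := pselect (B z); last by rewrite phi_B// mulr0 eqxx.
  by have Cz := BC z Bz; split; [exact: CsO|exact: CQ].
apply: eq_Rintegral => z _; rewrite /wt /phi patchE.
have [Bz|nB] := pselect (B z); first by rewrite mem_set; [rewrite mulrC|exact: BC].
by rewrite (phi_off z nB : mollifier e (x - z) = 0) mulr0 mul0r.
Unshelve. all: by end_near. Qed.


Lemma NLp_scale A (f : 'rV[R]_n -> R) k : measurable A -> measurable_fun A f ->
  (NLp p A (fun x => k * f x)%R = (`|k| `^ p)%:E * NLp p A f)%E.
Proof.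
move=> mA mf; rewrite /NLp -ge0_integralZl//.
- by apply: eq_integral => x _; rewrite normrM powRM.
- by apply/measurable_EFinP; exact: measurable_powabs.
Qed.

(** The approximants are [flat 1] of shifted mollifications of [trunc]: smooth, supported in [C] and
    uniformly convergent. Their partial derivatives are products of a uniformly convergent factor
    and a mollification of the component of [w] cut off outside [C]. *)
Lemma W1p_0_trunc : W1p_0 p D cutval cutgrad.
Proof.
have tc : continuous trunc by exact: trunc_cont.
have mt := measurable_contT tc.
have cfl : continuous (flat 1 : R -> R) by exact: continuous_flat.
have cdf : continuous (dflat1 : R -> R) by exact: continuous_flat.
have cvc : continuous cutval.
  move=> x; apply: (@cont_comp _ _ (flat 1) (fun x => trunc x - c)); first exact: cfl.
  by apply: contB; [exact: tc|exact: cont_cst].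
have mcv := measurable_contT cvc.
have cdc : continuous (fun x => dflat1 (trunc x - c)).
  move=> x; apply: (@cont_comp _ _ dflat1 (fun x => trunc x - c)); first exact: cdf.
  by apply: contB; [exact: tc|exact: cont_cst].
have mcd := measurable_contT cdc.
have mw i : measurable_fun D (Defs.coord w i) by have [] := wD i.
have fw i : (NLp p D (Defs.coord w i) < +oo)%E by have [] := wD i.
have gE i : Defs.coord cutgrad i = fun x => dflat1 (trunc x - c) * wt i x.
  apply/funext => x; rewrite /Defs.coord /cutgrad mxE /wt patchE; case: ifPn => // nC.
  rewrite /dflat1 flat_le0 ?mul0r//.
  by rewrite trunc_off ?sub0r ?oppr_le0 ?ltW// => /mem_set; exact/negP.
have mgi i : measurable_fun setT (Defs.coord cutgrad i).
  by rewrite gE; apply: measurable_funM.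
have mwtD i : measurable_fun D (wt i) by exact: measurable_funTS.
split.
- split; first exact: measurable_funTS.
  apply: (@le_lt_trans _ _ ((1 `^ p)%:E * mu D)%E).
    apply: (NLp_cst_le p1) => //; first exact: measurable_funTS.
    by move=> x _; rewrite /cutval ger0_norm ?flat1_ge0// flat1_le1.
  by rewrite powR1 mul1e.
- move=> i; split; first exact: measurable_funTS.
  apply: (@le_lt_trans _ _ (NLp p D (fun x => 2 * wt i x))).
    apply: (NLp_le p1) => //; [exact: measurable_funTS|exact: measurable_funM|].
    move=> x _; rewrite gE !normrM [`|2|]ger0_norm// ler_wpM2r//.
    exact: dflat1_le2.
  by rewrite NLp_scale// lte_mul_pinfty ?fwt// lee_fin powR_ge0.
have [Q [mQ fQ DQ iQ H]] := trunc_conv_near.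
(* The cap [c / 4] keeps [eta k] below the threshold [c / 2] of [trunc_conv_near]. *)
pose eta (k : nat) : R := Num.min k.+1%:R^-1 (c / 4).
have eta0 k : 0 < eta k by rewrite lt_min invr_gt0 ltr0n divr_gt0.
have etac k : eta k < c / 2 by rewrite gt_min; apply/orP; right; rewrite ltr_pM2l// ltf_pV2 ?posrE// ltr_nat.
pose P k e := [/\ 0 < e, (forall x, `|V Q e x - trunc x| <= eta k),
  (forall x, (flat 1 (V Q e x - c) != 0 -> C x) /\ forall i,
     is_derive x 'e_i (fun x => flat 1 (V Q e x - c)) (dflat1 (V Q e x - c) * conv Q (wt i) (mollifier e) x)) &
  forall i, (NLp p D (fun x => conv Q (wt i) (mollifier e) x - wt i x)%R < (eta k)%:E)%E].
have exP k : {e | P k e}.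
  apply: cid.
  have [e0 e00 He0] := H _ (eta0 k).
  have near1 : \forall e \near (0 : R)^'+, 0 < e /\ e < e0.
    near=> e; split; near: e; [exact: nbhs_right_gt|exact: nbhs_right_lt].
  have near2 : \forall e \near (0 : R)^'+, forall i : 'I_n,
      (NLp p D (fun x => conv Q (wt i) (mollifier e) x - wt i x)%R < (eta k)%:E)%E.
    apply: filter_ord_forall => i.
    have [r r0 Hr] := mollifier_cvg mQ fQ p1 mD cDb (@subset_closure _ D) DQ (mwt i) (fwt i mQ) ltr01 (eta0 k).
    near=> e; apply: Hr; near: e; [exact: nbhs_right_gt|exact: nbhs_right_lt].
  have [e [[[e1 e2] h2]]] := filter_ex (filterI near1 near2).
  exists e; have [_ [h3 h4]] := He0 e e1 e2.
  by split => //; exact: h4.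
pose ek k := sval (exP k); have ekP k : P k (ek k) := svalP (exP k).
pose vk k x := flat 1 (V Q (ek k) x - c).
have cV k : continuous (V Q (ek k)).
  by have [e0 _ _ _] := ekP k; apply: conv_cont => //; exact: csmooth_mollifier.
have sV k : smooth (V Q (ek k)).
  by have [e0 _ _ _] := ekP k; apply: smooth_conv => //; exact: csmooth_mollifier.
exists vk.
  move=> k; have [e0 _ h _] := ekP k.
  have sub : closure [set x | vk k x != 0] `<=` C.
    by rewrite [X in _ `<=` X]((closure_id C).1 clC); apply: closure_subset => x /= vx; exact: (h x).1.
  split.
  - pose B F := (exists q, F = fun x => flat q (V Q (ek k) x - c)) \/
      (exists s, F = iter_partial s (V Q (ek k))).
    apply: (@smooth_generated _ _ B); last by apply: gen_base; left; exists 1.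
    move=> _ [[q ->]|[s ->]]; split.
    + move=> x; apply: (@cont_comp _ _ (flat q) (fun x => V Q (ek k) x - c)); first exact: continuous_flat.
      by apply: contB; [exact: cV|exact: cont_cst].
    + move=> i.
      have dV x : is_derive x 'e_i (V Q (ek k)) (partial i (V Q (ek k)) x).
        by apply: derivableP; have [_] := sV k [::]; exact.
      have Hd x := @isd_comp _ _ (flat q) (fun y => V Q (ek k) y - c) x 'e_i _ _ (is_derive_flat q (V Q (ek k) x - c)) (isdB (dV x) (isd_cst c x 'e_i)).
      split => [x|]; first by have [] := Hd x.
      rewrite (_ : partial i _ = fun x => flat ((q - q^`()) * 'X^2) (V Q (ek k) x - c) * (iter_partial [:: i] (V Q (ek k)) x)).
        by apply: gen_mul; apply: gen_base; [left; eexists|right; exists [:: i]].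
      by apply/funext => x; rewrite (partialE (Hd x)) subr0.
    + by have [] := sV k s.
    + move=> i; split => [x|]; first by have [_] := sV k s; exact.
      by apply: gen_base; right; exists (i :: s).
  - by apply: subclosed_compact cC sub; exact: closed_closure.
  - by move=> x /sub /CD.
have mvk k : measurable_fun setT (vk k).
  apply: measurable_contT => x.
  apply: (@cont_comp _ _ (flat 1) (fun x => V Q (ek k) x - c)); first exact: cfl.
  by apply: contB; [exact: cV|exact: cont_cst].
have eta_small e : 0 < e -> \forall k \near \oo, eta k < e.
  move=> e0; have := near_infty_natSinv_lt (PosNum e0); apply: filterS => k /= ke.
  by rewrite gt_min ke.
split.
  apply: cvge0P => [k|e e0]; first exact: NLp_ge0.
  have q0 : 0 <= fine (mu D) by rewrite fine_ge0.
  pose r := Num.min 1 (e / (2 * (1 + fine (mu D)))).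
  have r0 : 0 < r by rewrite lt_min ltr01 divr_gt0// mulr_gt0// ltr_wpDr.
  have := eta_small (r / 2) ltac:(by rewrite divr_gt0); apply: filterS => k kr.
  have [_ h _ _] := ekP k.
  apply: (@le_lt_trans _ _ ((r `^ p)%:E * mu D)%E).
    apply: (NLp_cst_le p1) => //; [|exact: ltW|].
      by apply: measurable_funB; exact: measurable_funTS.
    move=> x _; rewrite /vk /cutval; apply: (le_trans (flat1_lip _ _)).
    rewrite (_ : _ - c - _ = V Q (ek k) x - trunc x); last by ring.
    by have := h x; lra.
  have -> : mu D = (fine (mu D))%:E by rewrite fineK// ge0_fin_numE.
  rewrite -EFinM lte_fin.
  have rp : r `^ p <= r by apply: le1_powR; [rewrite ltW//= ge_min lexx|exact: ltW].
  have re : r * (1 + fine (mu D)) <= e / 2.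
    rewrite -ler_pdivlMr ?ltr_wpDr//.
    rewrite (_ : e / 2 / _ = e / (2 * (1 + fine (mu D)))); last by field; rewrite gt_eqF// ltr_wpDr.
    by rewrite ge_min lexx orbT.
  nra.
move=> i; apply: cvge0P => [k|e e0]; first exact: NLp_ge0.
pose A := fine (NLp p D (wt i)).
have AE : NLp p D (wt i) = A%:E by rewrite fineK// ge0_fin_numE ?fwt//; exact: NLp_ge0.
have A0 : 0 <= A by rewrite fine_ge0//; exact: NLp_ge0.
(* The bound reached below is [2^p (2^p eta k + (36 eta k)^p A)], which is at most [eta k * T]
   because [eta k <= 1]. *)
pose T : R := 2 `^ p * (2 `^ p + 36 `^ p * (1 + A)).
have pw (a : R) : 0 < a -> 0 < a `^ p by exact: powR_gt0.
have T0 : 0 < T.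
  by rewrite mulr_gt0 ?pw// ltr_wpDr ?pw// mulr_ge0 ?powR_ge0// addr_ge0.
have r0 : 0 < Num.min 1 (e / T) by rewrite lt_min ltr01 divr_gt0.
have := eta_small _ r0; apply: filterS => k; rewrite lt_min => /andP[k1 kT].
have [e0' h hd hN] := ekP k.
have mc : measurable_fun setT (conv Q (wt i) (mollifier (ek k))).
  apply: measurable_contT; apply: conv_cont => //; last exact: csmooth_mollifier.
  by have [] := Lp_integrable p1 mQ fQ (measurable_funTS (mwt i)) (fwt i mQ).
have mF1 : measurable_fun D (fun x => 2 * (conv Q (wt i) (mollifier (ek k)) x - wt i x)).
  by apply: measurable_funTS; apply: measurable_funM => //; exact: measurable_funB.
have mF2 : measurable_fun D (fun x => 36 * eta k * wt i x) by exact: measurable_funM.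
apply: (@le_lt_trans _ _ (NLp p D (fun x => `|2 * (conv Q (wt i) (mollifier (ek k)) x - wt i x)| + `|36 * eta k * wt i x|)%R)).
  apply: (NLp_le p1) => //.
  - apply: measurable_funB; last exact: measurable_funTS.
    have -> : partial i (vk k) = fun x => dflat1 (V Q (ek k) x - c) * conv Q (wt i) (mollifier (ek k)) x.
      by apply/funext => x; exact: partialE ((hd x).2 i).
    apply: measurable_funTS; apply: measurable_funM => //; apply: measurable_contT => x.
    apply: (@cont_comp _ _ dflat1 (fun x => V Q (ek k) x - c)); first exact: cdf.
    by apply: contB; [exact: cV|exact: cont_cst].
  - by apply: measurable_funD; apply: measurableT_comp.
  move=> x _; rewrite (partialE ((hd x).2 i)) gE.
  set a := dflat1 (V Q _ x - c); set b := dflat1 (trunc x - c); set y := conv _ _ _ x.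
  (* A mollification error times a factor at most 2, plus [wt i x] times the increment of [dflat1],
     which is at most [36 eta k]. *)
  have -> : a * y - b * wt i x = a * (y - wt i x) + (a - b) * wt i x by ring.
  apply: (le_trans (ler_normD _ _)); rewrite [leRHS]ger0_norm ?addr_ge0// !normrM.
  apply: lerD; first by rewrite [`|2|]ger0_norm// ler_wpM2r//; exact: dflat1_le2.
  rewrite [`|36|]ger0_norm// (ger0_norm (ltW (eta0 k))) ler_wpM2r//.
  apply: (le_trans (dflat1_lip _ _)); rewrite ler_wpM2l//.
  by rewrite (_ : _ - c - _ = V Q (ek k) x - trunc x) ?h//; ring.
apply: le_lt_trans (NLp_add p1 _ _ _) _ => //; try by apply: measurableT_comp.
have EN F : NLp p D (fun x => `|F x|) = NLp p D F.
  by apply: eq_integral => x _; rewrite normr_id.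
rewrite !EN NLp_scale ?NLp_scale//; last first.
  by apply: measurable_funTS; exact: measurable_funB.
rewrite AE [`|2|]ger0_norm// ger0_norm; last by rewrite mulr_ge0// ltW.
have hNi := hN i.
apply: (@le_lt_trans _ _ ((2 `^ p)%:E * ((2 `^ p)%:E * (eta k)%:E + ((36 * eta k) `^ p)%:E * A%:E))%E).
  apply: lee_wpmul2l; first by rewrite lee_fin powR_ge0.
  apply: leeD => //; apply: lee_wpmul2l; first by rewrite lee_fin powR_ge0.
  exact: ltW.
have -> : ((2 `^ p)%:E * ((2 `^ p)%:E * (eta k)%:E + ((36 * eta k) `^ p)%:E * A%:E))%E =
    (2 `^ p * (2 `^ p * eta k + (36 * eta k) `^ p * A))%:E by rewrite EFinM EFinD !EFinM.
rewrite lte_fin powRM//; last exact: ltW.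
have rp : eta k `^ p <= eta k by apply: le1_powR; [rewrite !ltW|exact: ltW].
have h1 : 36 `^ p * eta k `^ p * A <= 36 `^ p * eta k * (1 + A).
  have g0 := powR_ge0 (eta k) p.
  rewrite -!mulrA ler_pM2l ?pw//; nra.
apply: (@le_lt_trans _ _ (eta k * T)).
  rewrite /T mulrCA ler_pM2l ?pw//; nra.
by rewrite -ltr_pdivlMr.
Unshelve. all: by end_near. Qed.

End truncation.

(** * Comparison principle and classical solutions *)

(** At positive values [powR] is differentiable; at the value 0 continuity is checked by hand, and
    the exponent 0, which occurs for [p = 2], gives the constant 1. *)
Lemma powR_continuous_comp {R : realType} {T : topologicalType} (f : T -> R) (q : R) (x : T) :
  0 <= q -> (\forall y \near x, 0 <= f y) -> {for x, continuous f} ->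
  {for x, continuous (fun y => f y `^ q)}.
Proof.
move=> q0 f0 cf; have [->|qn0] := eqVneq q 0.
  rewrite (_ : (fun y => _) = fun=> 1); first exact: cont_cst.
  by apply/funext => y; rewrite powRr0.
have qp : 0 < q by rewrite lt_neqAle eq_sym qn0.
have := nbhs_singleton f0; rewrite le_eqVlt => /orP[/eqP fx0|fx].
  apply: cont_dist => e e0; rewrite -fx0 powR0//.
  have d0 : 0 < e `^ q^-1 by exact: powR_gt0.
  have /cvgrPdist_lt /(_ _ d0) := cf; apply: filterS2 f0 => y y0.
  rewrite -fx0 !sub0r !normrN ger0_norm// => fy; rewrite ger0_norm ?powR_ge0//.
  by have := gt0_ltr_powR qp y0 (ltW d0) fy; rewrite -powRrM mulVf// powRr1// ltW.
apply: (@cont_comp T R (fun t => t `^ q) f x) => //.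
by have [/derivable1_diffP /differentiable_continuous] := is_derive1_powR q fx.
Qed.

Section vectors.
Context {R : realType} {n : nat}.
Implicit Types (x y : 'rV[R]_n).

Lemma dotv_ge0 x : 0 <= dotv x x.
Proof. by apply: sumr_ge0 => i _; rewrite -expr2 sqr_ge0. Qed.

Lemma enorm_ge0 x : 0 <= enorm x. Proof. exact: sqrtr_ge0. Qed.

Lemma sqr_enorm x : enorm x ^+ 2 = dotv x x.
Proof. by rewrite sqr_sqrtr ?dotv_ge0. Qed.

Lemma dotv_le x y : `|dotv x y| <= (\sum_i `|x ord0 i|) * (\sum_i `|y ord0 i|).
Proof.
apply: (le_trans (ler_norm_sum _ _ _)); rewrite mulr_suml; apply: ler_sum => i _.
by rewrite normrM ler_wpM2l// (bigD1 i)//= lerDl sumr_ge0.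
Qed.

Lemma enorm_le x : enorm x <= \sum_i `|x ord0 i|.
Proof.
have h : 0 <= \sum_i `|x ord0 i| by exact: sumr_ge0.
rewrite -(ger0_norm h) -sqrtr_sqr; apply: ler_wsqrtr.
by rewrite expr2; apply: le_trans (ler_norm _) (dotv_le _ _).
Qed.

Lemma dotvBr x y z : dotv x (y - z) = dotv x y - dotv x z.
Proof. by rewrite /dotv -sumrB; apply: eq_bigr => i _; rewrite !mxE mulrBr. Qed.

Lemma dotvZr k x y : dotv x (k *: y) = k * dotv x y.
Proof. by rewrite /dotv mulr_sumr; apply: eq_bigr => i _; rewrite !mxE mulrCA. Qed.

Lemma dotvC x y : dotv x y = dotv y x.
Proof. by apply: eq_bigr => i _; rewrite mulrC. Qed.

(* From [2 x.y <= |x|^2 + |y|^2] the difference is at least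
   [(|x|^(p-2) - |y|^(p-2)) (|x|^2 - |y|^2) / 2]. *)
Lemma plap_monotone (p : R) x y : 2 <= p ->
  0 <= enorm x `^ (p - 2) * dotv x (x - y) - enorm y `^ (p - 2) * dotv y (x - y).
Proof.
move=> p2; have q0 : 0 <= p - 2 by lra.
have := dotv_ge0 (x - y).
rewrite dotvBr [dotv (x - y) x]dotvC [dotv (x - y) y]dotvC !dotvBr [dotv y x]dotvC.
rewrite -!sqr_enorm; set s := dotv x y.
set a := enorm x; set b := enorm y; have a0 : 0 <= a := enorm_ge0 x; have b0 : 0 <= b := enorm_ge0 y.
have := powR_ge0 a (p - 2); have := powR_ge0 b (p - 2).
have [ab|/ltW ab] := leP a b.
  have := ge0_ler_powR q0 a0 b0 ab; have : a ^+ 2 <= b ^+ 2 by rewrite lerXn2r.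
  set A := a `^ _; set B := b `^ _; move: (a ^+ 2) (b ^+ 2) => ? ?; nra.
have := ge0_ler_powR q0 b0 a0 ab; have : b ^+ 2 <= a ^+ 2 by rewrite lerXn2r.
set A := a `^ _; set B := b `^ _; move: (a ^+ 2) (b ^+ 2) => ? ?; nra.
Qed.

Lemma continuous_enorm (g : 'rV[R]_n -> 'rV[R]_n) x :
  (forall i, {for x, continuous (Defs.coord g i)}) -> {for x, continuous (fun y => enorm (g y))}.
Proof.
move=> cg; apply: (@cont_comp _ _ Num.sqrt (fun y => dotv (g y) (g y))); first exact: sqrt_continuous.
by apply: cont_sum => i; apply: contM; exact: cg.
Qed.

End vectors.

Section solutions.
Context {R : realType} {n : nat}.
Implicit Types (x y z : 'rV[R]_n) (O D : set 'rV[R]_n).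
Local Notation mu := (lebesgue_rV R n).
Local Notation "''e_' i" := (delta_mx ord0 i : 'rV[R]_n) (at level 8, i at level 2, format "''e_' i").
Variable p : R.

(** The right-hand side is a free function [d] in place of [f(u)], so that strict sub- and
    supersolutions are exact solutions of other equations and one comparison lemma serves all cases.
    Continuity is included because comparison is a pointwise statement. *)
Definition solves O (u : 'rV[R]_n -> R) (g : 'rV[R]_n -> 'rV[R]_n) (d : 'rV[R]_n -> R) :=
  [/\ forall x, O x -> {for x, continuous u}, W1p_loc p O u g &
   forall D, compactly_inside D O -> forall phi psi, W1p_0 p D phi psi ->
      mu.-integrable D (EFin \o (fun x => d x * phi x)) /\
      - (\int[mu]_(x in D) (enorm (g x) `^ (p - 2) * dotv (g x) (psi x))) =
        \int[mu]_(x in D) (d x * phi x)].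

Hypothesis p2 : (2 : R) <= p.
Let p1 : 1 < p. Proof. by apply: lt_le_trans p2; rewrite ltr1n. Qed.
Let p0 : 0 < p. Proof. exact: lt_trans ltr01 p1. Qed.
Let q0 : 0 <= p - 2. Proof. by rewrite subr_ge0. Qed.

Lemma compactly_inside_measure D O : compactly_inside D O -> measurable D /\ (mu D < +oo)%E.
Proof.
move=> [oD cD DO]; have mD := open_measurable_rV oD; split => //.
have [mc fc] := compact_fin cD; apply: le_lt_trans fc.
by apply: le_measure; rewrite ?inE//; exact: subset_closure.
Qed.

Lemma in_Lp_add D f g : measurable D -> in_Lp p D f -> in_Lp p D g -> in_Lp p D (fun x => f x + g x).
Proof.
move=> mD [mf ff] [mg fg]; split; first exact: measurable_funD.
apply: (le_lt_trans (NLp_add p1 mD mf mg)); rewrite lte_mul_pinfty ?lee_fin ?powR_ge0//.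
exact: (lte_add_pinfty ff fg).
Qed.

Lemma in_Lp_norm D f : in_Lp p D f -> in_Lp p D (fun x => `|f x|).
Proof.
move=> [mf ff]; split; first exact: measurableT_comp.
by apply: le_lt_trans ff; rewrite le_eqVlt; apply/orP; left; apply/eqP; apply: eq_integral => x _; rewrite normr_id.
Qed.

Lemma in_Lp_sum D (I : Type) (r : seq I) (f : I -> 'rV[R]_n -> R) : measurable D ->
  (forall i, in_Lp p D (f i)) -> in_Lp p D (fun x => \sum_(i <- r) `|f i x|).
Proof.
move=> mD H; elim: r => [|i r IH].
  rewrite (_ : (fun x => _) = fun=> 0); last by apply/funext => x; rewrite big_nil.
  split => //; rewrite (eq_integral (cst 0%E)) ?integral0// => x _.
  by rewrite normr0 powR0// gt_eqF.
rewrite (_ : (fun x => _) = fun x => `|f i x| + \sum_(i <- r) `|f i x|).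
  exact: (@in_Lp_add D _ (fun x => \sum_(i <- r) `|f i x|) mD (in_Lp_norm (H i)) IH).
by apply/funext => x; rewrite big_cons.
Qed.

Lemma measurable_flux D (g psi : 'rV[R]_n -> 'rV[R]_n) :
  (forall i, measurable_fun D (Defs.coord g i)) -> (forall i, measurable_fun D (Defs.coord psi i)) ->
  measurable_fun D (fun x => enorm (g x) `^ (p - 2) * dotv (g x) (psi x)).
Proof.
move=> mg mpsi.
have mdot (h k : 'rV[R]_n -> 'rV[R]_n) : (forall i, measurable_fun D (Defs.coord h i)) ->
    (forall i, measurable_fun D (Defs.coord k i)) -> measurable_fun D (fun x => dotv (h x) (k x)).
  by move=> mh mk; apply: measurable_sum => i; apply: measurable_funM; [exact: mh|exact: mk].
apply: measurable_funM; last exact: mdot.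
apply: (measurableT_comp (@measurable_powR R _)).
rewrite (_ : (fun x => enorm (g x)) = fun x => dotv (g x) (g x) `^ 2^-1); last first.
  by apply/funext => x; rewrite powR12_sqrt ?dotv_ge0.
by apply: (measurableT_comp (@measurable_powR R _)); exact: mdot.
Qed.

Lemma integrable_flux D (g psi : 'rV[R]_n -> 'rV[R]_n) : measurable D -> (mu D < +oo)%E ->
  (forall i, in_Lp p D (Defs.coord g i)) -> (forall i, in_Lp p D (Defs.coord psi i)) ->
  mu.-integrable D (EFin \o (fun x => enorm (g x) `^ (p - 2) * dotv (g x) (psi x))).
Proof.
move=> mD fD Lg Lpsi.
pose a x := \sum_i `|g x ord0 i| + \sum_i `|psi x ord0 i|.
have La : in_Lp p D a.
  by apply: in_Lp_add => //; [apply: (@in_Lp_sum D _ _ (Defs.coord g))|apply: (@in_Lp_sum D _ _ (Defs.coord psi))].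
have [ma fa] := La; have [_ ia] := Lp_integrable p1 mD fD ma fa.
have s0 (h : 'rV[R]_n -> 'rV[R]_n) x : 0 <= \sum_i `|h x ord0 i| by exact: sumr_ge0.
apply: (integrable_dominated mD _ _ ia).
  by apply: measurable_flux => i; [have [] := Lg i|have [] := Lpsi i].
move=> x _; have a0 : 0 <= a x by rewrite addr_ge0.
have ga : \sum_i `|g x ord0 i| <= a x by rewrite lerDl.
have psia : \sum_i `|psi x ord0 i| <= a x by rewrite lerDr.
rewrite normrM ger0_norm ?powR_ge0// (ger0_norm a0).
apply: (@le_trans _ _ (a x `^ (p - 2) * (a x * a x))).
  apply: ler_pM; rewrite ?powR_ge0//.
    apply: ge0_ler_powR; rewrite ?nnegrE ?enorm_ge0//.
    exact: le_trans (enorm_le _) ga.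
  by apply: le_trans (dotv_le _ _) _; apply: ler_pM.
have [->|an0] := eqVneq (a x) 0; first by rewrite !mulr0 powR_ge0.
rewrite -expr2 -powR_mulrn// -powRD; last by rewrite an0 implybT.
by rewrite subrK.
Qed.

(* The test function is an approximation of [(u1 - u2 - c)^+]; only the strict inequality
   [d2 < d1] where [u2 < u1] is used, so no Poincare inequality is needed. *)
Lemma comparison O u1 g1 d1 u2 g2 d2 : open O -> solves O u1 g1 d1 -> solves O u2 g2 d2 ->
  (forall c, 0 < c -> compact [set x | O x /\ c <= u1 x - u2 x]) ->
  (forall x, O x -> u2 x < u1 x -> d2 x < d1 x) -> forall x, O x -> u1 x <= u2 x.
Proof.
move=> oO [c1 [L1 G1 W1] S1] [c2 [L2 G2 W2] S2] cK d12 x0 Ox0.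
rewrite leNgt; apply/negP => u21.
pose v x := u1 x - u2 x.
pose w x := g1 x - g2 x.
(* With a third of the gap, [x0] lies in the open set [v > 2 c], where the test function is
   positive. *)
pose c := v x0 / 3; have c0 : 0 < c by rewrite divr_gt0// subr_gt0.
have c20 : 0 < c / 2 by rewrite divr_gt0.
pose C := [set x | O x /\ c <= v x].
have cC : compact C by exact: cK.
have cv x : O x -> {for x, continuous v} by move=> Ox; apply: contB; [exact: c1|exact: c2].
pose D := [set x | O x /\ c / 2 < v x].
have oD : open D.
  rewrite openE => x [Ox vx]; apply: filterI; first exact: open_nbhs_nbhs.
  by have /cvgr_gt := cv x Ox; exact.
have DK : closure D `<=` [set x | O x /\ c / 2 <= v x].
  (* Compactness of the superlevel sets of [u1 - u2] is the form taken by the boundary condition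
     [u1 <= u2]; it also places the closure of [D] inside [O]. *)
  have cl : closed [set x | O x /\ c / 2 <= v x].
    by apply: compact_closed; [exact: norm_hausdorff|exact: cK].
  rewrite [X in _ `<=` X]((closure_id _).1 cl); apply: closure_subset => x [Ox /ltW vx]; split => //.
have DO : compactly_inside D O.
  split => //; last by move=> x /DK [].
  by apply: subclosed_compact (cK _ c20) DK; exact: closed_closure.
have [mD fD] := compactly_inside_measure DO.
have CD : C `<=` D by move=> x [Ox cx]; split => //=; apply: lt_le_trans cx; rewrite ltr_pdivrMr// ltr_pMr// ltr1n.
have wD i : in_Lp p D (Defs.coord w i).
  have [m1 f1] := G1 D DO i; have [m2 f2] := G2 D DO i.
  rewrite (_ : Defs.coord w i = fun x => Defs.coord g1 i x - Defs.coord g2 i x); last first.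
    by apply/funext => x; rewrite /w /Defs.coord !mxE.
  split; first exact: measurable_funB.
  have := in_Lp_add mD (in_Lp_norm (G1 D DO i)) (in_Lp_norm (G2 D DO i)) => -[m12].
  apply: le_lt_trans; apply: (NLp_le p1) => //; first exact: measurable_funB.
  by move=> x _; rewrite [leRHS]ger0_norm ?addr_ge0// ler_normB.
have wg phi : test_function D phi -> forall i,
    \int[mu]_(x in O) (v x * partial i phi x) = - (\int[mu]_(x in O) (w x ord0 i * phi x)).
  move=> tphi i; have [sphi cphi supD] := tphi.
  have tO : test_function O phi by split => // x /supD [].
  have off x : ~ D x -> phi x = 0.
    by move=> nD; apply: contrapT => /eqP h; apply: nD; apply: supD; exact: subset_closure.
  have csp : csmooth phi.
    split=> //; exists (closure [set x | phi x != 0]) => // x nS.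
    by apply: contrapT => /eqP h; apply: nS; exact: subset_closure.
  have poff x : ~ D x -> partial i phi x = 0.
    move=> nD; apply: partialE.
    apply: (@partial_off_supp _ _ phi (closure [set x | phi x != 0])); first exact: closed_closure.
      by move=> z nS; apply: contrapT => /eqP h; apply: nS; exact: subset_closure.
    by move=> /supD.
  have toD (F h : 'rV[R]_n -> R) : (forall x, ~ D x -> h x = 0) ->
      \int[mu]_(x in O) (F x * h x) = \int[mu]_(x in D) (F x * h x).
    move=> h0; apply: Rintegral_supp_eq => x.
    have [Dx _|/h0 ->] := pselect (D x); last by rewrite mulr0 eqxx.
    by split => //; case: Dx.
  have int (F h : 'rV[R]_n -> R) : in_Lp p D F -> csmooth h -> mu.-integrable D (EFin \o (fun x => F x * h x)).
    move=> [mF fF] ch; have [M M0 HM] := csmooth_bound ch.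
    have [iF _] := Lp_integrable p1 mD fD mF fF.
    have iN : mu.-integrable D (EFin \o (fun x => `|F x|)) by apply: eq_integrable (integrable_abse iF).
    apply: (integrable_dominated mD (g := fun x => M * `|F x|)).
    - by apply: measurable_funM => //; apply: measurable_funTS; apply: measurable_contT; exact: csmooth_cont.
    - by move=> x _; rewrite normrM mulrC ler_wpM2r.
    - exact: integrable_scaler.
  have cp := csmooth_partial i csp.
  rewrite !toD//.
  have -> : \int[mu]_(x in D) (v x * partial i phi x) =
      \int[mu]_(x in D) (u1 x * partial i phi x) - \int[mu]_(x in D) (u2 x * partial i phi x).
    rewrite -RintegralB//; [|exact: int (L1 D DO) cp|exact: int (L2 D DO) cp].
    by apply: eq_Rintegral => x _; rewrite /v mulrBl.
  have -> : \int[mu]_(x in D) (w x ord0 i * phi x) =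
      \int[mu]_(x in D) (g1 x ord0 i * phi x) - \int[mu]_(x in D) (g2 x ord0 i * phi x).
    rewrite -RintegralB//; [|exact: int (G1 D DO i) csp|exact: int (G2 D DO i) csp].
    by apply: eq_Rintegral => x _; rewrite /w !mxE mulrBl.
  by have := W1 phi tO i; have := W2 phi tO i; rewrite !toD// => -> ->; ring.
have W0 := W1p_0_trunc p1 oO cv c0 cC DO CD wg wD.
set phi := cutval O v c in W0; set psi := cutgrad O v w c in W0.
have [i1 E1] := S1 D DO phi psi W0; have [i2 E2] := S2 D DO phi psi W0.
have [_ Lpsi _] := W0.
have J1 := integrable_flux mD fD (G1 D DO) Lpsi; have J2 := integrable_flux mD fD (G2 D DO) Lpsi.
pose h x := d1 x * phi x - d2 x * phi x.
have phi_pos x : O x -> c * 2 < v x -> 0 < phi x.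
  move=> Ox vx; apply: flat1_gt0; rewrite /trunc mem_set// subr_gt0 lt_max; apply/orP; left; lra.
have phi_gt0 x : O x -> 0 < phi x -> u2 x < u1 x.
  move=> Ox; rewrite /phi /cutval => ph; rewrite -subr_gt0; apply: (lt_trans c0).
  rewrite ltNge; apply/negP => vx; move: ph; rewrite flat_le0 ?ltxx//.
  rewrite /trunc mem_set// max_r; [rewrite sub0r oppr_le0; exact: ltW|by rewrite subr_le0].
have phi0 x : 0 <= phi x by exact: flat1_ge0.
have h0 x : D x -> 0 <= h x.
  move=> [Ox vx]; rewrite /h -mulrBl; have := phi0 x; rewrite le_eqVlt => /orP[/eqP <-|px].
    by rewrite mulr0.
  by rewrite mulr_ge0// ltW// subr_gt0 d12//; exact: phi_gt0.
have ih : mu.-integrable D (EFin \o h) by exact: integrable_subr.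
have mh : measurable_fun D h by apply/measurable_EFinP; exact: measurable_int ih.
(* Subtracting the two weak formulations turns the integral of [h] into minus the integral of the
   monotone expression in [g1 - g2], weighted by [dflat1 >= 0]. *)
have hle : \int[mu]_(x in D) h x <= 0.
  rewrite /h RintegralB// -E1 -E2 opprK addrC -oppr_ge0 opprB -RintegralB//.
  apply: Rintegral_ge0 => x _; rewrite /psi /cutgrad !dotvZr.
  have := plap_monotone (g1 x) (g2 x) p2; rewrite -/(w x) => H.
  have dge := dflat1_ge0 (trunc O v c x - c).
  rewrite [X in X - _]mulrCA [X in _ - X]mulrCA -mulrBr mulr_ge0//.
have heq : (\int[mu]_(x in D) `|(h x)%:E| = 0)%E.
  apply/eqP; rewrite eq_le; apply/andP; split; last exact: integral_ge0.
  rewrite (eq_integral (EFin \o h)); last by move=> x /set_mem Dx; rewrite /= ger0_norm ?h0.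
  rewrite -[X in (X <= _)%E]fineK; first by rewrite lee_fin.
  exact: integrable_fin_num.
(* Being nonnegative with integral at most 0, [h] vanishes almost everywhere; but it is positive on
   the nonempty open set [U], which has positive measure. *)
pose U := [set x | O x /\ c * 2 < v x].
have oU : open U.
  rewrite openE => x [Ox vx]; apply: filterI; first exact: open_nbhs_nbhs.
  by have /cvgr_gt := cv x Ox; exact.
have Ux0 : U x0.
  split => //; rewrite -/(v x0) /c mulrAC ltr_pdivrMr// ltr_pM2l ?ltr_nat//.
  by rewrite subr_gt0.
have UD : U `<=` D by move=> x [Ox vx]; split => //; apply: lt_trans vx; rewrite ltr_pM2l//; apply: (@lt_trans _ _ 1); rewrite ?invf_lt1 ?ltr1n.
have mhE : measurable_fun D (EFin \o h) by exact/measurable_EFinP.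
have [N [mN N0 NN]] := (ae_eq_integral_abs mu mD mhE).1 heq.
have UN : U `<=` N.
  move=> x Ux; apply: NN => /= H; have [Ox vx] := Ux; have := H (UD _ Ux) => -[] /eqP; apply/negP.
  rewrite /h -mulrBl mulf_neq0// ?gt_eqF//; last exact: phi_pos.
  by rewrite subr_gt0 d12//; apply: phi_gt0 => //; exact: phi_pos.
have := open_pos oU Ux0; rewrite ltNge => /negP; apply; rewrite -N0.
by apply: le_measure; rewrite ?inE//; exact: open_measurable_rV.
Qed.

Lemma solves_sub O O' u g d : O' `<=` O -> solves O u g d -> solves O' u g d.
Proof.
move=> O'O [cu [L G W] S].
have ci D : compactly_inside D O' -> compactly_inside D O.
  by move=> [oD cD DO']; split => // x /DO' /O'O.
split; [by move=> x /O'O; exact: cu| |by move=> D /ci; exact: S].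
split; [by move=> D /ci; exact: L|by move=> D /ci; exact: G|].
move=> phi [sphi cphi supO'] i.
have tO : test_function O phi by split => // x /supO' /O'O.
have clS : closed (closure [set x | phi x != 0]) by exact: closed_closure.
have off x : ~ closure [set x | phi x != 0] x -> phi x = 0.
  by move=> nD; apply: contrapT => /eqP h; apply: nD; exact: subset_closure.
have toO (F h : 'rV[R]_n -> R) : (forall x, ~ closure [set x | phi x != 0] x -> h x = 0) ->
    \int[mu]_(x in O') (F x * h x) = \int[mu]_(x in O) (F x * h x).
  move=> h0; apply: Rintegral_supp_eq => x.
  have [Sx _|/h0 ->] := pselect (closure [set x | phi x != 0] x); last by rewrite mulr0 eqxx.
  by split; [exact: supO'|apply: O'O; exact: supO'].
rewrite !toO//; first exact: W.
by move=> x nS; apply: partialE; exact: partial_off_supp nS.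
Qed.

Definition locally_bounded_on O (E : 'rV[R]_n -> R) :=
  forall K, compact K -> K `<=` O -> exists M, forall x, K x -> `|E x| <= M.

(** The product [X * phi], which vanishes off the support of [phi], is continuous with a bounded
    partial derivative, so that derivative integrates to zero; [E] may be discontinuous. *)
Lemma integral_by_parts O (X E phi : 'rV[R]_n -> R) i : open O ->
  (forall x, O x -> {for x, continuous X}) -> (forall x, O x -> is_derive x 'e_i X (E x)) ->
  locally_bounded_on O E -> test_function O phi ->
  \int[mu]_(x in O) (X x * partial i phi x) = - \int[mu]_(x in O) (E x * phi x).
Proof.
move=> oO cX dX bE [sphi cK KO]; set K := closure _ in cK KO.
have clK : closed K by exact: closed_closure.
have off x : ~ K x -> phi x = 0.
  by move=> nD; apply: contrapT => /eqP h; apply: nD; exact: subset_closure.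
have csp : csmooth phi by split=> //; exists K.
have cp := csmooth_partial i csp.
have poff x : ~ K x -> partial i phi x = 0.
  by move=> nD; apply: partialE; exact: partial_off_supp nD.
have cphi : continuous phi by exact: csmooth_cont.
have cdphi : continuous (partial i phi) by exact: csmooth_cont.
have cont (h : 'rV[R]_n -> R) : continuous h -> (forall x, ~ K x -> h x = 0) ->
    continuous (fun x => X x * h x).
  move=> ch h0 x; have [Ox|nO] := pselect (O x).
    by apply: contM; [exact: cX|exact: ch].
  apply: (@cont_near_eq _ _ (fun=> 0)); last exact: cont_cst.
  have : nbhs x (~` K) by apply: open_nbhs_nbhs; split; [rewrite openC|move=> /KO].
  by apply: filterS => y nKy; rewrite h0// mulr0.
have cF := cont _ cphi off; have cG := cont _ cdphi poff.
pose F x := X x * phi x.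
have dF x : is_derive x 'e_i F (X x * partial i phi x + E x * phi x).
  have [Ox|nO] := pselect (O x).
    have d1 := isdM (dX x Ox) (derivableP (@csmooth_derivable _ _ phi i x csp)).
    by apply: (is_derive_eq d1); rewrite /partial; ring.
  have nK : ~ K x by move=> /KO.
  apply: (is_derive_eq (@partial_off_supp _ _ F K clK _ i x nK)).
    by move=> z nKz; rewrite /F off// mulr0.
  by rewrite off// poff// !mulr0 addr0.
have [MX MX0 HX] := compact_bound cK (fun x Kx => cX x (KO x Kx)).
have [ME HE] := bE K cK KO.
have [M0 M00 H0] := csmooth_bound csp; have [M1 M10 H1] := csmooth_bound cp.
have [mK fK] := compact_fin cK.
have bnd x : `|partial i F x| <= MX * M1 + `|ME| * M0.
  rewrite (partialE (dF x)).
  have [Kx|nK] := pselect (K x); last first.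
    by rewrite off// poff// !mulr0 addr0 normr0 addr_ge0// mulr_ge0.
  apply: (le_trans (ler_normD _ _)); rewrite !normrM; apply: lerD; apply: ler_pM => //; first exact: HX.
  exact: le_trans (HE x Kx) (ler_norm _).
have F0 x : ~ K x -> F x = 0 by move=> nK; rewrite /F off// mulr0.
have [iF IF] := @integral_partial0 _ _ F i _ K cF cK F0 (fun x => let: DeriveDef h _ := dF x in h) bnd.
pose G x := X x * partial i phi x.
have iG : mu.-integrable setT (EFin \o G).
  apply: (integrable_supp mK fK (M := MX * M1)); first exact: measurable_contT.
    move=> x; rewrite /G; have [Kx|nK] := pselect (K x); last by rewrite poff// mulr0 normr0 mulr_ge0.
    by rewrite normrM; apply: ler_pM => //; exact: HX.
  by move=> x nK; rewrite /G poff// mulr0.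
have EE x : E x * phi x = partial i F x - G x by rewrite (partialE (dF x)) /G; ring.
rewrite (@Rintegral_supp_eq _ _ _ mu O setT); last first.
  move=> x; have [Kx _|nK] := pselect (K x); last by rewrite poff// mulr0 eqxx.
  by split => //; exact: KO.
rewrite [in RHS](@Rintegral_supp_eq _ _ _ mu O setT); last first.
  move=> x; have [Kx _|nK] := pselect (K x); last by rewrite off// mulr0 eqxx.
  by split => //; exact: KO.
rewrite [in RHS](@eq_Rintegral _ _ _ mu _ (fun x => partial i F x - G x)); last by move=> x _; exact: EE.
by rewrite RintegralB// IF sub0r opprK.
Qed.

(** By [a <= eta + eta (a / eta)^p], convergence in [L^p] on a set of finite measure gives
    convergence of the integrals against a bounded weight. The constant [B] is [eta (1 / eta)^p]. *)
Lemma Lp_cvg_mul D (h v : 'rV[R]_n -> R) (vk : nat -> 'rV[R]_n -> R) M : measurable D -> (mu D < +oo)%E ->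
  measurable_fun D h -> (forall x, D x -> `|h x| <= M) ->
  in_Lp p D v -> (forall k, mu.-integrable D (EFin \o vk k)) -> Lp_cvg p D vk v ->
  mu.-integrable D (EFin \o (fun x => h x * v x)) /\
  (fun k => \int[mu]_(x in D) (h x * vk k x)) @ \oo --> \int[mu]_(x in D) (h x * v x).
Proof.
move=> mD fD mh hM [mv fv] ivk cvk.
have M0 : 0 <= `|M| by [].
have int (w : 'rV[R]_n -> R) : mu.-integrable D (EFin \o w) -> mu.-integrable D (EFin \o (fun x => h x * w x)).
  move=> iw; have mw : measurable_fun D w by apply/measurable_EFinP; exact: measurable_int iw.
  have iN : mu.-integrable D (EFin \o (fun x => `|w x|)) by apply: eq_integrable (integrable_abse iw).
  apply: (integrable_dominated mD (g := fun x => `|M| * `|w x|)).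
  - exact: measurable_funM.
  - move=> x Dx; rewrite normrM ler_wpM2r//; exact: le_trans (hM x Dx) (ler_norm _).
  - exact: integrable_scaler.
have [iv _] := Lp_integrable p1 mD fD mv fv.
split; first exact: int.
apply/cvgrPdist_lt => e e0.
have q0' : 0 <= fine (mu D) by rewrite fine_ge0.
pose eta := e / (2 * (`|M| + 1) * (fine (mu D) + 1)).
have M1 : 0 < `|M| + 1 by rewrite ltr_wpDl.
have D1 : 0 < fine (mu D) + 1 by rewrite ltr_wpDl.
have eta0 : 0 < eta by rewrite divr_gt0// mulr_gt0// mulr_gt0.
pose B := eta * eta^-1 `^ p.
have B0 : 0 < B by rewrite mulr_gt0// powR_gt0// invr_gt0.
pose e' := e / (2 * (`|M| + 1) * B).
have e'0 : 0 < e' by rewrite divr_gt0// mulr_gt0// mulr_gt0.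
have := cvge0_lt cvk e'0; apply: filterS => k hk.
pose w x := vk k x - v x.
have iw : mu.-integrable D (EFin \o w) by exact: integrable_subr.
have mw : measurable_fun D w by apply/measurable_EFinP; exact: measurable_int iw.
have fw : (NLp p D w < +oo)%E by rewrite (lt_trans hk)// ltry.
have [_ iwp] := Lp_integrable p1 mD fD mw fw.
rewrite distrC -RintegralB//; try exact: int.
have -> : \int[mu]_(x in D) (h x * vk k x - h x * v x) = \int[mu]_(x in D) (h x * w x).
  by apply: eq_Rintegral => x _; rewrite mulrBr.
apply: (le_lt_trans (le_normr_Rintegral mD (int _ iw))).
have iN : mu.-integrable D (EFin \o (fun x => `|h x * w x|)) by apply: eq_integrable (integrable_abse (int _ iw)).
pose b x := (`|M| + 1) * (eta + B * `|w x| `^ p).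
have ic : mu.-integrable D (EFin \o (fun=> eta)) by exact: integrable_cstQ.
have ib : mu.-integrable D (EFin \o b).
  by apply: integrable_scaler => //; apply: integrable_addr => //; exact: integrable_scaler.
apply: (@le_lt_trans _ _ (\int[mu]_(x in D) b x)).
  apply: le_Rintegral => // x Dx; rewrite normrM; apply: ler_pM => //.
    by apply: le_trans (hM x Dx) _; apply: le_trans (ler_norm _) _; rewrite lerDl.
  have eV : 0 <= eta^-1 by rewrite invr_ge0; exact: ltW.
  have h1 : 0 <= eta^-1 * `|w x| by exact: mulr_ge0.
  have := le_1_add_powR h1 (ltW p1); rewrite powRM//.
  rewrite -(ler_pM2l eta0) mulrA divff ?gt_eqF// mul1r.
  by rewrite mulrDr mulr1 mulrA.
rewrite RintegralZl//; last by apply: integrable_addr => //; exact: integrable_scaler.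
rewrite RintegralD//; last exact: integrable_scaler.
rewrite Rintegral_cst// RintegralZl//.
have hk' : \int[mu]_(x in D) `|w x| `^ p < e'.
  by rewrite -lte_fin /Rintegral fineK//; exact: integrable_fin_num.
have h1 : (`|M| + 1) * (eta * fine (mu D)) < e / 2.
  rewrite (_ : e / 2 = (`|M| + 1) * (eta * (fine (mu D) + 1))); last first.
    by rewrite /eta; field; rewrite !gt_eqF.
  by rewrite ltr_pM2l// ltr_pM2l// ltrDl.
have h2 : (`|M| + 1) * (B * \int[mu]_(x in D) `|w x| `^ p) < e / 2.
  rewrite (_ : e / 2 = (`|M| + 1) * (B * e')); last by rewrite /e'; field; rewrite !gt_eqF.
  by rewrite ltr_pM2l// ltr_pM2l.
by rewrite mulrDr [e]splitr ltrD.
Qed.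

Lemma Rintegral_sum_seq D (I : Type) (r : seq I) (F : I -> 'rV[R]_n -> R) : measurable D ->
  (forall i, mu.-integrable D (EFin \o F i)) ->
  mu.-integrable D (EFin \o (fun x => \sum_(i <- r) F i x)) /\
  \int[mu]_(x in D) (\sum_(i <- r) F i x) = \sum_(i <- r) \int[mu]_(x in D) F i x.
Proof.
move=> mD iF; elim: r => [|i r [IH1 IH2]].
  have E : (fun x => \sum_(i <- [::]) F i x) = fun=> 0 :> R by apply/funext => x; rewrite big_nil.
  by rewrite E big_nil; split; [exact: integrable0|rewrite Rintegral_cst ?mul0r].
have E : (fun x => \sum_(j <- i :: r) F j x) = fun x => F i x + \sum_(j <- r) F j x.
  by apply/funext => x; rewrite big_cons.
rewrite E big_cons; split; first exact: integrable_addr.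
by rewrite RintegralD// IH2.
Qed.

(** Integrate by parts componentwise against the smooth approximants of [phi], then pass to the
    limit using bounds on the field and on its derivatives. Local boundedness of the [E i] is the
    form that suits radial fields, whose derivatives come from separate formulas on and off the
    axis. *)
Lemma classical_solves O (u : 'rV[R]_n -> R) (g : 'rV[R]_n -> 'rV[R]_n) (E : 'I_n -> 'rV[R]_n -> R) d : open O ->
  (forall x, O x -> {for x, continuous u}) ->
  (forall i x, O x -> is_derive x 'e_i u (g x ord0 i)) ->
  (forall i x, O x -> {for x, continuous (Defs.coord g i)}) ->
  (forall i x, O x -> is_derive x 'e_i (fun y => enorm (g y) `^ (p - 2) * g y ord0 i) (E i x)) ->
  (forall i, locally_bounded_on O (E i)) ->
  (forall x, O x -> d x = \sum_i E i x) -> solves O u g d.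
Proof.
move=> oO cu du cg dX bE dE.
have Lp_cont (f : 'rV[R]_n -> R) D : (forall x, O x -> {for x, continuous f}) -> compactly_inside D O -> in_Lp p D f.
  move=> cf DO; have [mD fD] := compactly_inside_measure DO; have [oD cD DsO] := DO.
  have [M M0 HM] := compact_bound cD (fun x Dx => cf x (DsO x Dx)).
  have mf : measurable_fun D f.
    by apply: measurable_cont => // x Dx; apply: cf; apply: DsO; exact: subset_closure.
  split => //; apply: (@le_lt_trans _ _ ((M `^ p)%:E * mu D)%E).
    by apply: (NLp_cst_le p1) => // x Dx; apply: HM; exact: subset_closure.
  by rewrite lte_mul_pinfty// lee_fin powR_ge0.
have gb i : locally_bounded_on O (Defs.coord g i).
  move=> K cK KO; have [M _ HM] := compact_bound cK (fun x Kx => cg i x (KO x Kx)).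
  by exists M.
pose X i x := enorm (g x) `^ (p - 2) * g x ord0 i.
have cX i x : O x -> {for x, continuous (X i)}.
  move=> Ox; apply: contM; last exact: cg.
  apply: powR_continuous_comp => //; first by apply: filterE => y; exact: enorm_ge0.
  by apply: continuous_enorm => j; exact: cg.
split => //.
  split => [D DO|D DO i|phi tphi i]; [exact: Lp_cont|by apply: Lp_cont => //; exact: cg|].
  exact: (integral_by_parts oO cu (du i) (gb i) tphi).
move=> D DO phi psi [Lphi Lpsi [vk tvk [cvk cdvk]]].
have [mD fD] := compactly_inside_measure DO; have [oD cD DsO] := DO.
have DO' : D `<=` O by move=> x Dx; apply: DsO; exact: subset_closure.
have mE i : measurable_fun D (E i).
  have mO : measurable_fun D (partial i (X i)).
    by apply: measurable_partial => // x Dx; [exact/cX/DO'|have [] := dX i x (DO' x Dx)].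
  by apply: eq_measurable_fun mO => x /set_mem Dx; exact: partialE (dX i x (DO' x Dx)).
have mX i : measurable_fun D (X i) by apply: measurable_cont => // x Dx; exact/cX/DO'.
have bX i : exists M, forall x, D x -> `|X i x| <= M.
  have [M _ HM] := compact_bound cD (fun x Dx => cX i x (DsO x Dx)).
  by exists M => x Dx; apply: HM; exact: subset_closure.
have bD i : exists M, forall x, D x -> `|E i x| <= M.
  by have [M HM] := bE i _ cD DsO; exists M => x Dx; apply: HM; exact: subset_closure.
have csvk k : csmooth (vk k).
  have [sv cv _] := tvk k; split=> //; exists (closure [set x | vk k x != 0]) => // x nS.
  by apply: contrapT => /eqP h; apply: nS; exact: subset_closure.
have off k x : ~ D x -> vk k x = 0.
  move=> nD; apply: contrapT => /eqP h; apply: nD; have [_ _] := tvk k; apply.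
  exact: subset_closure.
have poff k i x : ~ D x -> partial i (vk k) x = 0.
  move=> nD; apply: partialE.
  apply: (@partial_off_supp _ _ (vk k) (closure [set x | vk k x != 0])); first exact: closed_closure.
    by move=> z nS; apply: contrapT => /eqP h; apply: nS; exact: subset_closure.
  by have [_ _ h] := tvk k; move=> /h.
have ivk k : mu.-integrable D (EFin \o vk k).
  by apply: integrableS (csmooth_integrable (csvk k)).
have idvk i k : mu.-integrable D (EFin \o partial i (vk k)).
  by apply: integrableS (csmooth_integrable (csmooth_partial i (csvk k))).
have HE i : mu.-integrable D (EFin \o (fun x => E i x * phi x)) /\
    (fun k => \int[mu]_(x in D) (E i x * vk k x)) @ \oo --> \int[mu]_(x in D) (E i x * phi x).
  by have [M HM] := bD i; exact: (Lp_cvg_mul mD fD (mE i) HM Lphi ivk cvk).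
have HX i : mu.-integrable D (EFin \o (fun x => X i x * psi x ord0 i)) /\
    (fun k => \int[mu]_(x in D) (X i x * partial i (vk k) x)) @ \oo --> \int[mu]_(x in D) (X i x * psi x ord0 i).
  by have [M HM] := bX i; exact: (Lp_cvg_mul mD fD (mX i) HM (Lpsi i) (idvk i) (cdvk i)).
have tD k : test_function O (vk k) by have [sv cv h] := tvk k; split => // x /h /DO'.
have ibp k i : \int[mu]_(x in D) (X i x * partial i (vk k) x) = - \int[mu]_(x in D) (E i x * vk k x).
  have := integral_by_parts oO (cX i) (dX i) (bE i) (tD k).
  rewrite (@Rintegral_supp_eq _ _ _ mu O D); last first.
    move=> x; have [Dx _|nD] := pselect (D x); last by rewrite poff// mulr0 eqxx.
    by split => //; exact: DO'.
  rewrite [in X in _ = X -> _](@Rintegral_supp_eq _ _ _ mu O D)//.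
  move=> x; have [Dx _|nD] := pselect (D x); last by rewrite off// mulr0 eqxx.
  by split => //; exact: DO'.
have lim i : \int[mu]_(x in D) (X i x * psi x ord0 i) = - \int[mu]_(x in D) (E i x * phi x).
  have [_ h1] := HX i; have [_ h2] := HE i.
  apply: (cvg_unique _ h1); first exact: Rhausdorff.
  rewrite (_ : (fun k => _) = fun k => - \int[mu]_(x in D) (E i x * vk k x)); last by apply/funext => k; exact: ibp.
  exact: cvgN.
have [i1 e1] := Rintegral_sum_seq (index_enum 'I_n) mD (fun i => (HE i).1).
have [i2 e2] := Rintegral_sum_seq (index_enum 'I_n) mD (fun i => (HX i).1).
split.
  apply: eq_integrable i1 => // x /set_mem Dx /=.
  by rewrite dE ?mulr_suml//; exact: DO'.
rewrite (@eq_Rintegral _ _ _ mu _ (fun x => \sum_i X i x * psi x ord0 i)); last first.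
  by move=> x _; rewrite /dotv mulr_sumr; apply: eq_bigr => i _; rewrite /X mulrA.
rewrite [in RHS](@eq_Rintegral _ _ _ mu _ (fun x => \sum_i E i x * phi x)); last first.
  by move=> x /set_mem Dx; rewrite dE ?mulr_suml//; exact: DO'.
by rewrite e1 e2 -sumrN; apply: eq_bigr => i _; rewrite lim opprK.
Qed.

End solutions.

(** * Radial solutions *)

Section radial.
Context {R : realType} {n : nat}.
Implicit Types (x y : 'rV[R]_n).
Local Notation "''e_' i" := (delta_mx ord0 i : 'rV[R]_n) (at level 8, i at level 2, format "''e_' i").
Variables (P : pred 'I_n) (c : 'rV[R]_n).

(** The predicate [P] selects the active coordinates: [predT] gives balls, and [i != ord_max] with
    centre 0 the distance to the axis of the cylinder. One theory of radial fields thus serves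
    both. *)
Definition rad x : R := Num.sqrt (\sum_(i | P i) (x ord0 i - c ord0 i) ^+ 2).

Lemma rad_ge0 x : 0 <= rad x. Proof. exact: sqrtr_ge0. Qed.

Lemma sqr_rad x : rad x ^+ 2 = \sum_(i | P i) (x ord0 i - c ord0 i) ^+ 2.
Proof. by rewrite sqr_sqrtr// sumr_ge0// => i _; rewrite sqr_ge0. Qed.

Lemma coord_le_rad x i : P i -> `|x ord0 i - c ord0 i| <= rad x.
Proof.
move=> Pi; rewrite -sqrtr_sqr; apply: ler_wsqrtr; rewrite (bigD1 i)//= lerDl.
by apply: sumr_ge0 => j _; rewrite sqr_ge0.
Qed.

Lemma rad_line x i h : P i ->
  rad (h *: 'e_i + x) = Num.sqrt (rad x ^+ 2 + 2 * h * (x ord0 i - c ord0 i) + h ^+ 2).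
Proof.
move=> Pi; rewrite sqr_rad /rad; congr Num.sqrt.
rewrite (bigD1 i)//= [in RHS](bigD1 i)//= !mxE !eqxx/= mulr1.
rewrite (eq_bigr (fun j => (x ord0 j - c ord0 j) ^+ 2)); first by ring.
by move=> j /andP[_ ji]; rewrite !mxE eqxx /= (negbTE ji) mulr0 add0r.
Qed.

Lemma rad_line_off x i h : ~~ P i -> rad (h *: 'e_i + x) = rad x.
Proof.
move=> nPi; rewrite /rad; congr Num.sqrt; apply: eq_bigr => j Pj.
rewrite !mxE eqxx /=; have /negbTE -> : j != i by apply: contraNN nPi => /eqP <-.
by rewrite mulr0 add0r.
Qed.

Lemma continuous_rad : continuous rad.
Proof.
move=> x; apply: (@cont_comp _ _ Num.sqrt (fun x => \sum_(i | P i) (x ord0 i - c ord0 i) ^+ 2)).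
  exact: sqrt_continuous.
apply: cont_sum => i; apply: (@contM _ _ (fun x => x ord0 i - c ord0 i) (fun x => x ord0 i - c ord0 i));
  by apply: contB; [exact: coord_continuous|exact: cont_cst].
Qed.

Lemma is_derive_rad x i : P i -> 0 < rad x -> is_derive x 'e_i rad ((x ord0 i - c ord0 i) / rad x).
Proof.
move=> Pi r0; apply/is_derive_line0.
rewrite (_ : (fun h : R => _) = fun h : R => Num.sqrt (rad x ^+ 2 + 2 * h * (x ord0 i - c ord0 i) + h * h)); last first.
  by apply/funext => h; rewrite rad_line.
set v := x ord0 i - c ord0 i.
have dq : is_derive (0 : R) (1 : R) (fun h : R => rad x ^+ 2 + 2 * h * v + h * h) (2 * v).
  apply: (is_derive_eq (isdD (isdD (isd_cst _ _ _) (isdM (isdM (isd_cst 2 _ _) (isd_id _ _)) (isd_cst v _ _))) (isdM (isd_id _ _) (isd_id _ _)))).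
  ring.
have p0 : 0 < rad x ^+ 2 + 2 * 0 * v + 0 * 0 by rewrite !mulr0 mul0r !addr0 exprn_gt0.
apply: (is_derive_eq (@isd_comp R _ Num.sqrt (fun h : R => rad x ^+ 2 + 2 * h * v + h * h) 0 1 _ _ (is_derive1_sqrt p0) dq)).
rewrite !mulr0 mul0r !addr0 sqrtr_sqr gtr0_norm//.
by field; rewrite gt_eqF.
Qed.

(** The field varies with [Z'] along the radius and with [Z / r] in the other active directions;
    summing over [P] yields [Z' + (#|P| - 1) Z / r]. *)
Lemma radial_derive (Z : R -> R) dz x i : P i -> 0 < rad x -> is_derive (rad x) 1 Z dz ->
  is_derive x 'e_i (fun y => Z (rad y) / rad y * (y ord0 i - c ord0 i))
   (dz * ((x ord0 i - c ord0 i) ^+ 2 / rad x ^+ 2) +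
    Z (rad x) / rad x * (1 - (x ord0 i - c ord0 i) ^+ 2 / rad x ^+ 2)).
Proof.
move=> Pi r0 dZ; have dr := is_derive_rad Pi r0.
have rn : rad x != 0 by rewrite gt_eqF.
have dv : is_derive x 'e_i (fun y : 'rV[R]_n => y ord0 i - c ord0 i) 1.
  apply: (is_derive_eq (isdB (is_derive_coord i x 'e_i) (isd_cst (c ord0 i) x 'e_i))).
  by rewrite !mxE !eqxx subr0.
apply: (is_derive_eq (isdM (isdM (isd_comp dZ dr) (isdV rn dr)) dv)).
by field.
Qed.

Lemma cvg_right0 (F : R -> R) (l : R) : F r @[r --> 0^'+] --> l ->
  forall e : R, 0 < e -> exists2 d : R, 0 < d & forall r : R, 0 < r -> r < d -> `|l - F r| < e.
Proof.
move=> /cvgrPdist_lt H e e0; have /= := H e e0; rewrite near_withinE => /nbhs_ballP[d /= d0 Hd].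
exists d => // r r0 rd; apply: Hd => //=.
by rewrite /ball /= sub0r normrN gtr0_norm.
Qed.

Lemma is_derive_lim (F : 'rV[R]_n -> R) x v l :
  (forall e, 0 < e -> exists2 d, 0 < d & forall h : R, 0 < `|h| -> `|h| < d ->
     `|l - (F (h *: v + x) - F x) / h| < e) -> is_derive x v F l.
Proof.
move=> H.
have cv : (fun h : R => h^-1 *: ((F \o shift x) (h *: v) - F x)) @ 0^' --> l.
  apply/cvgrPdist_lt => e e0; have [d d0 Hd] := H e e0.
  rewrite near_withinE; apply/nbhs_ballP; exists d => //= h.
  rewrite /ball /= sub0r normrN => hd h0.
  by rewrite /GRing.scale /= mulrC; apply: Hd => //; rewrite normr_gt0.
by split; [apply: cvgP cv|exact: cvg_lim cv].
Qed.

Lemma rad0_line x i h : P i -> rad x = 0 -> rad (h *: 'e_i + x) = `|h| /\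
  (h *: 'e_i + x) ord0 i - c ord0 i = h.
Proof.
move=> Pi r0; have := coord_le_rad x Pi; rewrite r0 normr_le0 => /eqP v0; split.
  by rewrite rad_line// r0 v0 mulr0 expr0n /= !add0r sqrtr_sqr.
by rewrite !mxE !eqxx mulr1 -addrA v0 addr0.
Qed.

(** Along [e_i] from a point of the axis the field is [h Z(|h|) / |h|], so its difference quotient
    is [Z(|h|) / |h|] itself. *)
Lemma radial_derive0 (Z : R -> R) w x i : P i -> rad x = 0 -> Z r / r @[r --> 0^'+] --> w ->
  is_derive x 'e_i (fun y => Z (rad y) / rad y * (y ord0 i - c ord0 i)) w.
Proof.
move=> Pi r0 /cvg_right0 H; apply: is_derive_lim => e e0; have [d d0 Hd] := H e e0.
exists d => // h h0 hd; have [-> ->] := rad0_line h Pi r0.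
rewrite r0 invr0 mulr0 mul0r subr0 mulfK; last by rewrite -normr_gt0.
exact: Hd.
Qed.

Lemma radial_fun_derive0 (G : R -> R) x i : P i -> rad x = 0 ->
  (G r - G 0) / r @[r --> 0^'+] --> (0 : R) -> is_derive x 'e_i (fun y => G (rad y)) 0.
Proof.
move=> Pi r0 /cvg_right0 H; apply: is_derive_lim => e e0; have [d d0 Hd] := H e e0.
exists d => // h h0 hd; have [-> _] := rad0_line h Pi r0.
have := Hd _ h0 hd; rewrite r0 !sub0r !normrN !normrM !normfV normr_id.
by [].
Qed.

Lemma radial_derive_off (F : R -> R) x i : ~~ P i -> is_derive x 'e_i (fun y => F (rad y)) 0.
Proof.
move=> nPi; apply/is_derive_line0; rewrite (_ : (fun h : R => _) = fun=> F (rad x)).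
  exact: isd_cst.
by apply/funext => h; rewrite rad_line_off.
Qed.

Lemma radial_field_cont (Q : R -> R) x i : P i -> {for rad x, continuous Q} -> Q 0 = 0 ->
  {for x, continuous (fun y => Q (rad y) / rad y * (y ord0 i - c ord0 i))}.
Proof.
move=> Pi cQ Q0; have := rad_ge0 x; rewrite le_eqVlt => /orP[/eqP r0|r0].
  apply: cont_dist => e e0; rewrite -r0 Q0 !mul0r.
  have cr : {for x, continuous (fun y => Q (rad y))}.
    by apply: cont_comp => //; exact: continuous_rad.
  have /cvgrPdist_lt /(_ _ e0) := cr; apply: filterS => y; rewrite -r0 Q0 !sub0r !normrN.
  apply: le_lt_trans; rewrite normrM normrM.
  have := rad_ge0 y; rewrite le_eqVlt => /orP[/eqP <-|ry].
    by rewrite invr0 normr0 mulr0 mul0r.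
  rewrite -mulrA ler_piMr// normfV (gtr0_norm ry) mulrC ler_pdivrMr// mul1r.
  exact: coord_le_rad.
apply: contM; last by apply: contB; [exact: coord_continuous|exact: cont_cst].
apply: contM; first by apply: cont_comp => //; exact: continuous_rad.
by apply: contV; [rewrite gt_eqF|exact: continuous_rad].
Qed.

Lemma rad_sum x : 0 < rad x -> \sum_(i | P i) (x ord0 i - c ord0 i) ^+ 2 / rad x ^+ 2 = 1.
Proof. by move=> r0; rewrite -mulr_suml -sqr_rad divff// gt_eqF// exprn_gt0. Qed.

Lemma rad_ratio x i : P i -> 0 <= (x ord0 i - c ord0 i) ^+ 2 / rad x ^+ 2 <= 1.
Proof.
move=> Pi; rewrite divr_ge0 ?sqr_ge0//=.
have := rad_ge0 x; rewrite le_eqVlt => /orP[/eqP <-|r0]; first by rewrite expr0n invr0 mulr0.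
rewrite ler_pdivrMr ?exprn_gt0// mul1r -real_normK ?num_real//.
by rewrite lerXn2r ?nnegrE ?rad_ge0//; exact: coord_le_rad.
Qed.

End radial.

(* [Y] is the flux [|G'|^(p-2) G'], so that [div] of the radial field is
   [Y' + (N - 1) Y / r = h]; all the functions are constant on the negative half-line. *)
Record radial_ode {R : realType} (p : R) (N : nat) (s : R) (h Y G : R -> R) : Prop := RadialOde {
  ode_flux : forall r, 0 < r -> r < s -> is_derive r 1 Y (h r - N.-1%:R * (Y r / r));
  ode_sol : forall r, 0 < r -> r < s -> is_derive r 1 G (Y r `^ (p - 1)^-1);
  ode_bound : forall r, 0 < r -> r < s -> 0 <= Y r / r <= h r / N%:R;
  ode_axis : forall r, r <= 0 -> Y r = 0;
  ode_fluxc : forall r, r < s -> {for r, continuous Y};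
  ode_solc : forall r, r < s -> {for r, continuous G};
  ode_rhsc : forall r, r < s -> {for r, continuous h};
  ode_lim : Y r / r @[r --> 0^'+] --> h 0 / N%:R;
  ode_grad0 : (G r - G 0) / r @[r --> 0^'+] --> (0 : R) }.

Section radial_solution.
Context {R : realType} {n : nat}.
Implicit Types (x y : 'rV[R]_n).
Local Notation "''e_' i" := (delta_mx ord0 i : 'rV[R]_n) (at level 8, i at level 2, format "''e_' i").
Variables (p : R) (P : pred 'I_n) (c : 'rV[R]_n) (s : R) (N : nat) (h Y G : R -> R).
Hypothesis p2 : (2 : R) <= p.
Hypothesis NP : #|P| = N.+1.
Hypothesis ode : radial_ode p N.+1 s h Y G.
Local Notation rad := (rad P c).

Definition radial_grad x : 'rV[R]_n :=
  \row_i (if P i then Y (rad x) `^ (p - 1)^-1 / rad x * (x ord0 i - c ord0 i) else 0).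

Let p1 : 0 < p - 1.
Proof. by rewrite subr_gt0; apply: lt_le_trans p2; rewrite ltr1n. Qed.

Lemma flux_ge0 r : r < s -> 0 <= Y r.
Proof.
move=> rs; have [r0|r0] := leP r 0; first by rewrite (ode_axis ode r0).
by have /andP[h0 _] := ode_bound ode r0 rs; move: h0; rewrite pmulr_lge0// invr_gt0.
Qed.

Lemma enorm_radial_grad x : rad x < s -> enorm (radial_grad x) = Y (rad x) `^ (p - 1)^-1.
Proof.
move=> xs; set q := (p - 1)^-1; have q0 : 0 < q by rewrite invr_gt0.
have := rad_ge0 P c x; rewrite le_eqVlt => /orP[/eqP r0|r0].
  have Y0 : Y (rad x) = 0 by rewrite -r0 (ode_axis ode).
  rewrite Y0 powR0 ?gt_eqF// /enorm /dotv big1 ?sqrtr0// => i _.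
  by rewrite !mxE Y0 powR0 ?gt_eqF// mul0r mul0r; case: ifP; rewrite mulr0.
rewrite /enorm; have -> : dotv (radial_grad x) (radial_grad x) = (Y (rad x) `^ q) ^+ 2.
  rewrite -[RHS]mulr1 -(rad_sum r0) mulr_sumr /dotv [RHS]big_mkcond /=; apply: eq_bigr => i _.
  rewrite !mxE; case: ifP => _; last by rewrite mulr0.
  by rewrite -/q; field; rewrite gt_eqF.
by rewrite sqrtr_sqr ger0_norm ?powR_ge0.
Qed.

Let near_rad x : rad x < s -> \forall y \near x, rad y < s.
Proof. by move=> xs; have /cvgr_lt := @continuous_rad _ _ P c x; exact. Qed.

Lemma flux_radial_grad x i : P i -> rad x < s ->
  enorm (radial_grad x) `^ (p - 2) * radial_grad x ord0 i = Y (rad x) / rad x * (x ord0 i - c ord0 i).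
Proof.
move=> Pi xs; rewrite enorm_radial_grad// mxE Pi !mulrA; congr (_ / _ * _).
set q := (p - 1)^-1.
have := flux_ge0 xs; rewrite le_eqVlt => /orP[/eqP <-|Y0].
  by rewrite (powR0 (x := q)) ?mulr0// gt_eqF// invr_gt0.
rewrite -powRrM -powRD; last by rewrite (gt_eqF Y0) implybT.
rewrite (_ : q * (p - 2) + q = 1) ?powRr1 ?ltW// /q.
by field; rewrite gt_eqF.
Qed.

Lemma radial_solves O : open O -> (forall x, O x -> rad x < s) ->
  solves p O (fun x => G (rad x)) radial_grad (fun x => h (rad x)).
Proof.
move=> oO Os; set q := (p - 1)^-1; have q0 : 0 < q by rewrite invr_gt0.
pose rho x i := (x ord0 i - c ord0 i) ^+ 2 / rad x ^+ 2.
pose y0 x := Y (rad x) / rad x.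
(* On the axis all [N + 1] active derivatives equal the limit of [Y / r], namely [h 0 / (N + 1)], so
   that they add up to [h 0]. *)
pose E i x := if P i then (if 0 < rad x then (h (rad x) - N%:R * y0 x) * rho x i + y0 x * (1 - rho x i)
  else h 0 / N.+1%:R) else 0.
have Nn0 : N.+1%:R != 0 :> R by rewrite pnatr_eq0.
apply: (@classical_solves _ _ p p2 O _ _ E) => //.
- move=> x Ox; apply: cont_comp; last exact: continuous_rad.
  exact: (ode_solc ode (Os x Ox)).
- move=> i x Ox; rewrite mxE; case: ifPn => [Pi|nPi]; last exact: radial_derive_off.
  have := rad_ge0 P c x; rewrite le_eqVlt => /orP[/eqP r0|r0].
    by rewrite -r0 invr0 mulr0 mul0r; apply: radial_fun_derive0 => //; exact: ode_grad0 ode.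
  apply: (is_derive_eq (isd_comp (ode_sol ode r0 (Os x Ox)) (is_derive_rad Pi r0))).
  by rewrite mulrA mulrAC.
- move=> i x Ox; rewrite /Defs.coord; case: (boolP (P i)) => [Pi|nPi].
    rewrite (_ : (fun y => _) = fun y => Y (rad y) `^ q / rad y * (y ord0 i - c ord0 i)); last first.
      by apply/funext => y; rewrite mxE Pi.
    apply: (@radial_field_cont _ _ P c (fun r => Y r `^ q)) => //; last first.
      by rewrite (ode_axis ode)// powR0// gt_eqF.
    apply: powR_continuous_comp; [exact: ltW| |exact: (ode_fluxc ode (Os x Ox))].
    have : nbhs (rad x) [set r | r < s] by apply: open_nbhs_nbhs; split; [exact: open_lt|exact: Os].
    by apply: filterS => r /flux_ge0.
  rewrite (_ : (fun y => _) = fun=> 0); first exact: cont_cst.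
  by apply/funext => y; rewrite mxE (negbTE nPi).
- move=> i x Ox; rewrite /E; case: ifPn => [Pi|nPi]; last first.
    rewrite (_ : (fun y => _) = fun=> 0); first exact: isd_cst.
    by apply/funext => y; rewrite mxE (negbTE nPi) mulr0.
  have H : is_derive x 'e_i (fun y => Y (rad y) / rad y * (y ord0 i - c ord0 i))
      (if 0 < rad x then (h (rad x) - N%:R * y0 x) * rho x i + y0 x * (1 - rho x i) else h 0 / N.+1%:R).
    case: ifPn => [r0|]; first exact: radial_derive (ode_flux ode r0 (Os x Ox)).
    rewrite -leNgt => r0; apply: radial_derive0 => //; last exact: ode_lim ode.
    by apply/eqP; rewrite eq_le r0 rad_ge0.
  apply: near_eq_is_derive H.
  by apply: filterS (near_rad (Os x Ox)) => y ys; rewrite flux_radial_grad.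
- move=> i K cK KO.
  have ch x : K x -> {for x, continuous (fun x => h (rad x))}.
    by move=> /KO /Os xs; apply: cont_comp; [exact: (ode_rhsc ode xs)|exact: continuous_rad].
  have [M M0 HM] := compact_bound cK ch.
  exists (M + N%:R * M + M) => x Kx; rewrite /E; case: ifPn => [Pi|_]; last first.
    by rewrite normr0 !addr_ge0// mulr_ge0.
  have hM := HM x Kx; have xs := Os x (KO x Kx).
  have N1 : (1 : R) <= N.+1%:R by rewrite ler1n.
  case: ifPn => [r0|].
    have /andP[rho0 rho1] := @rad_ratio _ _ P c x i Pi; rewrite -/(rho x i) in rho0 rho1.
    have /andP[b0 b1] := ode_bound ode r0 xs; rewrite -/(y0 x) in b0 b1.
    have h0 : 0 <= h (rad x) by move: (le_trans b0 b1); rewrite pmulr_lge0// invr_gt0 ltr0n.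
    have b2 : y0 x <= M.
      apply: (le_trans b1); apply: le_trans hM; rewrite ger0_norm// ler_pdivrMr ?ltr0n//.
      by rewrite ler_peMr.
    rewrite ger0_norm// in hM.
    have N0 : (0 : R) <= N%:R by [].
    have : `|h (rad x) - N%:R * y0 x| <= M + N%:R * M.
      rewrite ler_norml; apply/andP; split; nra.
    move=> h1; apply: (le_trans (ler_normD _ _)); apply: lerD.
      by rewrite normrM -[leRHS]mulr1 ler_pM// ger0_norm.
    rewrite ger0_norm; last by rewrite mulr_ge0// subr_ge0.
    by rewrite -[leRHS]mulr1; apply: ler_pM; rewrite ?subr_ge0// gerBl.
  rewrite -leNgt => r0; have r00 : rad x = 0 by apply/eqP; rewrite eq_le r0 rad_ge0.
  rewrite r00 in hM; rewrite normrM normfV (ger0_norm (ler0n _ _)) ler_pdivrMr ?ltr0n//.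
  apply: (le_trans hM); rewrite -[leLHS]mulr1; apply: ler_pM => //.
  by rewrite lerDr addr_ge0// mulr_ge0.
- move=> x Ox; rewrite /E -big_mkcond /=.
  have := rad_ge0 P c x; rewrite le_eqVlt => /orP[/eqP r0|r0].
    by rewrite -r0 ltxx sumr_const (_ : #|_| = N.+1)// -[RHS]mulr_natr mulfVK.
  rewrite r0 big_split /= -mulr_sumr -mulr_sumr sumrB (rad_sum r0) sumr_const.
  by rewrite (_ : #|_| = N.+1)// mulr1 -[N.+1%:R]natr1; ring.
Qed.

End radial_solution.

(** * Primitives and fluxes *)

Section real_integral.
Context {R : realType}.
Implicit Types (f g h F : R -> R) (r s a b : R).
Local Notation leb := (@lebesgue_measure R).

Lemma within_itv_cont f a b : (forall r, a <= r -> r <= b -> {for r, continuous f}) ->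
  {within `[a, b], continuous f}.
Proof.
move=> cf; apply: continuous_in_subspaceT => r /set_mem /=; rewrite in_itv /= => /andP[].
exact: cf.
Qed.

Lemma derive_ge0_le F dF a b : (forall r, a < r -> r < b -> is_derive r 1 F (dF r) /\ 0 <= dF r) ->
  (forall r, a <= r -> r <= b -> {for r, continuous F}) -> a <= b -> F a <= F b.
Proof.
move=> dFP cF ab; apply: (@ger0_derive1_ndecr _ F a b) => //.
- by move=> x; rewrite in_itv /= => /andP[ax xb]; have [[]] := dFP x ax xb.
- by move=> x; rewrite in_itv /= => /andP[ax xb]; have [[_ H] h0] := dFP x ax xb; rewrite derive1E H.
- exact: within_itv_cont.
Qed.

Lemma derive_eq_cst F dF G a b : (forall r, a < r -> r < b -> is_derive r 1 F (dF r)) ->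
  (forall r, a < r -> r < b -> is_derive r 1 G (dF r)) ->
  (forall r, a <= r -> r <= b -> {for r, continuous F}) ->
  (forall r, a <= r -> r <= b -> {for r, continuous G}) -> a <= b -> F b - F a = G b - G a.
Proof.
move=> dFP dGP cF cG ab; apply/eqP; rewrite eq_le.
have H1 (F1 F2 : R -> R) : (forall r, a < r -> r < b -> is_derive r 1 F1 (dF r)) ->
  (forall r, a < r -> r < b -> is_derive r 1 F2 (dF r)) ->
  (forall r, a <= r -> r <= b -> {for r, continuous F1}) ->
  (forall r, a <= r -> r <= b -> {for r, continuous F2}) -> F1 b - F1 a <= F2 b - F2 a.
  move=> d1 d2 c1 c2.
  have : F2 a - F1 a <= F2 b - F1 b.
    apply: (@derive_ge0_le (fun r => F2 r - F1 r) (fun=> 0)) => // r ar rb; last first.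
      by apply: contB; [exact: c2|exact: c1].
    by split => //; apply: (is_derive_eq (isdB (d2 r ar rb) (d1 r ar rb))); rewrite subrr.
  by move=> H; lra.
by rewrite !H1.
Qed.

Definition prim h r := \int[leb]_(s in `[0, r]) h s.

Lemma prim0 h r : r <= 0 -> prim h r = 0.
Proof.
rewrite /prim le_eqVlt => /orP[/eqP ->|r0]; first by rewrite set_itv1 Rintegral_set1.
by rewrite set_itv_ge ?bnd_simp -?ltNge// Rintegral_set0.
Qed.

Lemma cont_integrable h r : (forall t, 0 <= t -> t <= r -> {for t, continuous h}) ->
  leb.-integrable `[0, r] (EFin \o h).
Proof.
by move=> ch; apply: continuous_compact_integrable; [exact: segment_compact|exact: within_itv_cont].
Qed.

Section upto.
Variable s : R.

Lemma is_derive_prim h r : (forall r, r < s -> {for r, continuous h}) -> 0 < r -> r < s ->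
  is_derive r 1 (prim h) (h r).
Proof.
move=> ch r0 rs; pose u := (r + s) / 2.
have ru : r < u by rewrite /u; lra.
have us : u < s by rewrite /u; lra.
have ih : leb.-integrable `[0, u] (EFin \o h).
  by apply: cont_integrable => t _ tu; apply: ch; exact: le_lt_trans us.
have [d1 d2] := continuous_FTC1_closed ru ih r0 (ch r rs).
exact: (DeriveDef d1 (etrans (esym (derive1E _ _)) d2)).
Qed.

Lemma prim_le h g r : (forall r, r < s -> {for r, continuous h}) -> (forall r, r < s -> {for r, continuous g}) ->
  r < s -> (forall t, 0 <= t -> t <= r -> h t <= g t) -> prim h r <= prim g r.
Proof.
move=> ch cg rs hg; apply: le_Rintegral => //.
- by apply: cont_integrable => t _ tr; apply: ch; exact: le_lt_trans rs.
- by apply: cont_integrable => t _ tr; apply: cg; exact: le_lt_trans rs.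
- by move=> t /=; rewrite in_itv /= => /andP[]; exact: hg.
Qed.

Lemma prim_cst k r : 0 <= r -> prim (fun=> k) r = k * r.
Proof.
move=> r0; rewrite /prim Rintegral_cst//= lebesgue_measure_itv /= lte_fin.
by case: ltgtP r0 => // [r0 _|<- _]; rewrite ?oppr0 ?adde0.
Qed.

Lemma prim_ge0 h r : (forall t, 0 <= t -> t <= r -> 0 <= h t) -> 0 <= prim h r.
Proof. by move=> h0; apply: Rintegral_ge0 => t /=; rewrite in_itv /= => /andP[]; exact: h0. Qed.

Lemma prim_bound h r M : (forall r, r < s -> {for r, continuous h}) -> 0 <= r -> r < s ->
  (forall t, 0 <= t -> t <= r -> h t <= M) -> prim h r <= M * r.
Proof.
move=> ch r0 rs hM; rewrite -prim_cst//; apply: prim_le => // t _; exact: cont_cst.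
Qed.

Lemma prim_cont h r : (forall r, r < s -> {for r, continuous h}) -> r < s -> {for r, continuous (prim h)}.
Proof.
move=> ch rs; have [r0|r0|r0] := ltgtP r 0.
- apply: (@cont_near_eq _ _ (fun=> 0)); last exact: cont_cst.
  have : nbhs r [set t | t < 0] by apply: open_nbhs_nbhs; split; [exact: open_lt|].
  by apply: filterS => t t0; rewrite prim0 // ltW.
- by apply: isd_cont; exact: is_derive_prim.
rewrite r0 in rs *; apply: cont_dist => e e0; rewrite (prim0 h (lexx 0)).
have [d d0 Hd] : exists2 d, 0 < d & forall t, 0 <= t -> t < d -> t < s /\ `|h t| <= `|h 0| + 1.
  have := ch 0 rs => /cvgrPdist_lt /(_ _ ltr01) /nbhs_ballP[d /= d0 Hd].
  exists (Num.min d s); first by rewrite lt_min d0.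
  move=> t t0; rewrite lt_min => /andP[td ts]; split => //.
  have : `|h 0 - h t| < 1 by apply: Hd; rewrite /ball /= sub0r normrN ger0_norm.
  by move=> /ltW H; rewrite -[h t](subKr (h 0)) (le_trans (ler_normB _ _))// lerD2l.
pose M := `|h 0| + 1; have M0 : 0 < M by rewrite ltr_wpDl.
have m0 : 0 < Num.min d (e / M) by rewrite lt_min d0 divr_gt0.
apply/nbhs_ballP; exists (Num.min d (e / M)) => //= t.
rewrite /ball /= !sub0r !normrN lt_min => /andP[td te].
have [t0|t0] := leP t 0; first by rewrite prim0// normr0.
rewrite gtr0_norm// in td te.
have ts : t < s by case: (Hd t (ltW t0) td).
have hM u : 0 <= u -> u <= t -> `|h u| <= M by move=> u0 ut; apply: (Hd u u0 (le_lt_trans ut td)).2.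
have ih : leb.-integrable `[0, t] (EFin \o h).
  by apply: cont_integrable => u _ ut; apply: ch; exact: le_lt_trans ts.
apply: (le_lt_trans (le_normr_Rintegral _ ih)) => //.
apply: (@le_lt_trans _ _ (\int[leb]_(u in `[0, t]) M)).
  apply: le_Rintegral => //.
  - by apply: eq_integrable (integrable_abse ih).
  - by apply: cont_integrable => u _ _; exact: cont_cst.
  - by move=> u /=; rewrite in_itv /= => /andP[]; exact: hM.
by have := prim_cst M (ltW t0); rewrite /prim => ->; rewrite mulrC -ltr_pdivlMr.
Qed.

Lemma prim_lim (hk : nat -> R -> R) h r M : (forall k r, r < s -> {for r, continuous (hk k)}) ->
  (forall r, r < s -> {for r, continuous h}) -> r < s ->
  (forall k t, 0 <= t -> t <= r -> `|hk k t| <= M) ->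
  (forall t, 0 <= t -> t <= r -> hk k t @[k --> \oo] --> h t) ->
  prim (hk k) r @[k --> \oo] --> prim h r.
Proof.
move=> chk ch rs hM hl.
have cI f : (forall r, r < s -> {for r, continuous f}) -> leb.-integrable `[0, r] (EFin \o f).
  by move=> cf; apply: cont_integrable => t _ tr; apply: cf; exact: le_lt_trans rs.
have ic : leb.-integrable `[0, r] (EFin \o (fun=> M)).
  by apply: cont_integrable => t _ _; exact: cont_cst.
have mI : measurable `[0, r]%classic by exact: measurable_itv.
have [] := @dominated_convergence _ _ R leb `[0, r]%classic mI (fun k => EFin \o hk k) (EFin \o h) (EFin \o (fun=> M)).
- by move=> k; exact: measurable_int (cI _ (chk k)).
- exact: measurable_int (cI _ ch).
- apply: aeW => t /=; rewrite in_itv /= => /andP[t0 tr].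
  by apply: cvg_EFin; [exact: nearW|exact: hl].
- exact: ic.
- by apply: aeW => t k /=; rewrite in_itv /= lee_fin => /andP[]; exact: hM.
move=> _ _ H; apply: fine_cvg; rewrite fineK; first exact: H.
by apply: integrable_fin_num => //; exact: cI.
Qed.

Lemma prim_eq F h r : (forall r, r < s -> {for r, continuous h}) -> (forall r, r < s -> {for r, continuous F}) ->
  (forall r, 0 < r -> r < s -> is_derive r 1 F (h r)) -> 0 <= r -> r < s -> prim h r = F r - F 0.
Proof.
move=> ch cF dF r0 rs.
rewrite (_ : F r - F 0 = prim h r - prim h 0); first by rewrite (prim0 h (lexx 0)) subr0.
apply: (@derive_eq_cst F h (prim h) 0 r) => //.
- by move=> t t0 tr; apply: dF => //; exact: lt_trans rs.
- by move=> t t0 tr; apply: is_derive_prim => //; exact: lt_trans rs.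
- by move=> t t0 tr; apply: cF => //; exact: le_lt_trans rs.
- by move=> t t0 tr; apply: prim_cont => //; exact: le_lt_trans rs.
Qed.

End upto.
End real_integral.

Lemma cvg_right0P {R : realType} (F : R -> R) (l : R) :
  (forall e : R, 0 < e -> exists2 d : R, 0 < d & forall r : R, 0 < r -> r < d -> `|l - F r| < e) ->
  F r @[r --> 0^'+] --> l.
Proof.
move=> H; apply/cvgrPdist_lt => e e0; have [d d0 Hd] := H e e0.
rewrite near_withinE; apply/nbhs_ballP; exists d => //= r.
rewrite /ball /= sub0r normrN => rd r0; apply: Hd => //.
by rewrite gtr0_norm in rd.
Qed.

Lemma cont_right {R : realType} (F : R -> R) (x : R) : {for x, continuous F} ->
  forall e : R, 0 < e -> exists2 d : R, 0 < d & forall r : R, `|r - x| < d -> `|F r - F x| < e.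
Proof.
move=> /cvgrPdist_lt H e /H /nbhs_ballP[d /= d0 Hd]; exists d => // r rd.
by rewrite distrC; apply: Hd; rewrite /ball /= distrC.
Qed.

Section flux.
Context {R : realType} (N : nat).
Implicit Types (h g : R -> R) (r s m M : R).

(** The solution of [Y' + N Y / r = h] with [Y 0 = 0], that is the radial divergence equation in
    dimension [N + 1], found by integrating [(r^N Y)' = r^N h]. *)
Definition flux h r := prim (fun t => t ^+ N * h t) r / r ^+ N.

Lemma isd_exp k (x : R) : is_derive x 1 (fun y => y ^+ k) (k%:R * x ^+ k.-1).
Proof.
elim: k => [|k IH]; first by rewrite mul0r; exact: isd_cst.
rewrite (_ : (fun y => _) = fun y : R => y * y ^+ k); last by apply/funext => y; rewrite exprS.
apply: (is_derive_eq (isdM (isd_id x 1) IH)); rewrite -natr1 /=.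
by case: k {IH} => [|k]; rewrite /= ?exprS; ring.
Qed.

Lemma flux_axis h r : r <= 0 -> flux h r = 0.
Proof. by move=> r0; rewrite /flux prim0// mul0r. Qed.

Variable s : R.

Let cont_weight h : (forall r, r < s -> {for r, continuous h}) ->
  forall r, r < s -> {for r, continuous (fun t : R => t ^+ N * h t)}.
Proof.
move=> ch r rs; apply: contM; last exact: ch.
by apply: isd_cont; exact: isd_exp.
Qed.

Lemma is_derive_flux h r : (forall r, r < s -> {for r, continuous h}) -> 0 < r -> r < s ->
  is_derive r 1 (flux h) (h r - N%:R * (flux h r / r)).
Proof.
move=> ch r0 rs; have rn : r ^+ N != 0 by rewrite gt_eqF// exprn_gt0.
have r1 : r != 0 by rewrite gt_eqF.
rewrite [X in is_derive _ _ X](_ : flux h = fun t => prim (fun t => t ^+ N * h t) t * (t ^+ N)^-1)//.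
have H1 := is_derive_prim (cont_weight ch) r0 rs.
have H2 := @isdV R _ (fun y : R => y ^+ N) r 1 _ rn (isd_exp N r).
apply: (is_derive_eq (isdM H1 H2)).
rewrite /flux; move: rn; case: N => [|k] /=; first by rewrite expr0 => _; field.
by rewrite exprS => rn; field; rewrite r1 expf_neq0.
Qed.

Lemma flux_le h g r : (forall r, r < s -> {for r, continuous h}) -> (forall r, r < s -> {for r, continuous g}) ->
  r < s -> (forall t, 0 <= t -> t <= r -> h t <= g t) -> flux h r <= flux g r.
Proof.
move=> ch cg rs hg; have [r0|r0] := leP r 0; first by rewrite !flux_axis.
rewrite /flux ler_pM2r ?invr_gt0 ?exprn_gt0//.
apply: (prim_le (cont_weight ch) (cont_weight cg) rs) => t t0 tr.
by rewrite ler_wpM2l ?exprn_ge0//; exact: hg.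
Qed.

Lemma flux_cst m r : 0 <= r -> flux (fun=> m) r = m * r / N.+1%:R.
Proof.
rewrite le_eqVlt => /orP[/eqP <-|r0]; first by rewrite flux_axis// mulr0 mul0r.
have Nn0 : N.+1%:R != 0 :> R by rewrite pnatr_eq0.
have E : prim (fun t => t ^+ N * m) r = m / N.+1%:R * r ^+ N.+1 - m / N.+1%:R * 0 ^+ N.+1.
  apply: (@prim_eq R (r + 1) (fun t => m / N.+1%:R * t ^+ N.+1) (fun t => t ^+ N * m) r).
  - move=> t _; apply: contM; last exact: cont_cst.
    by apply: isd_cont; exact: isd_exp.
  - move=> t _; apply: isd_cont; apply: isdZ; exact: isd_exp.
  - move=> t _ _; apply: (is_derive_eq (isdZ (m / N.+1%:R) (isd_exp N.+1 t))).
    by rewrite /=; field.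
  - exact: ltW.
  - by rewrite ltrDl.
have rn : r ^+ N != 0 by rewrite gt_eqF// exprn_gt0.
rewrite /flux E expr0n /= mulr0 subr0 exprS; move: (r ^+ N) rn N.+1%:R Nn0 => a an b bn.
by field; rewrite an bn.
Qed.

Lemma flux_ge h r m : (forall r, r < s -> {for r, continuous h}) -> 0 <= r -> r < s ->
  (forall t, 0 <= t -> t <= r -> m <= h t) -> m * r / N.+1%:R <= flux h r.
Proof.
move=> ch r0 rs hm; rewrite -flux_cst//; apply: flux_le => // t _; exact: cont_cst.
Qed.

Lemma flux_bound h r M : (forall r, r < s -> {for r, continuous h}) -> 0 <= r -> r < s ->
  (forall t, 0 <= t -> t <= r -> h t <= M) -> flux h r <= M * r / N.+1%:R.
Proof.
move=> ch r0 rs hm; rewrite -flux_cst//; apply: flux_le => // t _; exact: cont_cst.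
Qed.

Lemma flux_ratio_lim h : (forall r, r < s -> {for r, continuous h}) -> 0 < s ->
  flux h r / r @[r --> 0^'+] --> h 0 / N.+1%:R.
Proof.
move=> ch s0; apply: cvg_right0P => e e0.
have N1 : (1 : R) <= N.+1%:R by rewrite ler1n.
have Np : (0 : R) < N.+1%:R by rewrite ltr0n.
have [d d0 Hd] := cont_right (ch 0 s0) (divr_gt0 e0 (ltr0n R 2)).
exists (Num.min d s); first by rewrite lt_min d0.
move=> r r0; rewrite lt_min => /andP[rd rs].
have close t : 0 <= t -> t <= r -> h 0 - e / 2 <= h t /\ h t <= h 0 + e / 2.
  move=> t0 tr; have : `|h t - h 0| < e / 2 by apply: Hd; rewrite subr0 ger0_norm// (le_lt_trans tr).
  by rewrite ltr_norml => /andP[h1 h2]; split; lra.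
have b1 : (h 0 - e / 2) * r / N.+1%:R <= flux h r.
  by apply: flux_ge => //; [exact: ltW|move=> t t0 tr; have [] := close t t0 tr].
have b2 : flux h r <= (h 0 + e / 2) * r / N.+1%:R.
  by apply: flux_bound => //; [exact: ltW|move=> t t0 tr; have [] := close t t0 tr].
have c1 : (h 0 - e / 2) / N.+1%:R <= flux h r / r by rewrite ler_pdivlMr// mulrAC.
have c2 : flux h r / r <= (h 0 + e / 2) / N.+1%:R by rewrite ler_pdivrMr// mulrAC.
have c3 : e / 2 / N.+1%:R <= e / 2 by rewrite ler_pdivrMr// ler_peMr// divr_ge0// ltW.
rewrite mulrDl mulNr in c1; rewrite mulrDl in c2.
move: c1 c2 c3; move: (h 0 / _) (flux h r / r) (e / 2 / _) => A C B c1 c2 c3.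
rewrite ltr_norml; apply/andP; split; lra.
Qed.

Lemma flux_cont h r : (forall r, r < s -> {for r, continuous h}) -> r < s -> {for r, continuous (flux h)}.
Proof.
move=> ch rs; have [r0|r0|r0] := ltgtP r 0.
- apply: (@cont_near_eq _ _ (fun=> 0)); last exact: cont_cst.
  have : nbhs r [set t | t < 0] by apply: open_nbhs_nbhs; split; [exact: open_lt|].
  by apply: filterS => t /ltW t0; rewrite flux_axis.
- by apply: isd_cont; exact: is_derive_flux.
rewrite r0 in rs *; apply: cont_dist => e e0; rewrite (flux_axis h (lexx 0)).
have [d d0 Hd] := cvg_right0 (flux_ratio_lim ch rs) ltr01.
pose M := `|h 0 / N.+1%:R| + 1; have M0 : 0 < M by rewrite ltr_wpDl.
apply/nbhs_ballP; exists (Num.min d (e / M)); first by rewrite /= lt_min d0 divr_gt0.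
move=> t; rewrite /ball /= !sub0r !normrN lt_min => /andP[td te].
have [t0|t0] := leP t 0; first by rewrite flux_axis// normr0.
rewrite gtr0_norm// in td te; have h1 := Hd t t0 td.
have h2 : `|flux h t / t| < M.
  rewrite -[flux h t / t](subKr (h 0 / N.+1%:R)); apply: le_lt_trans (ler_normB _ _) _.
  by rewrite ltrD2l.
rewrite -[flux h t](divfK (lt0r_neq0 t0)) normrM (gtr0_norm t0).
apply: (@le_lt_trans _ _ (M * t)); first by rewrite ler_wpM2r// ltW.
by rewrite mulrC -ltr_pdivlMr.
Qed.

Lemma flux_lim (hk : nat -> R -> R) h r M : (forall k r, r < s -> {for r, continuous (hk k)}) ->
  (forall r, r < s -> {for r, continuous h}) -> r < s ->
  (forall k t, 0 <= t -> t <= r -> `|hk k t| <= M) ->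
  (forall t, 0 <= t -> t <= r -> hk k t @[k --> \oo] --> h t) ->
  flux (hk k) r @[k --> \oo] --> flux h r.
Proof.
move=> chk ch rs hM hl; apply: cvgMl.
apply: (@prim_lim _ s (fun k t => t ^+ N * hk k t) _ _ (r ^+ N * M)) => //.
- by move=> k; exact: cont_weight (chk k).
- exact: cont_weight ch.
- move=> k t t0 tr; rewrite normrM ger0_norm ?exprn_ge0//; apply: ler_pM => //; rewrite ?exprn_ge0//.
    by rewrite lerXn2r// nnegrE// (le_trans t0).
  exact: hM.
- by move=> t t0 tr; apply: cvgMr; exact: hl.
Qed.

Lemma flux_unique h (Y : R -> R) r : (forall r, r < s -> {for r, continuous h}) ->
  (forall r, r < s -> {for r, continuous Y}) -> Y 0 = 0 ->
  (forall r, 0 < r -> r < s -> is_derive r 1 Y (h r - N%:R * (Y r / r))) -> 0 <= r -> r < s ->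
  Y r = flux h r.
Proof.
move=> ch cY Y0 dY; rewrite le_eqVlt => /orP[/eqP <-|r0] rs; first by rewrite Y0 flux_axis.
have -> : flux h r = (r ^+ N * Y r - 0 ^+ N * Y 0) / r ^+ N.
  congr (_ / _); apply: (@prim_eq _ s (fun t => t ^+ N * Y t)) => //.
  - exact: cont_weight ch.
  - exact: cont_weight cY.
  - move=> t t0 ts; apply: (is_derive_eq (isdM (isd_exp N t) (dY t t0 ts))).
    by case: N => [|k] /=; rewrite ?expr0 ?exprS; field; rewrite ?gt_eqF.
  - exact: ltW.
by rewrite Y0 mulr0 subr0 mulrC mulKf// gt_eqF// exprn_gt0.
Qed.

End flux.

(** * Radial profiles and shooting *)

Section profile.
Context {R : realType} (p : R) (N : nat).
Implicit Types (h g K : R -> R) (r s a M C : R).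
Hypothesis p2 : (2 : R) <= p.
Local Notation q := ((p - 1)^-1).

Let p1 : 0 < p - 1.
Proof. by rewrite subr_gt0; apply: lt_le_trans p2; rewrite ltr1n. Qed.
Let q0 : 0 < q. Proof. by rewrite invr_gt0. Qed.

(** Two explicit integrations solve the radial equation with prescribed right-hand side [h] and
    centre value [a]; a nonlinearity [j] leads to the fixed point problem
    [G = profile a (fun r => j (G r))]. *)
Definition profile a h r : R := a + prim (fun t => flux N h t `^ q) r.

Lemma profile_axis a h r : r <= 0 -> profile a h r = a.
Proof. by move=> r0; rewrite /profile prim0// addr0. Qed.

Section upto.
Variables (s : R) (h : R -> R).
Hypothesis ch : forall r, r < s -> {for r, continuous h}.
Hypothesis h0 : forall r, r < s -> 0 <= h r.

Lemma flux_nneg r : r < s -> 0 <= flux N h r.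
Proof.
move=> rs; have [r0|r0] := leP r 0; first by rewrite flux_axis.
have := @flux_ge _ N s h r 0 ch (ltW r0) rs; rewrite !mul0r; apply => t _ tr.
by apply: h0; exact: le_lt_trans rs.
Qed.

Lemma flux_pow_cont r : r < s -> {for r, continuous (fun t => flux N h t `^ q)}.
Proof.
move=> rs; apply: powR_continuous_comp; [exact: ltW| |exact: (flux_cont ch rs)].
have : nbhs r [set t | t < s] by apply: open_nbhs_nbhs; split; [exact: open_lt|].
by apply: filterS => t; exact: flux_nneg.
Qed.

Lemma is_derive_profile a r : 0 < r -> r < s -> is_derive r 1 (profile a h) (flux N h r `^ q).
Proof.
move=> r0 rs; apply: (is_derive_eq (isdD (isd_cst a r 1) (is_derive_prim flux_pow_cont r0 rs))).
by rewrite add0r.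
Qed.

Lemma profile_cont a r : r < s -> {for r, continuous (profile a h)}.
Proof. by move=> rs; apply: contD; [exact: cont_cst|exact: (prim_cont flux_pow_cont rs)]. Qed.

Lemma profile_nondecr a r t : r <= t -> t < s -> profile a h r <= profile a h t.
Proof.
move=> rt ts; have [t0|t0] := leP t 0.
  by rewrite !profile_axis// (le_trans rt).
have [r0|r0] := leP r 0.
  by rewrite profile_axis// /profile lerDl; apply: prim_ge0 => u _ _; exact: powR_ge0.
apply: (@derive_ge0_le _ _ (fun r => flux N h r `^ q)) => // u ru ut.
  split; last exact: powR_ge0.
  by apply: is_derive_profile; [exact: lt_trans ru|exact: lt_trans ts].
by apply: profile_cont; exact: le_lt_trans ts.
Qed.

(** For nondecreasing [h] the flux, a weighted integral of [h], is at most the one obtained with the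
    constant [h r]; this is the bound [Y / r <= h / (N + 1)]. *)
Lemma radial_ode_profile a : 0 < s -> (forall r t, 0 <= r -> r <= t -> t < s -> h r <= h t) ->
  radial_ode p N.+1 s h (flux N h) (profile a h).
Proof.
move=> s0 hh; split.
- by move=> r r0 rs; exact: (is_derive_flux N ch r0 rs).
- by move=> r r0 rs; exact: is_derive_profile.
- move=> r r0 rs; apply/andP; split; first by apply: divr_ge0; [exact: flux_nneg|exact: ltW].
  rewrite ler_pdivrMr// mulrAC.
  by apply: (@flux_bound _ N _ _ _ _ ch (ltW r0) rs) => t t0 tr; exact: hh.
- by move=> r; exact: flux_axis.
- by move=> r rs; exact: (flux_cont ch rs).
- by move=> r rs; exact: (@profile_cont a r rs).
- exact: ch.
- exact: (@flux_ratio_lim _ N s h ch s0).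
apply: cvg_right0P => e e0.
have [d d0 Hd] := cont_right (flux_pow_cont s0) (divr_gt0 e0 (ltr0n R 2)).
exists (Num.min d s); first by rewrite lt_min d0.
move=> r r0; rewrite lt_min => /andP[rd rs].
have le2 : profile a h r - profile a h 0 <= e / 2 * r.
  rewrite (profile_axis a h (lexx 0)) /profile addrC addKr.
  apply: (prim_bound flux_pow_cont (ltW r0) rs) => t t0 tr.
  have := Hd t; rewrite subr0 (ger0_norm t0) (flux_axis N h (lexx 0)) powR0 ?gt_eqF// subr0.
  by rewrite ger0_norm ?powR_ge0// => H; apply/ltW/H; exact: le_lt_trans tr rd.
have ge0 : 0 <= profile a h r - profile a h 0 by rewrite subr_ge0 profile_nondecr// ltW.
rewrite sub0r normrN normrM (ger0_norm ge0) gtr0_norm ?invr_gt0// ltr_pdivrMr//.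
by apply: (le_lt_trans le2); rewrite ltr_pM2r// ltr_pdivrMr// ltr_pMr// ltr1n.
Qed.

End upto.

Lemma profile_le a b h g r s : (forall r, r < s -> {for r, continuous h}) ->
  (forall r, r < s -> {for r, continuous g}) -> (forall r, r < s -> 0 <= h r) ->
  (forall r, r < s -> 0 <= g r) -> r < s ->
  a <= b -> (forall t, 0 <= t -> t <= r -> h t <= g t) -> profile a h r <= profile b g r.
Proof.
move=> ch cg h0 g0 rs ab hg; apply: (lerD ab).
apply: (prim_le (flux_pow_cont ch h0) (flux_pow_cont cg g0) rs) => t t0 tr.
have ts : t < s by exact: le_lt_trans rs.
apply: ge0_ler_powR; rewrite ?nnegrE; [exact: ltW|exact: flux_nneg ch h0 _ _|exact: flux_nneg cg g0 _ _|].
apply: (@flux_le _ N _ _ _ _ ch cg ts) => u u0 ut; apply: hg => //; exact: le_trans tr.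
Qed.

Lemma profile_lim a (hk : nat -> R -> R) h r s M : (forall k r, r < s -> {for r, continuous (hk k)}) ->
  (forall r, r < s -> {for r, continuous h}) -> (forall k r, r < s -> 0 <= hk k r) ->
  (forall r, r < s -> 0 <= h r) -> 0 <= r -> r < s ->
  (forall k t, 0 <= t -> t <= r -> hk k t <= M) ->
  (forall t, 0 <= t -> t <= r -> hk k t @[k --> \oo] --> h t) ->
  profile a (hk k) r @[k --> \oo] --> profile a h r.
Proof.
move=> chk ch hk0 h0 r0 rs hM hl; apply: cvgD; first exact: cvg_cst.
have ts t : t <= r -> t < s by move=> tr; exact: le_lt_trans rs.
have M0 : 0 <= M by apply: le_trans (hM 0%N 0 (lexx 0) r0); exact/hk0/ts.
apply: (@prim_lim _ s (fun k t => flux N (hk k) t `^ q) _ _ ((M * r) `^ q)) => //.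
- by move=> k; exact: flux_pow_cont (chk k) (hk0 k).
- exact: flux_pow_cont ch h0.
- move=> k t t0 tr; rewrite ger0_norm ?powR_ge0//.
  apply: ge0_ler_powR; rewrite ?nnegrE; [exact: ltW|exact: flux_nneg (chk k) (hk0 k) _ (ts t tr)|exact: mulr_ge0|].
  apply: (@le_trans _ _ (M * t / N.+1%:R)).
    by apply: (@flux_bound _ N _ _ _ _ (chk k) t0 (ts t tr)) => u u0 ut; apply: hM => //; exact: le_trans tr.
  rewrite ler_pdivrMr ?ltr0n//; apply: (@le_trans _ _ (M * r)); first by rewrite ler_wpM2l.
  by rewrite ler_peMr ?mulr_ge0// ler1n.
- move=> t t0 tr.
  have cf : flux N (hk k) t @[k --> \oo] --> flux N h t.
    apply: (flux_lim chk ch (ts t tr) (M := M)) => [k u u0 ut|u u0 ut].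
      by rewrite ger0_norm ?hM ?hk0 ?ts//; exact: le_trans tr.
    by apply: hl => //; exact: le_trans tr.
  (* Truncating at 0 gives a function continuous on the whole line, in particular at a limit flux
     equal to 0. *)
  pose F := fun y : R => Num.max y 0 `^ q.
  have cF : {for flux N h t, continuous F}.
    apply: powR_continuous_comp; [exact: ltW|by apply: filterE => y; rewrite le_max lexx orbT|].
    by apply: continuous_max => //; exact: cont_cst.
  have E y : 0 <= y -> F y = y `^ q by move=> y0; rewrite /F max_l.
  have H : F (flux N (hk k) t) @[k --> \oo] --> F (flux N h t) by exact: cvg_comp cf cF.
  rewrite E in H; last exact: flux_nneg ch h0 _ (ts t tr).
  apply: cvg_trans H; apply: near_eq_cvg; apply: nearW => k /=.
  by rewrite E//; exact: flux_nneg (chk k) (hk0 k) _ (ts t tr).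
Qed.

End profile.

Section picard.
Context {R : realType} (p : R) (N : nat).
Implicit Types (h g K : R -> R) (r s t a M : R).
Hypothesis p2 : (2 : R) <= p.
Variables (j : R -> R) (C : R).
Hypotheses (cj : forall v, {for v, continuous j}) (jj : {homo j : v w / v <= w}).
Hypotheses (j0 : forall v, 0 <= j v) (jC : forall v, j v <= C).
Local Notation q := ((p - 1)^-1).
Let p1 : 0 < p - 1.
Proof. by rewrite subr_gt0; apply: lt_le_trans p2; rewrite ltr1n. Qed.
Let q0 : 0 < q. Proof. by rewrite invr_gt0. Qed.
Let C0 : 0 <= C. Proof. exact: le_trans (j0 0) (jC 0). Qed.

(** Neither [j] nor the power [1 / (p - 1)] need be Lipschitz, so contraction is not at hand. Since
    [profile] is monotone in [h] and [j] is nondecreasing, the iterates starting from the constant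
    [a] increase, and the bound [C] on [j] keeps them finite. *)
Fixpoint picard a k : R -> R :=
  if k is k'.+1 then profile p N a (fun r => j (picard a k' r)) else fun=> a.

Lemma picard_cont a k r : {for r, continuous (picard a k)}.
Proof.
elim: k r => [|k IH] r; first exact: cont_cst.
apply: (@profile_cont _ p N p2 (r + 1)); last by rewrite ltrDl.
  by move=> t _; apply: cont_comp; [exact: cj|exact: IH].
by move=> t _; exact: j0.
Qed.

Let cjp a k s r : r < s -> {for r, continuous (fun r => j (picard a k r))}.
Proof. by move=> _; apply: cont_comp; [exact: cj|exact: picard_cont]. Qed.

Lemma picard_axis a k r : r <= 0 -> picard a k r = a.
Proof. by case: k => [//|k] r0; rewrite /= profile_axis. Qed.

Lemma picard_nondecr a k : {homo picard a k : r t / r <= t}.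
Proof.
case: k => [//|k] r t rt; apply: (@profile_nondecr _ p N p2 (t + 1)) => //; first exact: cjp.
by rewrite ltrDl.
Qed.

Lemma le_profile a h r : a <= profile p N a h r.
Proof. by rewrite lerDl; apply: prim_ge0 => t _ _; exact: powR_ge0. Qed.

Lemma picard_mono a k r : picard a k r <= picard a k.+1 r.
Proof.
elim: k r => [|k IH] r; first exact: le_profile.
apply: (@profile_le _ p N p2 a a _ _ r (r + 1) (@cjp a k _) (@cjp a k.+1 _) (fun _ _ => j0 _) (fun _ _ => j0 _)) => //.
  by rewrite ltrDl.
by move=> t _ _; apply: jj; exact: IH.
Qed.

Lemma picard_lip a k r t b : 0 <= r -> r <= t -> t <= b ->
  picard a k t - picard a k r <= (C * b) `^ q * (t - r).
Proof.
move=> r0 rt tb; case: k => [|k].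
  by rewrite subrr mulr_ge0 ?powR_ge0// subr_ge0.
set L := (C * b) `^ q.
have := @derive_ge0_le _ (fun u => L * u - picard a k.+1 u)
  (fun u => L - flux N (fun r => j (picard a k r)) u `^ q) r t.
have b0 : 0 <= b by exact: le_trans (le_trans r0 rt) tb.
have H : forall u, r < u -> u < t -> is_derive u 1 (fun u => L * u - picard a k.+1 u)
    (L - flux N (fun r => j (picard a k r)) u `^ q) /\ 0 <= L - flux N (fun r => j (picard a k r)) u `^ q.
  move=> u ru ut; have u0 : 0 < u by exact: le_lt_trans ru.
  have u1 : u < u + 1 by rewrite ltrDl.
  split.
    have d1 : is_derive u 1 (fun u : R => L * u) L.
      by apply: (is_derive_eq (isdZ L (isd_id u 1))); rewrite mulr1.
    apply: (isdB d1); rewrite [X in is_derive _ _ X]/=.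
    by apply: (@is_derive_profile _ p N p2 (u + 1)) => //; exact: cjp.
  rewrite subr_ge0; apply: ge0_ler_powR; rewrite ?nnegrE; [exact: ltW| |exact: mulr_ge0|].
    by apply: (flux_nneg N (@cjp a k (u + 1)) (fun r _ => j0 _)).
  apply: (@le_trans _ _ (C * u / N.+1%:R)).
    by apply: (@flux_bound _ N _ _ _ _ (@cjp a k (u + 1)) (ltW u0) u1) => v _ _; exact: jC.
  rewrite ler_pdivrMr ?ltr0n//; apply: (@le_trans _ _ (C * b)).
    by rewrite ler_wpM2l//; apply: ltW; exact: lt_le_trans tb.
  by rewrite ler_peMr ?mulr_ge0// ler1n.
move=> /(_ H) H1.
have : L * r - picard a k.+1 r <= L * t - picard a k.+1 t.
  apply: H1 => // u ru ut; apply: contB; last exact: picard_cont.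
  by apply: contM; [exact: cont_cst|exact: cvg_id].
by move=> H2; rewrite mulrBr; lra.
Qed.

Lemma picard_bound a k r : 0 <= r -> picard a k r <= a + (C * r) `^ q * r.
Proof.
move=> r0; have := picard_lip a k (lexx 0) r0 (lexx r).
by rewrite (picard_axis a k (lexx 0)) subr0 => H; rewrite -lerBlDl.
Qed.

Definition psol a r := limn (fun k => picard a k r).

Lemma picard_cvg a r : picard a k r @[k --> \oo] --> psol a r.
Proof.
apply: nondecreasing_is_cvgn.
  by apply/nondecreasing_seqP => k; exact: picard_mono.
have [r0|r0] := leP r 0.
  by exists a => _ [k _ <-]; rewrite picard_axis.
by exists (a + (C * r) `^ q * r) => _ [k _ <-]; apply: picard_bound; exact: ltW.
Qed.

Lemma psol_axis a r : r <= 0 -> psol a r = a.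
Proof.
move=> r0; apply: (cvg_unique _ (@picard_cvg a r)); first exact: Rhausdorff.
by rewrite (_ : (fun k => _) = fun=> a); [exact: cvg_cst|apply/funext => k; exact: picard_axis].
Qed.

Lemma psol_nondecr a : {homo psol a : r t / r <= t}.
Proof.
move=> r t rt; apply: (ler_cvg_to (@picard_cvg a r) (@picard_cvg a t)).
by apply: nearW => k; exact: picard_nondecr.
Qed.

Lemma psol_lip a r t b : 0 <= r -> r <= t -> t <= b -> psol a t - psol a r <= (C * b) `^ q * (t - r).
Proof.
move=> r0 rt tb; have H : (picard a k t - picard a k r) @[k --> \oo] --> psol a t - psol a r.
  by apply: cvgB; exact: picard_cvg.
apply: (ler_cvg_to H (cvg_cst _)); apply: nearW => k; exact: picard_lip.
Qed.

Lemma psol_cont a r : {for r, continuous (psol a)}.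
Proof.
apply: cont_dist => e e0; pose b := `|r| + 1; pose L := (C * b) `^ q + 1.
have L0 : 0 < L by rewrite ltr_wpDl ?powR_ge0.
have H u v : u <= v -> v <= b -> `|psol a v - psol a u| <= L * (v - u).
  move=> uv vb; rewrite ger0_norm ?subr_ge0; last exact: psol_nondecr.
  have up w : w <= b -> psol a w = psol a (Num.max w 0).
    by move=> _; have [w0|w0] := leP w 0; rewrite // !psol_axis.
  have b0 : 0 <= b by rewrite addr_ge0.
  rewrite (up v)// (up u); last exact: le_trans vb.
  apply: (@le_trans _ _ ((C * b) `^ q * (Num.max v 0 - Num.max u 0))).
    apply: psol_lip; [by rewrite le_max lexx orbT| |by rewrite ge_max vb b0].
    by case: (leP u 0); case: (leP v 0) => ? ?; lra.
  have h1 : 0 <= (C * b) `^ q by exact: powR_ge0.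
  have h2 : Num.max v 0 - Num.max u 0 <= v - u.
    by case: (leP v 0); case: (leP u 0) => ? ?; lra.
  have h3 : 0 <= v - u by rewrite subr_ge0.
  by rewrite /L; nra.
apply/nbhs_ballP; exists (Num.min 1 (e / L)) => /=; first by rewrite lt_min ltr01 divr_gt0.
move=> t; rewrite /ball /= lt_min => /andP[t1 te].
have rb : r <= b by rewrite /b; apply: le_trans (ler_norm r) _; rewrite lerDl.
have tb : t <= b.
  by have := ler_norm (t - r); have := ler_norm r; rewrite distrC in t1; rewrite /b; lra.
have [rt|/ltW rt] := leP r t.
  rewrite distrC; apply: (le_lt_trans (H _ _ rt tb)).
  by rewrite mulrC -ltr_pdivlMr// -[t - r]ger0_norm ?subr_ge0// distrC.
apply: (le_lt_trans (H _ _ rt rb)).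
by rewrite mulrC -ltr_pdivlMr// -[r - t]ger0_norm ?subr_ge0.
Qed.

Lemma psol_rhs_cont a s r : r < s -> {for r, continuous (fun r => j (psol a r))}.
Proof. by move=> _; apply: cont_comp; [exact: cj|exact: psol_cont]. Qed.

Lemma psol_eq a r : psol a r = profile p N a (fun r => j (psol a r)) r.
Proof.
have [r0|r0] := leP r 0; first by rewrite psol_axis// profile_axis.
have H : picard a k.+1 r @[k --> \oo] --> psol a r by rewrite (cvg_shiftS (fun k => picard a k r)); exact: (@picard_cvg a r).
apply: (cvg_unique _ H); first exact: Rhausdorff.
apply: (@profile_lim _ p N p2 a (fun k r => j (picard a k r)) _ r (r + 1) C) => //.
- by move=> k; exact: cjp.
- exact: psol_rhs_cont.
- exact: ltW.
- by rewrite ltrDl.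
- by move=> t t0 tr; exact: (cvg_comp _ _ (@picard_cvg a t) (@cj (psol a t))).
Qed.

(** Every iterate stays below a supersolution, by induction. As solutions with the same centre value
    may be several, minimality is the handle on [psol]. *)
Lemma psol_min a g K b s : (forall r, r < s -> {for r, continuous g}) -> (forall r, r < s -> 0 <= g r) ->
  b < s -> (forall r, 0 <= r -> r <= b -> profile p N a g r <= K r) ->
  (forall r, 0 <= r -> r <= b -> j (K r) <= g r) ->
  forall r, 0 <= r -> r <= b -> psol a r <= K r.
Proof.
move=> cg g0 bs gK jK r r0 rb.
suff H k t : 0 <= t -> t <= b -> picard a k t <= K t.
  by apply: (ler_cvg_to (@picard_cvg a r) (cvg_cst _)); apply: nearW => k; exact: H.
elim: k t => [|k IH] t t0 tb; first exact: le_trans (le_profile a g t) (gK t t0 tb).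
apply: le_trans (gK t t0 tb).
apply: (@profile_le _ p N p2 _ _ _ _ _ s) => //; [exact: cjp|exact: le_lt_trans bs|].
move=> u u0 ut; have ub : u <= b by exact: le_trans tb.
by apply: le_trans (jK u u0 ub); apply: jj; exact: IH.
Qed.


Let rhs a : R -> R := fun r => j (psol a r).
Let rhs0 a r : 0 <= rhs a r. Proof. exact: j0. Qed.

Lemma is_derive_psol a r : 0 < r -> is_derive r 1 (psol a) (flux N (rhs a) r `^ q).
Proof.
move=> r0; rewrite [X in is_derive _ _ X](_ : psol a = profile p N a (rhs a)); last first.
  by apply/funext => t; exact: psol_eq.
apply: (@is_derive_profile _ p N p2 (r + 1)) => //; last by rewrite ltrDl.
exact: psol_rhs_cont.
Qed.

(* [r |-> psol a (lam r)] solves the equation with [lam^p j] instead of [j]. *)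
Lemma profile_dilation a b lam r : 0 < lam -> 0 <= r ->
  profile p N b (fun t => lam `^ p * rhs a (lam * t)) r = b + (psol a (lam * r) - a).
Proof.
move=> lam0 r0; set g := fun t => _.
have cl t : {for t, continuous (fun t : R => lam * t)}.
  by apply: contM; [exact: cont_cst|exact: cvg_id].
have cg s t : t < s -> {for t, continuous g}.
  move=> _; apply: contM; first exact: cont_cst.
  by apply: (@cont_comp _ _ (rhs a)); [exact: (@psol_rhs_cont a (lam * t + 1) (lam * t) (ltr_pwDr ltr01 (lexx _)))|exact: cl].
have lamp : lam `^ p = lam * lam `^ (p - 1).
  by rewrite mulr_powRB1// ?ltW//; apply: lt_le_trans p2; rewrite ltr0n.
have dl t : is_derive t 1 (fun t : R => lam * t) lam.
  by apply: (is_derive_eq (isdZ lam (isd_id t 1))); rewrite mulr1.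
have lr s t : t < s -> {for t, continuous (rhs a)} by move=> _; exact: (@psol_rhs_cont a (t + 1) t (ltr_pwDr ltr01 (lexx _))).
have fl t : 0 <= t -> t < r + 1 -> flux N g t = lam `^ (p - 1) * flux N (rhs a) (lam * t).
  move=> t0 t1; apply/esym.
  apply: (@flux_unique _ N (r + 1) g (fun t => lam `^ (p - 1) * flux N (rhs a) (lam * t))) => //.
  - exact: cg.
  - move=> u _; apply: contM; first exact: cont_cst.
    apply: (@cont_comp _ _ (flux N (rhs a))); last exact: cl.
    by apply: (@flux_cont _ N (lam * u + 1)); [exact: lr|rewrite ltrDl].
  - by rewrite mulr0 flux_axis// mulr0.
  - move=> u u0 _; have lu : 0 < lam * u by exact: mulr_gt0.
    have lu1 : lam * u < lam * u + 1 by rewrite ltrDl.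
    have d1 := @isd_comp R _ (flux N (rhs a)) (fun t : R => lam * t) u 1 _ _
      (is_derive_flux N (@lr (lam * u + 1)) lu lu1) (dl u).
    apply: (is_derive_eq (isdZ (lam `^ (p - 1)) d1)).
    by rewrite /g lamp; field; rewrite !gt_eqF.
rewrite /profile; congr (_ + _).
rewrite (_ : psol a (lam * r) - a = psol a (lam * r) - psol a (lam * 0)); last first.
  by rewrite mulr0 (psol_axis a (lexx 0)).
apply: (@prim_eq _ (r + 1) (fun t => psol a (lam * t))) => //.
- apply: flux_pow_cont => //; first exact: cg.
  by move=> t _; apply: mulr_ge0; [exact: powR_ge0|exact: rhs0].
- by move=> t _; apply: (@cont_comp _ _ (psol a)); [exact: psol_cont|exact: cl].
- move=> t t0 t1; have lt0 : 0 < lam * t by exact: mulr_gt0.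
  apply: (is_derive_eq (@isd_comp R _ (psol a) (fun t : R => lam * t) t 1 _ _ (is_derive_psol a lt0) (dl t))).
  rewrite fl ?ltW// powRM ?powR_ge0//; last first.
    apply: (@flux_nneg _ N (lam * t + 1)) => //; [exact: lr|by rewrite ltrDl].
  by rewrite -powRrM divff ?gt_eqF// powRr1 ?ltW// mulrC.
- by rewrite ltrDl.
Qed.

Variable kappa : R.
Hypotheses (kappa0 : 0 < kappa) (jkappa : forall v, kappa <= j v).
Hypothesis uj : forall e : R, 0 < e -> exists2 d : R, 0 < d & forall v w : R, `|v - w| < d -> `|j v - j w| < e.

(** For want of uniqueness [psol] may jump as [a] varies. The function [psol a (lam r) + e] is a
    supersolution with centre value [a + e]: since [j >= kappa > 0], the factor [lam > 1] gained on
    [j] absorbs the change of [j] under a shift by [e]. Minimality then bounds the jump by 1,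
    uniformly in [a]. *)
Lemma psol_shift b : 0 < b -> exists2 e : R, 0 < e & forall a, psol (a + e) b < psol a b + 1.
Proof.
move=> b0; pose L := (C * (2 * b)) `^ q + 1.
have L0 : 0 < L by rewrite ltr_wpDl ?powR_ge0.
(* [L] bounds the slope on [[0, 2 b]], so replacing [b] by [lam b] costs at most [L eps b <= 1 / 2];
   with [e <= 1 / 4] the total stays below 1. *)
pose eps := Num.min 1 (1 / (2 * L * b)).
have eps0 : 0 < eps by rewrite lt_min ltr01 divr_gt0// !mulr_gt0.
have eps1 : eps <= 1 by rewrite ge_min lexx.
have [d d0 Hd] := uj (mulr_gt0 eps0 kappa0).
pose e := Num.min (d / 2) 4^-1.
have e0 : 0 < e by rewrite lt_min divr_gt0//= invr_gt0.
have ed : e < d by rewrite gt_min; apply/orP; left; rewrite ltr_pdivrMr// ltr_pMr// ltr1n.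
have e4 : e <= 4^-1 by rewrite ge_min lexx orbT.
exists e => // a; pose lam := 1 + eps; have lam0 : 0 < lam by rewrite ltr_wpDr// ltW.
have lam1 : 1 <= lam by rewrite lerDl ltW.
have b1 : b < b + 1 by rewrite ltrDl.
pose K r := (a + e) + (psol a (lam * r) - a).
have lamp : lam <= lam `^ p by apply: le1r_powR => //; apply: le_trans p2; rewrite ler1n.
have := @psol_min (a + e) (fun t => lam `^ p * rhs a (lam * t)) K b (b + 1).
move=> /(_ _ _ b1) H.
have H1 : psol (a + e) b <= K b.
  apply: (H _ _ _ _ b (ltW b0) (lexx b)).
  - move=> t _; apply: contM; first exact: cont_cst.
    apply: (@cont_comp _ _ (rhs a)); first exact: (@psol_rhs_cont a (lam * t + 1) (lam * t) (ltr_pwDr ltr01 (lexx _))).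
    by apply: contM; [exact: cont_cst|exact: cvg_id].
  - by move=> t _; apply: mulr_ge0; [exact: powR_ge0|exact: rhs0].
  - by move=> t t0 _; rewrite profile_dilation.
  - move=> t _ _; rewrite /K /rhs; set v := psol a _.
    have vd : `|a + e + (v - a) - v| < d by rewrite (_ : _ - v = e) ?gtr0_norm//; ring.
    have := Hd _ _ vd; rewrite ltr_norml => /andP[_ h1].
    apply: (@le_trans _ _ (lam * j v)); last by rewrite ler_wpM2r.
    have := jkappa v; rewrite /lam; nra.
apply: (le_lt_trans H1); rewrite /K.
have lamb : b <= lam * b by rewrite ler_peMl// ltW.
have lamb2 : lam * b <= 2 * b by rewrite ler_pM2r// /lam; lra.
have lip := psol_lip a (ltW b0) lamb lamb2.
have eL : L * (eps * b) <= 1 / 2.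
  rewrite mulrA -ler_pdivlMr// mulrC -ler_pdivlMr// ge_min; apply/orP; right.
  by rewrite le_eqVlt; apply/orP; left; apply/eqP; field; rewrite !gt_eqF.
have lamE : lam * b - b = eps * b by rewrite /lam; ring.
rewrite lamE in lip.
have c1 : 0 <= eps * b by rewrite mulr_ge0// ltW.
have c2 : (C * (2 * b)) `^ q * (eps * b) <= L * (eps * b) by apply: ler_wpM2r => //; rewrite /L lerDl.
by lra.
Qed.

(** Discrete shooting: advance [a] by steps of [e] from a value whose solution is still at most [B]
    at [b], and stop just before exceeding [B]; the next step gains less than 1. An exact hit cannot
    be expected where [psol] jumps. *)
Lemma psol_shoot b B : 0 < b -> exists a, B - 1 < psol a b /\ psol a b <= B.
Proof.
move=> b0; have [e e0 He] := psol_shift b0.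
pose a0 := B - (C * b) `^ q * b.
pose big (k : nat) := B < psol (a0 + e *+ k) b.
have base : psol a0 b <= B.
  have := psol_lip a0 (lexx 0) (ltW b0) (lexx b); rewrite (psol_axis a0 (lexx 0)) subr0 /a0.
  by move=> H; rewrite -lerBrDr in H; lra.
have ex : exists k, big k.
  have [k Hk] : exists k : nat, B - a0 < e *+ k.
    have B0 : 0 <= (B - a0) / e.
      apply: divr_ge0; last exact: ltW.
      by rewrite /a0 opprB addrC subrK mulr_ge0 ?powR_ge0// ltW.
    exists (Num.bound ((B - a0) / e)).
    by have := archi_boundP B0; rewrite ltr_pdivrMr// mulr_natl.
  exists k; rewrite /big; apply: (@lt_le_trans _ _ (a0 + e *+ k)); first by rewrite -ltrBlDl.
  by rewrite psol_eq; exact: le_profile.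
have := ex_minnP ex => -[k bk kmin].
case: k bk kmin => [|k] bk kmin.
  by move: bk; rewrite /big mulr0n addr0 ltNge base.
exists (a0 + e *+ k); split.
  have := He (a0 + e *+ k); move: bk; rewrite /big mulrS [e + _]addrC addrA => h1 h2.
  by rewrite ltrBlDr; exact: lt_trans h2.
by rewrite leNgt; apply/negP => /kmin; rewrite ltnn.
Qed.

End picard.

(** * The Keller-Osserman bound *)

Section keller_osserman.
Context {R : realType} (p : R) (f : R -> R).
Implicit Types (x y r s a : R).
Hypothesis p2 : (2 : R) <= p.
Hypothesis hf : condition_F p f.
Local Notation leb := (@lebesgue_measure R).
Let pp : 0 < p. Proof. by apply: lt_le_trans p2; rewrite ltr0n. Qed.
Let p1 : 0 < p - 1.
Proof. by rewrite subr_gt0; apply: lt_le_trans p2; rewrite ltr1n. Qed.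
Local Notation q := ((p - 1)^-1).
Let q0 : 0 < q. Proof. by rewrite invr_gt0. Qed.

(** The values of [f] on negative numbers are arbitrary. Freezing them at [f 0 = 0] gives a
    continuous nondecreasing function on the line, into which comparison functions of any sign can
    be inserted. *)
Definition fbar x := f (Num.max x 0).

Lemma fbarE x : 0 <= x -> fbar x = f x. Proof. by move=> x0; rewrite /fbar max_l. Qed.

Lemma fbar_le0 x : x <= 0 -> fbar x = 0.
Proof. by have [_ _ _ f0 _] := hf; move=> x0; rewrite /fbar max_r. Qed.

Lemma fbar_nondecr : {homo fbar : x y / x <= y}.
Proof.
have [_ fm _ _ _] := hf; move=> x y xy; apply: fm; rewrite ?in_itv /= ?andbT ?le_max ?lexx ?orbT//.
by case: (leP x 0); case: (leP y 0) => ? ?; lra.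
Qed.

Lemma fbar_ge0 x : 0 <= fbar x.
Proof. by rewrite -(@fbar_le0 (Num.min x 0)) ?fbar_nondecr// ge_min ?lexx ?orbT. Qed.

Lemma fbar_gt0 x : 0 < x -> 0 < fbar x.
Proof. by have [_ _ fp _ _] := hf; move=> x0; rewrite fbarE ?ltW// fp. Qed.

Lemma fbar_cont x : {for x, continuous fbar}.
Proof.
have [cf _ _ _ _] := hf; apply: cont_dist => e e0.
have y0 : 0 <= Num.max x 0 by rewrite le_max lexx orbT.
have yI : `[0, +oo[%classic (Num.max x 0) by rewrite /= in_itv /= andbT.
have /subspace_continuousP /(_ _ yI) /cvgrPdist_lt /(_ e e0) := cf.
rewrite near_withinE => /nbhs_ballP[d /= d0 Hd].
apply/nbhs_ballP; exists d => //= z xz; apply: Hd => /=; last by rewrite in_itv /= andbT le_max lexx orbT.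
apply: le_lt_trans xz.
have h1 := ler_norm (x - z); have h2 := ler_norm (z - x); rewrite distrC in h2.
by rewrite ler_norml; case: (leP x 0) => ?; case: (leP z 0) => ?; apply/andP; split; lra.
Qed.

Definition Fprim x := prim fbar x.

Lemma Fprim_cont x : {for x, continuous Fprim}.
Proof. by apply: (@prim_cont _ (x + 1)); [move=> *; exact: fbar_cont|rewrite ltrDl]. Qed.

Lemma is_derive_Fprim x : 0 < x -> is_derive x 1 Fprim (fbar x).
Proof. by move=> x0; apply: (@is_derive_prim _ (x + 1)) => //; [move=> *; exact: fbar_cont|rewrite ltrDl]. Qed.

Lemma Fprim_nondecr : {homo Fprim : x y / x <= y}.
Proof.
move=> x y xy; have [y0|y0] := leP y 0; first by rewrite /Fprim !prim0// (le_trans xy).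
have [x0|x0] := leP x 0.
  by rewrite {1}/Fprim prim0// prim_ge0// => t _ _; exact: fbar_ge0.
apply: (@derive_ge0_le _ _ fbar) => // t xt ty; last exact: Fprim_cont.
by split; [apply: is_derive_Fprim; exact: lt_trans xt|exact: fbar_ge0].
Qed.

Lemma Fprim_ub x : 0 <= x -> Fprim x <= x * fbar x.
Proof.
move=> x0; rewrite mulrC; apply: (@prim_bound _ (x + 1)) => //; first by move=> *; exact: fbar_cont.
  by rewrite ltrDl.
by move=> t _; exact: fbar_nondecr.
Qed.

(** Beyond [x] the slope of [F] is at least [f(x)], so [F (2 x) - F x >= x f(x) >= F x]. *)
Lemma Fprim_double x : 0 < x -> 2 * Fprim x <= Fprim (2 * x).
Proof.
move=> x0; have x2 : x <= 2 * x by lra.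
have H : Fprim x - fbar x * x <= Fprim (2 * x) - fbar x * (2 * x).
  apply: (@derive_ge0_le _ (fun t => Fprim t - fbar x * t) (fun t => fbar t - fbar x)) => //.
    move=> t xt _; split; last by rewrite subr_ge0 fbar_nondecr// ltW.
    apply: isdB; first by apply: is_derive_Fprim; exact: lt_trans xt.
    by apply: (is_derive_eq (isdZ (fbar x) (isd_id t 1))); rewrite mulr1.
  move=> t _ _; apply: contB; first exact: Fprim_cont.
  by apply: contM; [exact: cont_cst|exact: cvg_id].
by have := Fprim_ub (ltW x0); lra.
Qed.

Lemma Fprim_gt0 x : 0 < x -> 0 < Fprim x.
Proof.
move=> x0; have h0 : 0 < x / 2 by rewrite divr_gt0.
have H : Fprim (x / 2) - fbar (x / 2) * (x / 2) <= Fprim x - fbar (x / 2) * x.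
  apply: (@derive_ge0_le _ (fun t => Fprim t - fbar (x / 2) * t) (fun t => fbar t - fbar (x / 2))).
  - move=> t xt _; split; last by rewrite subr_ge0 fbar_nondecr// ltW.
    apply: isdB; first by apply: is_derive_Fprim; exact: lt_trans xt.
    by apply: (is_derive_eq (isdZ (fbar (x / 2)) (isd_id t 1))); rewrite mulr1.
  - move=> t _ _; apply: contB; first exact: Fprim_cont.
    by apply: contM; [exact: cont_cst|exact: cvg_id].
  - lra.
have F0 : 0 <= Fprim (x / 2) by apply: prim_ge0 => t _ _; exact: fbar_ge0.
have := mulr_gt0 (fbar_gt0 h0) h0; lra.
Qed.

(** The Keller-Osserman integrand, frozen below 1 so as to be continuous and bounded there; its
    primitive [Phi] is then bounded thanks to condition (F) at [r = 1]. *)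
Definition kofun x := (Fprim (Num.max x 1) `^ p^-1)^-1.

Lemma kofun_gt0 x : 0 < kofun x.
Proof. by rewrite invr_gt0 powR_gt0// Fprim_gt0// lt_max ltr01 orbT. Qed.

Lemma kofun_cont x : {for x, continuous kofun}.
Proof.
apply: contV; first by rewrite -invr_eq0 gt_eqF// kofun_gt0.
apply: powR_continuous_comp; first by rewrite invr_ge0 ltW.
  by apply: filterE => y; apply: ltW; rewrite Fprim_gt0// lt_max ltr01 orbT.
apply: (@cont_comp _ _ Fprim (fun y => Num.max y 1)); first exact: Fprim_cont.
by apply: continuous_max; [exact: cvg_id|exact: cont_cst].
Qed.

Lemma kofun_nonincr x y : x <= y -> kofun y <= kofun x.
Proof.
move=> xy; have g0 z : 0 < Fprim (Num.max z 1) by rewrite Fprim_gt0// lt_max ltr01 orbT.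
have h0 z : 0 < Fprim (Num.max z 1) `^ p^-1 by exact/powR_gt0/g0.
rewrite /kofun lef_pV2; [|exact: h0|exact: h0].
have pV : 0 <= p^-1 by rewrite invr_ge0 ltW.
apply: (ge0_ler_powR pV); rewrite ?nnegrE; [exact: ltW|exact: ltW|].
by apply: Fprim_nondecr; case: (leP x 1); case: (leP y 1) => ? ?; lra.
Qed.

Definition Phi x := prim kofun x.

Lemma is_derive_Phi x : 0 < x -> is_derive x 1 Phi (kofun x).
Proof. by move=> x0; apply: (@is_derive_prim _ (x + 1)) => //; [move=> *; exact: kofun_cont|rewrite ltrDl]. Qed.

Lemma Phi_cont x : {for x, continuous Phi}.
Proof. by apply: (@prim_cont _ (x + 1)); [move=> *; exact: kofun_cont|rewrite ltrDl]. Qed.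

Lemma Phi_bounded : exists M, forall x, Phi x <= M.
Proof.
have [_ _ _ _ /(_ 1 ltr01)] := hf; rewrite /Psi => fin.
set J := (\int[leb]_(s in _) _)%E in fin.
have J0 : (0 <= J)%E by apply: integral_ge0 => x _; rewrite lee_fin invr_ge0 powR_ge0.
have c0 : 0 < (1 - p^-1) `^ p^-1 by rewrite powR_gt0// subr_gt0 invf_lt1// -subr_gt0.
have Jfin : (J < +oo)%E.
  by rewrite ltey; apply/eqP => JE; move: fin; rewrite JE gt0_muley ?lte_fin// ltxx.
exists (kofun 0 + fine J) => x.
have [x1|/ltW x1] := leP x 0.
  by rewrite /Phi prim0// addr_ge0 ?fine_ge0// ltW// kofun_gt0.
have mk : measurable_fun [set: R] (EFin \o kofun).
  by apply/measurable_EFinP; apply: continuous_measurable_fun => y; exact: kofun_cont.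
have k0 y : (0 <= (kofun y)%:E)%E by rewrite lee_fin ltW// kofun_gt0.
have I1 : (\int[leb]_(s in `[0%R, 1%R]) (kofun s)%:E <= (kofun 0)%:E)%E.
  rewrite (@eq_integral _ _ _ leb _ (cst (kofun 0)%:E)); last first.
    move=> s; rewrite inE /= in_itv /= => /andP[_ s1].
    by rewrite /kofun (max_r s1) (max_r ler01).
  by rewrite integral_cst//= lebesgue_measure_itv /= lte_fin ltr01 oppr0 adde0 mule1.
have I2 : (\int[leb]_(s in `]1%R, +oo[) (kofun s)%:E)%E = J.
  apply: eq_integral => s; rewrite inE /= in_itv /= andbT => s1.
  have s0 : 0 < s by exact: lt_trans s1.
  rewrite /kofun (max_l (ltW s1)) /Fprim /prim /primitive; congr ((_ `^ _)^-1)%:E.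
  by apply: eq_Rintegral => t; rewrite inE /= in_itv /= => /andP[t0 _]; rewrite fbarE.
have iK : leb.-integrable `[0, x] (EFin \o kofun).
  by apply: cont_integrable => t _ _; exact: kofun_cont.
rewrite -lee_fin /Phi /prim /Rintegral fineK; last by apply: integrable_fin_num.
rewrite EFinD fineK; last by rewrite ge0_fin_numE.
apply: (@le_trans _ _ (\int[leb]_(s in `[0%R, 1%R] `|` `]1%R, +oo[) (kofun s)%:E)%E).
  have sub : `[0, x]%classic `<=` `[0, 1]%classic `|` `]1, +oo[%classic.
    move=> s /=; rewrite !in_itv /= andbT => /andP[s0 _].
    by rewrite s0 /=; have [s1|s1] := leP s 1; [left|right].
  have mU : measurable (`[0, 1]%classic `|` `]1, +oo[%classic : set R).
    by apply: measurableU; exact: measurable_itv.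
  exact: (ge0_subset_integral leb (measurable_itv _) mU (measurable_funTS mk) (fun x _ => k0 x) sub).
have disj : [disjoint `[0, 1]%classic & `]1, +oo[%classic : set R].
  by apply/disj_setPS => s /= []; rewrite !in_itv /= andbT => /andP[_ s1]; rewrite ltNge s1.
rewrite (ge0_integral_setU leb (measurable_itv _) (measurable_itv _) (measurable_funTS mk) (fun x _ => k0 x) disj).
by rewrite I2; apply: leeD2r.
Qed.

Lemma Phi_nondecr : {homo Phi : x y / x <= y}.
Proof.
move=> x y xy; have [y0|y0] := leP y 0; first by rewrite /Phi !prim0// (le_trans xy).
have [x0|x0] := leP x 0.
  by rewrite {1}/Phi prim0// prim_ge0// => t _ _; rewrite ltW// kofun_gt0.
apply: (@derive_ge0_le _ _ kofun) => // t xt ty; last exact: Phi_cont.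
by split; [apply: is_derive_Phi; exact: lt_trans xt|rewrite ltW// kofun_gt0].
Qed.

Lemma Phi_tail (e : R) : 0 < e -> exists2 A : R, 1 <= A & forall x y, A <= x -> Phi y - Phi x < e.
Proof.
move=> e0; have [M HM] := Phi_bounded.
have hs : has_sup (range Phi) by split; [exists (Phi 0), 0|exists M => _ [x _ <-]].
have [_ [A0 _ <-] HA] := sup_adherent e0 hs.
exists (Num.max A0 1); first by rewrite le_max lexx orbT.
move=> x y; rewrite ge_max => /andP[Ax _].
have h1 : Phi y <= sup (range Phi) by apply: ub_le_sup; [have [] := hs|exists y].
have := Phi_nondecr Ax; lra.
Qed.

(** [kofun] is nonincreasing, so [(x / 2) kofun x <= Phi x - Phi (x / 2)], which is small for large
    [x]; hence [F x / x^p] is large, and [F x <= x f(x)]. *)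
Lemma superlinear (K : R) : exists2 A : R, 1 <= A & forall x, A <= x -> K * x `^ (p - 1) <= fbar x.
Proof.
pose L := `|K| + 1; have L0 : 0 < L by rewrite ltr_wpDl.
have e0 : 0 < 2^-1 * L `^ (- p^-1) by rewrite mulr_gt0 ?powR_gt0 ?invr_gt0.
have [A A1 HA] := Phi_tail e0.
exists (2 * A); first lra.
move=> x Ax; have x0 : 0 < x by lra.
have F0 := Fprim_gt0 x0.
have x1 : 1 <= x by lra.
have H : Phi (x / 2) - kofun x * (x / 2) <= Phi x - kofun x * x.
  apply: (@derive_ge0_le _ (fun t => Phi t - kofun x * t) (fun t => kofun t - kofun x)).
  - move=> t xt tx; split; last by rewrite subr_ge0 kofun_nonincr// ltW.
    apply: isdB; first by apply: is_derive_Phi; apply: lt_trans xt; rewrite divr_gt0.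
    by apply: (is_derive_eq (isdZ (kofun x) (isd_id t 1))); rewrite mulr1.
  - move=> t _ _; apply: contB; first exact: Phi_cont.
    by apply: contM; [exact: cont_cst|exact: cvg_id].
  - lra.
have h1 : kofun x * (x / 2) < 2^-1 * L `^ (- p^-1).
  have Ax2 : A <= x / 2 by lra.
  by have := HA (x / 2) x Ax2; lra.
have h2 : x < L `^ (- p^-1) * Fprim x `^ p^-1.
  move: h1; rewrite /kofun (max_l x1) mulrA mulrC ltr_pM2l ?invr_gt0// mulrC ltr_pdivrMr//.
  exact: powR_gt0.
have h3 : x `^ p < L^-1 * Fprim x.
  have := gt0_ltr_powR pp (ltW x0) _ h2; rewrite !nnegrE mulr_ge0 ?powR_ge0// => /(_ isT).
  by rewrite powRM ?powR_ge0// -!powRrM mulNr !mulVf ?gt_eqF// powRr1 ?ltW// powR_inv1 ?ltW.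
have h4 := Fprim_ub (ltW x0).
have h5 : x * x `^ (p - 1) = x `^ p by rewrite mulr_powRB1// ltW.
have h6 : L * x `^ p <= x * fbar x.
  by rewrite ltr_pdivlMl// in h3; apply: le_trans h4; exact: ltW.
have h7 : L * x `^ (p - 1) <= fbar x.
  by rewrite -(ler_pM2l x0) mulrCA h5.
apply: le_trans h7; rewrite ler_wpM2r ?powR_ge0//.
by rewrite /L; have := ler_norm K; lra.
Qed.


(** As [Y / r <= h / (N + 1)], the slope of the flux is at least [h - N h / (N + 1) = h / (N + 1)],
    which is at least [h 0 / (N + 1)]. *)
Lemma radial_flux_lower N s h Y G r : radial_ode p N.+1 s h Y G ->
  (forall r t, 0 <= r -> r <= t -> t < s -> h r <= h t) -> 0 <= r -> r < s ->
  h 0 * r / N.+1%:R <= Y r.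
Proof.
move=> ode hh r0 rs; have Np : (0 : R) < N.+1%:R by rewrite ltr0n.
have H : Y 0 - h 0 / N.+1%:R * 0 <= Y r - h 0 / N.+1%:R * r.
  apply: (@derive_ge0_le _ (fun t => Y t - h 0 / N.+1%:R * t)
     (fun t => h t - N%:R * (Y t / t) - h 0 / N.+1%:R)) => //.
    move=> t t0 tr; have ts : t < s by exact: lt_trans rs.
    split.
      apply: isdB; first exact: (ode_flux ode t0 ts).
      by apply: (is_derive_eq (isdZ _ (isd_id t 1))); rewrite mulr1.
    have /andP[_ b1] := ode_bound ode t0 ts; have h0t := hh 0 t (lexx 0) (ltW t0) ts.
    have N0 : (0 : R) <= N%:R by [].
    have b2 : N%:R * (Y t / t) <= N%:R * (h t / N.+1%:R) by rewrite ler_wpM2l.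
    have e1 : h t = N%:R * (h t / N.+1%:R) + h t / N.+1%:R.
      by rewrite -[N.+1%:R]natr1; field; rewrite natr1 pnatr_eq0.
    have b3 : h 0 / N.+1%:R <= h t / N.+1%:R by rewrite ler_pM2r ?invr_gt0.
    by rewrite subr_ge0; apply: (le_trans b3); rewrite lerBrDr [leRHS]e1 addrC lerD2r.
  move=> t t0 tr; apply: contB; first by apply: (ode_fluxc ode); exact: le_lt_trans rs.
  by apply: contM; [exact: cont_cst|exact: cvg_id].
rewrite (ode_axis ode (lexx 0)) mulr0 subrr in H.
by rewrite mulrAC -subr_ge0.
Qed.

(* Once [G] has doubled, [Y^(p/(p-1)) >= c (F(G) - F(G 0)) >= c F(G) / 2], so that
   [Phi o G] increases at a rate bounded from below. *)
Lemma ko_bound (N : nat) (s : R) : 0 < s -> exists M : R, forall h Y G,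
  radial_ode p N.+1 s h Y G -> (forall r t, 0 <= r -> r <= t -> t < s -> h r <= h t) ->
  (forall r t, 0 <= r -> r <= t -> t < s -> G r <= G t) ->
  (forall r, 0 <= r -> r < s -> fbar (G r) / 2 <= h r) -> G 0 <= M.
Proof.
move=> s0; have Np : (0 : R) < N.+1%:R by rewrite ltr0n.
pose c : R := (2 * N.+1%:R)^-1; have c0 : 0 < c by rewrite invr_gt0 mulr_gt0.
pose c3 := (c / 2) `^ p^-1; have c30 : 0 < c3 by rewrite powR_gt0// divr_gt0.
(* [c3] is the lower bound for the speed of [Phi (G r)] once [G] has doubled; over
   [[s / 2, 3 s / 4]] the gain [c3 s / 4] exceeds what [Phi] has left beyond [A]. *)
have e0 : 0 < c3 * (s / 4) by rewrite mulr_gt0// divr_gt0.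
have [A A1 HA] := Phi_tail e0.
(* Chosen so that, when [a = G 0] exceeds [A'], the slope of [G] is at least [4 a / s] from [s / 4]
   on, and [G] doubles by [s / 2]. *)
pose K := (4 / s) `^ (p - 1) * (8 * N.+1%:R / s).
have [A' A'1 HA'] := superlinear K.
exists (Num.max A A') => h Y G ode hh GG hf2.
rewrite leNgt gt_max; apply/negP => /andP[GA GA'].
set a := G 0 in GA GA'.
have a0 : 0 < a by lra.
have s2 : s / 2 < s by rewrite ltr_pdivrMr// ltr_pMr// ltr1n.
have s20 : 0 < s / 2 by rewrite divr_gt0.
have s40 : 0 < s / 4 by rewrite divr_gt0.
have fK := HA' a (ltW GA').
have h0K : fbar a / 2 <= h 0 by apply: hf2.
have h00 : 0 < h 0 by apply: lt_le_trans h0K; rewrite divr_gt0// fbar_gt0.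
have Ylow r : 0 < r -> r < s -> 0 < Y r.
  move=> r0 rs; apply: lt_le_trans (radial_flux_lower ode hh (ltW r0) rs).
  by rewrite divr_gt0// mulr_gt0.
have cG r : r < s -> {for r, continuous G} by move=> rs; exact: (ode_solc ode rs).
have double : 2 * a <= G (s / 2).
  pose L := (h 0 * (s / 4) / N.+1%:R) `^ q.
  have H : G (s / 4) - L * (s / 4) <= G (s / 2) - L * (s / 2).
    apply: (@derive_ge0_le _ (fun t => G t - L * t) (fun t => Y t `^ q - L)).
    - move=> t t1 t2; have t0 : 0 < t by lra.
      have ts : t < s by lra.
      split.
        apply: isdB; first exact: (ode_sol ode t0 ts).
        by apply: (is_derive_eq (isdZ _ (isd_id t 1))); rewrite mulr1.
      rewrite subr_ge0; apply: ge0_ler_powR; rewrite ?nnegrE; [exact: ltW| |exact/ltW/Ylow|].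
        by rewrite divr_ge0 ?ltW// mulr_gt0.
      apply: le_trans (radial_flux_lower ode hh (ltW t0) ts).
      by rewrite ler_pM2r ?invr_gt0// ler_pM2l// ltW.
    - move=> t t1 t2; apply: contB; first by apply: cG; lra.
      by apply: contM; [exact: cont_cst|exact: cvg_id].
    - lra.
  have La : 4 / s * a <= L.
    have E : 4 / s * a = ((4 / s * a) `^ (p - 1)) `^ q.
      by rewrite -powRrM divff ?gt_eqF// powRr1// mulr_ge0 ?divr_ge0 ?ltW.
    rewrite E; apply: ge0_ler_powR; rewrite ?nnegrE ?powR_ge0//; [exact: ltW|by rewrite divr_ge0 ?ltW// mulr_gt0|].
    have s4 : 0 <= 4 / s by rewrite divr_ge0// ltW.
    rewrite (powRM _ s4 (ltW a0)) ler_pdivlMr//.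
    have := le_trans (ler_wpM2r (ltac:(by rewrite invr_ge0) : (0 : R) <= 2^-1) fK) h0K.
    move=> h1; have h2 := ler_wpM2r (ltW s40) h1.
    apply: le_trans h2; rewrite /K le_eqVlt; apply/orP; left; apply/eqP.
    move: (a `^ (p - 1)) ((4 / s) `^ (p - 1)) N.+1%:R => u v w.
    by field; rewrite gt_eqF.
  have Ga : a <= G (s / 4) by apply: GG; lra.
  have : a <= L * (s / 4).
    by apply: le_trans (ler_wpM2r (ltW s40) La); rewrite le_eqVlt; apply/orP; left; apply/eqP; field; rewrite gt_eqF.
  lra.
have Gpos r : 0 <= r -> r < s -> a <= G r by move=> r0 rs; apply: GG.
have Ypos r : r < s -> 0 <= Y r.
  move=> rs; have [r0|r0] := leP r 0; first by rewrite (ode_axis ode r0).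
  exact/ltW/Ylow.
have qp : 0 < p * q by rewrite mulr_gt0.
(* The equation is multiplied by [G' = Y^(1/(p-1))]: as [Y' >= c f(G)] and [p / (p - 1) >= 1], the
   derivative of [Y^(p/(p-1))] is at least [c f(G) G']. *)
have energy r : 0 < r -> r < s -> c * (Fprim (G r) - Fprim a) <= Y r `^ (p * q).
  move=> r0 rs.
  have H : 0 `^ (p * q) - c * (Fprim (G 0)) <= Y r `^ (p * q) - c * Fprim (G r).
    rewrite -[X in X `^ _ - _ <= _](ode_axis ode (lexx 0)).
    apply: (@derive_ge0_le _ (fun t => Y t `^ (p * q) - c * Fprim (G t))
      (fun t => p * q * Y t `^ (p * q - 1) * (h t - N%:R * (Y t / t)) - c * (fbar (G t) * Y t `^ q))) => //; last exact: ltW.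
      move=> t t0 tr; have ts : t < s by exact: lt_trans rs.
      have Gt : 0 < G t by apply: (lt_le_trans a0); apply: Gpos => //; exact: ltW.
      split.
        apply: isdB.
          exact: (@isd_comp _ _ (fun y => y `^ (p * q)) Y t 1 _ _ (is_derive1_powR _ (Ylow t t0 ts)) (ode_flux ode t0 ts)).
        apply: isdZ; exact: (@isd_comp _ _ Fprim G t 1 _ _ (is_derive_Fprim Gt) (ode_sol ode t0 ts)).
      have -> : p * q - 1 = q by field; rewrite gt_eqF.
      have /andP[_ b1] := ode_bound ode t0 ts.
      have N0 : (0 : R) <= N%:R by [].
      have b2 : N%:R * (Y t / t) <= N%:R * (h t / N.+1%:R) by rewrite ler_wpM2l.
      have e1 : h t = N%:R * (h t / N.+1%:R) + h t / N.+1%:R.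
        by rewrite -[N.+1%:R]natr1; field; rewrite natr1 pnatr_eq0.
      have b3 : c * fbar (G t) <= h t / N.+1%:R.
        rewrite /c invfM mulrC mulrA ler_pM2r ?invr_gt0//; apply: hf2 => //; exact: ltW.
      have b4 : c * fbar (G t) <= h t - N%:R * (Y t / t).
        by apply: (le_trans b3); rewrite lerBrDr [leRHS]e1 addrC lerD2r.
      have pq1 : 1 <= p * q by rewrite ler_pdivlMr// mul1r gerBl.
      have f0 := fbar_ge0 (G t).
      have Yq := powR_ge0 (Y t) q.
      have b5 : 0 <= c * fbar (G t) by rewrite mulr_ge0// ltW.
      rewrite (_ : _ - _ = Y t `^ q * (p * q * (h t - N%:R * (Y t / t)) - c * fbar (G t))); last by ring.
      apply: mulr_ge0 => //; rewrite subr_ge0; apply: (le_trans b4).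
      by rewrite ler_peMl// (le_trans b5).
    move=> t t0 tr; have ts : t < s by exact: le_lt_trans rs.
    apply: contB.
      apply: powR_continuous_comp; [exact: ltW| |exact: (ode_fluxc ode ts)].
      have : nbhs t [set u | u < s] by apply: open_nbhs_nbhs; split; [exact: open_lt|].
      by apply: filterS => u; exact: Ypos.
    apply: contM; first exact: cont_cst.
    by apply: cont_comp; [exact: Fprim_cont|exact: cG].
  by rewrite powR0 ?gt_eqF// in H; rewrite mulrBr -/a in H *; lra.
have rate r : s / 2 <= r -> r < s -> c3 * Fprim (G r) `^ p^-1 <= Y r `^ q.
  move=> r1 rs; have r0 : 0 < r by lra.
  have G2 : 2 * a <= G r by apply: (le_trans double); exact: GG (ltW s20) r1 rs.
  have F1 : Fprim (G r) / 2 <= Fprim (G r) - Fprim a.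
    have := Fprim_nondecr G2; have := Fprim_double a0; lra.
  have F0 : 0 <= Fprim (G r) by apply: ltW; apply: Fprim_gt0; lra.
  have -> : Y r `^ q = (Y r `^ (p * q)) `^ p^-1.
    by rewrite -powRrM mulrAC divff ?gt_eqF// mul1r.
  rewrite /c3 -powRM//; last by rewrite divr_ge0// ltW.
  apply: ge0_ler_powR; rewrite ?nnegrE ?powR_ge0//; first by rewrite invr_ge0 ltW.
    by rewrite mulr_ge0// divr_ge0// ltW.
  apply: le_trans (energy r r0 rs).
  by rewrite -mulrA ler_pM2l// mulrC.
have s34 : 3 * s / 4 < s by lra.
have H : Phi (G (s / 2)) - c3 * (s / 2) <= Phi (G (3 * s / 4)) - c3 * (3 * s / 4).
  apply: (@derive_ge0_le _ (fun t => Phi (G t) - c3 * t) (fun t => kofun (G t) * Y t `^ q - c3)).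
  - move=> t t1 t2; have t0 : 0 < t by lra.
    have ts : t < s by lra.
    have Gt : 1 <= G t by have := Gpos t (ltW t0) ts; lra.
    split.
      apply: isdB; last by apply: (is_derive_eq (isdZ _ (isd_id t 1))); rewrite mulr1.
      apply: (@isd_comp _ _ Phi G t 1 _ _ _ (ode_sol ode t0 ts)); apply: is_derive_Phi; lra.
    rewrite subr_ge0 /kofun (max_l Gt) mulrC ler_pdivlMr; last by apply/powR_gt0/Fprim_gt0; lra.
    by apply: rate => //; exact: ltW.
  - move=> t t1 t2; apply: contB; last by apply: contM; [exact: cont_cst|exact: cvg_id].
    by apply: cont_comp; [exact: Phi_cont|apply: cG; lra].
  - lra.
have GA2 : A <= G (s / 2) by lra.
by have := HA _ (G (3 * s / 4)) GA2; lra.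
Qed.

End keller_osserman.

(** * The minimal large radial solution *)

Lemma point_left {R : realType} (b e : R) : 0 < b -> 0 < e ->
  exists s : R, [/\ s < b, 0 <= s & b - s < e].
Proof.
move=> b0 e0; have [h|h] := leP 0 (b - e / 2); [exists (b - e / 2)|exists 0]; split; lra.
Qed.

Lemma point_right {R : realType} (b e : R) : b < 1 -> 0 < e ->
  exists s : R, [/\ b < s, s < 1 & s < b + e].
Proof.
move=> b1 e0; have [h|h] := leP (b + e / 2) ((1 + b) / 2); [exists (b + e / 2)|exists ((1 + b) / 2)]; split; lra.
Qed.

Lemma lt_half_neg {R : realType} (w : R) : w < 0 -> w < w / 2.
Proof. lra. Qed.

Section large_solution.
Context {R : realType} (p : R) (f : R -> R) (N : nat).
Implicit Types (r s a : R).
Hypothesis p2 : (2 : R) <= p.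
Hypothesis hf : condition_F p f.
Local Notation fbar := (fbar f).

Let clip_lip (B v w : R) : 0 <= B -> `|Num.max (Num.min v B) 0 - Num.max (Num.min w B) 0| <= `|v - w|.
Proof.
move=> B0; have h1 := ler_norm (v - w); have h2 := ler_norm (w - v); rewrite distrC in h2.
rewrite ler_norml; case: (leP v B) => ?; case: (leP w B) => ?;
  case: (leP v 0) => ?; case: (leP w 0) => ?; case: (leP B 0) => ?; apply/andP; split; lra.
Qed.

(** [sigma] and [kappa] cover two uses: [1] and [1 / (k + 1)] for the approximations of the large
    solution from below, [1 / 2] and a positive constant for a supersolution on balls. The value at
    [b] is prescribed up to 1, which is the precision of shooting. *)
Definition radial_approx (sigma kappa b B a : R) (h : R -> R) :=
  [/\ forall r, {for r, continuous h}, forall r, 0 <= h r,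
    forall r, r <= b -> h r = sigma * fbar (profile p N a h r) + kappa &
    B - 1 < profile p N a h b /\ profile p N a h b <= B].

(** Cutting [f] off at [B] makes the nonlinearity bounded and uniformly continuous; the solution
    found is nondecreasing and at most [B] at [b], so the cut-off is not active for [r <= b]. *)
Lemma radial_shoot (sigma kappa b B : R) : 0 < sigma -> 0 < kappa -> 0 < b -> 0 <= B ->
  exists a h, radial_approx sigma kappa b B a h.
Proof.
move=> sigma0 kappa0 b0 B0.
pose j v := sigma * fbar (Num.min v B) + kappa.
have cj v : {for v, continuous j}.
  apply: contD; last exact: cont_cst.
  apply: contM; first exact: cont_cst.
  apply: (@cont_comp _ _ fbar (fun v => Num.min v B)); first exact: (fbar_cont hf).
  by apply: continuous_min; [exact: cvg_id|exact: cont_cst].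
have jj : {homo j : v w / v <= w}.
  move=> v w vw; rewrite lerD2r ler_pM2l//; apply: (fbar_nondecr hf).
  by case: (leP v B) => ?; case: (leP w B) => ?; lra.
have jk v : kappa <= j v by rewrite lerDr; apply: mulr_ge0; [exact: ltW|exact: (fbar_ge0 hf)].
have j0 v : 0 <= j v by apply: le_trans (jk v); exact: ltW.
have jC v : j v <= sigma * fbar B + kappa.
  by rewrite lerD2r ler_pM2l//; apply: (fbar_nondecr hf); rewrite ge_min lexx orbT.
have uj (e : R) : 0 < e -> exists2 d : R, 0 < d & forall v w : R, `|v - w| < d -> `|j v - j w| < e.
  move=> e0; have es : 0 < e / sigma by rewrite divr_gt0.
  have [d d0 Hd] := compact_unif (@segment_compact R 0 B) (fun x _ => fbar_cont hf (x:=x)) es.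
  exists d => // v w vw; rewrite /j opprD addrACA subrr addr0 -mulrBr normrM gtr0_norm//.
  rewrite mulrC -ltr_pdivlMr//.
  have E u : fbar (Num.min u B) = fbar (Num.max (Num.min u B) 0).
    by case: (leP (Num.min u B) 0) => h; rewrite ?(fbar_le0 hf h) ?(fbar_le0 hf (lexx 0)).
  rewrite (E v) (E w); apply: Hd; last exact: le_lt_trans (clip_lip v w B0) vw.
  by rewrite /= in_itv /= le_max lexx orbT /= ge_max B0 ge_min lexx orbT.
have [a [a1 a2]] := @psol_shoot _ p N p2 j _ cj jj j0 jC _ kappa0 jk uj b B b0.
pose h r := j (psol p N j a r).
have E r : psol p N j a r = profile p N a h r by exact: (psol_eq N p2 cj jj j0 jC).
exists a, h; split.
- by move=> r; exact: (@psol_rhs_cont _ p N p2 j _ cj jj j0 jC a (r + 1) r (ltr_pwDr ltr01 (lexx _))).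
- by move=> r; exact: j0.
- move=> r rb; rewrite -E.
  change (h r) with (sigma * fbar (Num.min (psol p N j a r) B) + kappa).
  rewrite min_l//; apply: le_trans a2.
  exact: (@psol_nondecr R p N p2 j _ cj jj j0 jC a r b rb).
- by rewrite -E.
Qed.


Lemma approx_cont sigma kappa b B a h r : radial_approx sigma kappa b B a h -> {for r, continuous (profile p N a h)}.
Proof.
by move=> [ch h0 _ _]; apply: (@profile_cont _ p N p2 (r + 1)) => //; rewrite ltrDl.
Qed.

Lemma approx_nondecr sigma kappa b B a h : radial_approx sigma kappa b B a h ->
  {homo profile p N a h : r s / r <= s}.
Proof.
by move=> [ch h0 _ _] r t rt; apply: (@profile_nondecr _ p N p2 (t + 1)) => //; rewrite ltrDl.
Qed.

Lemma approx_rhs_nondecr sigma kappa b B a h : 0 <= sigma -> radial_approx sigma kappa b B a h ->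
  forall r s, r <= s -> s <= b -> h r <= h s.
Proof.
move=> sigma0 H r t rt ts; have [_ _ hE _] := H; rewrite !hE//; last exact: le_trans ts.
by rewrite lerD2r ler_wpM2l// (fbar_nondecr hf)// (approx_nondecr H).
Qed.

Lemma approx_ode sigma kappa b B a h : 0 <= sigma -> 0 < b -> radial_approx sigma kappa b B a h ->
  radial_ode p N.+1 b h (flux N h) (profile p N a h).
Proof.
move=> sigma0 b0 H; have [ch h0 hE _] := H; apply: radial_ode_profile => // r s r0 rs sb.
by apply: (approx_rhs_nondecr sigma0 H) => //; exact: ltW.
Qed.

(** Both profiles are radial solutions in the unit ball of dimension [N + 1], where comparison
    applies: [kappa2 < kappa1] orders the right-hand sides strictly, and [B1 <= B2 - 1] orders the
    boundary values in spite of the shooting error. *)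
Lemma approx_mono kappa1 kappa2 B1 B2 a1 a2 h1 h2 : radial_approx 1 kappa1 1 B1 a1 h1 ->
  radial_approx 1 kappa2 1 B2 a2 h2 -> kappa2 < kappa1 -> B1 <= B2 - 1 ->
  forall r, r < 1 -> profile p N a1 h1 r <= profile p N a2 h2 r.
Proof.
move=> H1 H2 k12 B12.
set G1 := profile p N a1 h1; set G2 := profile p N a2 h2.
pose rd := @rad R N.+1 predT 0.
have rd0 : rd 0 = 0.
  by rewrite /rd /rad big1 ?sqrtr0// => i _; rewrite !mxE subrr expr0n.
have rdE (r : R) : 0 <= r -> rd (r *: delta_mx ord0 ord0) = r.
  move=> r0; rewrite /rd; have := (@rad0_line _ _ predT 0 0 ord0 r isT rd0).1; rewrite addr0 => ->.
  by rewrite ger0_norm.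
have crd : continuous rd by exact: continuous_rad.
pose O := [set x | rd x < 1].
have oO : open O by rewrite openE => x Ox; have /cvgr_lt := crd x; exact.
have S1 := @radial_solves R N.+1 p predT 0 1 N _ _ _ p2 (card_ord _) (approx_ode ler01 ltr01 H1) O oO (fun _ h => h).
have S2 := @radial_solves R N.+1 p predT 0 1 N _ _ _ p2 (card_ord _) (approx_ode ler01 ltr01 H2) O oO (fun _ h => h).
have [_ _ E1 [_ G1b]] := H1; have [_ _ E2 [G2b _]] := H2.
have D1 : G1 1 < G2 1 by apply: (le_lt_trans G1b); apply: le_lt_trans G2b.
have cmp := comparison p2 oO S1 S2.
have H x : O x -> G1 (rd x) <= G2 (rd x).
  apply: cmp => [c c0|y Oy].
    (* The strict order at radius 1 lets the open ball be replaced by the closed one. *)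
    have -> : [set x | O x /\ c <= G1 (rd x) - G2 (rd x)] =
        [set x | rd x <= 1] `&` [set x | c <= G1 (rd x) - G2 (rd x)].
      apply/seteqP; split => y [] /=; first by move=> /ltW.
      rewrite le_eqVlt => /orP[/eqP ->|//] h; exfalso; move: (lt_le_trans c0 h).
      by rewrite subr_gt0 ltNge ltW.
    apply: bounded_closed_compact.
      exists 1; split; first exact: num_real.
      move=> t t1 y [/= y1 _]; apply: le_trans (ltW t1); apply: le_trans y1.
      rewrite [leLHS]mx_normrE; apply: bigmax_le => [|[i j] _] /=; first exact: rad_ge0.
      by have := @coord_le_rad _ _ predT 0 y j isT; rewrite mxE subr0 (ord1 i).
    apply: closedI.
      by apply: (@closed_comp _ _ rd [set t | t <= 1]); [move=> y _; exact: crd|exact: closed_le].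
    apply: (@closed_comp _ _ (fun y => G1 (rd y) - G2 (rd y)) [set t | c <= t]); last exact: closed_ge.
    move=> y _; apply: (@contB _ _ (fun y => G1 (rd y)) (fun y => G2 (rd y))).
    by apply: cont_comp; [exact: approx_cont H1|exact: crd].
  by apply: cont_comp; [exact: approx_cont H2|exact: crd].
  move=> h12; have y1 : rd y <= 1 := ltW Oy.
  have e1 := E1 (rd y) y1; have e2 := E2 (rd y) y1.
  suff : h2 (rd y) < h1 (rd y) by [].
  rewrite e1 e2; apply: ler_ltD; last exact: k12.
  by apply: (ler_wpM2l ler01); apply: (fbar_nondecr hf); exact: ltW h12.
move=> r r1; have [r0|r0] := leP r 0.
  have := H 0; rewrite /O /= rd0 /G1 /G2 => /(_ ltr01).
  by rewrite !(profile_axis _ _ _ _ (lexx 0)) !profile_axis.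
by have := H (r *: delta_mx ord0 ord0); rewrite /O /= (rdE _ (ltW r0)) => /(_ r1).
Qed.


Variables (a_ : nat -> R) (h_ : nat -> R -> R).
Hypothesis appr : forall k, radial_approx 1 k.+1%:R^-1 1 k%:R (a_ k) (h_ k).
Let G_ k := profile p N (a_ k) (h_ k).
Hypothesis G_ub : forall r, r < 1 -> exists M : R, forall k, G_ k r <= M.

Let G_mono k r : r < 1 -> G_ k r <= G_ k.+1 r.
Proof.
move=> r1; apply: (approx_mono (appr k) (appr k.+1)) => //.
  by rewrite ltf_pV2 ?posrE ?ltr0n// ltr_nat.
by rewrite -natr1 addrK.
Qed.

Definition lim_sol r := limn (fun k => G_ k r).

Lemma lim_sol_cvg r : r < 1 -> G_ k r @[k --> \oo] --> lim_sol r.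
Proof.
move=> r1; apply: nondecreasing_is_cvgn; first by apply/nondecreasing_seqP => k; exact: G_mono.
by have [M HM] := G_ub r1; exists M => _ [k _ <-].
Qed.

Lemma lim_sol_axis r : r <= 0 -> lim_sol r = lim_sol 0.
Proof.
move=> r0; rewrite /lim_sol (_ : (fun k => G_ k r) = fun k => G_ k 0)//.
by apply/funext => k; rewrite /G_ !profile_axis.
Qed.

#[local] Opaque lim_sol.

Lemma le_lim_sol k r : r < 1 -> G_ k r <= lim_sol r.
Proof.
move=> r1; apply: (@nondecreasing_cvgn_le _ (fun k => G_ k r)).
  by apply/nondecreasing_seqP => i; exact: G_mono.
by apply: cvgP; exact: (@lim_sol_cvg r r1).
Qed.

Lemma lim_sol_le r M : r < 1 -> (forall k, G_ k r <= M) -> lim_sol r <= M.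
Proof.
move=> r1 HM; apply: (ler_cvg_to (@lim_sol_cvg r r1) (@cvg_cst _ _ _ _ _)).
by apply: nearW => k; exact: HM.
Qed.

Lemma lim_sol_nondecr r s : r <= s -> s < 1 -> lim_sol r <= lim_sol s.
Proof.
move=> rs s1; apply: (ler_cvg_to (@lim_sol_cvg r (le_lt_trans rs s1)) (@lim_sol_cvg s s1)).
by apply: nearW => k; exact: (approx_nondecr (appr k)).
Qed.

Let hle k r t : r < 1 -> 0 <= t -> t <= r -> h_ k t <= fbar (lim_sol r) + 1.
Proof.
move=> r1 t0 tr; have [_ _ hE _] := appr k; have t1 := le_lt_trans tr r1.
rewrite hE ?mul1r; last exact: ltW.
apply: lerD; last by rewrite invf_le1 ?ltr0n// ler1n.
apply: (fbar_nondecr hf); apply: le_trans (@le_lim_sol k r r1).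
exact: (approx_nondecr (appr k)).
Qed.

(** The slopes of all the [G_ k] up to [b] have one common bound, because their right-hand sides are
    at most [fbar (lim_sol b) + 1]; this Lipschitz estimate passes to the limit. *)
Lemma lim_sol_cont r : r < 1 -> {for r, continuous lim_sol}.
Proof.
move=> r1; pose b := (Num.max r 0 + 1) / 2.
have b1 : b < 1 by rewrite /b; case: (leP r 0) => ?; lra.
have rb : r < b by rewrite /b; case: (leP r 0) => ?; lra.
have b0 : 0 < b by rewrite /b; case: (leP r 0) => ?; lra.
pose C := fbar (lim_sol b) + 1; have C0 : 0 <= C by rewrite addr_ge0// (fbar_ge0 hf).
pose L := (C * b) `^ (p - 1)^-1.
have q0 : 0 < (p - 1)^-1 by rewrite invr_gt0 subr_gt0; apply: lt_le_trans p2; rewrite ltr1n.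
have lip k u v : u <= v -> v <= b -> G_ k v - G_ k u <= L * (v - u).
  move=> uv vb; have [ch h0 _ _] := appr k.
  have L0 : 0 <= L by exact: powR_ge0.
  have ext w : G_ k w = G_ k (Num.max w 0).
    by have [w0|w0] := leP w 0; rewrite // /G_ !profile_axis.
  have main u' v' : 0 <= u' -> u' <= v' -> v' <= b -> G_ k v' - G_ k u' <= L * (v' - u').
    move=> u0 uv' vb'.
    have H : L * u' - G_ k u' <= L * v' - G_ k v'.
      apply: (@derive_ge0_le _ (fun t => L * t - G_ k t) (fun t => L - flux N (h_ k) t `^ (p - 1)^-1)) => //.
        move=> t ut tv; have t0 : 0 < t by exact: le_lt_trans ut.
        have tt : t < t + 1 by rewrite ltrDl.
        split.
          apply: isdB; first by apply: (is_derive_eq (isdZ _ (isd_id t 1))); rewrite mulr1.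
          by apply: (@is_derive_profile _ p N p2 (t + 1)).
        rewrite subr_ge0; apply: ge0_ler_powR; rewrite ?nnegrE; [exact: ltW| |by rewrite mulr_ge0// ltW|].
          by apply: (@flux_nneg _ N (t + 1)).
        apply: (@le_trans _ _ (C * t / N.+1%:R)).
          apply: (@flux_bound _ N (t + 1)) => //; first exact: ltW.
          by move=> w w0 wt; apply: hle => //; apply: le_trans vb'; apply: ltW; exact: le_lt_trans tv.
        rewrite ler_pdivrMr ?ltr0n//; apply: (@le_trans _ _ (C * b)).
          by rewrite ler_wpM2l//; apply: ltW; exact: lt_le_trans vb'.
        by apply: ler_peMr; [rewrite mulr_ge0// ltW|rewrite ler1n].
      move=> t _ _; apply: contB; last exact: approx_cont (appr k).
      by apply: contM; [exact: cont_cst|exact: cvg_id].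
    by rewrite mulrBr; lra.
  rewrite (ext v) (ext u); apply: (@le_trans _ _ (L * (Num.max v 0 - Num.max u 0))).
    apply: main; [by rewrite le_max lexx orbT| |by rewrite ge_max vb ltW].
    by case: (leP u 0); case: (leP v 0) => ? ?; lra.
  by apply: ler_wpM2l => //; case: (leP u 0); case: (leP v 0) => ? ?; lra.
have L0 : 0 < L + 1 by rewrite ltr_wpDl// powR_ge0.
have Lip u v : u <= v -> v <= b -> `|lim_sol v - lim_sol u| <= (L + 1) * (v - u).
  move=> uv vb; have v1 : v < 1 := le_lt_trans vb b1; have u1 : u < 1 := le_lt_trans uv v1.
  rewrite ger0_norm ?subr_ge0; last exact: lim_sol_nondecr.
  have H : (G_ k v - G_ k u) @[k --> \oo] --> lim_sol v - lim_sol u.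
    by apply: cvgB; exact: lim_sol_cvg.
  apply: (ler_cvg_to H (@cvg_cst _ _ _ _ _)); apply: nearW => k.
  by apply: (le_trans (lip k u v uv vb)); rewrite ler_wpM2r ?subr_ge0// lerDl.
apply: cont_dist => e e0.
apply/nbhs_ballP; exists (Num.min (b - r) (e / (L + 1))) => /=.
  by rewrite lt_min subr_gt0 rb divr_gt0.
move=> t; rewrite /ball /= lt_min => /andP[t1 te].
have tb : t <= b by have := ler_norm (t - r); rewrite distrC in t1; lra.
have [rt|/ltW rt] := leP r t.
  rewrite distrC; apply: (le_lt_trans (Lip _ _ rt tb)).
  by rewrite mulrC -ltr_pdivlMr// -[t - r]ger0_norm ?subr_ge0// distrC.
apply: (le_lt_trans (Lip _ _ rt (ltW rb))).
by rewrite mulrC -ltr_pdivlMr// -[r - t]ger0_norm ?subr_ge0.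
Qed.

Let hU r := fbar (lim_sol r).
Let chU r : r < 1 -> {for r, continuous hU}.
Proof. by move=> r1; apply: cont_comp; [exact: (fbar_cont hf)|exact: lim_sol_cont]. Qed.
Let hU0 r : r < 1 -> 0 <= hU r. Proof. by move=> _; exact: (fbar_ge0 hf). Qed.

(** The integral form of the equation passes to the limit: the right-hand sides converge pointwise,
    the added [1 / (k + 1)] tends to 0, and [hle] bounds them uniformly. *)
Lemma lim_sol_eq r : r < 1 -> lim_sol r = profile p N (lim_sol 0) hU r.
Proof.
move=> r1; have [r0|r0] := leP r 0; first by rewrite (lim_sol_axis r0) profile_axis.
have E a h : profile p N a h r = a + profile p N 0 h r by rewrite /profile add0r.
have H : profile p N 0 (h_ k) r @[k --> \oo] --> profile p N 0 hU r.
  apply: (@profile_lim _ p N p2 0 h_ hU r 1 (fbar (lim_sol r) + 1)) => //.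
  - by move=> k t _; have [ch _ _ _] := appr k; exact: ch.
  - by move=> k t _; have [_ h0 _ _] := appr k; exact: h0.
  - exact: ltW.
  - by move=> k t t0 tr; exact: hle.
  - move=> t t0 tr; have t1 : t < 1 := le_lt_trans tr r1.
    rewrite (_ : (fun k => _) = fun k => fbar (G_ k t) + k.+1%:R^-1); last first.
      by apply/funext => k; have [_ _ hE _] := appr k; rewrite (hE _ (ltW t1)) mul1r.
    rewrite -[hU t]addr0; apply: cvgD; last exact: cvg_harmonic.
    exact: (cvg_comp _ _ (@lim_sol_cvg t t1) (@fbar_cont _ _ _ hf (lim_sol t))).
have H0 : a_ k @[k --> \oo] --> lim_sol 0.
  rewrite (_ : a_ = fun k => G_ k 0); first exact: lim_sol_cvg.
  by apply/funext => k; rewrite /G_ profile_axis.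
have H2 : G_ k r @[k --> \oo] --> lim_sol 0 + profile p N 0 hU r.
  rewrite (_ : (fun k => G_ k r) = fun k => a_ k + profile p N 0 (h_ k) r); first exact: cvgD.
  by apply/funext => k; rewrite /G_ E.
by rewrite E; apply: (cvg_unique _ (@lim_sol_cvg r r1) H2); exact: Rhausdorff.
Qed.

Lemma lim_sol_large M : exists2 r : R, r < 1 & forall s, r <= s -> s < 1 -> M <= lim_sol s.
Proof.
pose k := (Num.bound `|M|).+1.
have Mk : M < k%:R - 1.
  by rewrite /k -natr1 addrK; apply: le_lt_trans (ler_norm M) _; apply: archi_boundP.
have [_ _ _ [Gk _]] := appr k.
have cG : {for (1 : R), continuous (G_ k)} by exact: approx_cont (appr k).
have MG : M < G_ k 1 by exact: lt_trans Gk.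
have /nbhs_ballP[d /= d0 Hd] : nbhs (1 : R) [set r | M < G_ k r] by have /cvgr_gt := cG; exact.
exists (1 - d / 2); first by rewrite gtrBl divr_gt0.
move=> s s0 s1; apply: le_trans (@le_lim_sol k s s1); apply: ltW; apply: Hd.
rewrite /ball /= gtr0_norm ?subr_gt0//.
have : d / 2 < d by rewrite ltr_pdivrMr// ltr_pMr// ltr1n.
lra.
Qed.

(** As long as [lim_sol] is negative its right-hand side vanishes, so it is constant; by continuity
    such an interval can be prolonged beyond its end, against the blow-up at 1. *)
Lemma lim_sol_ge0 r : r < 1 -> 0 <= lim_sol r.
Proof.
move=> r1; rewrite leNgt; apply/negP => Ur.
have U0 : lim_sol 0 < 0.
  have [r0|r0] := leP r 0; first by rewrite -(lim_sol_axis r0).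
  by apply: le_lt_trans Ur; apply: lim_sol_nondecr => //; exact: ltW.
pose S := [set s : R | 0 <= s /\ s < 1 /\ lim_sol s < 0].
have S0 : S 0 by split.
have [d d1 Hd] := lim_sol_large 0.
have Sub s : S s -> s <= d.
  by move=> [s0 [s1 Us]]; rewrite leNgt; apply/negP => /ltW ds; have := Hd s ds s1; rewrite leNgt Us.
have [b [b0 b1 bub blub]] : exists b : R, [/\ 0 <= b, b < 1, forall s, S s -> s <= b &
    forall s, s < b -> exists2 t, S t & s < t].
  have hs : has_sup S by split; [exists 0|exists d].
  exists (sup S); split.
  - by apply: ub_le_sup; [have [] := hs|exact: S0].
  - by apply: le_lt_trans d1; apply: ge_sup; [exists 0|exact: Sub].
  - by move=> s Ss; apply: ub_le_sup; [have [] := hs|].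
  - by move=> s sb; exact: (sup_gt (ex_intro _ 0 S0) sb).
have cstE s : 0 <= s -> s < b -> lim_sol s = lim_sol 0.
  move=> s0 sb; have s1 := lt_trans sb b1.
  have [t [t0 [t1 Ut]] st] := blub s sb.
  rewrite lim_sol_eq// /profile /prim.
  rewrite (@eq_Rintegral _ _ _ _ _ (fun=> 0)); first by rewrite Rintegral_cst// mul0r addr0.
  move=> u; rewrite inE /= in_itv /= => /andP[u0 us].
  have fz : flux N hU u = 0.
    have u1 : u < 1 := le_lt_trans us s1.
    apply/eqP; rewrite eq_le (@flux_nneg _ N 1 hU chU hU0 u u1) andbT.
    have := @flux_bound _ N 1 hU u 0 chU u0 u1; rewrite !mul0r; apply => w w0 wu.
    suff -> : hU w = 0 by exact: lexx.
    apply: (fbar_le0 hf); apply: ltW; apply: le_lt_trans Ut.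
    by apply: lim_sol_nondecr => //; apply: (le_trans wu); apply: (le_trans us); exact: ltW.
  rewrite fz powR0// invr_eq0 gt_eqF// subr_gt0; apply: lt_le_trans p2; rewrite ltr1n//.
have Ub : lim_sol b < 0.
  have [->|bn] := eqVneq b 0; first exact: U0.
  have bp : 0 < b by rewrite lt_neqAle eq_sym bn.
  rewrite ltNge; apply/negP => Ub.
  have cb := lim_sol_cont b1.
  have h0 : lim_sol 0 / 2 < lim_sol b by apply: lt_le_trans Ub; rewrite ltr_pdivrMr// mul0r.
  have /nbhs_ballP[e /= e0 He] : nbhs b [set r | lim_sol 0 / 2 < lim_sol r] by have /cvgr_gt := cb; exact.
  have [s [sb s0 se]] : exists s : R, [/\ s < b, 0 <= s & b - s < e].
    exact: point_left bp e0.
  have bs : ball b e s.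
    by rewrite /ball /= ger0_norm; [exact: se|rewrite subr_ge0; exact: ltW].
  have hh : lim_sol 0 / 2 < lim_sol s := He s bs.
  by move: hh; rewrite (cstE s s0 sb) ltNge (ltW (lt_half_neg U0)).
have cb := lim_sol_cont b1.
have /nbhs_ballP[e /= e0 He] : nbhs b [set r | lim_sol r < 0] by have /cvgr_lt := cb; exact.
have [s [bs s1 se]] : exists s : R, [/\ b < s, s < 1 & s < b + e].
  exact: point_right b1 e0.
have Ss : S s.
  split; first exact: ltW (le_lt_trans b0 bs).
  split; first exact: s1.
  apply: He; rewrite /ball /= distrC gtr0_norm; last by rewrite subr_gt0; exact: bs.
  by rewrite ltrBlDr addrC; exact: se.
by have := bub s Ss; rewrite leNgt bs.
Qed.

End large_solution.

(** * Barriers in the cylinder *)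

Lemma is_derive_on_line {R : realType} {n : nat} (F G : 'rV[R]_n -> R) x v l : (forall h : R, F (h *: v + x) = G (h *: v + x)) ->
  is_derive x v F l -> is_derive x v G l.
Proof.
move=> FG /is_derive_line0 H; apply/is_derive_line0.
by rewrite (_ : (fun h : R => _) = fun h => F (h *: v + x))//; apply/funext.
Qed.

Section kq.
Context {R : realType} (a : R).
Implicit Types (q s : R).
Hypothesis a0 : 0 <= a.

(** With [a = p - 2], radial slope [q] and vertical slope [s], this is [|grad W|^(p-2)]; [dkq] is
    the derivative of [kw q s * q] in [q], valid also at [q = 0]. *)
Definition kw q s : R := (q ^+ 2 + s ^+ 2) `^ (a / 2).
Definition dkq q s : R := kw q s + a * ((q ^+ 2 + s ^+ 2) `^ (a / 2 - 1) * q ^+ 2).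

Let Q0 q s : 0 <= q ^+ 2 + s ^+ 2. Proof. by rewrite addr_ge0// sqr_ge0. Qed.

Lemma kw_ge0 q s : 0 <= kw q s. Proof. exact: powR_ge0. Qed.

Lemma dkq_ge0 q s : 0 <= dkq q s.
Proof. by apply: addr_ge0; [exact: kw_ge0|rewrite mulr_ge0// mulr_ge0 ?powR_ge0// sqr_ge0]. Qed.

Lemma kwC q s : kw q s = kw s q. Proof. by rewrite /kw addrC. Qed.

Lemma dkq_le q s : dkq q s <= (1 + a) * kw q s.
Proof.
rewrite mulrDl mul1r lerD2l ler_wpM2l//.
have := Q0 q s; rewrite le_eqVlt => /orP[/eqP Q|Q].
  have -> : q ^+ 2 = 0.
    by apply/eqP; rewrite eq_le sqr_ge0 andbT [leRHS]Q lerDl sqr_ge0.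
  by rewrite mulr0 kw_ge0.
apply: (@le_trans _ _ ((q ^+ 2 + s ^+ 2) `^ (a / 2 - 1) * (q ^+ 2 + s ^+ 2))).
  by rewrite ler_wpM2l ?powR_ge0// lerDl sqr_ge0.
rewrite powRB; last by rewrite (gt_eqF Q) implybT.
by rewrite powRr1 ?(ltW Q)// divfK// gt_eqF.
Qed.

Lemma kw_le q s B : 0 <= B -> q ^+ 2 + s ^+ 2 <= B ^+ 2 -> kw q s <= B `^ a.
Proof.
move=> B0 H; rewrite /kw (_ : B `^ a = (B ^+ 2) `^ (a / 2)).
  by apply: ge0_ler_powR; rewrite ?nnegrE ?Q0 ?exprn_ge0// divr_ge0.
by rewrite -powR_mulrn// -powRrM mulrC divfK.
Qed.

Lemma kw_cont (T : topologicalType) (f g : T -> R) x : {for x, continuous f} -> {for x, continuous g} ->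
  {for x, continuous (fun y => kw (f y) (g y))}.
Proof.
move=> cf cg; apply: powR_continuous_comp; [by rewrite divr_ge0|by apply: filterE => y; exact: Q0|].
by apply: (@contD _ _ (fun y => f y ^+ 2) (fun y => g y ^+ 2)); [exact: contM|exact: contM].
Qed.

Lemma is_derive_kq q s : is_derive q 1 (fun q => kw q s * q) (dkq q s).
Proof.
have [->|qn] := eqVneq q 0.
  rewrite /dkq expr0n /= !mulr0 addr0.
  have cF : {for 0, continuous (fun q => kw q s)} by apply: kw_cont; [exact: cvg_id|exact: cont_cst].
  have cv : (fun h : R => h^-1 *: (((fun q => kw q s * q) \o shift 0) (h *: 1) - kw 0 s * 0)) @ 0^' --> kw 0 s.
    apply: (cvg_trans (G := (fun q => kw q s) @ 0^')); last by apply: cvg_within_filter; exact: cF.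
    apply: near_eq_cvg; apply: (filterS _ (@nbhs_dnbhs_neq _ 0)) => h /= h0.
    by rewrite mulr0 subr0 addr0 /GRing.scale /= mulr1 mulrC mulfK.
  by split; [apply: cvgP cv|exact: cvg_lim cv].
have Q : 0 < q ^+ 2 + s ^+ 2 by rewrite ltr_pwDl// ?sqr_ge0// exprn_even_gt0.
have dQ : is_derive q 1 (fun q : R => q ^+ 2 + s ^+ 2) (2 * q).
  apply: (is_derive_eq (isdD (isd_exp 2 q) (isd_cst (s ^+ 2) q 1))).
  by rewrite addr0 expr1.
apply: (is_derive_eq (isdM (@isd_comp _ _ (fun y => y `^ (a / 2)) (fun q : R => q ^+ 2 + s ^+ 2) q 1 _ _ (is_derive1_powR (a / 2) Q) dQ) (isd_id q 1))).
by rewrite /dkq /kw; field.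
Qed.

End kq.

Section smoothed_flux.
Context {R : realType} (p delta : R).
Implicit Types (y : R).
Hypothesis p2 : (2 : R) <= p.
Hypothesis delta0 : 0 < delta.

(* Replaces [y `^ (p - 1)^-1], whose derivative is unbounded at 0 when [p > 2]. *)
Definition sroot y : R := (y + delta `^ (p - 1)) `^ (p - 1)^-1.

Let p1 : 0 < p - 1. Proof. by rewrite subr_gt0; apply: lt_le_trans p2; rewrite ltr1n. Qed.
Let a0 : 0 <= p - 2. Proof. by rewrite subr_ge0. Qed.
Let D0 : 0 < delta `^ (p - 1). Proof. exact: powR_gt0. Qed.
Let aE (z : R) : 0 <= z -> z `^ (p - 1) = z `^ (p - 2) * z.
Proof.
move=> z0; rewrite -(mulr_powRB1 z0 p1) mulrC; congr (_ `^ _ * _).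
by ring.
Qed.
Let pos y : 0 <= y -> 0 < y + delta `^ (p - 1). Proof. by move=> y0; rewrite ltr_wpDl. Qed.
Let q0 : 0 <= (p - 1)^-1. Proof. by rewrite invr_ge0 ltW. Qed.

Lemma powRK (z : R) : 0 <= z -> (z `^ (p - 1)) `^ (p - 1)^-1 = z.
Proof. by move=> z0; rewrite -powRrM divff ?powRr1// gt_eqF. Qed.

Lemma sroot_ge y : 0 <= y -> delta <= sroot y.
Proof.
move=> y0; rewrite -[leLHS](powRK (ltW delta0)); by apply: ge0_ler_powR; rewrite ?nnegrE ?lerDr ?powR_ge0 ?(ltW (pos y0)) ?q0 ?(ltW delta0).
Qed.

Lemma sroot0 : sroot 0 = delta. Proof. by rewrite /sroot add0r powRK// ltW. Qed.

Lemma sroot_pow y : 0 <= y -> sroot y `^ (p - 1) = y + delta `^ (p - 1).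
Proof. by move=> y0; rewrite -powRrM mulVf ?powRr1 ?gt_eqF// ltW// pos. Qed.

(** The regularised slope [sroot y - delta] carries no more flux than [y], even when weighted with
    the larger gradient norm [sroot y]. *)
Lemma sroot_le y : 0 <= y -> sroot y `^ (p - 2) * (sroot y - delta) <= y.
Proof.
move=> y0; have sy := sroot_ge y0; have s0 : 0 <= sroot y by apply: le_trans sy; exact: ltW.
rewrite mulrBr -aE// sroot_pow// -addrA gerDl subr_le0 aE ?(ltW delta0)//.
by apply: ler_wpM2r; [exact: ltW|apply: ge0_ler_powR; rewrite ?nnegrE// ltW].
Qed.

Lemma sroot_ge_root y : 0 <= y -> y `^ (p - 1)^-1 <= sroot y.
Proof. by move=> y0; apply: ge0_ler_powR; rewrite ?nnegrE ?lerDl ?powR_ge0 ?(ltW (pos y0)) ?q0. Qed.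

Lemma sroot_le_root y : 0 <= y -> sroot y <= y `^ (p - 1)^-1 + delta.
Proof.
move=> y0; set z := y `^ _; have z0 : 0 <= z by exact: powR_ge0.
have d0 := ltW delta0; have zd : 0 <= z + delta by exact: addr_ge0.
rewrite -[leRHS](powRK zd); apply: ge0_ler_powR => //; rewrite ?nnegrE ?powR_ge0 ?(ltW (pos y0))//.
have <- : z `^ (p - 1) = y by rewrite /z -powRrM mulVf ?powRr1// gt_eqF.
rewrite !aE// mulrDr; apply: lerD; apply: ler_wpM2r => //; apply: ge0_ler_powR; rewrite ?nnegrE//.
  by rewrite lerDl.
by rewrite lerDr.
Qed.

Lemma is_derive_sroot y : 0 <= y -> is_derive y 1 sroot ((p - 1) * sroot y `^ (p - 2))^-1.
Proof.
move=> y0; have dz : is_derive y 1 (fun z : R => z + delta `^ (p - 1)) 1.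
  by apply: (is_derive_eq (isdD (isd_id y 1) (isd_cst (delta `^ (p - 1)) y 1))); rewrite addr0.
apply: (is_derive_eq (@isd_comp _ _ (fun z => z `^ (p - 1)^-1) (fun z : R => z + delta `^ (p - 1)) y 1 _ _
  (is_derive1_powR (p - 1)^-1 (pos y0)) dz)).
rewrite mulr1 invfM /sroot -powRrM -powRN; congr (_ * _ `^ _).
by field; rewrite gt_eqF.
Qed.

End smoothed_flux.

(* A radial strict supersolution [G] with flux [Y] on [A < r < B]; it lives on a ball when [A < 0],
   and only then does the behaviour at [r = 0] matter. *)
Record super_profile {R : realType} (p : R) (f : R -> R) (N : nat) (A B s e : R) (Y b G : R -> R) : Prop := SuperProfile {
  sp_AB : A < B;
  sp_B0 : 0 < B;
  sp_Bs : B < s;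
  sp_e0 : 0 < e;
  sp_fluxc : forall r, r < s -> {for r, continuous Y};
  sp_flux0 : forall r, r < s -> 0 <= Y r;
  sp_solc : forall r, r < s -> {for r, continuous G};
  sp_sol0 : forall r, A <= r -> 0 <= r -> r <= B -> 0 <= G r;
  sp_flux : forall r, A < r -> 0 < r -> r < B -> is_derive r 1 Y (b r - N%:R * (Y r / r));
  sp_incr : forall r, A < r -> 0 < r -> r < B -> 0 <= b r - N%:R * (Y r / r);
  sp_sol : forall r, A < r -> 0 < r -> r < B -> is_derive r 1 G (Y r `^ (p - 1)^-1);
  sp_bound : exists M, forall r, A < r -> 0 < r -> r < B -> b r <= M /\ Y r / r <= M;
  sp_super : forall r, A < r -> 0 <= r -> r < B -> b r + e <= fbar f (G r);
  sp_axis : A < 0 -> [/\ Y 0 = 0, 0 <= b 0 & Y r / r @[r --> 0^'+] --> b 0 / N.+1%:R] }.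

Section barrier.
Context {R : realType} (p : R) (f : R -> R) (N : nat) (A B s e : R) (Y b G : R -> R).
Hypothesis p2 : (2 : R) <= p.
Hypothesis hf : condition_F p f.
Hypothesis SP : super_profile p f N A B s e Y b G.
Variable delta : R.
Hypothesis delta0 : 0 < delta.
Implicit Types (r : R) (x y : 'rV[R]_N.+2).
Local Notation "''e_' i" := (delta_mx ord0 i : 'rV[R]_N.+2) (at level 8, i at level 2, format "''e_' i").
Local Notation P := [pred i : 'I_N.+2 | i != ord_max].
Local Notation hrad := (rad P 0).
Local Notation sroot := (sroot p delta).

Let p1 : 0 < p - 1. Proof. by rewrite subr_gt0; apply: lt_le_trans p2; rewrite ltr1n. Qed.
Let a0 : 0 <= p - 2. Proof. by rewrite subr_ge0. Qed.

(** Subtracting [delta] has two effects: the slope vanishes on the axis, where [Y = 0], and the full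
    gradient with a vertical part [|v| <= delta] has norm at most [sroot (Y r)], as
    [(z - delta)^2 + delta^2 <= z^2] for [z >= delta]. *)
Definition bq r := sroot (Y r) - delta.
(** The slope [bq] lies between [G' - delta] and [G']; with the value fixed at [B], the function is
    above [G] and within [delta (B - r)] of it. *)
Definition barr r := G B - (prim bq B - prim bq r).

Lemma bq_ge0 r : r < s -> 0 <= bq r.
Proof. by move=> rs; rewrite subr_ge0 sroot_ge// (sp_flux0 SP rs). Qed.

Lemma bq_cont r : r < s -> {for r, continuous bq}.
Proof.
move=> rs; apply: (@contB _ _ (fun r => sroot (Y r)) (fun=> delta)); last exact: cont_cst.
apply: powR_continuous_comp; [by rewrite invr_ge0 ltW| |].
  have : nbhs r [set r | r < s] by apply: open_nbhs_nbhs; split; [exact: open_lt|exact: rs].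
  by apply: filterS => t /(sp_flux0 SP) t0; apply: addr_ge0 => //; exact: powR_ge0.
by apply: (@contD _ _ Y (fun=> delta `^ (p - 1))); [exact: (sp_fluxc SP rs)|exact: cont_cst].
Qed.

Lemma is_derive_barr r : 0 < r -> r < s -> is_derive r 1 barr (bq r).
Proof.
move=> r0 rs; have dp := is_derive_prim bq_cont r0 rs.
apply: (is_derive_eq (isdB (isd_cst (G B) r 1) (isdB (isd_cst (prim bq B) r 1) dp))).
by ring.
Qed.

Lemma barr_cont r : r < s -> {for r, continuous barr}.
Proof.
move=> rs; apply: (@contB _ _ (fun=> G B) (fun r => prim bq B - prim bq r)); first exact: cont_cst.
by apply: (@contB _ _ (fun=> prim bq B) (prim bq)); [exact: cont_cst|exact: (prim_cont bq_cont rs)].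
Qed.

Lemma barr_B : barr B = G B. Proof. by rewrite /barr subrr subr0. Qed.

Let rs r : r <= B -> r < s. Proof. by move=> rB; apply: le_lt_trans rB (sp_Bs SP). Qed.

Let dGb r : A < r -> 0 < r -> r < B -> is_derive r 1 (fun r => G r - barr r) (Y r `^ (p - 1)^-1 - bq r).
Proof.
move=> Ar r0 rB; have dG := sp_sol SP Ar r0 rB.
exact: (isdB dG (is_derive_barr r0 (rs (ltW rB)))).
Qed.

Let cGb r : r <= B -> {for r, continuous (fun r => G r - barr r)}.
Proof. by move=> rB; apply: (@contB _ _ G barr); [exact: (sp_solc SP (rs rB))|exact: (barr_cont (rs rB))]. Qed.

Lemma barr_ge r : A <= r -> 0 <= r -> r <= B -> G r <= barr r.
Proof.
move=> Ar r0 rB; rewrite -subr_le0.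
suff H : G r - barr r <= G B - barr B by move: H; rewrite barr_B subrr.
apply: (@derive_ge0_le _ (fun r => G r - barr r) (fun r => Y r `^ (p - 1)^-1 - bq r) r B _ _ rB) => [t rt tB|t _ tB]; last exact: (cGb tB).
have t0 := le_lt_trans r0 rt; split; first exact: (dGb (le_lt_trans Ar rt) t0 tB).
have := sroot_le_root p2 delta0 (sp_flux0 SP (rs (ltW tB))).
by rewrite subr_ge0 /bq lerBlDr.
Qed.

Lemma barr_le r : A <= r -> 0 <= r -> r <= B -> barr r <= G r + delta * (B - r).
Proof.
move=> Ar r0 rB.
suff H : delta * r - (G r - barr r) <= delta * B - (G B - barr B).
  move: H; rewrite barr_B subrr; move: (G r) (barr r) => g w; lra.
apply: (@derive_ge0_le _ (fun r => delta * r - (G r - barr r)) (fun r => delta - (Y r `^ (p - 1)^-1 - bq r)) r B _ _ rB) => [t rt tB|t _ tB]; last first.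
  apply: contB; last exact: (cGb tB).
  by apply: (@contM _ _ (fun=> delta) id); [exact: cont_cst|exact: cvg_id].
have t0 := le_lt_trans r0 rt; split.
  have dt : is_derive t 1 (fun r => delta * r) delta.
    by apply: (is_derive_eq (isdM (isd_cst delta t 1) (isd_id t 1))); rewrite mul0r add0r mulr1.
  exact: (isdB dt (dGb (le_lt_trans Ar rt) t0 tB)).
have := sroot_ge_root p2 delta0 (sp_flux0 SP (rs (ltW tB))).
by rewrite /bq; move: (_ `^ _) (sroot _) => y z; lra.
Qed.

Definition bq' r := (b r - N%:R * (Y r / r)) * ((p - 1) * sroot (Y r) `^ (p - 2))^-1.

Lemma is_derive_bq r : A < r -> 0 < r -> r < B -> is_derive r 1 bq (bq' r).
Proof.
move=> Ar r0 rB; have Y0 := sp_flux0 SP (rs (ltW rB)).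
apply: (is_derive_eq (isdB (isd_comp (is_derive_sroot p2 delta0 Y0) (sp_flux SP Ar r0 rB)) (isd_cst delta r 1))).
by rewrite subr0 mulrC.
Qed.

Lemma bq_axis : A < 0 -> bq 0 = 0.
Proof. by move=> A0; have [Y0 _ _] := sp_axis SP A0; rewrite /bq Y0 sroot0// subrr. Qed.

Definition bw0 := b 0 / N.+1%:R * ((p - 1) * delta `^ (p - 2))^-1.

Lemma bq_lim : A < 0 -> bq r / r @[r --> 0^'+] --> bw0.
Proof.
move=> A0; have [Y0 _ Yl] := sp_axis SP A0; rewrite /bw0; set D := ((p - 1) * _)^-1.
(* The difference quotient of [sroot] at 0, continued by its limit: [bq r / r] is [Y r / r] times
   [S (Y r)]. *)
pose S (y : R) := if y == 0 then D else (sroot y - delta) / y.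
have cS : {for 0, continuous S}.
  have dS : is_derive (0 : R) 1 sroot D.
    by apply: (is_derive_eq (is_derive_sroot p2 delta0 (lexx 0))); rewrite sroot0.
  have [dv ev] := dS; have H : (fun h : R => h^-1 *: ((sroot \o shift 0) (h *: 1) - sroot 0)) @ 0^' --> D.
    by rewrite -ev; exact: dv.
  apply/cvgrPdist_lt => eps eps0.
  move/cvgrPdist_lt : H => /(_ eps eps0); rewrite !near_withinE => H.
  apply: filterS H => h /= H; rewrite {1}/S eqxx /S; have [_|h0] := eqVneq h 0; first by rewrite subrr normr0.
  have := H h0; rewrite addr0 sroot0// /GRing.scale /= mulr1 mulrC; exact.
have cSY : {for 0, continuous (fun r => S (Y r))}.
  by apply: (@cont_comp _ _ S Y); [rewrite Y0|exact: (sp_fluxc SP (rs (ltW (sp_B0 SP))))].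
have H1 : S (Y r) @[r --> 0^'+] --> D.
  have -> : D = S (Y 0) by rewrite Y0 /S eqxx.
  exact: cvg_within_filter.
have -> : (fun r => bq r / r) = (fun r => (Y r / r) * S (Y r)).
  apply/funext => r; rewrite /bq /S; have [->|Yn] := eqVneq (Y r) 0.
    by rewrite sroot0// subrr !mul0r.
  by rewrite mulrAC mulrCA mulfV// mulr1.
exact: (cvgM Yl H1).
Qed.

Lemma bq_prim_lim : A < 0 -> (barr r - barr 0) / r @[r --> 0^'+] --> (0 : R).
Proof.
move=> A0; apply: cvg_right0P => eps eps0.
have s0 : 0 < s by apply: lt_trans (sp_Bs SP); exact: (sp_B0 SP).
have [d d0 Hd] := cont_right (bq_cont s0) (e := eps / 2) (divr_gt0 eps0 (ltr0Sn _ _)).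
exists (Num.min d s); first by rewrite lt_min d0.
move=> r r0; rewrite lt_min => /andP[rd rs'].
have -> : barr r - barr 0 = prim bq r.
  rewrite /barr (prim0 _ (lexx 0)); move: (prim bq B) (prim bq r) => v w; ring.
rewrite sub0r normrN ger0_norm; last first.
  apply: divr_ge0; last exact: ltW.
  by apply: prim_ge0 => t t0 tr; apply: bq_ge0; exact: le_lt_trans rs'.
rewrite ltr_pdivrMr//; apply: (@le_lt_trans _ _ (eps / 2 * r)); last first.
  by rewrite ltr_pM2r// ltr_pdivrMr// ltr_pMr// ltr1n.
apply: (prim_bound bq_cont (ltW r0) rs') => t t0 tr.
have /Hd : `|t - 0| < d by rewrite subr0 ger0_norm//; exact: le_lt_trans rd.
by rewrite bq_axis// subr0 => /(le_lt_trans (ler_norm _)) /ltW.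
Qed.

Let prs r : r <= B -> 0 <= Y r. Proof. by move=> rB; exact: (sp_flux0 SP (rs rB)). Qed.

Lemma bkw_le r v : r <= B -> `|v| <= delta -> kw (p - 2) (bq r) v <= sroot (Y r) `^ (p - 2).
Proof.
move=> rB vd; have Yr := prs rB; have sY := sroot_ge p2 delta0 Yr; have d0 := ltW delta0.
apply: kw_le => //; first exact: le_trans sY.
have v2 : v ^+ 2 <= delta ^+ 2 by rewrite -real_normK ?num_real// ler_pXn2r// nnegrE.
apply: (@le_trans _ _ (bq r ^+ 2 + delta ^+ 2)); first by rewrite lerD2l.
by rewrite /bq; move: (sroot _) sY => z; nra.
Qed.

Lemma bdkq_le r v : r <= B -> `|v| <= delta -> dkq (p - 2) (bq r) v <= (p - 1) * sroot (Y r) `^ (p - 2).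
Proof.
move=> rB vd; apply: (le_trans (dkq_le a0 _ _)).
rewrite (_ : 1 + (p - 2) = p - 1); last by ring.
by rewrite ler_pM2l//; exact: bkw_le.
Qed.

Lemma bZ_le r v : r <= B -> `|v| <= delta -> 0 <= kw (p - 2) (bq r) v * bq r <= Y r.
Proof.
move=> rB vd; have q0 := bq_ge0 (rs rB); rewrite mulr_ge0 ?kw_ge0//=.
apply: le_trans (sroot_le p2 delta0 (prs rB)); apply: ler_wpM2r => //.
exact: bkw_le.
Qed.

(** The derivative of [sroot] is the inverse of [(p - 1) sroot^(p-2)], which bounds [dkq]; so the
    regularised flux grows no faster than [Y]. The sign of [Y'] given by [sp_incr] lets the factor
    be bounded by 1. *)
Lemma bdZ_le r v : A < r -> 0 < r -> r < B -> `|v| <= delta ->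
  0 <= dkq (p - 2) (bq r) v * bq' r <= b r - N%:R * (Y r / r).
Proof.
move=> Ar r0 rB vd; have I0 := sp_incr SP Ar r0 rB; have Yr := prs (ltW rB).
have s0 : 0 < sroot (Y r) by apply: lt_le_trans (sroot_ge p2 delta0 Yr).
have m0 : 0 < (p - 1) * sroot (Y r) `^ (p - 2) by rewrite mulr_gt0// powR_gt0.
rewrite mulr_ge0 ?dkq_ge0 ?mulr_ge0 ?invr_ge0 ?(ltW m0)//=.
rewrite /bq' mulrCA -[leRHS]mulr1; apply: ler_wpM2l => //.
by rewrite ler_pdivrMr// mul1r; apply: bdkq_le => //; exact: ltW.
Qed.

Variables (eta t0 : R).
Hypothesis eta0 : 0 < eta.

Definition bsg x := eta * (lastc x - t0).
Definition bW x := barr (hrad x) + eta / 2 * (lastc x - t0) ^+ 2.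
Definition bg x : 'rV[R]_N.+2 :=
  \row_i (if i != ord_max then bq (hrad x) / hrad x * (x ord0 i - (0 : 'rV[R]_N.+2) ord0 i) else bsg x).

Lemma lastc_cont : continuous (@lastc R N.+1).
Proof. exact: coord_continuous. Qed.

Lemma bsg_cont : continuous bsg.
Proof.
move=> x; apply: (@contM _ _ (fun=> eta) (fun y => lastc y - t0)); first exact: cont_cst.
by apply: (@contB _ _ (@lastc R N.+1) (fun=> t0)); [exact: lastc_cont|exact: cont_cst].
Qed.

Lemma bW_cont x : hrad x < s -> {for x, continuous bW}.
Proof.
move=> xs; apply: contD; first by apply: cont_comp; [exact: (barr_cont xs)|exact: continuous_rad].
have cl : {for x, continuous (fun y => lastc y - t0)}.
  by apply: (@contB _ _ (@lastc R N.+1) (fun=> t0)); [exact: lastc_cont|exact: cont_cst].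
by apply: (@contM _ _ (fun=> eta / 2) (fun y => (lastc y - t0) ^+ 2)); [exact: cont_cst|exact: contM].
Qed.

Lemma lastc_line x i (h : R) : i != ord_max -> lastc (h *: 'e_i + x) = lastc x.
Proof. by move=> im; rewrite /lastc !mxE eqxx eq_sym (negbTE im) mulr0 add0r. Qed.

Lemma is_derive_lastc x : is_derive x 'e_ord_max (fun y => lastc y - t0) 1.
Proof.
apply: (is_derive_eq (isdB (is_derive_coord ord_max x 'e_ord_max) (isd_cst t0 x 'e_ord_max))).
by rewrite mxE !eqxx subr0.
Qed.

Variable O : set 'rV[R]_N.+2.
Hypothesis oO : open O.
Hypothesis OA : forall x, O x -> A < hrad x.
Hypothesis OB : forall x, O x -> hrad x < B.
Hypothesis Osg : forall x, O x -> `|bsg x| <= delta.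

Let Os x : O x -> hrad x < s. Proof. by move=> Ox; apply: rs; exact: ltW (OB Ox). Qed.
Let Ax x : O x -> hrad x = 0 -> A < 0. Proof. by move=> /OA + r0; rewrite r0. Qed.

Lemma bW_derive i x : O x -> is_derive x 'e_i bW (bg x ord0 i).
Proof.
move=> Ox; rewrite mxE; case: ifPn => [im|].
  pose k := eta / 2 * (lastc x - t0) ^+ 2.
  apply: (@is_derive_on_line _ _ (fun y => barr (hrad y) + k)).
    by move=> h; rewrite /bW lastc_line.
  suff H : is_derive x 'e_i (fun y => barr (hrad y)) (bq (hrad x) / hrad x * (x ord0 i - (0 : 'rV[R]_N.+2) ord0 i)).
    by apply: (is_derive_eq (isdD H (isd_cst k x 'e_i))); rewrite addr0.
  have := rad_ge0 P 0 x; rewrite le_eqVlt => /orP[/eqP r0|r0].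
    rewrite -r0 invr0 mulr0 mul0r; apply: radial_fun_derive0 => //.
    by apply: bq_prim_lim; exact: Ax Ox _.
  apply: (is_derive_eq (isd_comp (is_derive_barr r0 (Os Ox)) (is_derive_rad im r0))).
  by rewrite mulrA mulrAC.
rewrite negbK => /eqP ->.
have nm : ~~ P ord_max by rewrite /= eqxx.
have H := @radial_derive_off _ _ P 0 barr x ord_max nm.
have dl := is_derive_lastc x.
apply: (is_derive_eq (isdD H (isdZ (eta / 2) (isdM dl dl)))).
by rewrite /bsg; field.
Qed.

Lemma bg_cont i x : O x -> {for x, continuous (Defs.coord bg i)}.
Proof.
move=> Ox; rewrite /Defs.coord; case: (boolP (i != ord_max)) => im.
  rewrite (_ : (fun y => _) = fun y => bq (hrad y) / hrad y * (y ord0 i - (0 : 'rV[R]_N.+2) ord0 i)); last first.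
    by apply/funext => y; rewrite mxE im.
  have cb := bq_cont (Os Ox).
  have := rad_ge0 P 0 x; rewrite le_eqVlt => /orP[/eqP r0|r0].
    by apply: radial_field_cont => //; apply: bq_axis; exact: Ax Ox _.
  apply: contM; last by apply: contB; [exact: coord_continuous|exact: cont_cst].
  apply: contM; first by apply: cont_comp; [exact: cb|exact: continuous_rad].
  by apply: (@contV _ _ hrad); [rewrite gt_eqF|exact: continuous_rad].
rewrite (_ : (fun y => _) = bsg); first exact: bsg_cont.
by apply/funext => y; rewrite mxE (negbTE im).
Qed.

Lemma enorm_bg x : O x -> enorm (bg x) `^ (p - 2) = kw (p - 2) (bq (hrad x)) (bsg x).
Proof.
move=> Ox; rewrite /kw (_ : enorm (bg x) = (bq (hrad x) ^+ 2 + bsg x ^+ 2) `^ 2^-1).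
  by rewrite -powRrM; congr (_ `^ _); rewrite mulrC.
rewrite powR12_sqrt ?addr_ge0 ?sqr_ge0// /enorm; congr Num.sqrt.
rewrite /dotv (bigD1 ord_max)//= addrC; congr (_ + _); last by rewrite mxE eqxx expr2.
have E : \sum_(i | i != ord_max) bg x ord0 i * bg x ord0 i =
    \sum_(i | i != ord_max) (bq (hrad x) / hrad x) ^+ 2 * (x ord0 i - (0 : 'rV[R]_N.+2) ord0 i) ^+ 2.
  by apply: eq_bigr => i im; rewrite mxE im -expr2 exprMn.
rewrite E -mulr_sumr -(sqr_rad P 0).
have := rad_ge0 P 0 x; rewrite le_eqVlt => /orP[/eqP r0|r0].
  by rewrite -r0 (bq_axis (Ax Ox (esym r0))) !mul0r expr0n /= mulr0.
by rewrite -exprMn divfK// gt_eqF.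
Qed.

(** The diagonal derivatives of the field [|grad W|^(p-2) grad W], with their limit values where
    [hrad x = 0]. *)
Definition bE i x : R :=
  let k := kw (p - 2) (bq (hrad x)) (bsg x) in
  if i != ord_max then
    if 0 < hrad x then
      dkq (p - 2) (bq (hrad x)) (bsg x) * bq' (hrad x) * ((x ord0 i - (0 : 'rV[R]_N.+2) ord0 i) ^+ 2 / hrad x ^+ 2) +
      k * bq (hrad x) / hrad x * (1 - (x ord0 i - (0 : 'rV[R]_N.+2) ord0 i) ^+ 2 / hrad x ^+ 2)
    else kw (p - 2) 0 (bsg x) * bw0
  else eta * dkq (p - 2) (bsg x) (bq (hrad x)).

Lemma bX_derive i x : O x -> is_derive x 'e_i (fun y => enorm (bg y) `^ (p - 2) * bg y ord0 i) (bE i x).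
Proof.
move=> Ox.
suff H : is_derive x 'e_i (fun y => kw (p - 2) (bq (hrad y)) (bsg y) * bg y ord0 i) (bE i x).
  apply: near_eq_is_derive H.
  have : nbhs x O by exact: open_nbhs_nbhs.
  by apply: filterS => y Oy; rewrite enorm_bg.
rewrite /bE; case: ifPn => [im|].
  pose Z r := kw (p - 2) (bq r) (bsg x) * bq r.
  apply: (@is_derive_on_line _ _ (fun y => Z (hrad y) / hrad y * (y ord0 i - (0 : 'rV[R]_N.+2) ord0 i))).
    by move=> h; rewrite [bg _ _ _]mxE im /bsg lastc_line// -/(bsg x) /Z; move: (hrad _) => r; rewrite !mulrA.
  case: ifPn => r0.
    apply: radial_derive => //.
    have dq := is_derive_bq (OA Ox) r0 (OB Ox).
    exact: (isd_comp (is_derive_kq a0 (bq (hrad x)) (bsg x)) dq).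
  have r00 : hrad x = 0 by apply/eqP; rewrite eq_le rad_ge0 andbT leNgt.
  have A0 := Ax Ox r00; have s0 : 0 < s by apply: lt_trans (sp_Bs SP); exact: (sp_B0 SP).
  apply: radial_derive0 => //.
  have -> : (fun r => Z r / r) = fun r => kw (p - 2) (bq r) (bsg x) * (bq r / r).
    by apply/funext => r; rewrite /Z mulrA.
  apply: cvgM; last exact: bq_lim.
  have -> : kw (p - 2) 0 (bsg x) = kw (p - 2) (bq 0) (bsg x) by rewrite bq_axis.
  apply: (@cvg_within_filter _ _ (fun r => kw (p - 2) (bq r) (bsg x))).
  by apply: (@kw_cont _ _ a0 _ bq (fun=> bsg x)); [exact: bq_cont|exact: cont_cst].
rewrite negbK => /eqP ->.
apply: (@is_derive_on_line _ _ (fun y => kw (p - 2) (bsg y) (bq (hrad x)) * bsg y)).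
  by move=> h; rewrite [bg _ _ _]mxE eqxx /= rad_line_off 1?kwC//= eqxx.
have ds : is_derive x 'e_ord_max bsg eta.
  by apply: (is_derive_eq (isdZ eta (is_derive_lastc x))); rewrite mulr1.
by apply: (is_derive_eq (@isd_comp _ _ (fun q => kw (p - 2) q (bq (hrad x)) * q) bsg x _ _ _ (is_derive_kq a0 (bsg x) (bq (hrad x))) ds)); rewrite mulrC.
Qed.

Let vx x i := (x ord0 i - (0 : 'rV[R]_N.+2) ord0 i) ^+ 2 / hrad x ^+ 2.
Let NP : #|[pred i : 'I_N.+2 | i != ord_max]| = N.+1. Proof. by rewrite cardC1 card_ord. Qed.

Let bE_max x : O x -> 0 <= bE ord_max x <= eta * ((p - 1) * sroot (Y (hrad x)) `^ (p - 2)).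
Proof.
move=> Ox; rewrite /bE eqxx /=; apply/andP; split.
  by apply: mulr_ge0; [exact: ltW|exact: dkq_ge0].
apply: ler_wpM2l; first exact: ltW.
apply: (le_trans (dkq_le a0 _ _)); rewrite (_ : 1 + (p - 2) = p - 1); last by ring.
apply: ler_wpM2l; first exact: ltW.
rewrite kwC.
by apply: bkw_le; [exact: ltW (OB Ox)|exact: Osg].
Qed.

Let bE_axis x : O x -> hrad x = 0 -> 0 <= kw (p - 2) 0 (bsg x) * bw0 <= b 0 / N.+1%:R.
Proof.
move=> Ox r0; have A0 := Ax Ox r0; have [Y0 b0 _] := sp_axis SP A0.
have bn : 0 <= b 0 / N.+1%:R by apply: divr_ge0.
have dp : 0 < delta `^ (p - 2) by exact: powR_gt0.
have m0 : 0 < (p - 1) * delta `^ (p - 2) by exact: mulr_gt0.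
have B0 : 0 <= B by exact: ltW (sp_B0 SP).
have := bkw_le B0 (Osg Ox); rewrite bq_axis// Y0 sroot0// => H.
rewrite mulr_ge0 ?kw_ge0 ?mulr_ge0 ?invr_ge0 ?(ltW m0)//=.
rewrite /bw0 mulrCA -[leRHS]mulr1; apply: ler_wpM2l => //.
rewrite ler_pdivrMr// mul1r; apply: (le_trans H); rewrite ler_peMl ?(ltW dp)//.
by rewrite lerBrDr -[leLHS]/(2 : R).
Qed.

(** Off the axis the radial second derivative contributes at most [Y' = b - N Y / r] and the [N]
    remaining horizontal ones at most [Y / r] each, which add up to [b]; the vertical direction adds
    an error of order [eta]. *)
Lemma bE_sum_le x : O x ->
  \sum_i bE i x <= b (hrad x) + eta * ((p - 1) * sroot (Y (hrad x)) `^ (p - 2)).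
Proof.
move=> Ox; rewrite (bigD1 ord_max)//= addrC; apply: lerD; last by case/andP: (bE_max Ox).
have := rad_ge0 P 0 x; rewrite le_eqVlt => /orP[/eqP r0|r0].
  have /andP[_ H] := bE_axis Ox (esym r0).
  rewrite (eq_bigr (fun=> kw (p - 2) 0 (bsg x) * bw0)); last by move=> i im; rewrite /bE im -r0 ltxx.
  rewrite sumr_const NP -r0 -[leLHS]mulr_natr -ler_pdivlMr//.
set dZ := dkq (p - 2) (bq (hrad x)) (bsg x) * bq' (hrad x).
set z := kw (p - 2) (bq (hrad x)) (bsg x) * bq (hrad x) / hrad x.
rewrite (eq_bigr (fun i => dZ * vx x i + z * (1 - vx x i))); last by move=> i im; rewrite /bE im r0.
rewrite big_split /= -mulr_sumr -mulr_sumr sumrB (rad_sum (P := P) r0) sumr_const NP.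
have /andP[_ H1] := bdZ_le (OA Ox) r0 (OB Ox) (Osg Ox); rewrite -/dZ in H1.
have /andP[_ H2] := bZ_le (ltW (OB Ox)) (Osg Ox).
have H3 : z <= Y (hrad x) / hrad x by rewrite ler_pM2r ?invr_gt0.
rewrite mulr1 -[N.+1%:R]natr1 addrK.
apply: (@le_trans _ _ (b (hrad x) - N%:R * (Y (hrad x) / hrad x) + Y (hrad x) / hrad x * N%:R)).
  by apply: lerD => //; exact: ler_wpM2r.
by rewrite mulrC subrK.
Qed.

Lemma bE_bounded i : locally_bounded_on O (bE i).
Proof.
move=> K cK KO.
have ck x : K x -> {for x, continuous (fun x => sroot (Y (hrad x)) `^ (p - 2))}.
  move=> /KO Ox; have cb := bq_cont (Os Ox).
  apply: powR_continuous_comp => //.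
    by apply: filterE => y; exact: powR_ge0.
  apply: (@cont_comp _ _ (fun r => sroot (Y r)) hrad x); last exact: continuous_rad.
  have cD := @contD _ _ bq (fun=> delta) (hrad x) cb (@cont_cst _ _ delta (hrad x)).
  apply: (cont_near_eq _ cD).
  by apply: filterE => y; rewrite /bq subrK.
have [M1 M10 HM1] := compact_bound cK ck.
have [M HM] := sp_bound SP.
have e1 : 0 <= eta * ((p - 1) * M1) by apply: mulr_ge0; [exact: ltW|apply: mulr_ge0 => //; exact: ltW].
exists (eta * ((p - 1) * M1) + `|b 0 / N.+1%:R| + (`|M| + `|M|)) => x Kx; have Ox := KO x Kx.
have [->|im] := eqVneq i ord_max.
  have /andP[E0 E1] := bE_max Ox; rewrite ger0_norm// -[leLHS]addr0 -addrA; apply: lerD; last by rewrite !addr_ge0.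
  apply: (le_trans E1); apply: ler_wpM2l; first exact: ltW.
  by apply: ler_wpM2l; [exact: ltW|exact: le_trans (ler_norm _) (HM1 x Kx)].
rewrite /bE im; case: ifPn => r0.
  have /andP[A1 A2] := bdZ_le (OA Ox) r0 (OB Ox) (Osg Ox).
  have /andP[B1 B2] := bZ_le (ltW (OB Ox)) (Osg Ox).
  have [M2 M3] := HM _ (OA Ox) r0 (OB Ox).
  have Yr : 0 <= Y (hrad x) / hrad x by apply: divr_ge0; [exact: prs (ltW (OB Ox))|exact: ltW].
  have NY : 0 <= N%:R * (Y (hrad x) / hrad x) by apply: mulr_ge0.
  have /andP[v0 v1] := @rad_ratio _ _ P 0 x i im.
  set dZ := dkq _ _ _ * _ in A1 A2 *; set v := _ / _ ^+ 2 in v0 v1 *.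
  have z0 : 0 <= kw (p - 2) (bq (hrad x)) (bsg x) * bq (hrad x) / hrad x by apply: divr_ge0 => //; exact: ltW.
  have z1 : kw (p - 2) (bq (hrad x)) (bsg x) * bq (hrad x) / hrad x <= `|M|.
    by apply: le_trans (ler_norm _); apply: le_trans M3; rewrite ler_pM2r ?invr_gt0.
  have d1 : dZ <= `|M|.
    by apply: le_trans (ler_norm _); apply: le_trans M2; apply: (le_trans A2); rewrite gerBl.
  rewrite ger0_norm; last by apply: addr_ge0; apply: mulr_ge0 => //; rewrite subr_ge0.
  rewrite -[leLHS]add0r; apply: lerD; first exact: addr_ge0.
  by apply: lerD; rewrite -[leRHS]mulr1; apply: ler_pM => //; rewrite ?subr_ge0// gerBl.
have r00 : hrad x = 0 by apply/eqP; rewrite eq_le rad_ge0 andbT leNgt.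
have /andP[A1 A2] := bE_axis Ox r00.
rewrite ger0_norm// -addrA -[leLHS]add0r; apply: lerD => //.
rewrite -[leLHS]addr0; apply: lerD; last exact: addr_ge0.
exact: le_trans A2 (ler_norm _).
Qed.

Lemma bsolves : solves p O bW bg (fun x => \sum_i bE i x).
Proof.
apply: (@classical_solves _ _ p p2 O _ _ bE) => //.
- by move=> x Ox; exact: bW_cont (Os Ox).
- exact: bW_derive.
- exact: bg_cont.
- exact: bX_derive.
- exact: bE_bounded.
Qed.

End barrier.

Lemma compact_superlevel {R : realType} {n : nat} (K : set 'rV[R]_n) (v : 'rV[R]_n -> R) c : compact K ->
  (forall x, K x -> {for x, continuous v}) -> compact [set x | K x /\ c <= v x].
Proof.
move=> cK cv; apply: (subclosed_compact _ cK); last by move=> x [].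
move=> x clx; have Kx : K x.
  have clK := compact_closed (@norm_hausdorff _ _) cK; apply: clK => U /clx [y [[Ky _] Uy]].
  by exists y.
split => //; rewrite leNgt; apply/negP => vc.
have /cvgr_lt /(_ _ vc) H := cv x Kx.
by have [y [[_ yc] /=]] := clx _ H; rewrite ltNge yc.
Qed.

Section barrier_bound.
Context {R : realType} (p : R) (f : R -> R) (N : nat) (A B s e : R) (Y b G : R -> R).
Hypothesis p2 : (2 : R) <= p.
Hypothesis hf : condition_F p f.
Hypothesis SP : super_profile p f N A B s e Y b G.
Implicit Types (x : 'rV[R]_N.+2).
Local Notation P := [pred i : 'I_N.+2 | i != ord_max].
Local Notation hrad := (rad P 0).

Definition slab t0 T : set 'rV[R]_N.+2 := [set x | A <= hrad x <= B /\ `|lastc x - t0| <= T].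

Lemma compact_slab t0 T : compact (slab t0 T).
Proof.
have cl : continuous (fun x : 'rV[R]_N.+2 => `|lastc x - t0|).
  move=> x; apply: (@cont_comp _ _ (fun r : R => `|r|) (fun x : 'rV[R]_N.+2 => lastc x - t0)); first exact: norm_continuous.
  by apply: (@contB _ _ (@lastc R N.+1) (fun=> t0)); [exact: lastc_cont|exact: cont_cst].
apply: (subclosed_compact _ (@compact_norm_le R N.+2 (`|B| + (`|T| + `|t0|)))).
  have -> : slab t0 T = hrad @^-1` [set r | A <= r] `&` (hrad @^-1` [set r | r <= B] `&`
     (fun x => `|lastc x - t0|) @^-1` [set r | r <= T]).
    apply/seteqP; split => x; first by case=> /andP[].
    by case=> /= H1 [H2 H3]; split => //; rewrite H1.
  apply: closedI; last apply: closedI.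
  - by apply: (@closed_comp _ _ hrad); [move=> x _; exact: continuous_rad|exact: closed_ge].
  - by apply: (@closed_comp _ _ hrad); [move=> x _; exact: continuous_rad|exact: closed_le].
  - by apply: (@closed_comp _ _ (fun x => `|lastc x - t0|)); [move=> x xT; exact: cl|exact: closed_le].
move=> x [/andP[_ xB] xT] /=; rewrite [leLHS]mx_normrE; apply: bigmax_le => [|[i j] _] /=.
  by rewrite !addr_ge0.
rewrite ord1.
have [->|jm] := eqVneq j ord_max.
  have := ler_normD (lastc x - t0) t0; rewrite subrK => /le_trans; apply.
  by rewrite -[leLHS]add0r; apply: lerD => //; apply: lerD => //; exact: le_trans xT (ler_norm _).
have := @coord_le_rad _ _ P 0 x j jm; rewrite mxE subr0 => /le_trans; apply.
by rewrite -[leLHS]addr0; apply: lerD; [exact: le_trans xB (ler_norm _)|exact: addr_ge0].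
Qed.

(* Comparison with [barr (hrad x) + eta / 2 * (lastc x - t0) ^+ 2]: the quadratic term exceeds [M] at the
   two ends of the slab, and its effect on the operator is absorbed by the gap [e] when [eta] is small. *)
Lemma barrier_bound (eps M : R) : 0 < eps -> 0 <= M -> exists2 T, 0 < T & forall t0 u gu O,
  slab t0 T `<=` O -> solves p O u gu (fun x => fbar f (u x)) ->
  (forall x, slab t0 T x -> u x <= M) ->
  (forall x, slab t0 T x -> hrad x = A \/ hrad x = B -> u x <= G (hrad x)) ->
  forall x, A <= hrad x <= B -> lastc x = t0 -> u x <= G (hrad x) + eps.
Proof.
move=> eps0 M0; have B0 := sp_B0 SP; have [Mb HMb] := sp_bound SP.
(* [barr] exceeds [G] by at most [delta (B - r) <= eps]. *)
pose delta := eps / B; have delta0 : 0 < delta by exact: divr_gt0.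
pose Q := sroot p delta (`|Mb| * B) `^ (p - 2).
have p1 : 0 < p - 1 by rewrite subr_gt0; apply: lt_le_trans p2; rewrite ltr1n.
pose k := (p - 1) * Q; have k0 : 0 <= k by apply: mulr_ge0; [exact: ltW|exact: powR_ge0].
have e0 := sp_e0 SP.
(* The first bound keeps the vertical error [eta k] below the gap [e]. The second makes
   [eta T^2 / 2 >= M] for [T = delta / eta], while the largest vertical slope [eta T] is exactly the
   permitted [delta]. *)
pose eta := Num.min (e / (k + 1)) (delta ^+ 2 / (2 * (M + 1))).
have k1 : 0 < k + 1 by apply: ltr_wpDl.
have M1 : 0 < 2 * (M + 1) by apply: mulr_gt0 => //; apply: ltr_wpDl.
have eta0 : 0 < eta by rewrite lt_min !divr_gt0// exprn_gt0.
have etak : eta * k < e.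
  have : eta <= e / (k + 1) by rewrite ge_min lexx.
  rewrite ler_pdivlMr//; apply: lt_le_trans; rewrite ltr_pM2l// ltrDl//.
have etaM : eta * (2 * (M + 1)) <= delta ^+ 2.
  by rewrite -ler_pdivlMr// ge_min lexx orbT.
pose T := delta / eta; have T0 : 0 < T by exact: divr_gt0.
have etaT : M <= eta / 2 * T ^+ 2.
  rewrite (_ : eta / 2 * T ^+ 2 = delta ^+ 2 / (eta * 2)); last by rewrite /T; field; rewrite gt_eqF.
  rewrite ler_pdivlMr ?mulr_gt0//; apply: le_trans etaM; nra.
exists T => // t0 u gu O sO su uM uG x xAB xt.
have [lxA|xA] := leP (hrad x) A.
  have xA : hrad x = A by apply/eqP; rewrite eq_le lxA; case/andP: xAB.
  have Sx : slab t0 T x by split => //; rewrite xt subrr normr0 ltW.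
  by apply: (le_trans (uG x Sx (or_introl xA))); rewrite lerDl ltW.
have [lxB|xB] := leP B (hrad x).
  have xB : hrad x = B by apply/eqP; rewrite eq_le lxB andbT; case/andP: xAB.
  have Sx : slab t0 T x by split => //; rewrite xt subrr normr0 ltW.
  by apply: (le_trans (uG x Sx (or_intror xB))); rewrite lerDl ltW.
pose O1 := [set y : 'rV[R]_N.+2 | A < hrad y /\ hrad y < B /\ `|lastc y - t0| < T].
have oO1 : open O1.
  rewrite openE => y [y1 [y2 y3]].
  have H1 : \forall z \near y, A < hrad z by have /cvgr_gt := @continuous_rad _ _ P 0 y; exact.
  have H2 : \forall z \near y, hrad z < B by have /cvgr_lt := @continuous_rad _ _ P 0 y; exact.
  have H3 : \forall z \near y, `|lastc z - t0| < T.
    have cl : {for y, continuous (fun x : 'rV[R]_N.+2 => `|lastc x - t0|)}.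
      apply: (@cont_comp _ _ (fun r : R => `|r|) (fun x : 'rV[R]_N.+2 => lastc x - t0)); first exact: norm_continuous.
      by apply: (@contB _ _ (@lastc R N.+1) (fun=> t0)); [exact: lastc_cont|exact: cont_cst].
    by have /cvgr_lt := cl; exact.
  by apply: filterS3 H1 H2 H3.
have O1S y : O1 y -> slab t0 T y by move=> [y1 [y2 y3]]; split; rewrite ?ltW.
have O1g y : O1 y -> `|bsg eta t0 y| <= delta.
  by move=> [_ [_ y3]]; rewrite /bsg normrM gtr0_norm// mulrC -ler_pdivlMr// ltW.
have O1A y : O1 y -> A < hrad y by case.
have O1B y : O1 y -> hrad y < B by case=> _ [].
have sW := bsolves p2 SP delta0 eta0 oO1 O1A O1B O1g.
have sub : O1 `<=` O by move=> y /O1S /sO.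
have [uc _ _] := su.
have Ws y : slab t0 T y -> hrad y < s.
  by move=> [/andP[_ yB] _]; exact: le_lt_trans yB (sp_Bs SP).
have Wlow y : slab t0 T y -> G (hrad y) + eta / 2 * (lastc y - t0) ^+ 2 <= bW p B Y G delta eta t0 y.
  move=> [/andP[yA yB] _]; rewrite lerD2r.
  by apply: (barr_ge p2 SP delta0) => //; exact: rad_ge0.
have quad0 (z : R) : 0 <= eta / 2 * z ^+ 2 by apply: mulr_ge0; [exact: divr_ge0 (ltW eta0) (ler0n _ _)|exact: sqr_ge0].
have uW y : O1 y -> u y <= bW p B Y G delta eta t0 y.
  apply: (comparison p2 oO1 (solves_sub sub su) sW) => [c c0|z Oz uz].
    have -> : [set x0 | O1 x0 /\ c <= u x0 - bW p B Y G delta eta t0 x0] =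
        [set x0 | slab t0 T x0 /\ c <= u x0 - bW p B Y G delta eta t0 x0].
      apply/seteqP; split => z [Oz cz]; split => //; first exact: O1S.
      have [/andP[zA zB] zT] := Oz.
      have Wz := Wlow z Oz.
      have h1 : bW p B Y G delta eta t0 z < u z.
        by rewrite -subr_gt0; exact: lt_le_trans cz.
      have h2 : G (hrad z) < u z.
        by apply: le_lt_trans h1; apply: le_trans Wz; rewrite lerDl.
      have nAB : ~ (hrad z = A \/ hrad z = B).
        by move=> /(uG z Oz); rewrite leNgt h2.
      split; first by rewrite lt_neqAle zA andbT; apply/eqP => E; apply: nAB; left.
      split; first by rewrite lt_neqAle zB andbT; apply/eqP => E; apply: nAB; right.
      rewrite lt_neqAle zT andbT; apply/eqP => E.
      have : u z <= bW p B Y G delta eta t0 z.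
        apply: (le_trans (uM z Oz)); apply: (le_trans etaT); apply: le_trans Wz.
        rewrite -E real_normK ?num_real// lerDr.
        by apply: (sp_sol0 SP) => //; exact: rad_ge0.
      by rewrite leNgt h1.
    apply: compact_superlevel; first exact: compact_slab.
    move=> z Sz; apply: (@contB _ _ u); first exact: uc (sO z Sz).
    by apply: (@bW_cont _ _ _ _ _ _ _ _ _ _ _ p2 SP); exact: Ws Sz.
  have rz := rad_ge0 P 0 z.
  apply: (le_lt_trans (bE_sum_le p2 SP delta0 eta0 O1A O1B O1g Oz)).
  have Yz : Y (hrad z) <= `|Mb| * B.
    move: rz; rewrite le_eqVlt => /orP[/eqP r0|r0].
      have A0 : A < 0 by rewrite r0; exact: O1A.
      by have [Y0 _ _] := sp_axis SP A0; rewrite -r0 Y0; apply: mulr_ge0 => //; exact: ltW.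
    have [_ HY] := HMb _ (O1A z Oz) r0 (O1B z Oz).
    rewrite -(divfK (lt0r_neq0 r0) (Y (hrad z))); apply: (@le_trans _ _ (`|Mb| * hrad z)).
      by rewrite ler_pM2r//; exact: le_trans HY (ler_norm _).
    by apply: ler_wpM2l => //; exact: ltW (O1B z Oz).
  have Y0 := sp_flux0 SP (Ws z (O1S z Oz)).
  have sk : sroot p delta (Y (hrad z)) `^ (p - 2) <= Q.
    apply: ge0_ler_powR; rewrite ?nnegrE ?powR_ge0 ?subr_ge0//.
    apply: ge0_ler_powR; rewrite ?nnegrE ?addr_ge0 ?powR_ge0 ?invr_ge0 ?(ltW p1)//.
      by apply: mulr_ge0 => //; exact: ltW.
    by rewrite lerD2r.
  have hs := sp_super SP (O1A z Oz) rz (O1B z Oz).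
  have h1 : b (hrad z) + eta * ((p - 1) * sroot p delta (Y (hrad z)) `^ (p - 2)) < b (hrad z) + e.
    rewrite ltrD2l; apply: le_lt_trans etak; apply: ler_wpM2l; first exact: ltW.
    by apply: ler_wpM2l; first exact: ltW.
  apply: (lt_le_trans h1); apply: (le_trans hs); apply: (fbar_nondecr hf).
  apply: (le_trans _ (ltW uz)); apply: le_trans (Wlow z (O1S z Oz)).
  by rewrite lerDl.
have Ox : O1 x by split => //; split => //; rewrite xt subrr normr0.
apply: (le_trans (uW x Ox)); rewrite /bW xt subrr expr0n /= mulr0 addr0.
have r0 := rad_ge0 P 0 x.
apply: (le_trans (barr_le p2 SP delta0 (ltW xA) r0 (ltW xB))); rewrite lerD2l.
rewrite /delta mulrAC -[leRHS]mulr1 -mulrA; apply: ler_wpM2l; first exact: ltW.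
by rewrite ler_pdivrMr// mul1r gerBl.
Qed.

End barrier_bound.

(** * Upper bound *)

Lemma nondecr_flat {R : realType} (F : R -> R) a b c (d : R) : (forall r t : R, a <= r -> r <= t -> t <= b -> F r <= F t) ->
  F a = F b -> a < c -> c < b -> is_derive c 1 F d -> d = 0.
Proof.
move=> Fm Fab ac cb dF.
have cst : is_derive c 1 F 0.
  apply: near_eq_is_derive (isd_cst (F a) c 1).
  have H : nbhs c [set t | a < t /\ t < b].
    by apply: open_nbhs_nbhs; split => //; apply: openI; [exact: open_gt|exact: open_lt].
  apply: filterS H => t [at_ tb]; apply/eqP; rewrite eq_le; apply/andP; split.
    by apply: Fm => //; exact: ltW.
  by rewrite Fab; apply: Fm => //; exact: ltW.
have [_ <-] := dF; by have [_ ->] := cst.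
Qed.

(** If the fluxes agreed at [c], the nondecreasing primitive of [t^N (g - h)] would vanish at both
    ends of [[0, c]], hence have derivative zero at [r]. *)
Lemma flux_lt {R : realType} (N : nat) (s : R) (h g : R -> R) c r : (forall r, r < s -> {for r, continuous h}) ->
  (forall r, r < s -> {for r, continuous g}) -> (forall t, 0 <= t -> t < s -> h t <= g t) -> c < s ->
  0 < r -> r < c -> h r < g r -> flux N h c < flux N g c.
Proof.
move=> ch cg hg cs r0 rc hgr; have c0 := lt_trans r0 rc.
have cw (k : R -> R) : (forall r, r < s -> {for r, continuous k}) -> forall r, r < s -> {for r, continuous (fun t : R => t ^+ N * k t)}.
  move=> ck t ts; apply: contM; last exact: ck.
  exact: isd_cont (isd_exp N t).
have cwh := cw h ch; have cwg := cw g cg.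
rewrite lt_neqAle; apply/andP; split; last first.
  by apply: (@flux_le _ N s _ _ _ ch cg cs) => t t0 tc; apply: hg => //; exact: le_lt_trans cs.
apply/eqP => E.
pose F t := prim (fun t => t ^+ N * g t) t - prim (fun t => t ^+ N * h t) t.
have dF t : 0 < t -> t < s -> is_derive t 1 F (t ^+ N * g t - t ^+ N * h t).
  by move=> t0 ts; apply: isdB; apply: (is_derive_prim (s := s)).
have cF t : t < s -> {for t, continuous F}.
  by move=> ts; apply: contB; [exact: (prim_cont cwg)|exact: (prim_cont cwh)].
have Fm t t' : 0 <= t -> t <= t' -> t' <= c -> F t <= F t'.
  move=> t0 tt' t'c.
  apply: (@derive_ge0_le _ F (fun t => t ^+ N * g t - t ^+ N * h t)) => // v tv vt'.
    have v0 : 0 < v by exact: le_lt_trans tv.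
    have vs : v < s by apply: lt_trans vt' _; exact: le_lt_trans cs.
    split; first exact: dF.
    by rewrite -mulrBr mulr_ge0 ?exprn_ge0 ?(ltW v0)// subr_ge0 hg// ltW.
  by apply: cF; apply: le_lt_trans vt' _; exact: le_lt_trans cs.
have F0 : F 0 = 0 by rewrite /F !prim0// subrr.
have Fc : F c = 0.
  move: E; rewrite /flux /F => E; have cn : c ^+ N != 0 by rewrite gt_eqF// exprn_gt0.
  by apply/eqP; rewrite subr_eq0 -(divfK cn (prim _ c)) -E divfK.
have H := nondecr_flat Fm (etrans F0 (esym Fc)) r0 rc (dF r r0 (lt_trans rc cs)).
have : 0 < r ^+ N * g r - r ^+ N * h r.
  by rewrite -mulrBr mulr_gt0 ?exprn_gt0// subr_gt0.
by rewrite H ltxx.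
Qed.

Lemma cvg_lt_ex {R : realType} (u_ : nat -> R) (l b : R) : u_ j @[j --> \oo] --> l -> l < b -> exists j, u_ j < b.
Proof. by move=> /cvgr_lt H /H [n _ Hn]; exists n; apply: Hn => /=. Qed.

Section upper_bound.
Context {R : realType} (p : R) (f : R -> R) (N : nat).
Hypothesis p2 : (2 : R) <= p.
Hypothesis hf : condition_F p f.
Implicit Types (x : 'rV[R]_N.+2) (l r k rho : R).
Local Notation P := [pred i : 'I_N.+2 | i != ord_max].
Local Notation hrad := (rad P 0).
Local Notation fbar := (fbar f).

Let p1 : 0 < p - 1. Proof. by rewrite subr_gt0; apply: lt_le_trans p2; rewrite ltr1n. Qed.

Variables (Sl : R -> set 'rV[R]_N.+2) (ul : R -> 'rV[R]_N.+2 -> R) (gl : R -> 'rV[R]_N.+2 -> 'rV[R]_N.+2).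
Hypothesis solv : forall l, 0 < l -> solves p (Sl l) (ul l) (gl l) (fun x => fbar (ul l x)).
Hypothesis cyl : forall l x, hrad x < 1 -> `|lastc x| < l -> Sl l x.

(* [Q l x] holds at all points that are far enough from the caps of the [l]-th domain. *)
Definition deep (Q : R -> 'rV[R]_N.+2 -> Prop) := exists2 L, 0 <= L & forall l x, `|lastc x| + L <= l -> Q l x.

Lemma deepI Q1 Q2 : deep Q1 -> deep Q2 -> deep (fun l x => Q1 l x /\ Q2 l x).
Proof.
move=> [L1 L10 H1] [L2 L20 H2]; exists (L1 + L2); first exact: addr_ge0.
by move=> l x H; split; [apply: H1|apply: H2]; apply: le_trans H; rewrite lerD2l ?lerDl ?lerDr.
Qed.

Lemma deepS Q1 Q2 : (forall l x, Q1 l x -> Q2 l x) -> deep Q1 -> deep Q2.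
Proof. by move=> H [L L0 HL]; exists L => // l x /HL /H. Qed.

Lemma deep_barrier A B s e Y b G eps M : super_profile p f N A B s e Y b G -> B < 1 -> 0 < eps -> 0 <= M ->
  deep (fun l x => A <= hrad x <= B -> ul l x <= M) ->
  deep (fun l x => hrad x = A \/ hrad x = B -> ul l x <= G (hrad x)) ->
  deep (fun l x => A <= hrad x <= B -> ul l x <= G (hrad x) + eps).
Proof.
move=> SP B1 eps0 M0 [L1 L10 H1] [L2 L20 H2].
have [T T0 HT] := barrier_bound p2 hf SP eps0 M0.
(* Heights in the slab differ from that of [x] by at most [T]; the extra 1 places the slab strictly
   inside the straight part of the [l]-th domain. *)
exists (T + 1 + (L1 + L2)); first by apply: addr_ge0; apply: addr_ge0 => //; exact: ltW.
move=> l x xl xAB.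
have l0 : 0 < l.
  apply: lt_le_trans xl; apply: ltr_wpDl => //; apply: ltr_wpDr; first exact: addr_ge0.
  by apply: addr_gt0 => //; exact: ltr01.
have St (y : 'rV[R]_N.+2) : slab A B (lastc x) T y -> `|lastc y| <= `|lastc x| + T.
  move=> [_ yT]; have := ler_normD (lastc y - lastc x) (lastc x); rewrite subrK => /le_trans; apply.
  by rewrite addrC lerD2l.
have T1 (y : 'rV[R]_N.+2) : slab A B (lastc x) T y -> `|lastc y| + (1 + (L1 + L2)) <= l.
  move=> /St yT; apply: le_trans xl; by rewrite -(addrA T) [leRHS]addrA lerD2r.
apply: (HT (lastc x) (ul l) (gl l) (Sl l)) => //.
- move=> y Sy; have [/andP[_ yB] _] := Sy; apply: cyl; first exact: le_lt_trans yB B1.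
  by apply: lt_le_trans (T1 y Sy); rewrite ltrDl ltr_pwDl// addr_ge0.
- exact: solv.
- move=> y Sy; have [yAB _] := Sy; apply: H1 => //; apply: le_trans (T1 y Sy).
  by rewrite lerD2l addrCA lerDl addr_ge0.
- move=> y Sy yE; apply: H2 => //; apply: le_trans (T1 y Sy).
  by rewrite lerD2l addrA lerDr addr_ge0.
Qed.

Hypothesis ub : forall rho, rho < 1 -> exists2 M, 0 <= M & deep (fun l x => hrad x <= rho -> ul l x <= M).

Variable U : R -> R.
Local Notation h := (fun r => fbar (U r)).
Hypothesis Uc : forall r, r < 1 -> {for r, continuous U}.
Hypothesis Um : forall r t, r <= t -> t < 1 -> U r <= U t.
Hypothesis U_large : forall M, exists2 r, r < 1 & forall t, r <= t -> t < 1 -> M <= U t.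
Hypothesis U0 : forall r, r < 1 -> 0 <= U r.
Hypothesis Ueq : forall r, r < 1 -> U r = profile p N (U 0) h r.

Let hc r : r < 1 -> {for r, continuous h}.
Proof. by move=> r1; apply: cont_comp; [exact: (fbar_cont hf)|exact: Uc]. Qed.
Let h0 r : 0 <= h r. Proof. exact: (fbar_ge0 hf). Qed.
Let hm r t : r <= t -> t < 1 -> h r <= h t. Proof. by move=> rt t1; apply: (fbar_nondecr hf); exact: Um. Qed.

Local Notation Y := (flux N h).

Let ode : radial_ode p N.+1 1 h Y (profile p N (U 0) h).
Proof. by apply: (@radial_ode_profile _ p N p2 1 h) => // r t _; exact: hm. Qed.

Let dU r : 0 < r -> r < 1 -> is_derive r 1 U (Y r `^ (p - 1)^-1).
Proof.
move=> r0 r1; apply: near_eq_is_derive (ode_sol ode r0 r1).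
have H : nbhs r [set t | t < 1] by apply: open_nbhs_nbhs; split; [exact: open_lt|exact: r1].
by apply: filterS H => t /= t1; rewrite -Ueq.
Qed.

Definition within k rho := deep (fun l x => hrad x <= rho -> ul l x <= U (hrad x) + k).

Lemma within_le k k' rho rho' : k <= k' -> rho' <= rho -> within k rho -> within k' rho'.
Proof.
move=> kk rr; apply: deepS => l x H xr; apply: (le_trans (H (le_trans xr rr))).
by rewrite lerD2l.
Qed.

Let m : R := N.+1%:R.
Let m1 : 1 <= m. Proof. by rewrite /m ler1n. Qed.
(** The offset [1 / (4 (N + 1))], shared with [r_out], is small enough for
    [N r_out <= (N + 1) r_in], the inequality that pays for the curvature term in [bo_le]. *)
Definition r_in : R := 1 - (4 * m)^-1.
Definition r_out : R := 1 + (4 * m)^-1.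

Let im : 0 < (4 * m)^-1 <= 1 / 4.
Proof.
have m0 : 0 < m by exact: lt_le_trans ltr01 m1.
rewrite mul1r invr_gt0 mulr_gt0//= lef_pV2 ?posrE ?mulr_gt0//.
by rewrite ler_peMr.
Qed.

Lemma r_in_gt0 : 0 < r_in. Proof. rewrite /r_in; move: im; move: (_^-1) => w /andP[w0 w1]; lra. Qed.
Lemma r_in_lt1 : r_in < 1. Proof. rewrite /r_in; move: im; move: (_^-1) => w /andP[w0 w1]; lra. Qed.
Lemma r_out_gt1 : 1 < r_out. Proof. rewrite /r_out; move: im; move: (_^-1) => w /andP[w0 w1]; lra. Qed.
Lemma r_out_lt2 : r_out < 2. Proof. rewrite /r_out; move: im; move: (_^-1) => w /andP[w0 w1]; lra. Qed.
Lemma r_out_in : N%:R * r_out <= m * r_in.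
Proof.
rewrite /r_in /r_out.
have mN : N%:R = m - 1 :> R by rewrite /m -natr1 addrK.
have m0 : 0 < m by exact: lt_le_trans ltr01 m1.
have H : m * (4 * m)^-1 = 1 / 4 by field; rewrite gt_eqF.
rewrite mN; move: im H; move: (_^-1) => w /andP[w0 w1] H; nra.
Qed.

(** * The outer step: from the radius [r_in] to every radius below 1 *)

Section outer.
Variables (alpha k B s : R).
Hypothesis alpha0 : 0 < alpha.
Hypothesis alpha1 : alpha < 1.
Hypothesis k0 : 0 < k.
(** The contraction towards [r_out > 1]: it moves every radius of the unit ball outwards, so that
    [U (phi r) >= U r] and [U (phi r)] becomes infinite already at [s < 1]. *)
Let phi r := (1 - alpha) * r + alpha * r_out.
Hypothesis rB : r_in < B.
Hypothesis Bs : B < s.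
Hypothesis phis : phi s = 1.

Let a1 : 0 < 1 - alpha. Proof. by rewrite subr_gt0. Qed.

Let phi_lt r t : r < t -> phi r < phi t. Proof. by move=> rt; rewrite ltrD2r ltr_pM2l. Qed.

Let phi1 r : r < s -> phi r < 1. Proof. by rewrite -phis; exact: phi_lt. Qed.

Let dphi r : is_derive r 1 phi (1 - alpha).
Proof.
apply: (is_derive_eq (isdD (isdZ (1 - alpha) (isd_id r 1)) (isd_cst (alpha * r_out) r 1))).
by rewrite mulr1 addr0.
Qed.

Let cphi r : {for r, continuous phi}. Proof. exact: isd_cont (dphi r). Qed.

(** The flux of [U (phi r) + k], whose slope is [(1 - alpha) U'(phi r)]. The function [bo] is its
    radial divergence, in which the curvature term carries [1 / r] in place of [1 / phi r]. *)
Let Yo r := (1 - alpha) `^ (p - 1) * Y (phi r).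
Let bo r := (1 - alpha) `^ (p - 1) * ((1 - alpha) * (h (phi r) - N%:R * (Y (phi r) / phi r)) + N%:R * (Y (phi r) / r)).

Let phi_gt0 r : 0 < r -> 0 < phi r.
Proof.
by move=> r0; rewrite addr_gt0 ?mulr_gt0//; apply: lt_trans r_out_gt1.
Qed.

Let w0 : 0 < (1 - alpha) `^ (p - 1). Proof. exact: powR_gt0. Qed.
Let w1 : (1 - alpha) `^ (p - 1) <= 1 - alpha.
Proof. by apply: ge1r_powR; [rewrite a1 gerBl ltW|rewrite lerBrDr]. Qed.

Let bo_incr r : 0 < r -> bo r - N%:R * (Yo r / r) = (1 - alpha) `^ (p - 1) * ((1 - alpha) * (h (phi r) - N%:R * (Y (phi r) / phi r))).
Proof. by move=> r0; rewrite /bo /Yo; ring. Qed.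

Let ratio r : 0 < r -> r < s -> 0 <= Y (phi r) / phi r /\ m * (Y (phi r) / phi r) <= h (phi r).
Proof.
move=> r0 rs; have /andP[H1 H2] := ode_bound ode (phi_gt0 r0) (phi1 rs); split => //.
by rewrite mulrC -ler_pdivlMr// ltr0n.
Qed.

Let bo_le r : r_in < r -> r < s -> bo r <= (1 - alpha) * h (phi r).
Proof.
move=> rr rs; have r0 : 0 < r by exact: lt_trans r_in_gt0 rr.
have p0 := phi_gt0 r0; have [y0 y1] := ratio r0 rs.
have E : Y (phi r) / r = Y (phi r) / phi r * ((1 - alpha) + alpha * (r_out / r)).
  rewrite /phi; field; rewrite -/(phi r) !gt_eqF//.
suff : (1 - alpha) * (h (phi r) - N%:R * (Y (phi r) / phi r)) + N%:R * (Y (phi r) / r) <= h (phi r).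
  by move=> H; apply: (le_trans (ler_wpM2l (ltW w0) H)); exact: ler_wpM2r.
rewrite E; move: y0 y1; set y := Y _ / _; set H := h (phi r) => y0 y1.
have : N%:R * (r_out / r) <= m.
  rewrite mulrA ler_pdivrMr//; apply: (le_trans r_out_in).
  by apply: ler_wpM2l; [exact: ler0n|exact: ltW].
move: (r_out / r) => v Hv.
have : alpha * (y * (N%:R * v)) <= alpha * H.
  apply: ler_wpM2l; first exact: ltW.
  by apply: le_trans y1; rewrite mulrC; exact: ler_wpM2r.
by move=> H3; rewrite [leLHS](_ : _ = (1 - alpha) * H + alpha * (y * (N%:R * v))); [lra|ring].
Qed.

(* Since [phi] reaches 1 before [s < 1], the profile [U (phi r) + k] is large at [B], so that a bound by
   [U + k] is needed at the inner radius only. *)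
Lemma outer_profile : super_profile p f N r_in B s (alpha * fbar k) Yo bo (fun r => U (phi r) + k).
Proof.
have ri := r_in_gt0.
have pos r : r_in < r -> 0 < r by exact: lt_trans ri.
have Yp r : r < s -> 0 <= Y (phi r).
  by move=> rs; apply: (@flux_nneg _ N 1 h) => //; exact: phi1.
split => //.
- exact: lt_trans rB.
- by apply: mulr_gt0 => //; exact: (fbar_gt0 hf).
- move=> r rs; apply: contM; first exact: cont_cst.
  by apply: (@cont_comp _ _ Y phi); [exact: (flux_cont hc (phi1 rs))|exact: cphi].
- by move=> r rs; apply: mulr_ge0; [exact: ltW|exact: Yp].
- move=> r rs; apply: contD; last exact: cont_cst.
  by apply: (@cont_comp _ _ U phi); [exact: Uc (phi1 rs)|exact: cphi].
- by move=> r _ _ rB'; apply: addr_ge0; [exact: U0 (phi1 (le_lt_trans rB' Bs))|exact: ltW].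
- move=> r rr r0 rB'; have rs := lt_trans rB' Bs; rewrite bo_incr//.
  have dY := isd_comp (ode_flux ode (phi_gt0 r0) (phi1 rs)) (dphi r).
  apply: (is_derive_eq (isdZ ((1 - alpha) `^ (p - 1)) dY)).
  by congr (_ * _); exact: mulrC.
- move=> r rr r0 rB'; have rs := lt_trans rB' Bs; rewrite bo_incr//.
  have [y0 y1] := ratio r0 rs.
  apply: mulr_ge0; first exact: ltW.
  apply: mulr_ge0; first exact: ltW.
  rewrite subr_ge0; apply: le_trans y1; apply: ler_wpM2r => //.
  by rewrite /m ler_nat.
- move=> r rr r0 rB'; have rs := lt_trans rB' Bs.
  have dU' := isd_comp (dU (phi_gt0 r0) (phi1 rs)) (dphi r).
  apply: (is_derive_eq (isdD dU' (isd_cst k r 1))).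
  rewrite addr0 /Yo (powRM _ (ltW w0) (Yp r rs)) -powRrM mulfV ?(gt_eqF p1)// (powRr1 (ltW a1)).
  exact: mulrC.
- exists (h (phi B) + h (phi B) / r_in) => r rr r0 rB'; have rs := lt_trans rB' Bs.
  have hB : h (phi r) <= h (phi B) by apply: hm (ltW (phi_lt rB')) (phi1 Bs).
  have hr : 0 <= h (phi B) by exact: h0.
  split.
    apply: (le_trans (bo_le rr rs)); rewrite -[leLHS]addr0; apply: lerD; last by apply: divr_ge0 => //; exact: ltW.
    by apply: le_trans hB; rewrite ler_piMl// gerBl ltW.
  have [y0 y1] := ratio r0 rs.
  rewrite -[leLHS]add0r; apply: lerD => //.
  rewrite ler_pdivrMr// mulrAC ler_pdivlMr//.
  have H1 : Yo r <= h (phi B).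
    have Y1 : Y (phi r) <= h (phi B).
      apply: le_trans hB; apply: le_trans y1; rewrite -[leLHS](divfK (lt0r_neq0 (phi_gt0 r0))).
      rewrite mulrC; apply: ler_wpM2r => //; apply: (le_trans (ltW (phi1 rs))); exact: m1.
    apply: le_trans Y1; rewrite ler_piMl ?Yp//; apply: (le_trans w1); by rewrite gerBl ltW.
  by apply: ler_pM => //; [apply: mulr_ge0; [exact: ltW|exact: Yp]|exact: ltW|exact: ltW].
- move=> r rr r0 rB'; have rs := lt_trans rB' Bs.
  apply: (@le_trans _ _ ((1 - alpha) * fbar (U (phi r) + k) + alpha * fbar (U (phi r) + k))); last first.
    by rewrite -mulrDl subrK mul1r.
  have Up := U0 (phi1 rs).
  apply: lerD.
    apply: (le_trans (bo_le rr rs)); apply: ler_wpM2l; first exact: ltW.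
    by apply: (fbar_nondecr hf); rewrite lerDl ltW.
  apply: ler_wpM2l; first exact: ltW.
  by apply: (fbar_nondecr hf); rewrite lerDr.
- by move=> H; have := lt_trans H ri; rewrite ltxx.
Qed.

End outer.

(** For small [alpha] the barrier [U (phi r) + k] is within [eps / 2] of [U + k] on [[0, rho]]; the
    other [eps / 2] is the loss in [deep_barrier]. *)
Lemma within_outer k eps rho : 0 < k -> within k r_in -> 0 < eps -> rho < 1 -> within (k + eps) rho.
Proof.
move=> k0 S0 eps0; wlog rr : rho / r_in < rho.
  move=> W rho1; have [/W|rr] := ltP r_in rho; first exact.
  by apply: (@within_le k _ r_in) => //; rewrite lerDl ltW.
move=> rho1; have ri := r_in_gt0; have ro1 := r_out_gt1; have ro2 := r_out_lt2.
have cK : compact `[0, rho]%classic by exact: segment_compact.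
have cU (t : R) : `[0, rho]%classic t -> {for t, continuous U}.
  by rewrite /= in_itv /= => /andP[_ tr]; apply: Uc; exact: le_lt_trans rho1.
have e2 : 0 < eps / 2 by exact: divr_gt0.
have [d d0 Hd] := compact_unif cK cU e2.
(* As [r_out < 2], the bound [d / 4] gives [|phi r - r| < d], and [(1 - rho) / 4] keeps
   [phi rho < 1]. *)
pose alpha := Num.min (d / 4) (Num.min ((1 - rho) / 4) 2^-1).
have al0 : 0 < alpha by rewrite !lt_min !divr_gt0 ?subr_gt0// invr_gt0 ltr0n.
have [al1 [al2 al3]] : alpha <= d / 4 /\ alpha <= (1 - rho) / 4 /\ alpha <= 1 / 2.
  by rewrite /alpha !ge_min !lexx ?orbT /= mul1r lexx ?orbT.
clearbody alpha.
have alpha1 : alpha < 1 by lra.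
pose phi r := (1 - alpha) * r + alpha * r_out.
have phiE r : phi r = r + alpha * (r_out - r) by rewrite /phi; ring.
have phi_rho : phi rho < 1 by rewrite phiE; nra.
have a1 : 0 < 1 - alpha by lra.
pose psi v := (v - alpha * r_out) / (1 - alpha).
have psiK v : phi (psi v) = v by rewrite /phi /psi; field; rewrite gt_eqF.
have phi_lt r t : (phi r < phi t) = (r < t) by rewrite ltrD2r ltr_pM2l.
pose s := psi 1.
have rhos : rho < s by rewrite -phi_lt psiK.
have s1 : s < 1.
  by rewrite -phi_lt psiK phiE -subr_gt0; nra.
have [M M0 HM] := ub s1.
have [r' r'1 Hr'] := U_large M.
(* Beyond [rho] and beyond the radius from which [U (phi r) >= M], where [M] bounds the [ul l] up to
   radius [s] away from the caps. *)
pose B := (Num.max rho (psi r') + s) / 2.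
have ms : Num.max rho (psi r') < s by rewrite gt_max rhos -phi_lt !psiK.
have [mr mp] : rho <= Num.max rho (psi r') /\ psi r' <= Num.max rho (psi r') by rewrite !le_max !lexx orbT.
have [rhoB [pB Bs]] : rho < B /\ psi r' < B /\ B < s.
  rewrite /B; move: (Num.max _ _) ms mr mp => w H1 H2 H3; split; [lra|split; lra].
clearbody B.
have phiB : phi B < 1 by rewrite -(psiK 1) phi_lt.
have MB : M <= U (phi B) by apply: Hr' => //; rewrite -(psiK r'); apply: ltW; rewrite phi_lt.
have rB : r_in < B by exact: lt_trans rhoB.
have SP := outer_profile al0 alpha1 k0 rB Bs (psiK 1).
have D1 : deep (fun l x => r_in <= hrad x <= B -> ul l x <= M).
  by apply: deepS HM => l x H /andP[_ xB]; apply: H; exact: le_trans xB (ltW Bs).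
have D2 : deep (fun l x => hrad x = r_in \/ hrad x = B -> ul l x <= U (phi (hrad x)) + k).
  apply: deepS (deepI S0 HM) => l x [H1 H2] [E|E].
    have phii : phi (hrad x) < 1 by rewrite E; apply: lt_trans phiB; rewrite phi_lt.
    apply: (le_trans (H1 _)); first by rewrite E.
    rewrite lerD2r; apply: Um => //; rewrite phiE lerDl; apply: mulr_ge0; first exact: ltW.
    rewrite subr_ge0 E; apply: ltW; apply: lt_trans ro1; exact: r_in_lt1.
  apply: (@le_trans _ _ M); first by apply: H2; rewrite E ltW.
  by rewrite E; apply: (le_trans MB); rewrite lerDl ltW.
have D3 := deep_barrier SP (lt_trans Bs s1) e2 M0 D1 D2.
apply: deepS (deepI S0 D3) => l x [H1 H2] xr.
have [xi|xi] := leP (hrad x) r_in.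
  by apply: (le_trans (H1 xi)); rewrite lerD2l lerDl ltW.
have {}H2 : ul l x <= U (phi (hrad x)) + k + eps / 2.
  by apply: H2; rewrite (ltW xi) ltW// (le_lt_trans xr).
have x0 := rad_ge0 P 0 x.
have Kx : `[0, rho]%classic (hrad x) by rewrite /= in_itv /= x0.
have xd : `|hrad x - phi (hrad x)| < d.
  rewrite phiE distrC addrAC subrr add0r ger0_norm; last by apply: mulr_ge0; [exact: ltW|lra].
  nra.
have := Hd _ _ Kx xd; rewrite ltr_norml => /andP[H3 _].
move: H2 H3; move: (U (phi (hrad x))) (U (hrad x)) (ul l x) => w1 w2 w3 H2 H3.
lra.
Qed.

(** Otherwise [fbar (v + k) <= fbar v] for every [v >= U (1/2)], since [U] takes all these values on
    []0, 1[]; then [fbar] is bounded along steps of length [k], against superlinear growth. *)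
Lemma strict_gain k : 0 < k -> exists2 r, 0 < r < 1 & h r < fbar (U r + k).
Proof.
move=> k0; apply: contrapT => H.
have E r : 0 < r -> r < 1 -> fbar (U r + k) <= h r.
  by move=> r0 r1; rewrite leNgt; apply/negP => hr; apply: H; exists r => //; rewrite r0.
have hf0 : (0 : R) < 1 / 2 by exact: divr_gt0.
pose v0 := U (1 / 2).
have step v : v0 <= v -> fbar (v + k) <= fbar v.
  move=> v0v; have [r r1 Hr] := U_large v.
  pose b := Num.max r (1 / 2).
  have b1 : b < 1 by rewrite /b gt_max r1 /=; lra.
  have vb : v <= U b by apply: Hr => //; rewrite le_max lexx.
  have hb : 1 / 2 <= b by rewrite le_max lexx orbT.
  have cU : {within `[1 / 2, b], continuous U}.
    by apply: within_itv_cont => t _ tb; apply: Uc; exact: le_lt_trans b1.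
  have vm : Num.min (U (1 / 2)) (U b) <= v <= Num.max (U (1 / 2)) (U b).
    by rewrite ge_min v0v /= le_max vb orbT.
  have [c] := IVT hb cU vm; rewrite in_itv /= => /andP[c1 c2] <-.
  by apply: E; [exact: lt_le_trans c1|exact: le_lt_trans b1].
have bnd j : fbar (v0 + j%:R * k) <= fbar v0.
  elim: j => [|j IH]; first by rewrite mul0r addr0.
  apply: le_trans IH; rewrite -natr1 mulrDl mul1r addrA; apply: step.
  by rewrite lerDl mulr_ge0// ltW.
have [A A1 HA] := superlinear p2 hf (fbar v0 + 1).
pose j := Num.bound ((`|A| + `|v0|) / k).
have jk : `|A| + `|v0| < j%:R * k.
  by rewrite -ltr_pdivrMr//; apply: archi_boundP; apply: divr_ge0; [exact: addr_ge0|exact: ltW].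
have Av : A <= v0 + j%:R * k.
  have := ler_norm A; have := ler_norm (- v0); rewrite normrN; move: (j%:R * k) jk => w; lra.
have := HA _ Av; set v := v0 + _ in Av *.
have v1 : 1 <= v `^ (p - 1).
  have v1 : 1 <= v by exact: le_trans A1 Av.
  by have := ler_powR v1 (ltW p1); rewrite powRr0.
have := bnd j; rewrite -/v; have := fbar_ge0 hf v0; move: (fbar v) (fbar v0) (v `^ _) v1 => x y z; nra.
Qed.

(** * The inner step: a smaller constant up to the radius [r_in] *)

Section inner.
Variables (tau w k r1 s a : R).
Hypothesis tau0 : 0 < tau.
Hypothesis tau1 : tau <= 1.
Hypothesis w0 : 0 < w.
Hypothesis w1 : w < 1.
Hypothesis k0 : 0 < k.
Hypothesis r10 : 0 < r1.
Hypothesis r1s : r1 < s.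
Hypothesis s1 : s < 1.

Let g r := fbar (U r + k).
Let bt r := (1 - tau) * h r + tau * g r.

Let gc r : r < 1 -> {for r, continuous g}.
Proof.
move=> rr; apply: (@cont_comp _ _ fbar (fun t => U t + k)); first exact: (fbar_cont hf).
by apply: (@contD _ _ U (fun=> k)); [exact: Uc|exact: cont_cst].
Qed.

Let btc r : r < 1 -> {for r, continuous bt}.
Proof.
move=> rr; apply: (@contD _ _ (fun r => (1 - tau) * h r) (fun r => tau * g r)).
  by apply: (@contM _ _ (fun=> 1 - tau) h); [exact: cont_cst|exact: hc].
by apply: (@contM _ _ (fun=> tau) g); [exact: cont_cst|exact: gc].
Qed.

Let hg r : h r <= g r. Proof. by apply: (fbar_nondecr hf); rewrite lerDl ltW. Qed.
Let t1 : 0 <= 1 - tau. Proof. by rewrite subr_ge0. Qed.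

Let bt0 r : 0 <= bt r.
Proof. by apply: addr_ge0; apply: mulr_ge0 => //; [exact: ltW|exact: (fbar_ge0 hf)]. Qed.

Let btm r t : r <= t -> t < 1 -> bt r <= bt t.
Proof.
move=> rt tt; apply: lerD; apply: ler_wpM2l => //; [exact: hm|exact: ltW|].
by apply: (fbar_nondecr hf); rewrite lerD2r; exact: Um.
Qed.

Let btg r : bt r <= g r.
Proof.
rewrite -[leRHS]mul1r -[X in X * g r](subrK tau 1) mulrDl; apply: lerD => //.
exact: ler_wpM2l.
Qed.

Let hbt r : h r <= bt r.
Proof.
rewrite -[leLHS]mul1r -[X in X * h r](subrK tau 1) mulrDl; apply: lerD => //.
by apply: ler_wpM2l => //; exact: ltW.
Qed.

Let V := profile p N 0 bt.
Let ode_t : radial_ode p N.+1 1 bt (flux N bt) V.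
Proof. by apply: (@radial_ode_profile _ p N p2 1 bt) => // r t _; exact: btm. Qed.

Hypothesis Va : forall r, 0 <= r -> r <= r1 -> U r + k <= a + w * V r.

Let lam := w `^ (p - 1).
Let lam0 : 0 < lam. Proof. exact: powR_gt0. Qed.
Let lam1 : lam < 1.
Proof.
have : w `^ (p - 1) < 1 `^ (p - 1) by apply: gt0_ltr_powR; rewrite ?nnegrE// ltW.
by rewrite powR1.
Qed.

(** The right-hand side [bt] lies between [f(U)] and [f(U + k)]. As [a + w V >= U + k], the
    nonlinearity at the profile is at least [g >= bt], and the factor [lam = w^(p-1) < 1] on the
    flux leaves the gap [(1 - lam) f(k)]. The left end [-1] turns the annulus into a full ball,
    radii being nonnegative. *)
Lemma inner_profile : super_profile p f N (-1) r1 s ((1 - lam) * fbar k)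
  (fun r => lam * flux N bt r) (fun r => lam * bt r) (fun r => a + w * V r).
Proof.
have lt1 r : r < s -> r < 1 by move=> /lt_trans; exact.
have l0 := ltW lam0.
have dV r : 0 < r -> r < s -> is_derive r 1 V (flux N bt r `^ (p - 1)^-1).
  by move=> r0 rs; exact: (ode_sol ode_t r0 (lt1 r rs)).
have fn r : r < s -> 0 <= flux N bt r.
  by move=> rs; apply: (@flux_nneg _ N 1 bt) => //; exact: lt1.
split => //.
- by apply: lt_trans r10; rewrite oppr_lt0.
- by apply: mulr_gt0; [rewrite subr_gt0|exact: (fbar_gt0 hf)].
- move=> r rs; apply: contM; first exact: cont_cst.
  exact: (flux_cont btc (lt1 r rs)).
- by move=> r rs; apply: mulr_ge0 => //; exact: fn.
- move=> r rs; apply: contD; first exact: cont_cst.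
  by apply: contM; [exact: cont_cst|exact: (ode_solc ode_t (lt1 r rs))].
- move=> r _ r0 rr1; apply: le_trans (Va r0 rr1); apply: addr_ge0; last exact: ltW.
  by apply: U0; apply: lt1; exact: le_lt_trans r1s.
- move=> r _ r0 rr1; have rs := lt_trans rr1 r1s.
  apply: (is_derive_eq (isdZ lam (ode_flux ode_t r0 (lt1 r rs)))).
  by rewrite /=; ring.
- move=> r _ r0 rr1; have rs := lt_trans rr1 r1s.
  have /andP[H1 H2] := ode_bound ode_t r0 (lt1 r rs).
  rewrite (_ : _ - _ = lam * (bt r - N%:R * (flux N bt r / r))); last by ring.
  apply: mulr_ge0 => //; rewrite subr_ge0.
  apply: (@le_trans _ _ (N.+1%:R * (flux N bt r / r))); first by apply: ler_wpM2r => //; rewrite ler_nat.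
  by rewrite mulrC -ler_pdivlMr// ltr0n.
- move=> r _ r0 rr1; have rs := lt_trans rr1 r1s.
  apply: (is_derive_eq (isdD (isd_cst a r 1) (isdZ w (dV r r0 rs)))).
  rewrite add0r powRM//; last exact: fn.
  by rewrite -powRrM mulfV ?(gt_eqF p1)// powRr1// ltW.
- exists (g r1) => r _ r0 rr1; have rs := lt_trans rr1 r1s.
  have b1 : bt r <= g r1.
    by apply: le_trans (btg r1); apply: btm; [exact: ltW|exact: lt1].
  have /andP[H1 H2] := ode_bound ode_t r0 (lt1 r rs).
  have lamb v : 0 <= v -> lam * v <= v by move=> v0; rewrite ler_piMl// ltW.
  split; first by apply: le_trans b1; exact: lamb.
  rewrite -mulrA; apply: (le_trans (lamb _ H1)); apply: (le_trans H2); apply: le_trans b1.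
  by rewrite ler_pdivrMr ?ltr0n// ler_peMr// ler1n.
- move=> r _ r0 rr1; have rs := lt_trans rr1 r1s.
  apply: (@le_trans _ _ (g r)); last by apply: (fbar_nondecr hf); apply: Va => //; exact: ltW.
  have gE : lam * g r + (1 - lam) * g r = g r by ring.
  rewrite -[leRHS]gE; apply: lerD; first exact: ler_wpM2l.
  apply: ler_wpM2l; first by rewrite subr_ge0 ltW.
  by apply: (fbar_nondecr hf); rewrite lerDr; apply: U0; exact: lt1.
- move=> _; split.
  + by rewrite flux_axis// mulr0.
  + by apply: mulr_ge0.
  + rewrite (_ : (fun r => lam * flux N bt r / r) = fun r => lam * (flux N bt r / r)); last first.
      by apply/funext => r; exact/esym/mulrA.
    by rewrite -mulrA; apply: cvgMr; exact: (ode_lim ode_t).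
Qed.

End inner.

(* The flux of the supersolution is a little larger than that of [U], because [fbar (U + k / 2)] is
   somewhere larger than [fbar U]; being equal to [U + k] at [r1], it is smaller than that inside. *)
Lemma within_inner k : 0 < k -> (forall eps rho, 0 < eps -> rho < 1 -> within (k + eps) rho) ->
  exists2 k', k' < k & within k' r_in.
Proof.
move=> k0 S; have k2 : 0 < k / 2 by exact: divr_gt0.
have [rs /andP[rs0 rs1] hrs] := strict_gain k2.
have ri0 := r_in_gt0; have ri1 := r_in_lt1.
(* A radius beyond [rs], so that the flux at [c] has felt the strict inequality at [rs], and between
   [r_in] and [r1], where the gain is measured. *)
pose c := (Num.max r_in rs + 1) / 2.
have [mi [ms m1']] : r_in <= Num.max r_in rs /\ rs <= Num.max r_in rs /\ Num.max r_in rs < 1.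
  by rewrite !le_max !lexx orbT gt_max ri1 rs1.
have [ic [sc c1]] : r_in < c /\ rs < c /\ c < 1.
  rewrite /c; move: (Num.max _ _) mi ms m1' => w0 w1 w2 w3; split; [lra|split; lra].
clearbody c.
pose r1 := (c + 1) / 2; pose s := (r1 + 1) / 2.
have [cr1 [r1s s1]] : c < r1 /\ r1 < s /\ s < 1 by rewrite /s /r1; split; [lra|split; lra].
clearbody s r1.
have r11 := lt_trans r1s s1; have ir1 := lt_trans ic cr1; have r10 := lt_trans ri0 ir1.
(* Half of [k] enters the nonlinearity; the other half covers [V - V0 < k / 2] at [r1], so that the
   profile still exceeds [U + k / 2] on the ball. *)
pose g r := fbar (U r + k / 2).
pose bt (tau : R) r := (1 - tau) * h r + tau * g r.
have gc r : r < 1 -> {for r, continuous g}.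
  move=> rr; apply: (@cont_comp _ _ fbar (fun t => U t + k / 2)); first exact: (fbar_cont hf).
  by apply: (@contD _ _ U (fun=> k / 2)); [exact: Uc|exact: cont_cst].
have btc tau r : r < 1 -> {for r, continuous (bt tau)}.
  move=> rr; apply: (@contD _ _ (fun r => (1 - tau) * h r) (fun r => tau * g r)).
    by apply: (@contM _ _ (fun=> 1 - tau) h); [exact: cont_cst|exact: hc].
  by apply: (@contM _ _ (fun=> tau) g); [exact: cont_cst|exact: gc].
have hg r : h r <= g r by apply: (fbar_nondecr hf); rewrite lerDl ltW.
have g0 r : 0 <= g r by exact: (fbar_ge0 hf).
have bt0 tau r : 0 <= tau <= 1 -> 0 <= bt tau r.
  by move=> /andP[t0 t1]; apply: addr_ge0; apply: mulr_ge0; rewrite ?subr_ge0.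
have btg tau r : 0 <= tau <= 1 -> bt tau r <= g r.
  move=> /andP[t0 t1]; rewrite -[leRHS]mul1r -[X in X * g r](subrK tau 1) mulrDl; apply: lerD => //.
  by apply: ler_wpM2l; rewrite ?subr_ge0.
have hbt tau r : 0 <= tau <= 1 -> h r <= bt tau r.
  move=> /andP[t0 t1]; rewrite -[leLHS]mul1r -[X in X * h r](subrK tau 1) mulrDl; apply: lerD => //.
  exact: ler_wpM2l.
pose V tau := profile p N 0 (bt tau).
pose V0 := profile p N 0 h.
have UV r : r < 1 -> U r = U 0 + V0 r by move=> rr; rewrite Ueq// /V0 /profile add0r.
have hk j : 0 <= (j.+1%:R^-1 : R) <= 1 by rewrite invr_ge0 ler0n /= invf_le1 ?ler1n ?ltr0n.
have Vlim : V j.+1%:R^-1 r1 @[j --> \oo] --> V0 r1.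
  apply: (@profile_lim _ p N p2 0 (fun j => bt j.+1%:R^-1) h r1 1 (g r1)) => //.
  - by move=> j r rr; exact: btc.
  - by move=> j r rr; exact: bt0.
  - by exact: ltW.
  - move=> j t t0 tr; apply: (le_trans (btg _ _ (hk j))).
    by apply: (fbar_nondecr hf); rewrite lerD2r; exact: Um.
  - move=> t t0 tr.
    have H0 : harmonic @ \oo --> (0 : R) by exact: cvg_harmonic.
    have E : (fun j => bt j.+1%:R^-1 t) = (fun j => h t + harmonic j * (g t - h t)).
      by apply/funext => j; rewrite /bt /harmonic /=; ring.
    rewrite E -[X in _ --> X]addr0; apply: cvgD; first exact: cvg_cst.
    by rewrite -[X in _ --> X](mul0r (g t - h t)); apply: cvgMl.
have [j Hj] : exists j, V j.+1%:R^-1 r1 < V0 r1 + k / 2.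
  have Vb : V0 r1 < V0 r1 + k / 2 by rewrite ltrDl.
  exact: (@cvg_lt_ex _ (fun j => V j.+1%:R^-1 r1) _ _ Vlim Vb).
pose tau : R := j.+1%:R^-1; have tau0 : 0 < tau by rewrite invr_gt0 ltr0n.
have t01 : 0 <= tau <= 1 by exact: hk.
have [_ tau1] := andP t01.
rewrite -/tau in Hj; clearbody tau.
pose D r := V tau r - V0 r.
have ode_t : radial_ode p N.+1 1 (bt tau) (flux N (bt tau)) (V tau).
  apply: (@radial_ode_profile _ p N p2 1 (bt tau)) => //.
  - by move=> r rr; exact: btc.
  - by move=> r rr; exact: bt0.
  - move=> r t _ rt tt; apply: lerD; apply: ler_wpM2l; rewrite ?subr_ge0//; first exact: hm.
      exact: ltW.
    by apply: (fbar_nondecr hf); rewrite lerD2r; exact: Um.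
have ode_0 : radial_ode p N.+1 1 h Y V0.
  by apply: (@radial_ode_profile _ p N p2 1 h) => // r t _; exact: hm.
have dD r : 0 < r -> r < 1 -> is_derive r 1 D (flux N (bt tau) r `^ (p - 1)^-1 - Y r `^ (p - 1)^-1).
  by move=> r0 rr; exact: (isdB (ode_sol ode_t r0 rr) (ode_sol ode_0 r0 rr)).
have fY r : r < 1 -> 0 <= Y r <= flux N (bt tau) r.
  move=> rr; apply/andP; split; first by apply: (@flux_nneg _ N 1 h).
  by apply: (@flux_le _ N 1 _ _ _ hc (btc tau) rr) => t _ _; exact: hbt.
have Dm r t : r <= t -> t < 1 -> 0 <= r -> D r <= D t.
  move=> rt tt r0; apply: (@derive_ge0_le _ D (fun r => flux N (bt tau) r `^ (p - 1)^-1 - Y r `^ (p - 1)^-1) r t _ _ rt) => v rv vt.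
    have v1 := lt_trans vt tt; have v0 := le_lt_trans r0 rv.
    split; first exact: dD.
    have /andP[y0 yb] := fY v v1.
    by rewrite subr_ge0; apply: ge0_ler_powR; rewrite ?nnegrE ?invr_ge0 ?(ltW p1)//; exact: le_trans yb.
  have v1 := le_lt_trans vt tt.
  by apply: contB; [exact: (ode_solc ode_t v1)|exact: (ode_solc ode_0 v1)].
have D0 : D 0 = 0 by rewrite /D /V /V0 !profile_axis// subrr.
have Dpos r : 0 <= r -> r < 1 -> 0 <= D r by move=> r0 rr; rewrite -D0; exact: Dm.
(* Equal values would make the nondecreasing [D] constant on [[r_in, r1]], and the two fluxes would
   agree at [c]. *)
have Dgain : D r_in < D r1.
  rewrite lt_neqAle Dm ?(ltW ir1) ?(ltW ri0)// andbT; apply/eqP => E.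
  have Dm' r t : r_in <= r -> r <= t -> t <= r1 -> D r <= D t.
    move=> ir rt tr; apply: Dm => //; first exact: le_lt_trans r11.
    exact: le_trans (ltW ri0) ir.
  have c0 := lt_trans ri0 ic.
  have := nondecr_flat Dm' E ic cr1 (dD c c0 c1) => /eqP; rewrite subr_eq0 => /eqP Ef.
  have bs : h rs < bt tau rs.
    rewrite /bt -subr_gt0 (_ : _ - _ = tau * (g rs - h rs)); last by ring.
    apply: mulr_gt0; first exact: tau0.
    rewrite subr_gt0; exact: hrs.
  have fl := flux_lt N hc (btc tau) (fun t _ _ => hbt tau t t01) c1 rs0 sc bs.
  have /andP[y0 yb] := fY c c1.
  have : Y c `^ (p - 1)^-1 < flux N (bt tau) c `^ (p - 1)^-1.
    apply: gt0_ltr_powR; [rewrite invr_gt0; exact: p1|rewrite nnegrE; exact: y0|rewrite nnegrE; exact: (le_trans y0 yb)|exact: fl].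
  by rewrite Ef ltxx.
pose th := D r1 - D r_in; have th0 : 0 < th by rewrite subr_gt0.
have Vge r : 0 <= V tau r by exact: le_profile.
pose K := V tau r1; have K0 : 0 <= K by exact: Vge.
have K1 : 0 < 2 * (K + 1) by apply: mulr_gt0 => //; exact: ltr_wpDl.
(* The factor [w = 1 - y] costs at most [y K <= th / 2] of the gain [th]. *)
pose y := Num.min (1 / 2) (th / (2 * (K + 1))).
have y0 : 0 < y by rewrite lt_min !divr_gt0.
have y1 : y <= 1 / 2 by rewrite ge_min lexx.
have y2 : y * (2 * (K + 1)) <= th by rewrite -ler_pdivlMr// ge_min lexx orbT.
clearbody y.
pose w := 1 - y; have w0 : 0 < w by rewrite /w; lra.
have w1 : w < 1 by rewrite /w; lra.
pose eps := th / 8; have eps0 : 0 < eps by exact: divr_gt0.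
(* Normalised so that the profile equals [U r1 + k + eps] at [r1], the bound known there. *)
pose a := U r1 + k + eps - w * K.
have Vinc r : 0 <= r -> r <= r1 -> 0 <= K - V tau r.
  by move=> r0 rr; rewrite subr_ge0; apply: (@profile_nondecr _ p N p2 1 (bt tau)) => // [t tt|t tt]; [exact: btc|exact: bt0].
have DV r : r < 1 -> D r = V tau r - (U r - U 0) by move=> rr; rewrite /D (UV r rr) [U 0 + _]addrC addrK.
have Hj' : D r1 <= k / 2 by rewrite /D; move: Hj; move: (V tau r1) (V0 r1) => v1 v2; lra.
have EK : K = D r1 + (U r1 - U 0) by rewrite DV// subrK.
have Va r : 0 <= r -> r <= r1 -> U r + k / 2 <= a + w * V tau r.
  move=> r0 rr; have H1 := Vinc r r0 rr; have r1' := le_lt_trans rr r11.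
  have H2 := Dpos r r0 r1'; have H3 := DV r r1'.
  move: H1 H2 H3; rewrite /a /w; move: (V tau r) (D r) (U r) => v d u H1 H2 H3.
  have : (1 - y) * (K - v) <= K - v by apply: ler_piMl => //; lra.
  rewrite mulrBr EK in H1 *; lra.
have SP := inner_profile tau0 tau1 w0 w1 k2 r10 r1s s1 Va.
(* For [r <= r_in] the barrier gives at most [U r + k + 2 eps - th + y K], with [2 eps = th / 4] and
   [y K <= th / 2]. *)
exists (k - th / 4); first by rewrite gtrDl oppr_lt0 divr_gt0.
have S1 := S eps r1 eps0 r11.
have M0 : 0 <= U r1 + (k + eps) by apply: addr_ge0; [exact: U0|apply: addr_ge0; exact: ltW].
have D1 : deep (fun l x => -1 <= hrad x <= r1 -> ul l x <= U r1 + (k + eps)).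
  apply: deepS S1 => l x H /andP[_ xr]; apply: (le_trans (H xr)).
  by rewrite lerD2r; exact: Um.
have D2 : deep (fun l x => hrad x = -1 \/ hrad x = r1 -> ul l x <= a + w * V tau (hrad x)).
  apply: deepS S1 => l x H [E|E].
    by have := rad_ge0 P 0 x; rewrite E oppr_ge0 leNgt ltr01.
  by apply: (le_trans (H _)); rewrite E// /a -/K subrK addrA.
have D3 := deep_barrier SP r11 eps0 M0 D1 D2.
apply: deepS D3 => l x H xr; have x0 := rad_ge0 P 0 x.
have xr1 : hrad x <= r1 by exact: le_trans (ltW ir1).
have {}H : ul l x <= a + w * V tau (hrad x) + eps.
  by apply: H; rewrite xr1 andbT; apply: le_trans x0; rewrite oppr_le0.
apply: (le_trans H) => {H}.
have x1 := le_lt_trans xr1 r11.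
have H1 := Vge (hrad x); have H3 := DV _ x1; have H4 := Dm _ _ xr ri1 x0.
move: H1 H3 H4; rewrite /a /w /eps /th; move: (V tau _) (D (hrad x)) (U (hrad x)) y2 => v d u y2 H1 H3 H4.
rewrite /th in y2.
have : y * K <= (D r1 - D r_in) / 2 by nra.
have : 0 <= y * v by apply: mulr_ge0 => //; exact: ltW.
move=> E1 E2; rewrite EK in E2 *; lra.
Qed.

(** Consider the infimum of the constants valid up to [r_in]. If it were positive, the outer step
    would extend it, up to any [eps], to all radii below 1, and the inner step would then produce a
    smaller constant at [r_in]. *)
Lemma within_all k rho : 0 < k -> rho < 1 -> within k rho.
Proof.
pose K := [set k | 0 < k /\ within k r_in].
suff H k' : 0 < k' -> within k' r_in.
  move=> k0 rho1; have k2 : 0 < k / 2 by exact: divr_gt0.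
  by rewrite (splitr k); exact: within_outer (H _ k2) _ _.
move=> k'0; have [M M0 HM] := ub r_in_lt1.
have KM : K (M + 1).
  split; first by apply: ltr_wpDl.
  apply: deepS HM => l x H xr; apply: (le_trans (H xr)).
  have := U0 (le_lt_trans xr r_in_lt1); move: (U _) => v; lra.
have Klb : has_lbound K by exists 0 => v [/ltW].
have hK : has_inf K by split => //; exists (M + 1).
have small e : 0 < e -> within (inf K + e) r_in.
  move=> e0; have [v [_ Kv] ve] := inf_adherent e0 hK.
  exact: within_le (ltW ve) (lexx _) Kv.
have [K0|K0] := leP (inf K) 0.
  have := small _ k'0; apply: within_le => //.
  by rewrite gerDr.
have SK : forall eps rho, 0 < eps -> rho < 1 -> within (inf K + eps) rho.
  move=> eps rh eps0 rh1; have e2 : 0 < eps / 2 by exact: divr_gt0.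
  rewrite (splitr eps) addrA; apply: within_outer => //; last exact: small.
  exact: addr_gt0.
have [k1 k1K S1] := within_inner K0 SK; exfalso.
(* [K] contains positive constants only and [k1] may be negative, hence the maximum with half of the
   infimum. *)
have KK : K (Num.max k1 (inf K / 2)).
  split; first by rewrite lt_max orbC divr_gt0.
  by apply: within_le (lexx _) S1; rewrite le_max lexx.
have : inf K <= Num.max k1 (inf K / 2) by exact: ge_inf.
rewrite leNgt gt_max k1K /=.
by rewrite ltr_pdivrMr// ltr_pMr// ltr1n.
Qed.

End upper_bound.

(** * The capped cylinders and the limit *)

Section transfer.
Context {R : realType} {n : nat} (p : R).
Implicit Types (O D : set 'rV[R]_n) (u v : 'rV[R]_n -> R).
Local Notation mu := (lebesgue_rV R n).

Lemma solves_eq O u v g d e : open O -> (forall x, O x -> u x = v x) -> (forall x, O x -> d x = e x) ->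
  solves p O u g d -> solves p O v g e.
Proof.
move=> oO uv de [cu [L G W] S]; split.
- move=> x Ox; apply: cont_near_eq (cu x Ox).
  by have H : nbhs x O by [exact: open_nbhs_nbhs]; apply: filterS H => y Oy; exact: uv.
- split => [D DO|//|phi tphi i].
    have [_ _ DsO] := DO; have DO' : D `<=` O by move=> x /subset_closure /DsO.
    have [mv iv] := L D DO; split.
      by apply: eq_measurable_fun mv => x /set_mem /DO' /uv.
    have E : (\int[mu]_(x in D) (`|v x| `^ p)%:E = \int[mu]_(x in D) (`|u x| `^ p)%:E)%E.
      by apply: eq_integral => x /set_mem /DO' /uv ->.
    rewrite E; exact: iv.
  rewrite -W//; apply: eq_Rintegral => x /set_mem Ox.
  by rewrite uv.
- move=> D DO phi psi Wp; have [mD _] := compactly_inside_measure DO.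
  have [_ _ DsO] := DO; have DO' : D `<=` O by move=> x /subset_closure /DsO.
  have [I E] := S D DO phi psi Wp; split.
    by apply: (eq_integrable mD _ _ _ I) => x /set_mem /DO' /de /= ->.
  rewrite E; apply: eq_Rintegral => x /set_mem /DO' /de.
  by move=> ->.
Qed.

(** The sign of a weak solution turns [f] into [fbar], and its continuity fixes the representative
    to which pointwise comparison applies. *)
Lemma weak_solution_solves f O u : open O -> {within O, continuous u} -> weak_solution p f O u ->
  exists g, solves p O u g (fun x => fbar f (u x)).
Proof.
move=> oO; rewrite continuous_open_subspace// => cu [u0 [g W S]]; exists g.
apply: (@solves_eq O u u g (fun x => f (u x))) => // [x Ox|].
  by rewrite fbarE// u0.
by split => // x Ox; apply: cu; exact: mem_set.
Qed.

Lemma solves_weak_solution f O u g : (forall x, O x -> 0 <= u x) -> open O ->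
  solves p O u g (fun x => fbar f (u x)) -> weak_solution p f O u.
Proof.
move=> u0 oO /(@solves_eq O u u g _ (fun x => f (u x)) oO) H; split => //.
have {H} [|_ W S] := H (fun _ _ => erefl); last by exists g.
by move=> x Ox; rewrite fbarE// u0.
Qed.

End transfer.

(** Near the boundary [u] exceeds the bound [K] of [G], so the set cannot accumulate there. *)
Lemma compact_blowup {R : realType} {n : nat} (S : set 'rV[R]_n) (u G : 'rV[R]_n -> R) (B K c : R) : open S ->
  (forall x, S x -> `|x| <= B) -> blowup_near_boundary S u -> (forall x, S x -> {for x, continuous u}) ->
  (forall x, S x -> {for x, continuous G}) -> (forall x, S x -> G x <= K) -> 0 < c ->
  compact [set x | S x /\ c <= G x - u x].
Proof.
move=> oS SB bu cu cG GK c0; apply: (subclosed_compact _ (@compact_norm_le R n B)); last first.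
  by move=> x [/SB].
have [d d0 Hd] := bu K.
move=> x clx; have Sx : S x.
  apply: contrapT => nSx.
  have bx : boundary S x.
    split.
      by move=> V /clx [y [[Sy _] Vy]]; exists y.
    by move=> /interior_subset.
  have ce : {for x, continuous (fun y : 'rV[R]_n => enorm (y - x))}.
    apply: continuous_enorm => i.
    rewrite (_ : Defs.coord _ _ = fun y : 'rV[R]_n => y ord0 i - x ord0 i); last by apply/funext => y; rewrite /Defs.coord !mxE.
    by apply: (@contB _ _ (fun y : 'rV[R]_n => y ord0 i) (fun=> x ord0 i)); [exact: coord_continuous|exact: cont_cst].
  have e0 : enorm (x - x) < d.
    by rewrite subrr /enorm /dotv big1 ?sqrtr0// => i _; rewrite mxE mul0r.
  have /cvgr_lt /(_ d) H := ce.
  have [y [[Sy cy] /= yd]] := clx _ (H e0).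
  have := Hd y Sy (ex_intro2 _ _ x bx yd).
  have := GK y Sy; move: (G y) (u y) cy => g v; lra.
split => //; rewrite leNgt; apply/negP => vc.
have cv : {for x, continuous (fun x => G x - u x)} by apply: contB; [exact: cG|exact: cu].
have /cvgr_lt /(_ _ vc) H := cv.
by have [y [[_ yc] /=]] := clx _ H; rewrite ltNge yc.
Qed.

Section geometry.
Context {R : realType} {N : nat}.
Implicit Types (x : 'rV[R]_N.+2) (l : R).
Local Notation P := [pred i : 'I_N.+2 | i != ord_max].
Local Notation hrad := (rad P 0).

Lemma horiz2E x : horiz2 x = hrad x ^+ 2.
Proof. by rewrite sqr_rad /horiz2; apply: eq_bigr => i _; rewrite mxE subr0. Qed.

Lemma cylinderE x : cylinder R N.+1 x <-> hrad x < 1.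
Proof. by rewrite /cylinder /= horiz2E expr_lt1// rad_ge0. Qed.

(** By symmetry only the cap on the side of [x] has to be tested, because the distance from [|t|] to
    [l] is at most both [|t + l|] and [|t - l|]. *)
Lemma capped_cylinderE l x : 0 < l -> capped_cylinder R N.+1 l x <->
  hrad x < 1 /\ (`|lastc x| < l \/ (hrad x ^+ 2) ^+ 2 + (`|lastc x| - l) ^+ 4 < 1).
Proof.
move=> l0; rewrite /capped_cylinder /= !horiz2E.
have r0 := rad_ge0 P 0 x; have r2 : 0 <= hrad x ^+ 2 by exact: sqr_ge0.
have four (a : R) : a ^+ 4 = (a ^+ 2) ^+ 2 by rewrite -exprM.
have sq (a b : R) : 0 <= a -> 0 <= b -> a <= b -> a ^+ 2 <= b ^+ 2 by move=> a0 b0; rewrite ler_pXn2r.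
have inr (b : R) : (hrad x ^+ 2) ^+ 2 + b ^+ 4 < 1 -> hrad x < 1.
  move=> H; rewrite -(expr_lt1 (n := 2))// -(expr_lt1 (n := 2))//; apply: le_lt_trans H.
  by rewrite lerDl four sqr_ge0.
split.
  move=> [[]|[]].
  - by rewrite expr_lt1// => r1 lx; split => //; left; rewrite ltr_norml.
  - move=> H; split; first exact: inr H.
    right; apply: le_lt_trans H; rewrite lerD2l !four; apply: (sq _ _); rewrite ?sqr_ge0//.
    rewrite -(real_normK (num_real (_ - _))) -[leRHS](real_normK (num_real _)); apply: (sq _ _) => //.
    by rewrite ler_norml; case: (ler0P (lastc x)) => H0; case: (ler0P (lastc x + l)) => H1; apply/andP; split; lra.
  - move=> H; split; first exact: inr H.
    right; apply: le_lt_trans H; rewrite lerD2l !four; apply: (sq _ _); rewrite ?sqr_ge0//.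
    rewrite -(real_normK (num_real (_ - _))) -[leRHS](real_normK (num_real _)); apply: (sq _ _) => //.
    by rewrite ler_norml; case: (ler0P (lastc x)) => H0; case: (ler0P (lastc x - l)) => H1; apply/andP; split; lra.
move=> [r1 [xl|H]].
  by left; rewrite expr_lt1//; split => //; rewrite -ltr_norml.
right; case: (ler0P (lastc x)) H => H0 H.
  by left; suff -> : (lastc x + l) ^+ 4 = (- lastc x - l) ^+ 4 by []; ring.
by right.
Qed.

Lemma capped_cylinder_mono l l' x : 0 < l -> l <= l' -> capped_cylinder R N.+1 l x -> capped_cylinder R N.+1 l' x.
Proof.
move=> l0 ll; have l'0 := lt_le_trans l0 ll; rewrite !capped_cylinderE// => -[r1 H]; split => //.
have [xl|xl] := ltP `|lastc x| l'; first by left.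
right; case: H => [/lt_le_trans /(_ ll)|H]; first by rewrite ltNge xl.
apply: le_lt_trans H; rewrite lerD2l; apply: lerXn2r; rewrite ?nnegrE ?subr_ge0//.
  exact: le_trans xl.
by rewrite lerD2l lerN2.
Qed.

Lemma capped_cylinder_lastc l x : 0 < l -> capped_cylinder R N.+1 l x -> `|lastc x| < l + 1.
Proof.
move=> l0; rewrite capped_cylinderE// => -[_ [H|H]]; first by apply: (lt_trans H); rewrite ltrDl.
have r4 : 0 <= (hrad x ^+ 2) ^+ 2 by exact: sqr_ge0.
have {}H : (`|lastc x| - l) ^+ 4 < 1 by apply: le_lt_trans H; rewrite lerDr.
rewrite -ltrBlDl; have [le0|le0] := leP (`|lastc x| - l) 0; first exact: le_lt_trans ltr01.
by rewrite -(expr_lt1 (n := 4))// ltW.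
Qed.

Lemma open_cylinder : open (cylinder R N.+1).
Proof.
rewrite openE => x /cylinderE xr.
have /cvgr_lt /(_ _ xr) := @continuous_rad _ _ P 0 x.
by apply: filterS => y /= yr; apply/cylinderE.
Qed.

Lemma open_capped_cylinder l : 0 < l -> open (capped_cylinder R N.+1 l).
Proof.
move=> l0; have ch : continuous (@horiz2 R N.+1).
  move=> x; rewrite (_ : horiz2 = fun y => hrad y ^+ 2); last by apply/funext => y; exact: horiz2E.
  by apply: contM; exact: continuous_rad.
have cl : continuous (@lastc R N.+1) by exact: lastc_cont.
have op (F : 'rV[R]_N.+2 -> R) : continuous F -> open [set x | F x < 1].
  move=> cF; rewrite openE => x Fx; have /cvgr_lt := cF x; exact.
have c4 b : continuous (fun x : 'rV[R]_N.+2 => horiz2 x ^+ 2 + (lastc x + b) ^+ 4).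
  move=> x; have cb : {for x, continuous (fun x : 'rV[R]_N.+2 => lastc x + b)}.
    by apply: contD; [exact: cl|exact: cont_cst].
  apply: (@contD _ _ (fun x => horiz2 x ^+ 2) (fun x => (lastc x + b) ^+ 4)); first by apply: contM; exact: ch.
  by do 3 apply: contM => //.
apply: openU; last apply: openU; [|exact: op|exact: op (c4 (- l))].
rewrite (_ : [set x | _] = [set x | horiz2 x < 1] `&` (@lastc R N.+1 @^-1` [set t | - l < t] `&` @lastc R N.+1 @^-1` [set t | t < l])).
  apply: openI; first exact: op; apply: openI.
    by apply: open_comp => //; exact: open_gt.
  by apply: open_comp => //; exact: open_lt.
apply/seteqP; split => x /= [H1 H2]; split => //; first by case/andP: H2.
by case: H2 => -> ->.
Qed.

End geometry.

(** * A local upper bound on balls, common to all solutions *)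

Section keller_osserman.
Context {R : realType} (p : R) (f : R -> R) (N : nat).
Hypothesis p2 : (2 : R) <= p.
Hypothesis hf : condition_F p f.
Implicit Types (x y : 'rV[R]_N.+2).
Local Notation fbar := (fbar f).

Let ball_compact x (s : R) : compact [set y | @rad R N.+2 predT x y <= s].
Proof.
apply: (subclosed_compact _ (@compact_norm_le R N.+2 (`|x| + `|s|))).
  apply: (@closed_comp _ _ (@rad R N.+2 predT x) [set t | t <= s]); last exact: closed_le.
  by move=> y _; exact: continuous_rad.
move=> y /= ys; rewrite [leLHS]mx_normrE; apply: bigmax_le => [|[i j] _] /=; first exact: addr_ge0.
rewrite ord1 -(subrK (x ord0 j) (y ord0 j)); apply: (le_trans (ler_normD _ _)); rewrite addrC; apply: lerD.
  exact: coord_le_norm.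
apply: le_trans (ler_norm s); apply: le_trans ys.
exact: (@coord_le_rad R N.+2 predT x y j isT).
Qed.

(** The comparison function is a radial solution for [f / 2] plus a constant whose boundary value
    exceeds the maximum of [u] on the ball; [ko_bound] controls its centre value regardless of that
    maximum. *)
Lemma ball_bound (s : R) : 0 < s -> exists2 M, 0 <= M & forall x u gu O,
  (forall y, @rad R N.+2 predT x y <= s -> O y) -> solves p O u gu (fun y => fbar (u y)) -> u x <= M.
Proof.
move=> s0; have [M HM] := ko_bound p2 hf N.+1 s0.
exists (Num.max M 1); first by rewrite le_max ler01 orbT.
move=> x u gu O sO su; have [cu _ _] := su.
set rd := @rad R N.+2 predT x in sO.
have [B1 B10 HB1] := compact_bound (@ball_compact x s) (fun y yr => cu y (sO y yr)).
(* With [W >= 1] below, the right-hand side is at most [f(W) / 2 + f(1) / 4 <= 3 f(W) / 4], strictly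
   less than [f(u)] where [u > W]. *)
pose kappa := fbar 1 / 4; have f1 : 0 < fbar 1 by exact: (fbar_gt0 hf ltr01).
have kap0 : 0 < kappa by exact: divr_gt0.
have h2 : (0 : R) < 1 / 2 by exact: divr_gt0.
have B11 : 0 <= B1 + 1 by exact: addr_ge0.
have [a [h ap]] := radial_shoot N.+1 p2 hf h2 kap0 s0 B11.
have [ch h0 hE [GB1 _]] := ap; rewrite addrK in GB1.
set G := profile p N.+1 a h in hE GB1.
have hm r t : 0 <= r -> r <= t -> t < s -> h r <= h t.
  by move=> _ rt ts; apply: (approx_rhs_nondecr p2 hf (ltW h2) ap rt (ltW ts)).
have aM : a <= M.
  have := HM h (flux N.+1 h) G; rewrite /G profile_axis//; apply => //.
  - exact: (approx_ode p2 hf (ltW h2) s0 ap).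
  - by move=> r t _ rt _; exact: (approx_nondecr p2 ap).
  - move=> r r0 rs; rewrite hE ?(ltW rs)// mul1r mulrC lerDl; exact: ltW.
(* Raising the centre value while keeping [h] gives [W >= 1] and can only increase the boundary
   value. *)
pose a' := Num.max a 1; pose W := profile p N.+1 a' h.
have WG r : G r <= W r by rewrite /G /W /profile lerD2r /a' le_max lexx.
have W1 r : 1 <= W r.
  by apply: le_trans (@le_profile _ p N.+1 a' h r); rewrite /a' le_max lexx orbT.
have cW r : {for r, continuous W}.
  by apply: (@profile_cont _ p N.+1 p2 (r + 1)) => //; rewrite ltrDl.
have odeW : radial_ode p N.+2 s h (flux N.+1 h) W by exact: radial_ode_profile.
have cT : #|[pred i : 'I_N.+2 | true]| = N.+2 by rewrite eq_cardT ?size_enum_ord.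
pose O1 := [set y | rd y < s].
have oO1 : open O1.
  by rewrite openE => y Oy; have /cvgr_lt := @continuous_rad _ _ predT x y; exact.
have rdx : rd x = 0 by rewrite /rd /rad big1 ?sqrtr0// => i _; rewrite subrr expr0n.
have sW := @radial_solves R N.+2 p predT x s N.+1 h (flux N.+1 h) W p2 cT odeW O1 oO1 (fun y yO => yO).
have sub : O1 `<=` O by move=> y yO; apply: sO; exact: ltW.
have uW : u x <= W (rd x).
  apply: (comparison p2 oO1 (solves_sub sub su) sW) => [c c0|y Oy Wu|]; last by rewrite /O1 /= rdx.
    rewrite (_ : [set y | _] = [set y | rd y <= s /\ c <= u y - W (rd y)]).
      apply: compact_superlevel; first exact: ball_compact.
      move=> y ys; apply: (@contB _ _ u (fun y => W (rd y))); first exact: cu (sO y ys).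
      by apply: cont_comp; [exact: cW|exact: continuous_rad].
    apply/seteqP; split => y [ys cy]; split => //; first exact: ltW.
    rewrite /O1 /= lt_neqAle ys andbT; apply/eqP => E.
    have h3 := HB1 y ys; have h4 := ler_norm (u y); have h5 := WG s; rewrite E in cy.
    move: cy h3 h4 h5 GB1; move: (W s) (G s) (u y) `|u y| => w1 w2 w3 w4; lra.
  have yr : rd y <= s by exact: ltW.
  rewrite hE//.
  have g1 : fbar (G (rd y)) <= fbar (W (rd y)) by exact: (fbar_nondecr hf).
  have g2 : fbar 1 <= fbar (W (rd y)) by exact: (fbar_nondecr hf).
  have g3 : fbar (W (rd y)) <= fbar (u y) by apply: (fbar_nondecr hf); exact: ltW.
  move: g1 g2 g3; rewrite /kappa; move: (fbar _) (fbar (W _)) (fbar (u y)) (fbar 1) f1 => v1 v2 v3 v4; lra.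
apply: (le_trans uW); rewrite rdx /W profile_axis// /a' ge_max le_max aM /= le_max lexx orbT//.
Qed.

Local Notation P := [pred i : 'I_N.+2 | i != ord_max].
Local Notation hrad := (rad P 0).

Lemma ball_in_cylinder (rho : R) : rho < 1 -> exists2 s, 0 < s & forall x y, hrad x <= rho ->
  rad predT x y <= s -> hrad y < 1 /\ `|lastc y| < `|lastc x| + 1.
Proof.
move=> rho1; pose r := Num.max rho 0.
have r0 : 0 <= r by rewrite le_max lexx orbT.
have r1 : r < 1 by rewrite gt_max rho1 ltr01.
have r2 : r ^+ 2 < 1 by rewrite expr_lt1.
have n0 : (0 : R) < 6 * N.+1%:R by apply: mulr_gt0.
(* From [|x_i| <= 1] and [s <= 1 / 2] follows [y_i^2 <= x_i^2 + 3 s]; over [N + 1] coordinates the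
   total increase is at most half of [1 - r^2]. *)
pose s := Num.min (1 / 2) ((1 - r ^+ 2) / (6 * N.+1%:R)).
have s0 : 0 < s by rewrite lt_min !divr_gt0// subr_gt0.
have s1 : s <= 1 / 2 by rewrite ge_min lexx.
have s2 : s * (6 * N.+1%:R) <= 1 - r ^+ 2 by rewrite -ler_pdivlMr// ge_min lexx orbT.
clearbody s; exists s => // x y xr ys.
have dc i : `|y ord0 i - x ord0 i| <= s.
  by apply: le_trans ys; exact: (@coord_le_rad R N.+2 predT x y i isT).
split.
  rewrite -(expr_lt1 (n := 2)) ?rad_ge0// -horiz2E /horiz2.
  have xr2 : hrad x ^+ 2 <= r ^+ 2.
    apply: lerXn2r; rewrite ?nnegrE ?rad_ge0//; apply: (le_trans xr); by rewrite le_max lexx.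
  apply: (@le_lt_trans _ _ (\sum_(i | i != ord_max) (x ord0 i ^+ 2 + 3 * s))).
    apply: ler_sum => i im.
    have xi : `|x ord0 i| <= 1.
      have := @coord_le_rad _ _ P 0 x i im; rewrite mxE subr0 => /le_trans; apply.
      exact: le_trans xr (ltW rho1).
    have := dc i; move: xi; rewrite !ler_norml => /andP[x1 x2] /andP[d1 d2].
    by move: (x ord0 i) (y ord0 i) x1 x2 d1 d2 => v w x1 x2 d1 d2; nra.
  rewrite big_split /= -[X in X + _]/(horiz2 x) horiz2E sumr_const cardC1 card_ord /=.
  rewrite -[(3 * s) *+ _]mulr_natr; move: (N.+1%:R : R) s2 => n s2.
  have : 0 < 1 - r ^+ 2 by rewrite subr_gt0.
  move: (r ^+ 2) (hrad x ^+ 2) xr2 s2 => v w; nra.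
have := ler_normD (lastc y - lastc x) (lastc x); rewrite subrK addrC => /le_lt_trans; apply.
by rewrite ltrD2l; apply: le_lt_trans (dc ord_max) _; lra.
Qed.

End keller_osserman.

Lemma minimal_large_solution {R : realType} (p : R) (f : R -> R) (N : nat) (a_ : nat -> R) (h_ : nat -> R -> R) :
  (2 : R) <= p -> condition_F p f ->
  (forall k, radial_approx p f N 1 k.+1%:R^-1 1 k%:R (a_ k) (h_ k)) ->
  (forall r, r < 1 -> exists M : R, forall k, profile p N (a_ k) (h_ k) r <= M) ->
  exists U : R -> R, [/\ forall r, r < 1 -> {for r, continuous U},
    forall r t, r <= t -> t < 1 -> U r <= U t,
    forall M, exists2 r, r < 1 & forall t, r <= t -> t < 1 -> M <= U t,
    forall r, r < 1 -> 0 <= U r /\ U r = profile p N (U 0) (fun t => fbar f (U t)) r &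
    forall r M, r < 1 -> (forall k, profile p N (a_ k) (h_ k) r <= M) -> U r <= M].
Proof.
move=> p2 hf appr G_ub; exists (lim_sol p N a_ h_); split.
- by move=> r r1; exact: (@lim_sol_cont _ _ _ _ p2 hf _ _ appr G_ub r r1).
- by move=> r t rt t1; exact: (lim_sol_nondecr p2 hf appr G_ub rt t1).
- by move=> M; exact: (lim_sol_large p2 hf appr G_ub M).
- move=> r r1; split; first exact: (lim_sol_ge0 p2 hf appr G_ub r1).
  exact: (lim_sol_eq p2 hf appr G_ub r1).
- by move=> r M r1 H; exact: (lim_sol_le p2 hf appr G_ub r1 H).
Qed.

(** * The solutions on capped cylinders between [U] and [U + k] *)

Section main.
Context {R : realType} (N : nat) (p : R) (f : R -> R).
Hypothesis p2 : (2 : R) <= p.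
Hypothesis hf : condition_F p f.
Implicit Types (x : 'rV[R]_N.+2) (l : R).
Local Notation P := [pred i : 'I_N.+2 | i != ord_max].
Local Notation hrad := (rad P 0).
Local Notation fbar := (fbar f).
Local Notation S := (capped_cylinder R N.+1).
Variables (ul : R -> 'rV[R]_N.+2 -> R) (gl : R -> 'rV[R]_N.+2 -> 'rV[R]_N.+2).
Hypothesis solv : forall l, 0 < l -> solves p (S l) (ul l) (gl l) (fun x => fbar (ul l x)).
Hypothesis blow : forall l, 0 < l -> blowup_near_boundary (S l) (ul l).

Let NP : #|P| = N.+1. Proof. by rewrite cardC1 card_ord. Qed.

Let cyl l x : hrad x < 1 -> `|lastc x| < l -> S l x.
Proof. by move=> r1 xl; apply/capped_cylinderE; [exact: le_lt_trans xl|split => //; left]. Qed.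

Let ub rho : rho < 1 -> exists2 M, 0 <= M & deep (fun l x => hrad x <= rho -> ul l x <= M).
Proof.
move=> rho1; have [s s0 Hs] := @ball_in_cylinder R N rho rho1.
have [M M0 HM] := @ball_bound R p f N p2 hf s s0; exists M => //.
exists 1 => // l x xl xr.
have l0 : 0 < l by apply: lt_le_trans xl; rewrite ltr_wpDl.
apply: (HM x (ul l) (gl l) (S l)); last exact: solv.
move=> y ys; have [y1 y2] := Hs x y xr ys; apply: cyl => //.
exact: lt_le_trans xl.
Qed.

Lemma capped_cylinder_bounded l x : 0 < l -> S l x -> `|x| <= 1 + (l + 1).
Proof.
move=> l0 Sx; have := capped_cylinder_lastc l0 Sx; have [x1 _] := (capped_cylinderE x l0).1 Sx => xl.
rewrite [leLHS]mx_normrE; apply: bigmax_le => [|[i j] _] /=; first by rewrite !addr_ge0// ltW.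
rewrite ord1; have [->|jm] := eqVneq j ord_max.
  by apply: (le_trans (ltW xl)); rewrite lerDr.
have := @coord_le_rad _ _ P 0 x j jm; rewrite mxE subr0 => /le_trans; apply.
by apply: (le_trans (ltW x1)); rewrite lerDl addr_ge0// ltW.
Qed.

(** The profile stays below [k] while [ul l] blows up at the boundary, and the added [1 / (k + 1)]
    gives the strict inequality that comparison requires. *)
Lemma approx_le k l x a h : radial_approx p f N 1 k.+1%:R^-1 1 k%:R a h -> 0 < l -> S l x ->
  profile p N a h (hrad x) <= ul l x.
Proof.
move=> ap l0; have oS : open (S l) by exact: open_capped_cylinder.
have [_ _ hE [_ GB]] := ap.
have Sr y : S l y -> hrad y < 1 by move=> /(capped_cylinderE y l0) [].
have odeG := approx_ode p2 hf ler01 ltr01 ap.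
have sG := @radial_solves R N.+2 p P 0 1 N h (flux N h) (profile p N a h) p2 NP odeG (S l) oS Sr.
have [cu _ _] := solv l0.
move: x; apply: (comparison p2 oS sG (solv l0)) => [c c0|y Sy uG].
  apply: (@compact_blowup _ _ (S l) (ul l) (fun y => profile p N a h (hrad y)) (1 + (l + 1)) k%:R c) => //.
  - by move=> y; exact: capped_cylinder_bounded.
  - exact: blow.
  - move=> y Sy; apply: cont_comp; last exact: continuous_rad.
    exact: (ode_solc odeG (Sr y Sy)).
  - move=> y Sy; apply: le_trans GB; apply: (approx_nondecr p2 ap); exact: ltW (Sr y Sy).
rewrite hE ?(ltW (Sr y Sy))// mul1r; apply: (@le_lt_trans _ _ (fbar (profile p N a h (hrad y)))).
  by apply: (fbar_nondecr hf); exact: ltW.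
by rewrite ltrDl invr_gt0 ltr0n.
Qed.

Lemma point_of_radius (r : R) : 0 <= r -> exists2 x, hrad x = r & lastc x = 0.
Proof.
move=> r0; have rd0 : hrad (0 : 'rV[R]_N.+2) = 0.
  by apply/eqP; rewrite -sqrf_eq0 sqr_rad big1 // => i _; rewrite subrr expr0n.
have P0 : P ord0 by [].
have [H _] := rad0_line (P := P) (c := 0) (x := 0) (i := ord0) r P0 rd0.
exists (r *: delta_mx ord0 ord0 + 0); first by rewrite H ger0_norm.
by rewrite /lastc !mxE mulr0 addr0.
Qed.

Lemma radial_limit : exists U : R -> R, [/\ forall r, r < 1 -> 0 <= U r,
  forall M, exists2 r, r < 1 & forall t, r <= t -> t < 1 -> M <= U t,
  exists g, solves p (cylinder R N.+1) (fun x => U (hrad x)) g (fun x => fbar (U (hrad x))),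
  forall l x, 0 < l -> S l x -> U (hrad x) <= ul l x &
  forall k x, 0 < k -> hrad x < 1 -> exists L, forall l, L <= l -> ul l x <= U (hrad x) + k].
Proof.
have /choice[ah Hah] : forall k : nat, exists ah : R * (R -> R), radial_approx p f N 1 k.+1%:R^-1 1 k%:R ah.1 ah.2.
  move=> k; have k0 : 0 < k.+1%:R^-1 :> R by rewrite invr_gt0 ltr0n.
  have [a [h ap]] := radial_shoot N p2 hf ltr01 k0 ltr01 (ler0n R k).
  by exists (a, h).
have [|U [Uc Um Ul UE Ule]] := minimal_large_solution p2 hf Hah.
  (* The single solution [ul 1], evaluated at a point of radius [max r 0], bounds all the
     approximations at [r], so their increasing limit is finite. *)
  move=> r r1; have r0 : 0 <= Num.max r 0 by rewrite le_max lexx orbT.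
  have [x xr xt] := point_of_radius r0.
  have Sx : S 1 x by apply: cyl; rewrite ?xt ?normr0// xr gt_max r1 ltr01.
  exists (ul 1 x) => k; apply: (le_trans _ (approx_le (Hah k) ltr01 Sx)).
  by apply: (approx_nondecr p2 (Hah k)); rewrite xr le_max lexx.
have U0 r : r < 1 -> 0 <= U r by move=> /UE [].
have Ueq r : r < 1 -> U r = profile p N (U 0) (fun t => fbar (U t)) r by move=> /UE [].
exists U; split => //.
- have hc r : r < 1 -> {for r, continuous (fun t => fbar (U t))}.
    by move=> r1; apply: cont_comp; [exact: (fbar_cont hf)|exact: Uc].
  have ode : radial_ode p N.+1 1 (fun t => fbar (U t)) (flux N (fun t => fbar (U t))) (profile p N (U 0) (fun t => fbar (U t))).
    apply: (@radial_ode_profile _ p N p2 1 (fun t => fbar (U t))) => //.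
    - by move=> r _; exact: (fbar_ge0 hf).
    - by move=> r t _ rt t1; apply: (fbar_nondecr hf); exact: Um.
  have Cr y : cylinder R N.+1 y -> hrad y < 1 by move=> /cylinderE.
  have H := @radial_solves R N.+2 p P 0 1 N _ _ _ p2 NP ode (cylinder R N.+1) (@open_cylinder R N) Cr.
  exists (radial_grad p P 0 (flux N (fun t => fbar (U t)))).
  apply: (solves_eq (@open_cylinder R N) _ _ H) => [x /Cr x1|//].
  exact/esym/Ueq.
- move=> l x l0 Sx; have [x1 _] := (capped_cylinderE x l0).1 Sx.
  by apply: Ule => // k; exact: approx_le (Hah k) l0 Sx.
- move=> k x k0 x1.
  have [L L0 HL] := @within_all R p f N p2 hf S ul gl solv cyl ub U Uc Um Ul U0 Ueq k (hrad x) k0 x1.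
  by exists (`|lastc x| + L) => l lL; exact: HL.
Qed.

End main.

Theorem theorem4p3 (R : realType) (m : nat) (hn : (2 <= m.+1)%N)
  (p : R) (hp : 2 <= p)
  (f : R -> R) (hf : condition_F p f)
  (ul : R -> 'rV[R]_m.+1 -> R)
  (ul_sol : forall l : R, 0 < l -> weak_solution p f (capped_cylinder R m l) (ul l))
  (ul_cont : forall l : R, 0 < l -> {within capped_cylinder R m l, continuous (ul l)})
  (ul_blowup : forall l : R, 0 < l ->
     blowup_near_boundary (capped_cylinder R m l) (ul l))
  (ell : 'rV[R]_m.+1 -> R)
  (hell : forall x, cylinder R m x -> 0 < ell x /\ capped_cylinder R m (ell x) x)
  (u : 'rV[R]_m.+1 -> R)
  (hu : forall x, cylinder R m x ->
     u x = inf [set ul l x | l in [set l : R | ell x <= l]]) :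
  weak_solution p f (cylinder R m) u /\
  blowup_at_boundary_points (cylinder R m) u.
Proof.
case: m hn ul ul_sol ul_cont ul_blowup ell hell u hu => [//|N] _ ul ul_sol ul_cont ul_blowup ell hell u hu.
have /choice[gl solv] : forall l, exists g, 0 < l -> solves p (capped_cylinder R N.+1 l) (ul l) g (fun x => fbar f (ul l x)).
  move=> l; have [l0|l0] := ltP 0 l; last by exists (fun=> 0).
  have [g Hg] := weak_solution_solves (open_capped_cylinder l0) (ul_cont l l0) (ul_sol l l0).
  by exists g.
have [U [U0 Ul [g sU] Ule Uge]] := radial_limit hp hf solv ul_blowup.
set rd := rad [pred i | i != ord_max] 0 in sU Ule Uge.
have uE x : cylinder R N.+1 x -> u x = U (rd x).
  move=> Cx; have [e0 Sx] := hell x Cx; have x1 : rd x < 1 by exact/cylinderE.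
  have lb l : ell x <= l -> U (rd x) <= ul l x.
    move=> el; apply: Ule; first exact: lt_le_trans el.
    exact: capped_cylinder_mono el Sx.
  (* [U] is a lower bound of all the competitors because [x] stays in the growing domains, and large
     [l] brings [ul l x] within any [k] of it. *)
  rewrite hu//; apply/eqP; rewrite eq_le; apply/andP; split.
    apply/ler_addgt0Pr => k k0; have [L HL] := Uge k x k0 x1.
    apply: le_trans (HL (Num.max (ell x) L) _); last by rewrite le_max lexx orbT.
    apply: ge_inf; first by exists (U (rd x)) => _ [l /= el <-]; exact: lb.
    by exists (Num.max (ell x) L) => //=; rewrite le_max lexx.
  apply: lb_le_inf; first by exists (ul (ell x) x), (ell x) => /=.
  by move=> _ [l /= el <-]; exact: lb.
have oC := @open_cylinder R N.
split.
  apply: (solves_weak_solution (g := g)) => //.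
    by move=> x Cx; rewrite uE//; apply: U0; exact/cylinderE.
  by apply: (solves_eq oC _ _ sU) => x Cx; rewrite uE.
(* A boundary point of the open cylinder has radius at least 1, so by continuity nearby points of
   the cylinder have radius beyond any [r < 1], where [U] is large. *)
move=> z [_ nz]; have z1 : 1 <= rd z.
  rewrite leNgt; apply/negP => z1; apply: nz.
  by move: oC; rewrite openE; apply; exact/cylinderE.
apply/cvgryPge => M; have [r r1 Hr] := Ul M.
rewrite near_withinE.
have /cvgr_gt /(_ r (lt_le_trans r1 z1)) := @continuous_rad R N.+2 [pred i | i != ord_max] 0 z.
apply: filterS => x rx Cx; rewrite uE//; apply: Hr; first exact: ltW.
exact/cylinderE.
Qed.
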